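(* Let $\Omega\subset\mathbb{R}^d$ be a bounded domain with smooth boundary, $H\in C^1(\overline{\Omega};\mathbb{R}^d)$ with $|H(x)|\ge\delta_0>0$ on $\overline{\Omega}$, and let $M>0$. Let $\{\Omega_i\}_{1\le i\le N}$ be a partition of $\Omega$ satisfying Conditions (B) and (C) defined in the context. Then there exists $T_0>0$ depending on $H,\Omega$ such that for each $T>T_0$, writing $Q=\Omega\times(0,T)$, and each $R$ with $$R,\ \partial_tR\in L^2(0,T;L^\infty(\Omega)),\qquad |R(x,0)|>0,\quad x\in\overline{\Omega},$$ there is a constant $C>0$ (depending on $\Omega,T,H,M,R$ and the partition, but not on $u,f$) such that $$\|f\|_{L^2(\Omega)}\le C\|\partial_tu\|_{L^2(\partial\Omega\times(0,T))}$$ whenever $p\in L^\infty(\Omega)$ with $\|p\|_{L^\infty(\Omega)}\le M$, $f\in L^2(\Omega)$, and $u,\partial_tu\in H^1(Q)$ satisfy $$\partial_tu(x,t)+(H(x)\cdot\nabla u(x,t))+p(x)u(x,t)=R(x,t)f(x)\ \text{ in }Q,\qquad u(x,0)=0,\ x\in\Omega.$$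
   Context: $(v\cdot w)$ is the Euclidean scalar product, $S^{d-1}$ the unit sphere of $\mathbb{R}^d$, $\nabla$ the gradient in $x$. Boundary and initial values are traces. Note $R\in H^1(0,T;L^\infty(\Omega))\subset C([0,T];L^\infty(\Omega))$, so $R(\cdot,0)$ is defined. Partition: $\overline{\Omega}=\bigcup_{i=1}^N\overline{\Omega_i}$, where $\Omega_i\subset\Omega$ are non-empty pairwise disjoint subdomains. For $i\ne j$ put $\gamma_{ij}:=\partial\Omega_i\cap\partial\Omega_j$ and let $|\gamma_{ij}|$ be its surface measure; it is assumed that $\gamma_{ij}$ is of piecewise $C^2$-class whenever $|\gamma_{ij}|>0$. Interfaces with $|\gamma_{ij}|=0$ are neglected. $\nu_{i\to j}$ is the unit normal vector to $\gamma_{ij}$ directed from $\Omega_i$ towards $\Omega_j$ (so $\nu_{i\to j}=-\nu_{j\to i}$). Condition (B): (i) on each $\gamma_{ij}$ one of the following holds: $(H\cdot\nu_{i\to j})>0$ almost everywhere on $\gamma_{ij}$; or $(H\cdot\nu_{i\to j})<0$ almost everywhere on $\gamma_{ij}$; or $(H\cdot\nu_{i\to j})=0$ almost everywhere on $\gamma_{ij}$. (ii) For each $i=1,\dots,N$ there exist a constant $\delta_1>0$ and a constant vector $v_i\in S^{d-1}$ such that $(H(x)\cdot v_i)>\delta_1$ for all $x\in\overline{\Omega_i}$. Directed graph $\Lambda$ associated with the partition: there is one node $O_i$ for each $\Omega_i$; distinct nodes $O_i,O_j$ are connected by a segment $\Gamma_{ij}$ if and only if $|\gamma_{ij}|>0$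 and $(H\cdot\nu_{i\to j})\neq0$ on $\gamma_{ij}$; the segment is directed from $O_i$ to $O_j$ if $(H\cdot\nu_{i\to j})>0$ a.e. on $\gamma_{ij}$, and from $O_j$ to $O_i$ if $(H\cdot\nu_{i\to j})<0$ a.e. on $\gamma_{ij}$. $\Lambda$ has a closed loop if some subset of its directed segments forms an oriented closed Jordan curve, i.e. a directed cycle. Condition (C): the directed graph $\Lambda$ associated with the partition has no closed loops.
   Formalization: Since R(·,0) is only an L^∞ class, the condition |R(x,0)|>0 on the closure of Ω is taken as: near every point of the closure, |R(·,0)| is a.e. bounded below by a positive constant (automatic if R(·,0) is continuous there); mere pointwise or a.e. positivity makes the estimate false. *)

(* Defs.v *)
From HB Require Import structures.
From mathcomp Require Import all_boot all_order all_algebra.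
From mathcomp Require Import all_classical all_reals all_analysis.
Set Implicit Arguments.
Unset Strict Implicit.
Unset Printing Implicit Defensive.
Import Order.TTheory GRing.Theory Num.Theory.
Import numFieldNormedType.Exports.
Local Open Scope classical_set_scope.
Local Open Scope ring_scope.

(* R^n is 'rV[R]_n; the library norm on it is the sup norm, hence [dot] and
   [enorm] for the Euclidean structure.  Positive dimensions are written n.+1. *)

Section Euclidean.
Context {R : realType} {n : nat}.
Implicit Types x y : 'rV[R]_n.

Definition dot x y : R := \sum_i x ord0 i * y ord0 i.

Definition enorm x : R := Num.sqrt (dot x x).

Definition ediam (U : set 'rV[R]_n) : \bar R :=
  ereal_sup [set (enorm (xy.1 - xy.2))%:E | xy in U `*` U].

End Euclidean.

Section CoverOuterMeasure.
Context {R : realType} {V : pointedType}.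
Local Open Scope ereal_scope.

Definition cover_outer (tau : set V -> \bar R) (A : set V) : \bar R :=
  ereal_inf [set \sum_(k <oo) tau (U k) |
             U in [set U : (set V)^nat | A `<=` \bigcup_k U k]].

Variable tau : set V -> \bar R.
Hypotheses (tau0 : tau set0 = 0) (tau_ge0 : forall U, 0 <= tau U).

Let W := g_sigma_algebraType [set: set V].

Let cover_outerE : cover_outer tau = mu_ext (tau : set W -> \bar R).
Proof.
apply/funext => A; congr ereal_inf; apply/seteqP.
split=> _ [U AU <-]; exists U => //=; last by case: AU.
by split=> // i; apply: sub_sigma_algebra.
Qed.

Lemma cover_outer0 : cover_outer tau set0 = 0.
Proof. by rewrite cover_outerE; exact: mu_ext0. Qed.

Lemma cover_outer_ge0 A : 0 <= cover_outer tau A.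
Proof. by rewrite cover_outerE; exact: mu_ext_ge0. Qed.

Lemma le_cover_outer :
  {homo cover_outer tau : A B / A `<=` B >-> A <= B}.
Proof. by move=> A B; rewrite cover_outerE; exact: (@le_mu_ext _ W R). Qed.

Lemma cover_outer_sigma_subadditive : sigma_subadditive (cover_outer tau).
Proof. by rewrite cover_outerE; exact: (@mu_ext_sigma_subadditive _ W R). Qed.

End CoverOuterMeasure.

Section LebesgueMeasure.
Context {R : realType} (n : nat).
Local Notation V := 'rV[R]_n.+1.
Local Open Scope ereal_scope.

Definition box (a b : V) : set V :=
  [set x | forall i, (a ord0 i <= x ord0 i <= b ord0 i)%R].

Definition box_gauge (U : set V) : \bar R :=
  ereal_inf [set (\prod_i (ab.2 ord0 i - ab.1 ord0 i))%:E |
             ab in [set ab : V * V |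
               (forall i, (ab.1 ord0 i <= ab.2 ord0 i)%R) /\
               U `<=` box ab.1 ab.2]].

Lemma box_gauge_ge0 U : 0 <= box_gauge U.
Proof.
apply: le_ereal_inf_tmp => _ [ab [leab _] <-].
by rewrite lee_fin; apply: prodr_ge0 => i _; rewrite subr_ge0.
Qed.

Lemma box_gauge0 : box_gauge set0 = 0.
Proof.
apply/eqP; rewrite eq_le box_gauge_ge0 andbT.
apply: ereal_inf_lbound; exists (0%R, 0%R); first by split.
by rewrite /= big_ord_recl mxE subrr mul0r.
Qed.

Definition lebesgue_outer : set V -> \bar R := cover_outer box_gauge.

HB.instance Definition _ := isOuterMeasure.Build R V lebesgue_outer
  (cover_outer0 box_gauge0 box_gauge_ge0)
  (cover_outer_ge0 box_gauge_ge0)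
  (@le_cover_outer _ _ box_gauge)
  (cover_outer_sigma_subadditive box_gauge_ge0).

Definition lebesgue_om : {outer_measure set V -> \bar R} := lebesgue_outer.

Definition lebesgueN :
    {measure set (caratheodory_type lebesgue_om) -> \bar R} :=
  (lebesgue_om : set (caratheodory_type lebesgue_om) -> \bar R).

End LebesgueMeasure.
Arguments lebesgueN {R n}.

(* Volume of the unit ball of R^s; it normalises the Hausdorff measure so that
   it coincides with surface area on hypersurfaces. *)
Fixpoint unit_ball_volume {R : realType} (s : nat) : R :=
  match s with
  | 0 => 1
  | 1 => 2
  | m.+2 => 2 * pi / m.+2%:R * unit_ball_volume m
  end.

Section SurfaceMeasure.
Context {R : realType} (n : nat).
Local Notation V := 'rV[R]_n.+1.
Local Open Scope ereal_scope.

Definition hausdorff_gauge (s : nat) (delta : R) (U : set V) : \bar R :=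
  if `[< U = set0 >] then 0
  else if ediam U <= delta%:E
    then (unit_ball_volume s * (fine (ediam U) / 2) ^+ s)%:E
  else +oo.

Definition hausdorff (s : nat) (A : set V) : \bar R :=
  ereal_sup [set cover_outer (hausdorff_gauge s delta) A |
             delta in [set delta : R | (0 < delta)%R]].

Lemma unit_ball_volume_ge0 s : (0 <= unit_ball_volume s :> R)%R.
Proof.
have [m] := ubnP s; elim: m s => // m IH [|[|s]] //= sm.
rewrite !mulr_ge0 ?pi_ge0 ?invr_ge0//.
by apply: IH; rewrite ltnS in sm; exact: ltnW.
Qed.

Lemma hausdorff_gauge0 s delta : hausdorff_gauge s delta set0 = 0.
Proof. by rewrite /hausdorff_gauge; case: asboolP. Qed.

Lemma hausdorff_gauge_ge0 s delta U : 0 <= hausdorff_gauge s delta U.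
Proof.
rewrite /hausdorff_gauge; case: asboolP => // /eqP/set0P[x Ux].
case: ifPn => // _; rewrite lee_fin mulr_ge0 ?unit_ball_volume_ge0//.
rewrite exprn_ge0// divr_ge0// fine_ge0//.
apply: (@le_trans _ _ (enorm (x - x))%:E); first by rewrite lee_fin sqrtr_ge0.
by apply: ereal_sup_ubound; exists (x, x).
Qed.

Lemma hausdorff0 s : hausdorff s set0 = 0.
Proof.
rewrite /hausdorff -(@ereal_sup1 R 0); congr ereal_sup; apply/seteqP; split=> x.
  move=> [delta _ <-]; apply: cover_outer0; last exact: hausdorff_gauge_ge0.
  exact: hausdorff_gauge0.
move=> ->; exists 1%R => //=; apply: cover_outer0.
  exact: hausdorff_gauge0.
exact: hausdorff_gauge_ge0.
Qed.

Lemma hausdorff_ge0 s A : 0 <= hausdorff s A.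
Proof.
apply: (@le_trans _ _ (cover_outer (hausdorff_gauge s 1) A)).
  exact/cover_outer_ge0/hausdorff_gauge_ge0.
by apply: ereal_sup_ubound; exists 1%R => /=.
Qed.

Lemma le_hausdorff s : {homo hausdorff s : A B / A `<=` B >-> A <= B}.
Proof.
move=> A B AB; apply: ge_ereal_sup => _ [delta d0 <-].
apply: le_trans (le_cover_outer _ AB) _.
by apply: ereal_sup_ubound; exists delta.
Qed.

Lemma hausdorff_sigma_subadditive s : sigma_subadditive (hausdorff s).
Proof.
move=> F; apply: ge_ereal_sup => _ [delta d0 <-].
apply: le_trans (cover_outer_sigma_subadditive _ _) _.
  exact: hausdorff_gauge_ge0.
apply: lee_nneseries => k *.
  by apply: cover_outer_ge0; exact: hausdorff_gauge_ge0.
by apply: ereal_sup_ubound; exists delta.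
Qed.

HB.instance Definition _ s := isOuterMeasure.Build R V (hausdorff s)
  (hausdorff0 s) (hausdorff_ge0 s) (@le_hausdorff s)
  (@hausdorff_sigma_subadditive s).

(* Surface measure in R^(n+1): the n-dimensional Hausdorff measure. *)
Definition surface_om : {outer_measure set V -> \bar R} := hausdorff n.

Definition surface :
    {measure set (caratheodory_type surface_om) -> \bar R} :=
  (surface_om : set (caratheodory_type surface_om) -> \bar R).

End SurfaceMeasure.
Arguments surface {R n}.

Section Lp.
Context {dT} {T : measurableType dT} {R : realType}.
Variables (mu : {measure set T -> \bar R}) (D : set T).
Local Open Scope ereal_scope.

Definition ae_on (P : T -> Prop) := {ae mu, forall x, D x -> P x}.

Definition Lp_norm (p : \bar R) (f : T -> R) : \bar R :=
  'N[mu]_p[(EFin \o f) \_ D].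

Definition in_Lp (p : \bar R) (f : T -> R) :=
  measurable_fun D f /\ Lp_norm p f < +oo.

End Lp.

Section Smoothness.
Context {R : realType} {n : nat}.
Local Notation V := 'rV[R]_n.+1.
Implicit Types (U A S : set V) (f psi : V -> R).

Definition basis_vec (i : 'I_n.+1) : V := delta_mx ord0 i.

Definition partial (i : 'I_n.+1) f (x : V) : R := 'D_(basis_vec i) f x.

Definition grad f (x : V) : V := \row_i partial i f x.

Fixpoint Ck_on (k : nat) U f : Prop :=
  (forall x, U x -> {for x, continuous f}) /\
  match k with
  | 0 => True
  | k'.+1 => forall i, (forall x, U x -> derivable f x (basis_vec i)) /\
                       Ck_on k' U (partial i f)
  end.

Definition smooth_on U f := forall k, Ck_on k U f.

(* C^1(closure U; R^m): C^1 in U, all derivatives of order <= 1 extending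
   continuously to the closure. *)
Definition C1_closure {m} U (F : V -> 'rV[R]_m.+1) :=
  {within closure U, continuous F} /\
  forall i j, exists g : V -> R,
    {within closure U, continuous g} /\
    forall x, U x -> derivable (fun y => F y ord0 j) x (basis_vec i) /\
                     partial i (fun y => F y ord0 j) x = g x.

Definition test_function U f :=
  smooth_on setT f /\
  exists2 K : set V, compact K /\ K `<=` U & forall x, ~ K x -> f x = 0.

Definition bdry A : set V := closure A `\` interior A.

Definition smooth_boundary A := forall x, bdry A x ->
  exists U psi, [/\ open_nbhs x U, smooth_on U psi, grad psi x != 0 &
                    forall y, U y -> (A y <-> psi y < 0)].

Definition C2_hypersurface S := forall x, S x ->
  exists U psi, [/\ open_nbhs x U, Ck_on 2 U psi, grad psi x != 0 &
                    forall y, U y -> (S y <-> psi y = 0)].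

Definition rel_interior S A : set V :=
  [set x | A x /\ exists2 U, open_nbhs x U & U `&` S `<=` A].

(* Finite union of compact pieces of C^2 hypersurfaces S k; the pieces have
   surface-null relative boundaries and surface-null overlaps. *)
Definition piecewise_C2 A := exists m (S P : 'I_m -> set V),
  [/\ A = \bigcup_k P k,
      forall k, [/\ C2_hypersurface (S k), compact (P k), P k `<=` S k &
                    surface (P k `\` rel_interior (S k) (P k)) = 0%E] &
      forall k l, k != l -> surface (P k `&` P l) = 0%E].

Definition interface A B : set V := bdry A `&` bdry B.

(* Closures allow for A, B having slits close to the interface. *)
Definition unit_normal A B (x nu : V) :=
  [/\ enorm nu = 1,
      exists U psi c, [/\ open_nbhs x U, Ck_on 2 U psi,
        c != 0 /\ grad psi x = c *: nu &
        forall y, U y -> (interface A B y <-> psi y = 0)] &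
      \forall s \near 0^'+,
        closure A (x - s *: nu) /\ closure B (x + s *: nu)].

End Smoothness.

Section Sobolev.
Context {R : realType} {n : nat}.
Local Notation V := 'rV[R]_n.+1.
Implicit Types (Q S : set V) (u v g : V -> R) (Du : V -> V).

Definition weak_partial Q (i : 'I_n.+1) u v :=
  forall phi : V -> R, test_function Q phi ->
    \int[lebesgueN]_(z in Q) (u z * partial i phi z) =
    - \int[lebesgueN]_(z in Q) (v z * phi z).

(* u is in H^1(Q), with weak gradient Du *)
Definition H1 Q u Du :=
  in_Lp lebesgueN Q 2%:E u /\
  forall i, in_Lp lebesgueN Q 2%:E (fun z => Du z ord0 i) /\
            weak_partial Q i u (fun z => Du z ord0 i).

(* g is the L^2(S)-trace, on a piece S of the boundary of the bounded Lipschitz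
   domain Q, of the function u of H^1(Q) with weak gradient Du: the value at u
   of the continuous extension of phi |-> phi|_S from smooth functions. *)
Definition trace_on Q S u Du g :=
  in_Lp surface S 2%:E g /\
  exists phi : nat -> V -> R,
    [/\ forall k, smooth_on setT (phi k),
        Lp_norm lebesgueN Q 2%:E (phi k \- u) @[k --> \oo] --> 0%E,
        forall i, Lp_norm lebesgueN Q 2%:E
          (fun z => partial i (phi k) z - Du z ord0 i) @[k --> \oo] --> 0%E &
        Lp_norm surface S 2%:E (phi k \- g) @[k --> \oo] --> 0%E].

End Sobolev.

Section SpaceTime.
Context {R : realType} {d : nat}.
Local Notation V := 'rV[R]_d.+1.
Local Notation VT := 'rV[R]_d.+2.
Implicit Types (Om : set V) (T : R).

(* (x, t) in R^(d+1) x R is the vector whose last coordinate is t. *)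
Definition space_of (z : VT) : V := \row_i z ord0 (lift ord_max i).
Definition time_of (z : VT) : R := z ord0 ord_max.
Definition spacetime (x : V) (t : R) : VT :=
  \row_j (if unlift ord_max j is Some i then x ord0 i else t).

Definition cylinder Om T : set VT := [set z | Om (space_of z) /\ 0 < time_of z < T].
Definition lateral Om T : set VT :=
  [set z | bdry Om (space_of z) /\ 0 < time_of z < T].
Definition initial_slice Om : set VT := [set z | Om (space_of z) /\ time_of z = 0].

Definition simple_Linfty Om (s : R -> V -> R) :=
  exists m (A : 'I_m -> set R) (g : 'I_m -> V -> R),
    (forall k, measurable (A k) /\ in_Lp lebesgueN Om +oo%E (g k)) /\
    forall t x, s t x = \sum_k \1_(A k) t * g k x.

(* The Bochner space L^2(0,T; L^oo(Om)); r is a jointly measurable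
   representative. *)
Definition L2_Linfty Om T (r : VT -> R) :=
  [/\ measurable_fun (cylinder Om T : set (caratheodory_type (lebesgue_om _))) r,
      exists2 s : nat -> R -> V -> R, (forall k, simple_Linfty Om (s k)) &
        ae_on lebesgue_measure `]0, T[ (fun t =>
          Lp_norm lebesgueN Om +oo%E (fun x => s k t x - r (spacetime x t))
            @[k --> \oo] --> 0%E) &
      (\int[lebesgue_measure]_(t in `]0%R, T[)
        (Lp_norm lebesgueN Om +oo (fun x => r (spacetime x t)) `^ 2) < +oo)%E].

(* r(., t) --> r0 in L^oo(Om) as t --> 0+, along the complement of a null set
   of times; this is the value at 0 of the representative of r in
   C([0,T]; L^oo(Om)). *)
Definition initial_value Om (r : VT -> R) (r0 : V -> R) :=
  in_Lp lebesgueN Om +oo%E r0 /\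
  forall e : R, 0 < e -> exists2 delta : R, 0 < delta &
    ae_on lebesgue_measure `]0, delta[ (fun t =>
      (Lp_norm lebesgueN Om +oo (fun x => r (spacetime x t) - r0 x)%R
        <= e%:E)%E).

(* |r0| > 0 at every point of the closure, for an L^oo class r0: r0 is
   essentially bounded away from 0 near each point.  For r0 continuous on the
   closure this is |r0 x| > 0 for all x. *)
Definition nonvanishing_on_closure Om (r0 : V -> R) :=
  forall x, closure Om x ->
    exists2 m : R, 0 < m &
      exists2 U : set V, open_nbhs x U &
        ae_on lebesgueN (Om `&` U) (fun y => m <= `|r0 y|).

End SpaceTime.

Section Partition.
Context {R : realType} {d N : nat}.
Local Notation V := 'rV[R]_d.+1.
Variables (Om : set V) (H : V -> V).
Variables (Oi : 'I_N -> set V) (nu : 'I_N -> 'I_N -> V -> V).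

Definition is_domain (A : set V) := [/\ open A, connected A & A !=set0].

Definition gamma i j : set V := interface (Oi i) (Oi j).

Definition proper_interface i j := i != j /\ (0 < surface (gamma i j))%E.

(* nu i j is the field of unit normals of gamma_ij directed from Omega_i
   towards Omega_j. *)
Record domain_partition : Prop := DomainPartition {
  partition_domain : forall i, is_domain (Oi i) /\ Oi i `<=` Om;
  partition_disjoint : forall i j, i != j -> Oi i `&` Oi j = set0;
  partition_cover : closure Om = \bigcup_i closure (Oi i);
  partition_C2 : forall i j, proper_interface i j -> piecewise_C2 (gamma i j);
  partition_normal : forall i j, proper_interface i j ->
    ae_on surface (gamma i j) (fun x => unit_normal (Oi i) (Oi j) x (nu i j x))
}.

Definition flux i j x : R := dot (H x) (nu i j x).

Definition outflow i j := ae_on surface (gamma i j) (fun x => 0 < flux i j x).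
Definition inflow i j := ae_on surface (gamma i j) (fun x => flux i j x < 0).
Definition noflow i j := ae_on surface (gamma i j) (fun x => flux i j x = 0).

Definition condition_B :=
  (forall i j, proper_interface i j ->
    [\/ outflow i j, inflow i j | noflow i j]) /\
  forall i, exists2 delta1 : R, 0 < delta1 &
    exists2 v : V, enorm v = 1 &
      forall x, closure (Oi i) x -> delta1 < dot (H x) v.

(* Edge of the graph Lambda from O_i to O_j; the segment between them is
   labelled either ij or ji. *)
Definition Lambda : rel 'I_N := fun i j =>
  `[< proper_interface i j /\ outflow i j \/
      proper_interface j i /\ inflow j i >].

Definition condition_C := forall c : seq 'I_N, ucycle Lambda c -> c = [::].

End Partition.

(* Main.v *)
(* Conditions (B) and (C) force every integral curve of H to leave Omega before a
 time S: along almost every curve the subdomains are crossed in the order of the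
 acyclic graph, and in each of them H has a fixed direction; exits are an open
 condition, so "almost every" improves to "every". Take T0 = S. For w = du/dt,
 integrating w_t + H.grad w + p w = (dR/dt) f along the curves of (H, 1) up to the
 boundary bounds w(., t), with the weight e^(-l tau), tau the exit time, by the
 lateral trace plus a multiple of f that tends to 0 as l grows. Since u vanishes
 at t = 0, averaging the equation of u over short times gives
 |R(., 0) f| <= |w| + o(1), and the f term is absorbed. *)
Require Import Defs.
From HB Require Import structures.
From mathcomp Require Import all_boot all_order all_algebra.
From mathcomp Require Import all_classical all_reals all_analysis measurable_realfun.
From mathcomp Require Import ring lra.
Set Implicit Arguments.
Unset Strict Implicit.
Unset Printing Implicit Defensive.
Import Order.TTheory GRing.Theory Num.Theory.
Import numFieldNormedType.Exports.
Local Open Scope classical_set_scope.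
Local Open Scope ring_scope.

Local Notation lam := lebesgue_outer.
Local Notation xof := space_of.
Local Notation tof := time_of.
Local Notation LM := (caratheodory_type (lebesgue_om _)).
Local Notation mfunT := (measurable_fun setT).
Local Notation mEF := measurable_EFinP.
Local Notation nullB N := (measurable N /\ lam N = 0%E).
Local Notation lam_sub := (outer_measure_sigma_subadditive (lebesgue_om _)).
Local Notation measK := measurable_cst.
Local Notation measF := continuous_measurable_fun.
Local Notation measM := measurable_funM.
Local Notation measX := measurable_funX.
Local Notation measB := measurable_funB.
Local Notation measC := measurableT_comp.
Local Notation measI := measurable_indic.
Local Notation measTS := measurable_funTS.
Local Notation measeM := measurable_funeM.
Local Notation le_via y := (@le_trans _ _ y).
Local Notation mset := (X in measurable X)%pattern.
Local Notation mge0 := mulr_ge0.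
Local Notation intZl := ge0_integralZl.

Ltac rvring := by apply/rowP => ?; rewrite !mxE; ring.

Section norm_facts.
Context {R : realType} {n : nat}.
Implicit Types x y z : 'rV[R]_n.+1.

Lemma coord_le x i : `|x ord0 i| <= `|x|.
Proof.
rewrite {2}/Num.norm/= mx_normrE.
by apply: (le_bigmax_cond _ (fun ij : 'I_1 * 'I_n.+1 => `|x ij.1 ij.2|) (j := (ord0, i))).
Qed.

Lemma norm_le x (e : R) : 0 <= e -> (forall i, `|x ord0 i| <= e) -> `|x| <= e.
Proof.
move=> e0 h; rewrite {1}/Num.norm/= mx_normrE.
by apply: bigmax_le => // -[i j] _ /=; rewrite (ord1 i).
Qed.

Lemma norm_coord x : exists i, `|x| = `|x ord0 i|.
Proof.
have [->|x0] := eqVneq x 0.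
 by exists ord0; rewrite normr0 mxE normr0.
have : mx_norm x != 0 by apply: contra x0 => /eqP/mx_norm_eq0 ->.
by move=> /mx_norm_neq0[[i j] /= h]; exists j; move: h; rewrite (ord1 i) => <-.
Qed.

Lemma ball_normP x y (e : R) : ball x e y <-> `|x - y| < e.
Proof. by rewrite -ball_normE. Qed.

Lemma dotDl x y z : dot (x + y) z = dot x z + dot y z.
Proof. by rewrite /dot -big_split/=; apply: eq_bigr => i _; rewrite mxE mulrDl. Qed.

Lemma dotC x y : dot x y = dot y x.
Proof. by rewrite /dot; apply: eq_bigr => i _; rewrite mulrC. Qed.

Lemma dotDr x y z : dot x (y + z) = dot x y + dot x z.
Proof. by rewrite dotC dotDl !(dotC x). Qed.

Lemma dotZl (a : R) x y : dot (a *: x) y = a * dot x y.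
Proof. by rewrite /dot mulr_sumr; apply: eq_bigr => i _; rewrite mxE mulrA. Qed.

Lemma dotZr (a : R) x y : dot x (a *: y) = a * dot x y.
Proof. by rewrite dotC dotZl dotC. Qed.

Lemma dotNl x y : dot (- x) y = - dot x y.
Proof. by rewrite -scaleN1r dotZl mulN1r. Qed.

Lemma dotNr x y : dot x (- y) = - dot x y.
Proof. by rewrite dotC dotNl dotC. Qed.

Lemma dotBl x y z : dot (x - y) z = dot x z - dot y z.
Proof. by rewrite dotDl dotNl. Qed.

Lemma dotBr x y z : dot x (y - z) = dot x y - dot x z.
Proof. by rewrite dotDr dotNr. Qed.

Lemma dot0l x : dot 0 x = 0.
Proof. by rewrite -(scale0r 0) dotZl mul0r. Qed.

Lemma dot0r x : dot x 0 = 0.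
Proof. by rewrite dotC dot0l. Qed.

Lemma dot_ge0 x : 0 <= dot x x.
Proof. by rewrite /dot; apply: sumr_ge0 => i _; rewrite -expr2 sqr_ge0. Qed.

Lemma sqr_coord_le_dot x i : x ord0 i ^+ 2 <= dot x x.
Proof.
rewrite /dot (bigD1 i)//= -expr2 lerDl.
by apply: sumr_ge0 => j _; rewrite -expr2 sqr_ge0.
Qed.

Lemma dot_eq0 x : dot x x = 0 -> x = 0.
Proof.
move=> h; apply/rowP => i; rewrite mxE; apply/eqP; rewrite -sqrf_eq0 eq_le sqr_ge0 andbT.
by rewrite -h sqr_coord_le_dot.
Qed.

Lemma dot_gt0 x : x != 0 -> 0 < dot x x.
Proof.
move=> x0; rewrite lt_neqAle dot_ge0 andbT eq_sym.
by apply: contra x0 => /eqP/dot_eq0 ->.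
Qed.

Lemma dot_le_norm x y : `|dot x y| <= n.+1%:R * `|x| * `|y|.
Proof.
rewrite /dot; apply: le_trans (ler_norm_sum _ _ _) _.
apply: (le_via (\sum_(i < n.+1) `|x| * `|y|)).
 by apply: ler_sum => i _; rewrite normrM ler_pM// coord_le.
by rewrite sumr_const card_ord -mulrA mulr_natl.
Qed.

Lemma norm_le_enorm x : `|x| <= enorm x.
Proof.
have [i ->] := norm_coord x.
by rewrite /enorm -sqrtr_sqr ler_wsqrtr// sqr_coord_le_dot.
Qed.

Lemma enorm_sqr x : enorm x ^+ 2 = dot x x.
Proof. by rewrite /enorm sqr_sqrtr// dot_ge0. Qed.

Lemma closed_rVball x (r : R) : closed [set y : 'rV[R]_n.+1 | `|x - y| <= r].
Proof.
rewrite (_ : [set _ | _] = (fun y => `|x - y|) @^-1` [set t | t <= r])//.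
apply: closed_comp; last exact: closed_le.
move=> y _; apply: continuous_comp; last exact: norm_continuous.
by apply: continuousB; [exact: cst_continuous|move=> A].
Qed.

Lemma compact_rVball x (r : R) : compact [set y : 'rV[R]_n.+1 | `|x - y| <= r].
Proof.
apply: bounded_closed_compact; last exact: closed_rVball.
exists (`|x| + r); split; first by rewrite num_real.
move=> M ltM y /= xyr; apply: le_trans (ltW ltM).
have -> : y = x - (x - y) by rewrite opprB addrC subrK.
by rewrite (le_trans (ler_normB _ _))// lerD2l.
Qed.

End norm_facts.

Section calculus.
Context {R : realType} {n : nat}.
Local Notation V := 'rV[R]_n.+1.

Lemma is_derive_line (f : V -> R) (w v : V) (t : R) :
 derivable f (w + t *: v) v ->
 is_derive t 1 (fun s : R => f (w + s *: v)) ('D_v f (w + t *: v)).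
Proof.
move=> df.
have e : (fun h : R => h^-1 *: (((fun s : R => f (w + s *: v)) \o shift t) (h *: 1) -
 (fun s : R => f (w + s *: v)) t)) =
 (fun h : R => h^-1 *: ((f \o shift (w + t *: v)) (h *: v) - f (w + t *: v))).
 apply/funext => h /=; congr (_ *: (f _ - _)).
 by rewrite -[h *: 1]/(h * 1) mulr1 scalerDl addrCA.
by split; rewrite /derivable /derive e.
Qed.

Lemma mvt_unit (g dg : R -> R) (c e : R) :
 (forall t : R, 0 <= t <= 1 -> is_derive t 1 g (dg t)) ->
 (forall t : R, 0 <= t <= 1 -> `|dg t - c| <= e) ->
 `|g 1 - g 0 - c| <= e.
Proof.
move=> dgP le.
have [||x x01 ->] := @MVT_segment R g dg 0 1 ler01.
- by move=> x; rewrite in_itv/= => /andP[x0 x1]; apply: dgP; rewrite !ltW.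
- apply: derivable_within_continuous => x; rewrite in_itv/= => x01.
 by have [] := dgP _ x01.
- by rewrite subr0 mulr1; apply: le; move: x01; rewrite in_itv.
Qed.

Lemma derivable_scale (f : V -> R) (x v : V) (a : R) :
 derivable f x v -> derivable f x (a *: v) /\ 'D_(a *: v) f x = a * 'D_v f x.
Proof.
move=> df.
have H : h^-1 *: ((f \o shift x) (h *: (a *: v)) - f x) @[h --> 0^'] --> a * 'D_v f x.
 have [->|a0] := eqVneq a 0.
 rewrite mul0r; apply: cvg_near_cst; near=> h.
 by rewrite /= scale0r scaler0 add0r subrr scaler0.
 have -> : (fun h : R => h^-1 *: ((f \o shift x) (h *: (a *: v)) - f x)) =
 (fun h : R => a * ((h * a)^-1 *: ((f \o shift x) ((h * a) *: v) - f x))).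
 apply/funext => h /=; rewrite scalerA /GRing.scale/= invfM.
 by rewrite mulrA (mulrCA a) divff// mulr1.
 apply: cvgZr.
 have ca : (fun h : R => h * a) @ 0^' --> 0^'.
 move=> A; rewrite /= /dnbhs /within /= => -[e e0 Ae].
 exists (e / `|a|) => /=; first by rewrite divr_gt0// normr_gt0.
 move=> h /=; rewrite sub0r normrN => he h0; apply: Ae => /=.
 by rewrite sub0r normrN normrM -ltr_pdivlMr// normr_gt0.
 by rewrite mulf_neq0.
 exact: (cvg_comp _ _ ca df).
split; first by apply/cvg_ex; eexists; exact: H.
exact: cvg_lim H.
Unshelve. all: by end_near. Qed.

(* The path from z to y changes one coordinate at a time; it stays in the ball
 because balls of the sup norm are boxes. *)
Lemma strict_diff (f : V -> R) (x : V) (r0 e : R) :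
 (forall w, ball x r0 w -> forall i, derivable f w (basis_vec i)) ->
 0 < r0 -> (forall i, {for x, continuous (partial i f)}) -> 0 < e ->
 exists2 r, 0 < r <= r0 & forall y z, ball x r y -> ball x r z ->
 `|f y - f z - dot (grad f x) (y - z)| <= e * `|y - z|.
Proof.
move=> df r00 cf e0.
have : \forall w \near x, forall i, `|partial i f x - partial i f w| <= e / n.+1%:R.
 have H i : \forall w \near x, `|partial i f x - partial i f w| <= e / n.+1%:R.
 by have /cvgrPdist_le := cf i; apply; rewrite divr_gt0.
 exact: (@filter_forall V 'I_n.+1 _ (nbhs x) _ H).
move=> /nbhs_ballP[r1 /= r10 hr1].
exists (Num.min r0 r1); first by rewrite lt_min r00 r10 ge_min lexx.
move=> y z xy xz.
pose w k : V := \row_i (if (i < k)%N then y ord0 i else z ord0 i).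
have -> : f y - f z - dot (grad f x) (y - z) =
 \sum_(k < n.+1) (f (w k.+1) - f (w k) - partial k f x * (y ord0 k - z ord0 k)).
 rewrite sumrB; congr (_ - _); last first.
 by rewrite /dot; apply: eq_bigr => i _; rewrite !mxE.
 rewrite -(big_mkord predT (fun k => f (w k.+1) - f (w k))) telescope_sumr//.
 by congr (f _ - f _); apply/rowP => i; rewrite mxE ?ltn_ord.
apply: le_trans (ler_norm_sum _ _ _) _.
suff h (k : 'I_n.+1) : `|f (w k.+1) - f (w k) - partial k f x * (y ord0 k - z ord0 k)|
 <= e / n.+1%:R * `|y - z|.
 apply: le_trans (ler_sum _ (fun k _ => h k)) _.
 by rewrite sumr_const card_ord -(mulr_natl (e / _ * _)) mulrA mulrCA divff// mulr1.
set a := y ord0 k - z ord0 k.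
have ea : `|a| <= `|y - z| by rewrite (_ : a = (y - z) ord0 k) ?coord_le// !mxE.
have wS : w k.+1 = w k + 1 *: (a *: basis_vec k).
 rewrite scale1r; apply/rowP => i; rewrite !mxE ltnS leq_eqVlt eqxx/=.
 have [->|ik] := eqVneq i k; first by rewrite eqxx/= ltnn mulr1 /a addrC subrK.
 by rewrite mulr0 addr0 (_ : (i == k :> nat) = false)//; apply/negbTE.
have inb t : 0 <= t <= 1 -> ball x (Num.min r0 r1) (w k + t *: (a *: basis_vec k)).
 move=> /andP[t0 t1]; apply/ball_normP.
 have /ball_normP xy' := xy; have /ball_normP xz' := xz.
 apply: (@le_lt_trans _ _ (Num.max `|x - y| `|x - z|)); last by rewrite gt_max xy' xz'.
 apply: norm_le => [|i]; first by rewrite le_max normr_ge0.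
 rewrite !mxE eqxx/=; have [->|ik] := eqVneq i k; last first.
 rewrite !mulr0 addr0; case: ifP => _; rewrite le_max.
 by have := coord_le (x - y) i; rewrite !mxE => ->.
 by have := coord_le (x - z) i; rewrite !mxE => ->; rewrite orbT.
 rewrite ltnn mulr1 /a.
 have := coord_le (x - y) k; have := coord_le (x - z) k; rewrite !mxE.
 set X := x _ _; set Y := y _ _; set Z := z _ _ => h1 h2.
 rewrite (_ : X - _ = t * (X - Y) + (1 - t) * (X - Z)); last by ring.
 apply: le_trans (ler_normD _ _) _; rewrite !normrM (ger0_norm t0) (@ger0_norm _ (1 - t)) ?subr_ge0//.
 rewrite [leRHS](_ : _ = t * Num.max `|x - y| `|x - z| + (1 - t) * Num.max `|x - y| `|x - z|); last by ring.
 by rewrite lerD// ler_wpM2l ?subr_ge0// le_max ?h1 ?h2 ?orbT.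
rewrite wS -{2}(addr0 (w k)) -(scale0r (a *: basis_vec k)).
have der w' : ball x (Num.min r0 r1) w' -> derivable f w' (a *: basis_vec k) /\
 'D_(a *: basis_vec k) f w' = a * partial k f w'.
 move=> xw'; apply: derivable_scale; apply: df.
 by apply: le_ball xw'; rewrite ge_min lexx.
have K1 (t : R) : 0 <= t <= 1 -> is_derive t 1 (fun s : R => f (w k + s *: (a *: basis_vec k)))
 ('D_(a *: basis_vec k) f (w k + t *: (a *: basis_vec k))).
 by move=> t01; apply: is_derive_line; exact: (der _ (inb _ t01)).1.
apply: (mvt_unit K1) => t t01.
rewrite (der _ (inb _ t01)).2 [_ * a]mulrC -mulrBr normrM mulrC.
apply: ler_pM => //; rewrite distrC; apply: hr1.
by apply: le_ball (inb _ t01); rewrite ge_min lexx orbT.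
Qed.

End calculus.

Lemma is_derive_eps {R : realType} (g : R -> R) (t d : R) :
 is_derive t 1 g d <->
 (forall e : R, 0 < e -> exists2 r : R, 0 < r &
 forall h, `|h| < r -> `|g (t + h) - g t - h * d| <= e * `|h|).
Proof.
have key h : h != 0 -> `|d - h^-1 *: ((g \o shift t) (h *: 1) - g t)| =
 `|h|^-1 * `|g (t + h) - g t - h * d|.
 move=> h0; rewrite -normfV -normrM distrC; congr `| _ |.
 rewrite /GRing.scale/= mulr1 [h + t]addrC mulrBr mulrBr (mulrA _ h) mulVf// mul1r.
 by rewrite mulrBr.
split=> [[dg <-]|H].
 move=> e e0; have /cvgrPdist_le := dg; rewrite -/('D_1 g t) => /(_ _ e0).
 rewrite /= nearE /dnbhs /within /= => -[r /= r0 hr]; exists r => // h hr'.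
 have [->|h0] := eqVneq h 0; first by rewrite addr0 subrr mul0r subrr normr0 mulr0.
 have := hr h; rewrite /= sub0r normrN => /(_ hr' h0).
 move=> le1.
 have e1 : g (t + h) - g t - h * 'D_1 g t =
 - (h * ('D_1 g t - h^-1 *: ((g \o shift t) (h *: 1) - g t))).
 rewrite /GRing.scale/= mulr1 [h + t]addrC !mulrBr !mulrA divff// !mul1r.
 by rewrite opprB.
 by rewrite e1 normrN normrM mulrC ler_wpM2r.
have C : h^-1 *: ((g \o shift t) (h *: 1) - g t) @[h --> 0^'] --> d.
 apply/cvgrPdist_le => e e0; have [r r0 hr] := H _ e0.
 exists r => // h hr' h0.
 have {}hr' : `|h| < r by move: hr'; rewrite /ball_/= sub0r normrN.
 by rewrite key// mulrC ler_pdivrMr ?normr_gt0// hr.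
by split; [apply/cvg_ex; exists d|exact: cvg_lim C].
Qed.

Section chain_rule.
Context {R : realType} {n : nat}.
Local Notation V := 'rV[R]_n.+1.

Lemma continuous_ballP (f : V -> R) (x : V) : {for x, continuous f} <->
 forall e : R, 0 < e -> exists2 r : R, 0 < r & forall y, ball x r y -> `|f x - f y| <= e.
Proof.
split=> [/cvgrPdist_le cf e e0|H].
 by have /nbhs_ballP[r /= r0 hr] := cf _ e0; exists r.
apply/(@cvgrPdist_le _ _ _ (nbhs x) (nbhs_filter x)) => e e0.
by have [r r0 hr] := H _ e0; apply/nbhs_ballP; exists r.
Qed.

Definition is_derive_rV (c : R -> V) (t : R) (v : V) :=
 forall i, is_derive t 1 (fun s : R => c s ord0 i) (v ord0 i).

Lemma is_derive_rV_eps (c : R -> V) (t : R) (v : V) :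
 is_derive_rV c t v ->
 forall e : R, 0 < e -> exists2 r : R, 0 < r &
 forall h, `|h| < r -> `|c (t + h) - c t - h *: v| <= e * `|h|.
Proof.
move=> dc e e0.
have H i : exists r : R, 0 < r /\ forall h, `|h| < r ->
 `|c (t + h) ord0 i - c t ord0 i - h * v ord0 i| <= e * `|h|.
 by have /is_derive_eps/(_ _ e0)[r r0 hr] := dc i; exists r.
have [r hr] := choice H.
exists (\big[Num.min/1]_i r i) => [|h hh].
 by apply: lt_bigmin => // i _; case: (hr i).
apply: norm_le => [|i]; first by rewrite mge0// ltW.
rewrite !mxE; apply: (hr i).2; apply: lt_le_trans hh _.
exact: bigmin_le_cond.
Qed.

Definition strict_at (f : V -> R) (x g : V) := forall e : R, 0 < e ->
 exists2 r : R, 0 < r & forall y z, ball x r y -> ball x r z ->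
 `|f y - f z - dot g (y - z)| <= e * `|y - z|.

Lemma is_derive_comp_strict (f : V -> R) (g : V) (c : R -> V) (t : R) (v : V) :
 strict_at f (c t) g -> is_derive_rV c t v ->
 is_derive t 1 (fun s => f (c s)) (dot g v).
Proof.
move=> sf dc; apply/is_derive_eps => e e0.
set K := `|v| + 1; have K0 : 0 < K by rewrite ltr_wpDl.
set G := n.+1%:R * `|g| + 1; have G0 : 0 < G by rewrite ltr_wpDl.
have [r r0 hr] := sf (e / 2 / K) (divr_gt0 (divr_gt0 e0 (ltr0Sn _ 1)) K0).
have [r1 r10 hr1] := is_derive_rV_eps dc (ltr01 : 0 < 1 :> R).
have [r2 r20 hr2] := is_derive_rV_eps dc (divr_gt0 (divr_gt0 e0 (ltr0Sn _ 1)) G0).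
exists (Num.min (Num.min r1 r2) (r / K)) => [|h].
 by rewrite !lt_min r10 r20 divr_gt0.
rewrite !lt_min => /andP[/andP[h1 h2] h3].
have le1 : `|c (t + h) - c t| <= K * `|h|.
 rewrite (_ : c (t + h) - c t = (c (t + h) - c t - h *: v) + h *: v); last by rewrite subrK.
 apply: le_trans (ler_normD _ _) _; rewrite normrZ /K mulrDl addrC mulrC lerD2l.
 exact: hr1.
have b1 : ball (c t) r (c (t + h)).
 apply/ball_normP; rewrite distrC; apply: le_lt_trans le1 _.
 by rewrite mulrC -ltr_pdivlMr.
have b0 : ball (c t) r (c t) by apply/ball_normP; rewrite subrr normr0.
have := hr _ _ b1 b0 => le2.
rewrite (_ : f (c (t + h)) - _ - _ = (f (c (t + h)) - f (c t) - dot g (c (t + h) - c t)) +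
 dot g (c (t + h) - c t - h *: v)); last by rewrite !dotBr dotZr; ring.
apply: le_trans (ler_normD _ _) _; rewrite (splitr e) mulrDl lerD//.
 apply: le_trans le2 _; rewrite -mulrA; apply: ler_wpM2l; first by rewrite divr_ge0// ltW.
 by rewrite ler_pdivrMl.
apply: le_trans (dot_le_norm _ _) _.
apply: (le_via (G * (e / 2 / G * `|h|))); last by rewrite mulrA mulrCA divff ?gt_eqF// mulr1.
by apply: ler_pM; rewrite ?mge0//; [rewrite lerDl|exact: hr2].
Qed.

Lemma strict_at_bound (f : V -> R) (x g : V) : strict_at f x g ->
 exists r K : R, [/\ 0 < r, 0 < K & forall y z, ball x r y -> ball x r z ->
 `|f y - f z| <= K * `|y - z|].
Proof.
move=> /(_ _ ltr01)[r r0 h]; exists r, (n.+1%:R * `|g| + 1); split=> //.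
move=> y z xy xz; rewrite -(subrK (dot g (y - z)) (f y - f z)).
apply: le_trans (ler_normD _ _) _; apply: le_trans (lerD (h _ _ xy xz) (dot_le_norm _ _)) _.
by rewrite -mulrDl addrC.
Qed.

Lemma Ck_strict (U : set V) (f : V -> R) (x : V) :
 open U -> Ck_on 1 U f -> U x -> strict_at f x (grad f x).
Proof.
move=> oU [_ cf] Ux e e0.
have /nbhs_ballP[r0 /= r00 r0U] : nbhs x U by exact: open_nbhs_nbhs.
have [||||r /andP[r1 _] hr] := @strict_diff _ _ f x r0 e; last by exists r.
- by move=> w xw i; apply: (cf i).1; exact: r0U.
- by [].
- by move=> i; have [_ [+ _]] := cf i; exact.
- by [].
Qed.

Lemma CkS k (U : set V) (f : V -> R) : Ck_on k.+1 U f -> Ck_on k U f.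
Proof.
elim: k f => [|k IH] f [cf df]; first by split.
by split=> // i; have [h1 h2] := df i; split=> //; exact: IH.
Qed.

End chain_rule.

Lemma clip_le (R : realDomainType) (B p q a : R) : 0 <= a -> p <= q + a ->
 Num.max (- B) (Num.min B p) <= Num.max (- B) (Num.min B q) + a.
Proof.
move=> a0 pq; rewrite ge_max; apply/andP; split.
 by apply: ler_wpDr => //; rewrite le_max lexx.
apply: (le_via (Num.min B q + a)); last by rewrite lerD2r le_max lexx orbT.
by case: (leP B q) => _; [rewrite ge_min lerDl a0|rewrite ge_min pq orbT].
Qed.

Section lipschitz_geometry.
Context {R : realType} {n : nat}.
Local Notation V := 'rV[R]_n.+1.

Definition lipschitz_on (A : set V) (f : V -> R) (L : R) :=
 forall y z, A y -> A z -> `|f y - f z| <= L * `|y - z|.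

Lemma segment_lip (A : set V) (f : V -> R) (K : R) (y z : V) :
 (forall w, A w -> strict_at f w (grad f w)) ->
 (forall w, A w -> `|grad f w| <= K) ->
 (forall t : R, 0 <= t <= 1 -> A (z + t *: (y - z))) ->
 `|f y - f z| <= n.+1%:R * K * `|y - z|.
Proof.
move=> sf gK hA.
have D (t : R) : 0 <= t <= 1 -> is_derive t 1 (fun s : R => f (z + s *: (y - z)))
 (dot (grad f (z + t *: (y - z))) (y - z)).
 move=> t01; apply: is_derive_comp_strict; first exact/sf/hA.
 move=> i; apply/is_derive_eps => e e0; exists 1 => // h _.
 rewrite !mxE; set a := y _ _; set b := z _ _.
 by rewrite (_ : _ - _ = 0) ?normr0 ?mge0// ?ltW//; ring.
have := mvt_unit (c := 0) D; rewrite /= scale0r scale1r addr0 subr0 [z + _]addrC subrK.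
apply => t t01; rewrite subr0; apply: le_trans (dot_le_norm _ _) _.
by rewrite ler_wpM2r// ler_wpM2l// gK//; exact: hA.
Qed.

Lemma compact_lip (K A : set V) (f : V -> R) (B : R) :
 compact K -> A `<=` K -> (forall y, A y -> `|f y| <= B) ->
 (forall x, K x -> exists r L : R, [/\ 0 < r & lipschitz_on (A `&` ball x r) f L]) ->
 exists2 L : R, 0 <= L & lipschitz_on A f L.
Proof.
move=> cK AK fB loc; apply: contrapT => /forall2NP nL.
have Hn (m : nat) : exists p : V * V, [/\ A p.1, A p.2 &
 m%:R * `|p.1 - p.2| < `|f p.1 - f p.2|].
 have [|] := nL m%:R; first by rewrite ler0n.
 move=> /existsNP[y /existsNP[z /not_implyP[Ay /not_implyP[Az /negP]]]].
 by rewrite -ltNge => h; exists (y, z).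
have [p hp] := choice Hn.
have PF : ProperFilter ((fun m => (p m).1) @ \oo) by exact: fmap_proper_filter.
have [|x [Kx clx]] := cK _ PF.
 by exists 0%N => // m _; apply: AK; have [] := hp m.
have [r [L [r0 hL]]] := loc _ Kx.
pose N := (Num.bound (`|L| + 1 + 4 * `|B| / r)).
have Nb : `|L| + 1 + 4 * `|B| / r < N%:R.
 by have := archi_boundP (_ : 0 <= `|L| + 1 + 4 * `|B| / r); apply; rewrite addr_ge0 ?divr_ge0 ?mge0 ?addr_ge0// ltW.
have [||w [[m /= Nm <-]]] := clx [set (p m).1 | m in [set m | (N <= m)%N]] (ball x (r / 2)).
 by exists N => // m /= Nm; exists m.
 by apply/nbhs_ballP; exists (r / 2) => //=; rewrite divr_gt0.
move=> xp; have [Ap1 Ap2 hlt] := hp m.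
have NLm : `|L| + 1 + 4 * `|B| / r < m%:R by apply: lt_le_trans Nb _; rewrite ler_nat.
have B0 : 0 <= `|B| by [].
have L0 : 0 <= `|L| by [].
have m0 : 0 < m%:R :> R.
 by apply: le_lt_trans NLm; rewrite addr_ge0 ?addr_ge0// divr_ge0 ?mge0// ltW.
have d1 : `|(p m).1 - (p m).2| < r / 2.
 have h1 : m%:R * `|(p m).1 - (p m).2| < 2 * `|B|.
 apply: lt_le_trans hlt _; apply: le_trans (ler_normB _ _) _.
 rewrite mulr_natl mulr2n lerD// (le_trans _ (ler_norm _))//; exact: fB.
 have h2 : 4 * `|B| / r < m%:R by apply: le_lt_trans NLm; rewrite lerDr addr_ge0.
 move: h2; rewrite ltr_pdivrMr// => h2.
 by rewrite -(ltr_pM2l m0); apply: lt_trans h1 _; lra.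
have := hL (p m).1 (p m).2; move=> /(_ _ _)/wrap[].
 by split=> //; apply: le_ball xp; lra.
 split=> //; apply/ball_normP; have /ball_normP xp' := xp.
 rewrite (_ : x - (p m).2 = (x - (p m).1) + ((p m).1 - (p m).2)); last by rewrite addrA subrK.
 by apply: le_lt_trans (ler_normD _ _) _; rewrite (splitr r) ltrD.
move=> h; have := lt_le_trans hlt h; apply/negP; rewrite -leNgt.
rewrite ler_wpM2r//; apply: le_trans (ltW NLm).
by apply: (le_trans (ler_norm _)); rewrite -addrA lerDl addr_ge0// divr_ge0 ?mge0// ltW.
Qed.

Lemma lipschitz_extension (A : set V) (f : V -> R) (L B : R) :
 A !=set0 -> 0 <= L -> lipschitz_on A f L -> (forall y, A y -> `|f y| <= B) ->
 exists g : V -> R, [/\ lipschitz_on setT g L, forall y, `|g y| <= B &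
 forall y, A y -> g y = f y].
Proof.
move=> [a Aa] L0 lf fB.
have B0 : 0 <= B by apply: le_trans (fB _ Aa).
pose S x := [set f y + L * `|x - y| | y in A].
have hS x : has_inf (S x).
 split; first by exists (f a + L * `|x - a|); exists a.
 exists (- B) => _ [y Ay <-]; have := fB _ Ay; rewrite ler_norml => /andP[+ _].
 by move=> h; rewrite (le_trans h)// lerDl mge0.
have lS x y : inf (S x) <= inf (S y) + L * `|x - y|.
 rewrite -lerBlDr; apply: lb_le_inf; first by case: (hS y).
 move=> _ [z Az <-]; rewrite lerBlDr.
 apply: (le_via (f z + L * `|x - z|)).
 by apply: ge_inf; [case: (hS x)|exists z].
 rewrite -addrA lerD2l -mulrDr ler_wpM2l// [leRHS]addrC.
 by rewrite (_ : x - z = (x - y) + (y - z)) ?ler_normD// addrA subrK.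
have lS' x y : `|inf (S x) - inf (S y)| <= L * `|x - y|.
 rewrite ler_norml lerBlDl lS andbT lerNl opprB lerBlDl distrC; exact: lS.
exists (fun x => Num.max (- B) (Num.min B (inf (S x)))); split.
- move=> x y _ _; apply: le_trans (lS' x y).
 set p := inf _; set q := inf _.
 rewrite ler_norml; apply/andP; split; rewrite ?lerBrDl ?lerBlDl addrC.
 by apply: clip_le => //; rewrite -lerBlDl distrC ler_norm.
 by rewrite [leRHS]addrC; apply: clip_le => //; rewrite -lerBlDl ler_norm.
- by move=> x; rewrite ler_norml le_max lexx/= ge_max ge_min lexx/= andbT; lra.
move=> y Ay.
have -> : inf (S y) = f y.
 apply/eqP; rewrite eq_le; apply/andP; split.
 by apply: ge_inf; [case: (hS y)|exists y => //; rewrite subrr normr0 mulr0 addr0].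
 apply: lb_le_inf; first by case: (hS y).
 move=> _ [z Az <-]; rewrite -lerBlDl; apply: le_trans (lf _ _ Ay Az).
 exact: ler_norm.
have := fB _ Ay; rewrite ler_norml => /andP[h1 h2].
by rewrite (min_idPr h2) (max_idPr h1).
Qed.

End lipschitz_geometry.

Section smooth_domain.
Context {R : realType} {n : nat}.
Local Notation V := 'rV[R]_n.+1.

Lemma within_continuous_bounded {W : normedModType R} (K : set V) (g : V -> W) :
 compact K -> {within K, continuous g} -> exists2 M : R, 0 <= M & forall x, K x -> `|g x| <= M.
Proof.
move=> cK cg.
have : bounded_set [set g x | x in K] by apply: compact_bounded; exact: continuous_compact.
move=> [M [Mr h]]; exists (`|M| + 1) => // x Kx.
by apply: (h (`|M| + 1)); [rewrite (le_lt_trans (ler_norm _))// ltrDl|exists x].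
Qed.

Lemma closure_compact (A : set V) : bounded_set A -> compact (closure A).
Proof.
move=> [M [Mr h]]; apply: bounded_closed_compact; last exact: closed_closure.
exists M; split=> // M' MM' x clx.
have : closure [set y : V | `|0 - y| <= M'] x.
 by apply: closure_subset clx => y Ay /=; rewrite sub0r normrN; exact: h.
by rewrite -(closure_id _).1 /=; [rewrite sub0r normrN|exact: closed_rVball].
Qed.

Lemma strict_near (Om : set V) (f : V -> R) (g : 'I_n.+1 -> V -> R) (w : V) :
 open Om -> (forall i, {within Om, continuous (g i)}) ->
 (forall i x, Om x -> derivable f x (basis_vec i) /\ partial i f x = g i x) ->
 Om w -> strict_at f w (grad f w).
Proof.
move=> oOm cg df Omw e e0.
have /nbhs_ballP[r0 /= r00 r0U] : nbhs w Om by exact: open_nbhs_nbhs.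
have [||||r /andP[r1 _] hr] := @strict_diff _ _ f w r0 e; last by exists r.
- by move=> y wy i; apply: (df i y (r0U _ wy)).1.
- by [].
- move=> i; apply/continuous_ballP => e1 e10.
 have := cg i; rewrite continuous_open_subspace// => /(_ w (mem_set Omw)).
 move=> /continuous_ballP/(_ _ e10)[r r'0 hr].
 exists (Num.min r0 r); first by rewrite lt_min r00.
 move=> y wy; rewrite (df i _ Omw).2 (df i y _).2.
 by apply: hr; apply: le_ball wy; rewrite ge_min lexx orbT.
 by apply: r0U; apply: le_ball wy; rewrite ge_min lexx.
- by [].
Qed.

Lemma norm_grad_le (f : V -> R) x (K : R) : 0 <= K ->
 (forall i, `|partial i f x| <= K) -> `|grad f x| <= K.
Proof. by move=> K0 h; apply: norm_le => // i; rewrite mxE. Qed.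

Lemma convex_comb_ball (x y z : V) (r t : R) : 0 <= t <= 1 ->
 ball x r y -> ball x r z -> ball x r (z + t *: (y - z)).
Proof.
move=> /andP[t0 t1] /ball_normP xy /ball_normP xz; apply/ball_normP.
rewrite (_ : x - _ = t *: (x - y) + (1 - t) *: (x - z)); last first.
 by apply/rowP => i; rewrite !mxE; ring.
apply: le_lt_trans (ler_normD _ _) _; rewrite !normrZ ger0_norm// (@ger0_norm _ (1 - t)) ?subr_ge0//.
have [->|t00] := eqVneq t 0; first by rewrite mul0r add0r subr0 mul1r.
rewrite [ltRHS](_ : r = t * r + (1 - t) * r); last by ring.
apply: ltr_leD; first by rewrite ltr_pM2l// lt_neqAle eq_sym t00.
by rewrite ler_wpM2l ?subr_ge0// ltW.
Qed.

(* Near a boundary point, two points of the domain are joined by a path of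
 comparable length: push both inwards along - grad psi. *)
Lemma boundary_lip (Om : set V) (f : V -> R) (K : R) (x g : V) (U : set V) (psi : V -> R) :
 (forall w, Om w -> strict_at f w (grad f w)) ->
 (forall w, Om w -> `|grad f w| <= K) ->
 open_nbhs x U -> strict_at psi x g -> g != 0 ->
 (forall y, U y -> (Om y <-> psi y < 0)) ->
 exists r L : R, [/\ 0 < r & lipschitz_on (Om `&` ball x r) f L].
Proof.
move=> sf gK [oU Ux] sp g0 hU.
set m := dot g g; have m0 : 0 < m by exact: dot_gt0.
have ng0 : 0 < `|g| by rewrite normr_gt0.
set e := m / 2 / `|g|; have e0 : 0 < e by rewrite !divr_gt0.
have [r r0 hr] := sp _ e0.
have /nbhs_ballP[rU /= rU0 hrU] : nbhs x U by exact: open_nbhs_nbhs.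
set c := 2 * (n.+1%:R * `|g| + e) / m.
have c0 : 0 <= c by rewrite divr_ge0 ?mge0 ?addr_ge0 ?mge0// ltW.
set rr := Num.min r rU; have rr0 : 0 < rr by rewrite lt_min r0.
set Q := 1 + 2 * c * `|g|; have Q0 : 0 < Q by rewrite ltr_pwDl// mge0// mge0.
exists (rr / Q), (n.+1%:R * `|K| * Q).
split=> [|y z [Omy xy] [Omz xz]]; first by rewrite divr_gt0.
set D := `|y - z|; have D0 : 0 <= D by rewrite normr_ge0.
have Q1 : 1 <= Q by rewrite lerDl mge0// mge0.
have lerr : rr / Q <= rr by rewrite ler_pdivrMr// ler_peMr// ltW.
have byr : ball x rr y by apply: le_ball xy.
have bzr : ball x rr z by apply: le_ball xz.
have Dlt : D < 2 * (rr / Q).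
 have /ball_normP h1 := xy; have /ball_normP h2 := xz.
 rewrite /D (_ : y - z = (x - z) - (x - y)); last rvring.
 by apply: le_lt_trans (ler_normB _ _) _; lra.
have psi_lt w : ball x rr w -> (Om w <-> psi w < 0).
 by move=> xw; apply: hU; apply: hrU; apply: le_ball xw; rewrite ge_min lexx orbT.
have hrr y' z' : ball x rr y' -> ball x rr z' ->
 `|psi y' - psi z' - dot g (y' - z')| <= e * `|y' - z'|.
 by move=> *; apply: hr; apply: (@le_ball _ _ _ rr) => //; rewrite ge_min lexx.
have in1 w t : ball x (rr / Q) w -> 0 <= t <= c * D -> ball x rr (w - t *: g).
 move=> /ball_normP xw /andP[t0 tc]; apply/ball_normP; rewrite (_ : x - _ = (x - w) + t *: g); last rvring.
 apply: le_lt_trans (ler_normD _ _) _; rewrite normrZ ger0_norm//.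
 apply: (@lt_le_trans _ _ (rr / Q + c * (2 * (rr / Q)) * `|g|)).
 rewrite ltr_leD// ler_wpM2r//; apply: le_trans tc _.
 by rewrite ler_wpM2l// ltW.
 rewrite (_ : _ + _ = rr / Q * (1 + 2 * c * `|g|)); last by ring.
 by rewrite -/Q divfK// gt_eqF.
have psi_dec w t : Om w -> ball x (rr / Q) w -> 0 <= t <= c * D ->
 psi (w - t *: g) <= psi w - t * m / 2.
 move=> Omw xw tcD; have xw' : ball x rr w by apply: le_ball xw.
 have := hrr _ _ (in1 _ _ xw tcD) xw'.
 rewrite (_ : w - t *: g - w = - (t *: g)); last rvring.
 rewrite dotNr dotZr -/m normrN normrZ ger0_norm; last by case/andP: tcD.
 rewrite (_ : e * _ = t * m / 2); last by rewrite /e; field; rewrite gt_eqF.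
 by rewrite ler_norml => /andP[_ h]; lra.
set s := c * D.
have s01 : 0 <= s <= s by rewrite lexx mge0.
have K' : forall w, Om w -> `|grad f w| <= `|K|.
 by move=> w Omw; rewrite (le_trans (gK _ Omw))// ler_norm.
have seg1 w : Om w -> ball x (rr / Q) w -> `|f w - f (w - s *: g)| <= n.+1%:R * `|K| * (s * `|g|).
 move=> Omw xw; have := @segment_lip _ _ Om f `|K| (w - s *: g) w sf K'.
 rewrite (_ : w - s *: g - w = - (s *: g)); last rvring.
 rewrite normrN normrZ distrC (ger0_norm (_ : 0 <= s)); last by case/andP: s01.
 apply => t /andP[t0 t1].
 have ts : 0 <= t * s <= c * D by rewrite mge0 ?ler_piMl//; case/andP: s01.
 rewrite scalerN scalerA; apply/psi_lt; first exact: in1.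
 apply: le_lt_trans (psi_dec _ _ Omw xw ts) _.
 have xw' : ball x rr w by apply: le_ball xw.
 have := (psi_lt _ xw').1 Omw.
 have /andP[ts0 _] := ts.
 have h3 : 0 <= t * s * m by apply: mge0 => //; exact: ltW.
 by clear -h3; lra.
have seg2 : `|f (y - s *: g) - f (z - s *: g)| <= n.+1%:R * `|K| * D.
 have := @segment_lip _ _ Om f `|K| (y - s *: g) (z - s *: g) sf K'.
 rewrite (_ : y - s *: g - (z - s *: g) = y - z); last rvring.
 apply => t t01.
 have b1 := in1 _ _ xz s01; have b2 := in1 _ _ xy s01.
 have b3 : ball x rr (z - s *: g + t *: (y - z)).
 have := convex_comb_ball t01 b2 b1.
 by rewrite (_ : y - s *: g - (z - s *: g) = y - z); last rvring.
 apply/psi_lt => //.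
 have := hrr _ _ b3 b1.
 rewrite (_ : _ + _ - (z - _) = t *: (y - z)); last rvring.
 rewrite dotZr normrZ -/D.
 rewrite ger0_norm; last by case/andP: t01.
 have h1 := psi_dec _ _ Omz xz s01.
 have h2 := (psi_lt _ bzr).1 Omz.
 have h3 : t * dot g (y - z) <= n.+1%:R * `|g| * D.
 apply: (le_via (1 * (n.+1%:R * `|g| * D))); last by rewrite mul1r.
 apply: (le_via (t * (n.+1%:R * `|g| * D))).
 rewrite ler_wpM2l//; first by case/andP: t01.
 exact: le_trans (ler_norm _) (dot_le_norm _ _).
 by rewrite ler_wpM2r ?mge0//; case/andP: t01.
 have h4 : e * (t * D) <= e * D.
 by rewrite ler_wpM2l// ?(ltW e0)// ler_piMl//; case/andP: t01.
 have h5 : s * m / 2 = n.+1%:R * `|g| * D + e * D by rewrite /s /c; field; rewrite gt_eqF.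
 by rewrite ler_norml => /andP[_ h]; lra.
rewrite (_ : f y - f z = (f y - f (y - s *: g)) + (f (y - s *: g) - f (z - s *: g)) -
 (f z - f (z - s *: g))); last by ring.
apply: le_trans (ler_normB _ _) _; apply: le_trans (lerD (ler_normD _ _) (lexx _)) _.
apply: le_trans (lerD (lerD (seg1 _ Omy xy) seg2) (seg1 _ Omz xz)) _.
by rewrite le_eqVlt; apply/orP; left; apply/eqP; rewrite /s /Q -/D; ring.
Qed.

Lemma domain_field_extension (Om : set V) (H : V -> V) :
 open Om -> Om !=set0 -> bounded_set Om -> smooth_boundary Om -> C1_closure Om H ->
 exists (Ht : V -> V) (L B : R), [/\ 0 <= L, 0 <= B,
 forall x y, `|Ht x - Ht y| <= L * `|x - y|,
 forall x, `|Ht x| <= B & forall x, Om x -> Ht x = H x].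
Proof.
move=> oOm Om0 bOm sOm [cH dH].
have cOm := closure_compact bOm.
have [B B0 hB] := within_continuous_bounded cOm cH.
have hBj j x : Om x -> `|H x ord0 j| <= B.
 by move=> Omx; apply: le_trans (coord_le _ _) (hB _ _); exact: subset_closure.
have P j : exists (h : V -> R) (L : R), 0 <= L /\ [/\ lipschitz_on setT h L, forall y, `|h y| <= B &
 forall y, Om y -> h y = H y ord0 j].
 pose f y := H y ord0 j.
 have [g hg] := choice (fun i => dH i j).
 have M i : exists M : R, forall x, closure Om x -> `|g i x| <= M.
 by have [M _ hM] := within_continuous_bounded cOm (hg i).1; exists M.
 have {M}[M hM] := choice M.
 pose K := \sum_i `|M i|.
 have K0 : 0 <= K by rewrite /K sumr_ge0.
 have sf w : Om w -> strict_at f w (grad f w).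
 move=> Omw; apply: (@strict_near Om f g) => //.
 move=> i; apply: continuous_subspaceW (hg i).1; exact: subset_closure.
 by move=> i x Omx; exact: (hg i).2.
 have gK w : Om w -> `|grad f w| <= K.
 move=> Omw; apply: norm_grad_le => // i; rewrite ((hg i).2 _ Omw).2.
 apply: (le_trans (hM _ _ (subset_closure Omw))); apply: (le_trans (ler_norm _)).
 by rewrite /K (bigD1 i)//= lerDl sumr_ge0.
 have [|L L0 hL] := @compact_lip _ _ (closure Om) Om f B cOm (@subset_closure _ Om) (hBj j).
 move=> x clx; have [Omx|nOmx] := pselect (Om x).
 have [r [L [r0 _ hL]]] := strict_at_bound (sf _ Omx).
 by exists r, L; split=> // y z [_ xy] [_ xz]; exact: hL.
 have [|U [psi [oU sp gp hU]]] := sOm x.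
 by split=> // /interior_subset.
 apply: (boundary_lip sf gK oU _ gp hU).
 by case: oU => oU Ux; apply: (Ck_strict oU (sp 1%N) Ux).
 have [h [h1 h2 h3]] := lipschitz_extension Om0 L0 hL (hBj j).
 by exists h, L.
have {P}[h] := choice P; move=> /choice[L hL].
exists (fun x => \row_j h j x), (\sum_j L j), B; split=> //.
- by rewrite sumr_ge0// => j _; case: (hL j).
- move=> x y; apply: norm_le.
 by rewrite mge0// sumr_ge0// => j _; case: (hL j).
 move=> j; rewrite !mxE; have [L0 [h1 _ _]] := hL j.
 apply: le_trans (h1 x y I I) _; rewrite ler_wpM2r// (bigD1 j)//= lerDl.
 by rewrite sumr_ge0// => i _; case: (hL i).
- by move=> x; apply: norm_le => // j; rewrite mxE; have [_ []] := hL j.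
- by move=> x Omx; apply/rowP => j; rewrite mxE; have [_ [_ _ ->]] := hL j.
Qed.

End smooth_domain.

Section one_variable.
Context {R : realType}.
Implicit Types (g dg : R -> R).

Lemma derive_nonneg_le g dg (a b : R) : a <= b ->
 (forall t : R, a <= t <= b -> is_derive t 1 g (dg t)) ->
 (forall t : R, a <= t <= b -> 0 <= dg t) -> g a <= g b.
Proof.
move=> ab dP d0; have [||c cab e] := @MVT_segment R g dg a b ab.
- by move=> x; rewrite in_itv/= => /andP[x0 x1]; apply: dP; rewrite !ltW.
- apply: derivable_within_continuous => x; rewrite in_itv/= => x01.
 by have [] := dP _ x01.
- rewrite -subr_ge0 e mge0 ?subr_ge0//; apply: d0.
 by move: cab; rewrite in_itv.
Qed.

Lemma derive_abs_le g dg h dh (a b : R) : a <= b ->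
 (forall t : R, a <= t <= b -> is_derive t 1 g (dg t)) ->
 (forall t : R, a <= t <= b -> is_derive t 1 h (dh t)) ->
 (forall t : R, a <= t <= b -> `|dg t| <= dh t) -> `|g b - g a| <= h b - h a.
Proof.
move=> ab dP hP le; rewrite ler_norml; apply/andP; split.
 have : (h + g) a <= (h + g) b.
 apply: (@derive_nonneg_le _ (fun t => dh t + dg t)) => // t tab.
 by apply: is_deriveD; [exact: hP|exact: dP].
 by rewrite -lerBlDr sub0r; have := le _ tab; rewrite ler_norml => /andP[]; rewrite lerNl.
 by rewrite -[(h + g) a]/(h a + g a) -[(h + g) b]/(h b + g b); lra.
have : (h - g) a <= (h - g) b.
 apply: (@derive_nonneg_le _ (fun t => dh t - dg t)) => // t tab.
 by apply: is_deriveB; [exact: hP|exact: dP].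
 by rewrite subr_ge0; have := le _ tab; rewrite ler_norml => /andP[].
by rewrite -[(h - g) a]/(h a - g a) -[(h - g) b]/(h b - g b); lra.
Qed.

Lemma is_derive_expRM (k t : R) : is_derive t 1 (fun s : R => expR (k * s)) (k * expR (k * t)).
Proof.
have h1 : is_derive t 1 (fun s : R => k * s) k.
 apply/is_derive_eps => e e0; exists 1 => // h _.
 by rewrite (_ : _ - _ = 0) ?normr0 ?mge0// ?ltW//; ring.
by have := @is_derive1_comp _ expR _ t _ _ (is_derive_expR _) h1; rewrite mulrC.
Qed.

Lemma exp_comparison g dg (a k t : R) : 0 < k -> 0 <= a ->
 (forall s : R, is_derive s 1 g (dg s)) ->
 (forall s : R, `|s| <= `|t| -> `|dg s| <= a * expR (k * `|s|)) ->
 `|g t - g 0| <= a / k * expR (k * `|t|).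
Proof.
move=> k0 a0 dP le.
have main (f df : R -> R) (u : R) : 0 <= u -> (forall s : R, is_derive s 1 f (df s)) ->
 (forall s : R, 0 <= s <= u -> `|df s| <= a * expR (k * s)) ->
 `|f u - f 0| <= a / k * expR (k * u).
 move=> u0 fP fle.
 have := @derive_abs_le f df (fun s => a / k * expR (k * s)) (fun s => a / k * (k * expR (k * s))) 0 u u0.
 move=> /(_ (fun t _ => fP t)) /(_ _ _)/wrap[].
 - by move=> s _; have := @is_deriveZ _ _ _ _ (a / k) s 1 _ (is_derive_expRM k s).
 - by move=> s s0u; rewrite mulrA divfK ?gt_eqF//; exact: fle.
 move=> h; apply: le_trans h _; rewrite lerBlDr lerDl mge0 ?divr_ge0 ?expR_ge0// ltW//.
have [t0|t0] := leP 0 t.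
 rewrite (ger0_norm t0); apply: (main _ dg) => // s /andP[s0 st].
 by have := le s; rewrite (ger0_norm s0) (ger0_norm t0); exact.
rewrite (ltr0_norm t0) -{1}(opprK t) -{1}oppr0.
apply: (main (fun s => g (- s)) (fun s => - dg (- s))); first by rewrite oppr_ge0 ltW.
 move=> s; apply/is_derive_eps => e e0.
 have /is_derive_eps/(_ _ e0)[r r0 hr] := dP (- s).
 exists r => // h hh; have := hr (- h); rewrite normrN -opprD => /(_ hh).
 by rewrite mulrN mulNr.
move=> s /andP[s0 st]; rewrite normrN; have := le (- s); rewrite normrN (ger0_norm s0).
by apply; rewrite ltr0_norm.
Qed.

Lemma continuous_antiderivative_loc g (C : R) : continuous g -> 0 < C ->
 exists2 G : R -> R, G 0 = 0 & forall t : R, - C < t -> is_derive t 1 G (g t).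
Proof.
move=> cg C0.
pose F0 t := \int[lebesgue_measure]_(s in `[- C, t]) g s.
exists (fun t => F0 t - F0 0); first by rewrite subrr.
move=> t Ct.
have dF : is_derive t 1 F0 (g t).
 have [||||dF1 dF2] := @continuous_FTC1_closed R g (- C) t (t + 1).
 - by rewrite ltrDl.
 - apply: continuous_compact_integrable; first exact: segment_compact.
 exact: continuous_subspaceT.
 - exact: Ct.
 - exact: cg.
 - rewrite derive1E in dF2; exact: (DeriveDef dF1 dF2).
have := is_deriveB dF (is_derive_cst (F0 0) t 1); rewrite subr0.
by move=> h; exact: h.
Qed.

Lemma same_derive_eq g1 g2 dg (a b : R) : a <= b -> (forall t : R, a <= t <= b -> is_derive t 1 g1 (dg t)) ->
 (forall t : R, a <= t <= b -> is_derive t 1 g2 (dg t)) -> g1 b - g1 a = g2 b - g2 a.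
Proof.
move=> ab d1 d2.
have H : `|(g1 - g2) b - (g1 - g2) a| <= (cst 0 : R -> R) b - (cst 0 : R -> R) a.
 apply: (@derive_abs_le (g1 - g2) (fun t => dg t - dg t) (cst 0) (cst 0)) => // t tab.
 by apply: is_deriveB; [exact: d1|exact: d2].
 by rewrite subrr normr0.
move: H; rewrite subr0 normr_le0 -[(g1 - g2) b]/(g1 b - g2 b) -[(g1 - g2) a]/(g1 a - g2 a).
by move=> /eqP h; lra.
Qed.

Lemma is_derive_near (g h : R -> R) (t d r : R) : 0 < r ->
 (forall s, `|s - t| < r -> g s = h s) -> is_derive t 1 h d -> is_derive t 1 g d.
Proof.
move=> r0 gh /is_derive_eps dh; apply/is_derive_eps => e e0.
have [r1 r10 hr] := dh _ e0; exists (Num.min r r1); first by rewrite lt_min r0.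
move=> k; rewrite lt_min => /andP[kr kr1]; rewrite !gh ?subrr ?normr0//; first exact: hr.
by rewrite addrAC subrr add0r.
Qed.

Lemma continuous_antiderivative g : continuous g ->
 exists2 G : R -> R, G 0 = 0 & forall t : R, is_derive t 1 G (g t).
Proof.
move=> cg.
have P C : exists G : R -> R, 0 < C -> G 0 = 0 /\ forall t : R, - C < t -> is_derive t 1 G (g t).
 have [C0|C0] := ltP 0 C; last by exists (cst 0).
 by have [G h1 h2] := continuous_antiderivative_loc cg C0; exists G.
have [G hG] := choice P.
have E C C' t : 0 < C -> 0 < C' -> - C < t -> - C' < t -> G C t = G C' t.
 move=> C0 C'0 Ct C't.
 have [h1 h2] := hG _ C0; have [h3 h4] := hG _ C'0.
 have [t0|t0] := leP 0 t.
 have := @same_derive_eq (G C) (G C') g 0 t t0.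
 rewrite h1 h3 !subr0; apply => s /andP[s0 st]; [apply: h2|apply: h4]; lra.
 have := @same_derive_eq (G C) (G C') g t 0 (ltW t0).
 rewrite h1 h3 !sub0r => H; apply: oppr_inj; apply: H => s /andP[s0 st]; [apply: h2|apply: h4]; lra.
exists (fun t => G (`|t| + 1) t).
 by rewrite normr0 add0r; have [] := hG 1 ltr01.
move=> t; have t0 : 0 <= `|t| by []; have t1 : - `|t| <= t by have := ler_norm (- t); rewrite normrN; lra.
apply: (@is_derive_near _ (G (`|t| + 2)) _ _ 1) => // [s st|].
 have s1 : - `|s| <= s by have := ler_norm (- s); rewrite normrN; lra.
 have := ler_norm (- (s - t)); rewrite normrN => h.
 by apply: E; have : 0 <= `|s| by []; lra.
by apply: (hG (`|t| + 2) _).2; lra.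
Qed.

End one_variable.

Section flow.
Context {R : realType} {n : nat}.
Local Notation V := 'rV[R]_n.+1.

Lemma lipschitz_curve_continuous (c : R -> V) (B : R) :
 (forall s t, `|c s - c t| <= B * `|s - t|) -> continuous c.
Proof.
move=> cB t; apply/cvgrPdist_le => e e0.
have B0 : 0 < `|B| + 1 by rewrite ltr_wpDl.
apply/nbhs_ballP; exists (e / (`|B| + 1)) => /=; first by rewrite divr_gt0.
move=> s; rewrite /ball/= ltr_pdivlMr// => h.
apply: le_trans (cB _ _) _; apply: le_trans _ (ltW h).
rewrite mulrC ler_wpM2l//; have := ler_norm B; lra.
Qed.

Variables (F : V -> V) (L B : R).
Hypotheses (L0 : 0 <= L) (B0 : 0 <= B)
 (FL : forall x y, `|F x - F y| <= L * `|x - y|) (FB : forall x, `|F x| <= B).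

Let k := 2 * (L + 1).
Let k0 : 0 < k. Proof. by rewrite /k; have := L0; lra. Qed.

Let contF i : continuous (fun x => F x ord0 i).
Proof.
move=> x; apply/continuous_ballP => e e0; exists (e / (L + 1)).
 by rewrite divr_gt0//; have := L0; lra.
move=> y /ball_normP; rewrite ltr_pdivlMr; last by have := L0; lra.
move=> h; apply: (le_via `|F x - F y|).
 by have := coord_le (F x - F y) i; rewrite !mxE.
apply: le_trans (FL _ _) _; apply: le_trans _ (ltW h).
by rewrite mulrC ler_wpM2l//; lra.
Qed.

Definition solves (c : R -> V) := forall t, is_derive_rV c t (F (c t)).

Lemma solution_lip c s t : solves c -> `|c s - c t| <= B * `|s - t|.
Proof.
move=> sc; apply: norm_le => [|i]; first by rewrite mge0.
wlog st : s t / t <= s.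
 by move=> H; have [/H//|/ltW/H] := leP t s; rewrite !mxE distrC [`|t - s|]distrC.
rewrite !mxE (ger0_norm (_ : 0 <= s - t)) ?subr_ge0// mulrBr.
apply: (@derive_abs_le _ (fun s => c s ord0 i) (fun s => F (c s) ord0 i) (fun s => B * s) (fun=> B)) => //.
- by move=> u _; exact: sc.
- move=> u _; apply/is_derive_eps => e e0; exists 1 => // h _.
 by rewrite (_ : _ - _ = 0) ?normr0 ?mge0// ?ltW//; ring.
- by move=> u _; apply: le_trans (coord_le _ _) _.
Qed.

Lemma solution_gap c1 c2 t : solves c1 -> solves c2 ->
 `|c1 t - c2 t| <= 2 * `|c1 0 - c2 0| * expR (k * `|t|).
Proof.
move=> s1 s2.
set d0 := `|c1 0 - c2 0|.
pose S := [set expR (- (k * `|u|)) * `|c1 u - c2 u| | u in [set u : R | `|u| <= `|t|]].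
have S0 : S !=set0 by exists (expR (- (k * `|t|)) * `|c1 t - c2 t|); exists t => /=.
have ubS : has_ubound S.
 exists (d0 + 2 * B * `|t|) => _ [u /= ut <-].
 apply: (le_via (1 * `|c1 u - c2 u|)).
 rewrite ler_wpM2r// -expR0 ler_expR lerNl oppr0 mge0//; exact: ltW.
 rewrite mul1r (_ : c1 u - c2 u = (c1 0 - c2 0) + ((c1 u - c1 0) - (c2 u - c2 0))); last rvring.
 apply: le_trans (ler_normD _ _) _; rewrite lerD2l.
 apply: le_trans (ler_normB _ _) _.
 have h1 := solution_lip u 0 s1; have h2 := solution_lip u 0 s2; rewrite subr0 in h1 h2.
 have : B * `|u| <= B * `|t| by rewrite ler_wpM2l.
 by lra.
set M := sup S.
have M0 : 0 <= M.
 apply: (le_via (expR (- (k * `|t|)) * `|c1 t - c2 t|)); first by rewrite mge0 ?expR_ge0.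
 by apply: ub_le_sup => //; exists t => /=.
have MP u : `|u| <= `|t| -> `|c1 u - c2 u| <= M * expR (k * `|u|).
 move=> ut; rewrite -ler_pdivrMr ?expR_gt0// -expRN mulrC.
 by apply: ub_le_sup => //; exists u.
have step u : `|u| <= `|t| -> `|c1 u - c2 u| <= d0 + M / 2 * expR (k * `|u|).
 move=> ut; apply: norm_le => [|i].
 by apply: addr_ge0; [exact: normr_ge0|apply: mge0; [exact: divr_ge0|exact: expR_ge0]].
 rewrite !mxE.
 have := @exp_comparison _ (fun s => c1 s ord0 i - c2 s ord0 i)
 (fun s => F (c1 s) ord0 i - F (c2 s) ord0 i) (M * (L + 1)) k u k0.
 move=> /(_ _ _ _)/wrap[].
 - by rewrite mge0//; have := L0; lra.
 - by move=> s; apply: is_deriveB; [exact: s1|exact: s2].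
 - move=> s su; apply: (le_via `|F (c1 s) - F (c2 s)|).
 by have := coord_le (F (c1 s) - F (c2 s)) i; rewrite !mxE.
 apply: le_trans (FL _ _) _.
 have h := MP _ (le_trans su ut).
 apply: (le_via ((L + 1) * `|c1 s - c2 s|)); first by rewrite ler_wpM2r//; lra.
 apply: (le_via ((L + 1) * (M * expR (k * `|s|)))).
 by rewrite ler_wpM2l//; have := L0; lra.
 by rewrite le_eqVlt; apply/orP; left; apply/eqP; ring.
 rewrite (_ : M * (L + 1) / k = M / 2); last by rewrite /k; field; have := L0; lra.
 have := coord_le (c1 0 - c2 0) i; rewrite !mxE -/d0.
 set a := c1 u _ _ - _; set b := c1 0 _ _ - _ => h1 h2.
 rewrite (_ : a = b + (a - b)); last by ring.
 by apply: le_trans (ler_normD _ _) _; rewrite lerD.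
have : M <= d0 + M / 2.
 apply: ge_sup => // _ [u /= ut <-].
 rewrite mulrC -ler_pdivlMr ?expR_gt0// expRN invrK.
 apply: le_trans (step _ ut) _; rewrite mulrDl lerD2r ler_peMr ?normr_ge0//.
 by rewrite -expR0 ler_expR mge0// ltW.
move=> hM; apply: le_trans (MP t (lexx _)) _; rewrite ler_wpM2r ?expR_ge0//; lra.
Qed.

Lemma solution_exists x : exists2 c : R -> V, c 0 = x & solves c.
Proof.
have P (c : R -> V) : exists c' : R -> V, continuous c ->
 c' 0 = x /\ forall t, is_derive_rV c' t (F (c t)).
 have [cc|] := pselect (continuous c); last by exists (cst x).
 have Q i : exists g : R -> R, g 0 = 0 /\ forall t : R, is_derive t 1 g (F (c t) ord0 i).
 have [|G G0 dG] := @continuous_antiderivative R (fun t => F (c t) ord0 i); last by exists G.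
 by move=> t; apply: (@continuous_comp _ _ _ c (fun y => F y ord0 i)); [exact: cc|exact: contF].
 have [g hg] := choice Q.
 exists (fun t => x + \row_i g i t) => _; split.
 by apply/rowP => i; rewrite !mxE (hg i).1 addr0.
 move=> t i; have := is_deriveD (is_derive_cst (x ord0 i) t 1) ((hg i).2 t).
 rewrite add0r; congr is_derive; apply/funext => s; by rewrite !mxE.
have [A hA] := choice P.
pose X := fix X m := if m is m'.+1 then A (X m') else cst x.
have lipA c s t : continuous c -> `|A c s - A c t| <= B * `|s - t|.
 move=> cc; apply: norm_le => [|i]; first by rewrite mge0.
 wlog st : s t / t <= s.
 by move=> H; have [/H//|/ltW/H] := leP t s; rewrite !mxE distrC [`|t - s|]distrC.
 rewrite !mxE (ger0_norm (_ : 0 <= s - t)) ?subr_ge0// mulrBr.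
 apply: (@derive_abs_le _ (fun s => A c s ord0 i) (fun s => F (c s) ord0 i) (fun s => B * s) (fun=> B)) => //.
 - by move=> u _; have [_] := hA _ cc; exact.
 - move=> u _; apply/is_derive_eps => e e0; exists 1 => // h _.
 by rewrite (_ : _ - _ = 0) ?normr0 ?mge0// ?ltW//; ring.
 - by move=> u _; apply: le_trans (coord_le _ _) _.
have cX m : continuous (X m).
 elim: m => [|m IH]; first exact: cst_continuous.
 by apply: (@lipschitz_curve_continuous _ B) => s t; exact: lipA.
have comp c1 c2 a t : continuous c1 -> continuous c2 -> 0 <= a ->
 (forall s, `|c1 s - c2 s| <= a * expR (k * `|s|)) ->
 `|A c1 t - A c2 t| <= a / 2 * expR (k * `|t|).
 move=> cc1 cc2 a0 le; apply: norm_le => [|i].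
 by rewrite mge0 ?expR_ge0// divr_ge0.
 have [h1 d1] := hA _ cc1; have [h2 d2] := hA _ cc2.
 have := @exp_comparison _ (fun s => A c1 s ord0 i - A c2 s ord0 i)
 (fun s => F (c1 s) ord0 i - F (c2 s) ord0 i) (a * (L + 1)) k t k0.
 move=> /(_ _ _ _)/wrap[].
 - by rewrite mge0//; have := L0; lra.
 - by move=> s; apply: is_deriveB; [exact: d1|exact: d2].
 - move=> s su; apply: (le_via `|F (c1 s) - F (c2 s)|).
 by have := coord_le (F (c1 s) - F (c2 s)) i; rewrite !mxE.
 apply: le_trans (FL _ _) _.
 apply: (le_via ((L + 1) * `|c1 s - c2 s|)); first by rewrite ler_wpM2r//; lra.
 apply: (le_via ((L + 1) * (a * expR (k * `|s|)))).
 by rewrite ler_wpM2l//; have := L0; lra.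
 by rewrite le_eqVlt; apply/orP; left; apply/eqP; ring.
 rewrite (_ : a * (L + 1) / k = a / 2); last by rewrite /k; field; have := L0; lra.
 by rewrite h1 h2 subrr subr0 !mxE.
pose K := B / k.
have K0 : 0 <= K by rewrite /K divr_ge0// ltW.
have step m t : `|X m.+1 t - X m t| <= K * 2 ^- m * expR (k * `|t|).
 elim: m t => [|m IH] t.
 have := lipA (cst x) t 0 (cX 0%N); rewrite (hA _ (cX 0%N)).1 /= subr0 => h.
 apply: le_trans h _; rewrite expr0 invr1 mulr1 /K -mulrA.
 rewrite ler_wpM2l// ler_pdivlMl//.
 by apply: le_trans _ (expR_ge1Dx _); rewrite lerDr.
 have := comp _ _ _ t (cX m.+1) (cX m) _ IH.
 rewrite -/(X m.+2) -/(X m.+1) => /(_ _)/wrap[]; first by rewrite mge0// invr_ge0 exprn_ge0.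
 by move=> h; apply: le_trans h _; rewrite exprS invfM (mulrC 2^-1) !mulrA.
clearbody K.
have gap m p t : (m <= p)%N -> `|X p t - X m t| <= 2 * K * 2 ^- m * expR (k * `|t|).
 move=> mp; rewrite -(subnK mp); move: (p - m)%N => q {p mp}.
 suff H : `|X (q + m)%N t - X m t| <= 2 * K * (2 ^- m - 2 ^- (q + m)) * expR (k * `|t|).
 apply: le_trans H _; rewrite ler_wpM2r ?expR_ge0// ler_wpM2l ?mge0//.
 by rewrite lerBlDr lerDl invr_ge0 exprn_ge0.
 elim: q => [|q IH]; first by rewrite add0n !subrr normr0 mulr0 mul0r.
 rewrite addSn (_ : X _ t - _ = (X (q + m).+1 t - X (q + m)%N t) + (X (q + m)%N t - X m t)); last by rewrite addrA subrK.
 apply: le_trans (ler_normD _ _) _; apply: le_trans (lerD (step _ _) IH) _.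
 rewrite exprS invfM; set z := 2 ^- (q + m); set w := 2 ^- m.
 by rewrite le_eqVlt; apply/orP; left; apply/eqP; field.
have pow0 (C e : R) : 0 <= C -> 0 < e -> exists m : nat, C * 2 ^- m <= e.
 move=> C0 e0; exists (Num.bound (C / e)).
 have h := archi_boundP (divr_ge0 C0 (ltW e0)).
 rewrite ler_pdivrMr ?exprn_gt0//.
 have h2 : (Num.bound (C / e))%:R <= 2 ^+ (Num.bound (C / e)) :> R.
 by rewrite -natrX ler_nat ltnW// ltn_expl.
 rewrite ltr_pdivrMr// in h; apply: (le_trans (ltW h)).
 by rewrite mulrC ler_wpM2l// ltW.
have lim t : exists y : V, forall m, `|y - X m t| <= 2 * K * 2 ^- m * expR (k * `|t|).
 have Q i : exists z : R, forall m, `|z - X m t ord0 i| <= 2 * K * 2 ^- m * expR (k * `|t|).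
 pose S := [set X m t ord0 i - 2 * K * 2 ^- m * expR (k * `|t|) | m in [set: nat]].
 have C m p : X m t ord0 i - 2 * K * 2 ^- m * expR (k * `|t|) <=
 X p t ord0 i + 2 * K * 2 ^- p * expR (k * `|t|).
 have [mp|/ltnW pm] := leqP m p.
 have := le_trans (coord_le _ i) (gap m p t mp); rewrite !mxE ler_norml => /andP[h _].
 have : 0 <= 2 * K * 2 ^- p * expR (k * `|t|) by rewrite !mge0 ?expR_ge0// invr_ge0 exprn_ge0.
 by lra.
 have := le_trans (coord_le _ i) (gap p m t pm); rewrite !mxE ler_norml => /andP[_ h].
 have : 0 <= 2 * K * 2 ^- m * expR (k * `|t|) by rewrite !mge0 ?expR_ge0// invr_ge0 exprn_ge0.
 by lra.
 exists (sup S) => m; rewrite ler_norml; apply/andP; split.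
 rewrite lerBrDl; apply: ub_le_sup; last by exists m.
 by exists (X 0%N t ord0 i + 2 * K * 2 ^- 0 * expR (k * `|t|)) => _ [p _ <-].
 rewrite lerBlDl; apply: ge_sup; first by eexists; exists 0%N.
 by move=> _ [p _ <-].
 have [z hz] := choice Q; exists (\row_i z i) => m; apply: norm_le.
 by rewrite !mge0 ?expR_ge0// invr_ge0 exprn_ge0.
 by move=> i; rewrite !mxE.
have [Y hY] := choice lim.
have cY : continuous Y.
 apply: (@lipschitz_curve_continuous _ B) => s t.
 apply/ler_addgt0Pr => e e0.
 have [m hm] := pow0 (2 * K * expR (k * `|s|) + 2 * K * expR (k * `|t|)) e (addr_ge0 (mge0 (mge0 (ler0n _ 2) K0) (expR_ge0 _)) (mge0 (mge0 (ler0n _ 2) K0) (expR_ge0 _))) e0.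
 have h1 := hY s m.+1; have h2 := hY t m.+1; have h3 := lipA _ s t (cX m).
 rewrite (_ : Y s - Y t = (Y s - X m.+1 s) + (X m.+1 s - X m.+1 t) - (Y t - X m.+1 t)); last rvring.
 apply: le_trans (ler_normB _ _) _; apply: le_trans (lerD (ler_normD _ _) (lexx _)) _.
 move: h1 h2; rewrite exprS invfM => h1 h2.
 have e1 : 2 * K * (2^-1 * 2 ^- m) * expR (k * `|s|) + 2 * K * (2^-1 * 2 ^- m) * expR (k * `|t|) <= e.
 apply: le_trans _ hm; rewrite (_ : _ + _ = (2 * K * expR (k * `|s|) + 2 * K * expR (k * `|t|)) * 2 ^- m / 2); last by ring.
 rewrite ler_pdivrMr// ler_peMr ?ler1n// mge0 ?invr_ge0 ?exprn_ge0//.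
 by rewrite addr_ge0// !mge0 ?expR_ge0.
 by move: h3; rewrite -/(X m.+1) => h3; lra.
have AY : A Y = Y.
 apply/funext => t; apply/eqP; rewrite -subr_eq0 -normr_le0; apply/ler_addgt0Pr => e e0; rewrite add0r.
 have [m hm] := pow0 (2 * K * expR (k * `|t|)) e (mge0 (mge0 (ler0n _ 2) K0) (expR_ge0 _)) e0.
 have a0 : 0 <= 2 * K * 2 ^- m by rewrite !mge0// invr_ge0 exprn_ge0.
 have h1 := comp Y (X m) _ t cY (cX m) a0 (hY ^~ m).
 have h2 := hY t m.+1; rewrite exprS invfM in h2.
 rewrite (_ : A Y t - Y t = (A Y t - A (X m) t) - (Y t - X m.+1 t)); last rvring.
 apply: le_trans (ler_normB _ _) _; apply: le_trans (lerD h1 h2) _; apply: le_trans _ hm.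
 by rewrite le_eqVlt; apply/orP; left; apply/eqP; field.
exists Y; first by rewrite -AY; exact: (hA _ cY).1.
by move=> t; have [_] := hA _ cY; rewrite AY; exact.
Qed.

Definition flow (t : R) (x : V) : V := (projT1 (cid2 (solution_exists x))) t.

Lemma flow0 x : flow 0 x = x.
Proof. by rewrite /flow; case: cid2. Qed.

Lemma flow_solves x : solves (fun t => flow t x).
Proof. by rewrite /flow; case: cid2. Qed.

Lemma flow_lip t x y : `|flow t x - flow t y| <= 2 * expR (k * `|t|) * `|x - y|.
Proof.
have := solution_gap t (flow_solves x) (flow_solves y); rewrite !flow0.
by rewrite mulrAC.
Qed.

Lemma flow_time s t x : `|flow s x - flow t x| <= B * `|s - t|.
Proof. exact: solution_lip (flow_solves x). Qed.

Lemma flowD s t x : flow (s + t) x = flow s (flow t x).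
Proof.
have sh : solves (fun s => flow (s + t) x).
 move=> u i; have /is_derive_eps du := flow_solves x (u + t) i.
 apply/is_derive_eps => e e0; have [r r0 hr] := du _ e0; exists r => // h /hr.
 by rewrite (addrAC u h t).
have := solution_gap s sh (flow_solves (flow t x)).
by rewrite add0r flow0 subrr normr0 mulr0 mul0r normr_le0 subr_eq0 => /eqP.
Qed.

End flow.

Record is_flow {R : realType} {n : nat} (F : 'rV[R]_n.+1 -> 'rV[R]_n.+1)
 (Phi : R -> 'rV[R]_n.+1 -> 'rV[R]_n.+1) : Prop := IsFlow {
 flow_init : forall x, Phi 0 x = x;
 flow_add : forall s t x, Phi (s + t) x = Phi s (Phi t x);
 flow_derive : forall t x, is_derive_rV (fun s => Phi s x) t (F (Phi t x));
 flow_lipschitz : forall S : R, exists2 K : R, 0 < K &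
 forall t x y, `|t| <= S -> `|Phi t x - Phi t y| <= K * `|x - y|;
 flow_speed : exists2 B : R, 0 <= B & forall s t x, `|Phi s x - Phi t x| <= B * `|s - t|
}.

Lemma flow_exists {R : realType} {n : nat} (F : 'rV[R]_n.+1 -> 'rV[R]_n.+1) (L B : R) :
 0 <= L -> 0 <= B -> (forall x y, `|F x - F y| <= L * `|x - y|) ->
 (forall x, `|F x| <= B) -> exists Phi, is_flow F Phi.
Proof.
move=> L0 B0 FL FB; exists (flow L0 B0 FL FB); split.
- exact: flow0.
- exact: flowD.
- move=> t x; exact: flow_solves.
- move=> S; exists (2 * expR (2 * (L + 1) * `|S|)) => [|t x y tS].
 by rewrite mulr_gt0// expR_gt0.
 apply: le_trans (flow_lip _ _ _ _ _ _ _) _; rewrite ler_wpM2r// ler_wpM2l// ler_expR.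
 by rewrite ler_wpM2l ?(le_trans tS) ?ler_norm// mge0// addr_ge0.
- by exists B => // s t x; exact: flow_time.
Qed.

Section covers.
Context {R : realType} {V : pointedType}.
Local Open Scope ereal_scope.
Variable tau : set V -> \bar R.
Hypotheses (tau0 : tau set0 = 0) (tau_ge0 : forall U, 0 <= tau U).

Lemma cover_outer_le (A : set V) : cover_outer tau A <= tau A.
Proof.
apply: ereal_inf_lbound; exists (fun k => if k is 0%N then A else set0) => /=.
 by move=> x Ax; exists 0%N.
rewrite nneseries_recl// eseries0 ?adde0// => -[|i]//.
Qed.

Lemma cover_outer_split (A B : set V) :
 (forall U, cover_outer tau (U `&` A) + cover_outer tau (U `&` B) <= tau U) ->
 cover_outer tau A + cover_outer tau B <= cover_outer tau (A `|` B).
Proof.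
move=> H; apply: le_ereal_inf_tmp => _ [U AU <-].
have sub D : D `<=` A `|` B -> cover_outer tau D <= \sum_(k <oo) cover_outer tau (U k `&` D).
 move=> DAB; apply: le_trans (cover_outer_sigma_subadditive tau_ge0 _).
 apply: le_cover_outer => // x Dx; have [k _ Ukx] := AU _ (DAB _ Dx).
 by exists k.
apply: le_trans (leeD (sub A (@subsetUl _ _ _)) (sub B (@subsetUr _ _ _))) _.
rewrite -nneseriesD; first by apply: lee_nneseries => // *; rewrite adde_ge0// cover_outer_ge0.
- by move=> *; exact: cover_outer_ge0.
- by move=> *; exact: cover_outer_ge0.
Qed.

End covers.

Section metric_outer_measure.
Context {R : realType} {n : nat}.
Local Notation V := 'rV[R]_n.+1.
Local Open Scope ereal_scope.

Definition separated_sets (A B : set V) :=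
 exists2 e : R, (0 < e)%R & forall x y, A x -> B y -> (e <= `|x - y|)%R.

Variable mu : {outer_measure set V -> \bar R}.
Hypothesis mu_sep : forall A B : set V, separated_sets A B ->
 mu A + mu B <= mu (A `|` B).

(* Caratheodory's criterion, by exhausting the complement of C by the points
 at distance at least 1/(m+1) from C. *)
Lemma closed_caratheodory (C : set V) : closed C -> mu.-caratheodory C.
Proof.
move=> cC; apply: le_caratheodory_measurable => X.
have [->|Xoo] := eqVneq (mu X) +oo; first exact: leey.
pose Y m := X `&` [set x | forall y, C y -> (m.+1%:R^-1 <= `|x - y|)%R].
have Ymono m p : (m <= p)%N -> Y m `<=` Y p.
 move=> mp x [Xx h]; split=> // y Cy; apply: le_trans (h _ Cy).
 by rewrite lef_pV2 ?posrE// ler_nat ltnS.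
have sepY m A B : A `<=` Y m -> B `&` Y m.+1 = set0 -> B `<=` X -> separated_sets A B.
 move=> AY BY BX; exists (m.+1%:R^-1 - m.+2%:R^-1)%R.
 by rewrite subr_gt0 ltf_pV2 ?posrE// ltr_nat.
 move=> x z Ax Bz; have [_ hx] := AY _ Ax.
 have : ~ Y m.+1 z by move=> Yz; have : (B `&` Y m.+1) z by []; rewrite BY.
 move=> /not_andP[|]; first by move=> /(_ (BX _ Bz)).
 move=> /existsNP[y /not_implyP[Cy /negP]]; rewrite -ltNge => h.
 rewrite lerBlDr; apply: (le_trans (hx _ Cy)).
 rewrite (_ : x - y = (x - z) + (z - y))%R; last by rewrite addrA subrK.
 by apply: le_trans (ler_normD _ _) _; rewrite lerD2l ltW.
have cover : X `&` ~` C `<=` \bigcup_m Y m.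
 move=> x [Xx nCx].
 have /nbhs_ballP[r /= r0 hr] : nbhs x (~` C).
 by apply: open_nbhs_nbhs; split=> //; rewrite openC.
 exists (Num.bound r^-1) => //; split=> // y Cy.
 have := archi_boundP (ltW (_ : 0 < r^-1)%R); rewrite invr_gt0 => /(_ r0) h.
 rewrite leNgt; apply/negP => h2; apply: (hr y) => //; apply/ball_normP.
 apply: lt_le_trans h2 _; rewrite invf_ple ?posrE//.
 by apply: le_trans (ltW h) _; rewrite ler_nat.
have C_Y m : mu (X `&` C) + mu (Y m) <= mu X.
 apply: le_trans (mu_sep _) _; last by apply: le_outer_measure => x [[]|[]].
 exists (m.+1%:R^-1)%R => [|x y [_ Cx] [_ h]]; first by rewrite invr_gt0.
 by rewrite distrC; exact: h.
pose D m := Y m.+1 `\` Y m.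
have finX : mu X \is a fin_num by rewrite ge0_fin_numE ?outer_measure_ge0 ?ltey.
have parity p N : \sum_(0 <= k < N) mu (D (2 * k + p)%N) <= mu X.
 have : \sum_(0 <= k < N) mu (D (2 * k + p)%N) <= mu (\big[setU/set0]_(0 <= k < N) D (2 * k + p)%N).
 elim: N => [|N IH]; first by rewrite !big_nil outer_measure0.
 rewrite !big_nat_recr//=; apply: le_trans (leeD IH (lexx _)) _.
 case: N IH => [|N] IH.
 by rewrite !big_nil outer_measure0 add0e set0U.
 apply: mu_sep; apply: (sepY (2 * N + p).+1).
 - move=> x; rewrite big_mkord -(bigcup_mkord N.+1 (fun k => D (2 * k + p)%N)) => -[k /= kN [Yx _]]; apply: Ymono Yx.
 by rewrite ltnS leq_add2r leq_mul2l/= -ltnS.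
 - rewrite -subset0 => x [[_ nY] Y1]; apply: nY.
 by rewrite (_ : (2 * N.+1 + p)%N = (2 * N + p).+2)// mulnS.
 - by move=> x [[]].
 move/le_trans; apply; apply: le_outer_measure => x.
 by rewrite big_mkord -(bigcup_mkord N (fun k => D (2 * k + p)%N)) => -[k _ [[]]].
have sumD : \sum_(k <oo) mu (D k) < +oo.
 apply: (@le_lt_trans _ _ (mu X + mu X)); last by rewrite ltey_eq fin_numD finX.
 apply: lime_le; first by apply: is_cvg_nneseries => *; exact: outer_measure_ge0.
 apply: nearW => N.
 apply: (le_via (\sum_(0 <= k < N * 2) mu (D k))).
 rewrite [leRHS](@big_cat_nat _ _ _ N)//=; last by rewrite leq_pmulr.
 by rewrite leeDl// sume_ge0// => *; exact: outer_measure_ge0.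
 apply: (le_via (\sum_(0 <= k < N) (mu (D (2 * k + 0)%N) + mu (D (2 * k + 1)%N)))).
 elim: N => [|N IH]; first by rewrite !big_nil.
 rewrite mulSn !addSn add0n !big_nat_recr//= -addeA.
 by rewrite leeD// addn0 addn1 mulnC.
 by rewrite big_split/= leeD// parity.
have tl := nneseries_tail_cvg sumD (fun k _ => outer_measure_ge0 mu (D k)).
apply/lee_addgt0Pr => e e0.
have [N _ hN] : \forall N \near \oo, \sum_(N <= k <oo) mu (D k) <= e%:E.
 move: tl => /fine_cvgP[fin /cvgrPdist_le/(_ _ e0) hd].
 near=> N; have h : \sum_(N <= k <oo) mu (D k) \is a fin_num by near: N.
 rewrite -(fineK h) lee_fin; apply: le_trans (ler_norm _) _.
 by rewrite -normrN -sub0r; near: N.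
have XC : mu (X `&` ~` C) <= mu (Y N) + e%:E.
 apply: (le_via (mu (Y N `|` \bigcup_k D (N + k)%N))).
 apply: le_outer_measure => x /cover[m _ Ym].
 have [mN|Nm] := leqP m N; first by left; apply: Ymono mN _ Ym.
 have [YN|nYN] := pselect (Y N x); [by left|right].
 have : exists k, Y (N + k)%N x by exists (m - N)%N; rewrite subnKC// ltnW.
 move=> /cid[k0 hk0]; move: k0 hk0; elim=> [|k IH]; first by rewrite addn0.
 move=> Yk; have [/IH//|nY] := pselect (Y (N + k)%N x).
 by exists k => //; split; rewrite -?addnS.
 apply: le_trans (outer_measureU2 _ _ _) _; rewrite leeD2l//.
 apply: le_trans (outer_measure_sigma_subadditive mu _) _.
 apply: le_trans _ (hN N (leqnn _)).
 rewrite -(@nneseries_addn _ (fun k => mu (D k)) N) => [|k]; last exact: outer_measure_ge0.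
 by apply: lee_nneseries => [*|k _]; [exact: outer_measure_ge0|rewrite addnC].
apply: (le_via (mu (X `&` C) + (mu (Y N) + e%:E))); first by rewrite leeD2l.
by rewrite addeA leeD2r.
Unshelve. all: by end_near. Qed.

Lemma open_caratheodory (U : set V) : open U -> mu.-caratheodory U.
Proof.
move=> oU; rewrite -(setCK U); apply: caratheodory_measurable_setC.
by apply: closed_caratheodory; rewrite closedC.
Qed.

Lemma borel_caratheodory (A : set V) : <<s open >> A -> mu.-caratheodory A.
Proof.
have : <<s open >> `<=` (measurable : set (set (caratheodory_type mu))).
 apply: smallest_sub; first exact: sigma_algebra_measurable.
 by move=> U oU; exact: open_caratheodory.
by move=> /(_ A).
Qed.

End metric_outer_measure.

Section lebesgue_covers.
Context {R : realType} {n : nat}.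
Local Notation V := 'rV[R]_n.+1.
Local Notation lam := (@lebesgue_outer R n).

Lemma lam_ge0 A : (0 <= lam A)%E.
Proof. exact: (cover_outer_ge0 (@box_gauge_ge0 R n)). Qed.

Lemma le_lam A B : A `<=` B -> (lam A <= lam B)%E.
Proof. exact: (@le_cover_outer _ _ (@box_gauge R n)). Qed.

Lemma lam_gauge A : (lam A <= box_gauge A)%E.
Proof. exact: (cover_outer_le (@box_gauge0 R n) (@box_gauge_ge0 R n)). Qed.

Lemma lam0 : (lam set0 = 0)%E.
Proof. exact: cover_outer0 (@box_gauge0 R n) (@box_gauge_ge0 R n). Qed.

Lemma lam_box (a b : V) (A : set V) : (forall i, a ord0 i <= b ord0 i) -> A `<=` box a b ->
 (lam A <= (\prod_i (b ord0 i - a ord0 i))%:E)%E.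
Proof.
move=> ab Ab; apply: le_trans (lam_gauge _) _.
by apply: ereal_inf_lbound; exists (a, b).
Qed.

Lemma lam_diam (A : set V) (r : R) : 0 <= r -> (forall x y, A x -> A y -> `|x - y| <= r) ->
 (lam A <= ((2 * r) ^+ n.+1)%:E)%E.
Proof.
move=> r0 hA; have [->|/set0P[c Ac]] := eqVneq A set0.
 by apply: le_trans (lam_gauge _) _; rewrite box_gauge0 lee_fin exprn_ge0// mge0.
have := @lam_box (\row_i (c ord0 i - r)) (\row_i (c ord0 i + r)) A.
rewrite (eq_bigr (fun=> 2 * r)); last by move=> i _; rewrite !mxE; ring.
rewrite prodr_const card_ord; apply.
 by move=> i; rewrite !mxE lerD2l; lra.
move=> x Ax i; rewrite !mxE.
have := le_trans (coord_le _ i) (hA _ _ Ax Ac); rewrite !mxE ler_norml => /andP[h1 h2].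
by apply/andP; split; lra.
Qed.

Lemma lam_translate (A : set V) (v : V) : (lam [set (x + v)%R | x in A] <= lam A)%E.
Proof.
apply: le_ereal_inf_tmp => _ [U AU <-].
apply: (le_via (\sum_(k <oo) box_gauge [set (x + v)%R | x in U k])%E).
 apply: ereal_inf_lbound; exists (fun k => [set x + v | x in U k]) => //=.
 by move=> _ [x /AU[k _ Ukx] <-]; exists k => //; exists x.
apply: lee_nneseries => [k _ _|k _]; first exact: box_gauge_ge0.
apply: le_ereal_inf_tmp => _ [[a b] /= [ab Uab] <-].
apply: ereal_inf_lbound; exists (a + v, b + v) => /=; first split.
- by move=> i; rewrite !mxE lerD2r.
- by move=> _ [x Ux <-] i; rewrite !mxE !lerD2r; exact: Uab.
by congr EFin; apply: eq_bigr => i _; rewrite !mxE; ring.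
Qed.

Lemma prod_enlarge (l : 'I_n.+1 -> R) (eta : R) : 0 < eta ->
 exists2 e : R, 0 < e & forall e', 0 <= e' <= e -> \prod_i (l i + e') <= \prod_i l i + eta.
Proof.
move=> eta0; pose p : {poly R} := \prod_i ((l i)%:P + 'X).
have pE t : p.[t] = \prod_i (l i + t).
 by rewrite /p horner_prod; apply: eq_bigr => i _; rewrite hornerD hornerC hornerX.
have /cvgrPdist_le/(_ _ eta0) := @continuous_horner R p 0.
move=> /nbhs_ballP[e /= e0 he]; exists (e / 2); first by rewrite divr_gt0.
move=> e' /andP[e'0 e'e]; have := he e'; rewrite /ball/= sub0r normrN ger0_norm// !pE.
have -> : \prod_i (l i + 0) = \prod_i l i by apply: eq_bigr => i _; rewrite addr0.
move=> /(_ _)/wrap[]; first by lra.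
by rewrite ler_norml => /andP[h _]; lra.
Qed.

Lemma grid_cover (a b : V) (eta e0 : R) : (forall i, a ord0 i <= b ord0 i) -> 0 < eta -> 0 < e0 ->
 exists (J : finType) (c : J -> V) (e : R), [/\ 0 < e <= e0,
 box a b `<=` \bigcup_(j in [set: J]) [set x | forall i, c j ord0 i <= x ord0 i <= c j ord0 i + e] &
 #|J|%:R * e ^+ n.+1 <= \prod_i (b ord0 i - a ord0 i) + eta].
Proof.
move=> ab eta0 e00.
have [e1 e10 he1] := prod_enlarge (fun i => b ord0 i - a ord0 i) eta0.
pose e := Num.min e1 e0; have ep : 0 < e by rewrite lt_min e10.
pose m i := (Num.truncn ((b ord0 i - a ord0 i) / e)).+1.
have m0 i : 0 <= (b ord0 i - a ord0 i) / e by rewrite divr_ge0 ?subr_ge0// ltW.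
pose M := (\max_i m i).+1.
pose Q (f : {ffun 'I_n.+1 -> 'I_M}) := [forall i, (f i < m i)%N].
pose J : finType := {f : {ffun 'I_n.+1 -> 'I_M} | Q f}.
exists J, (fun j : J => \row_i (a ord0 i + (sval j i)%:R * e)), e; split.
- by rewrite ep/= ge_min lexx orbT.
- move=> x xab.
 have kP i : (Num.truncn ((x ord0 i - a ord0 i) / e) < m i)%N.
 rewrite ltnS; apply: le_truncn; rewrite ler_pM2r ?invr_gt0// lerD2r.
 by have /andP[] := xab i.
 have kM i : (Num.truncn ((x ord0 i - a ord0 i) / e) < M)%N.
 by apply: ltn_trans (kP i) _; rewrite ltnS (leq_bigmax i).
 pose f := [ffun i => Ordinal (kM i)].
 have Qf : Q f by apply/forallP => i; rewrite ffunE/= kP.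
 exists (exist _ f Qf) => //= i; rewrite !mxE/= ffunE/=.
 have xi0 : 0 <= (x ord0 i - a ord0 i) / e.
 by rewrite divr_ge0 ?(ltW ep)// subr_ge0; have /andP[] := xab i.
 have /andP[h1 h2] := truncn_itv xi0.
 move: h1 h2; set t := Num.truncn _; rewrite ler_pdivlMr// ltr_pdivrMr// -natr1 mulrDl mul1r => h1 h2.
 by apply/andP; split; lra.
have cardJ : #|J|%:R * e ^+ n.+1 = \prod_i ((m i)%:R * e).
 transitivity (\prod_(i < n.+1) \sum_(k < M | (k < m i)%N) e); last first.
 apply: eq_bigr => i _; rewrite sumr_const -(mulr_natl e); congr (_%:R * _).
 have miM : (m i <= M)%N by rewrite ltnW// ltnS (leq_bigmax i).
 rewrite -sum1_card -[RHS]card_ord -[RHS]sum1_card.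
 by rewrite [RHS](big_ord_widen M (fun=> 1%N) miM); exact: eq_bigl.
 rewrite (bigA_distr_big_dep _ (fun i k => e)) /=.
 rewrite (eq_bigr (fun=> e ^+ n.+1)); last by move=> f _; rewrite prodr_const card_ord.
 rewrite sumr_const -[RHS]mulr_natl; congr (_%:R * _).
 by rewrite card_sig; apply: eq_card => f; rewrite !inE.
rewrite cardJ.
apply: (le_via (\prod_i ((b ord0 i - a ord0 i) + e))); last first.
 by apply: he1; rewrite (ltW ep) ge_min lexx.
apply: ler_prod => i _; rewrite mge0 ?(ltW ep)//=.
have /andP[h _] := truncn_itv (m0 i); move: h; rewrite /m; set t := Num.truncn _.
rewrite ler_pdivlMr// -natr1.
by rewrite mulrDl mul1r => h; rewrite lerD2r.
Qed.

Lemma lam_finite_bigcup (J : finType) (A : J -> set V) :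
 (lam (\bigcup_(j in [set: J]) A j) <= \sum_j lam (A j))%E.
Proof.
rewrite (_ : [set: J] = [set` index_enum J]); last first.
 by apply/seteqP; split=> j //= _; exact: mem_index_enum.
rewrite bigcup_seq.
apply: (big_ind2 (fun (P : set V) (s : \bar R) => lam P <= s)%E).
- by apply: le_trans (lam_gauge _) _; rewrite box_gauge0.
- move=> P s Q t hP hQ; apply: le_trans (outer_measureU2 (@lebesgue_om R n) P Q) _.
 exact: leeD.
- by [].
Qed.

(* A box has bounded aspect ratio only after it is cut into small cubes. *)
Lemma lam_box_image (f : V -> V) (K eta : R) (a b : V) (A : set V) : 0 <= K -> 0 < eta ->
 (forall i, a ord0 i <= b ord0 i) ->
 (forall x y, A x -> A y -> `|f x - f y| <= K * `|x - y|) ->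
 (lam (f @` (box a b `&` A)) <= ((2 * K) ^+ n.+1 * (\prod_i (b ord0 i - a ord0 i) + eta))%:E)%E.
Proof.
move=> K0 eta0 ab fK.
have [J [c [e [/andP[e0 _] cov card]]]] := grid_cover ab eta0 (ltr01 : 0 < 1 :> R).
pose Q j := [set x : V | forall i, c j ord0 i <= x ord0 i <= c j ord0 i + e].
apply: (le_via (lam (\bigcup_(j in [set: J]) (f @` (Q j `&` A))))).
 by apply: le_lam => _ [x [/cov[j _ Qjx] Ax] <-]; exists j => //; exists x.
apply: le_trans (lam_finite_bigcup _) _.
apply: (le_via (\sum_(j : J) ((2 * (K * e)) ^+ n.+1)%:E)%E).
 apply: lee_sum => j _; apply: lam_diam; first by rewrite mge0// ltW.
 move=> _ _ [x [Qx Ax] <-] [y [Qy Ay] <-]; apply: le_trans (fK _ _ Ax Ay) _.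
 rewrite ler_wpM2l//; apply: norm_le; first exact: ltW.
 move=> i; rewrite !mxE ler_norml.
 by have /andP[h1 h2] := Qx i; have /andP[h3 h4] := Qy i; apply/andP; split; lra.
rewrite sumEFin lee_fin sumr_const cardT -cardE mulrA exprMn -mulrnAr.
by rewrite ler_wpM2l ?exprn_ge0 ?mge0// -(mulr_natl (e ^+ _)).
Qed.

Lemma lam_gauge_image (f : V -> V) (K : R) (U A : set V) : 0 < K ->
 (forall x y, A x -> A y -> `|f x - f y| <= K * `|x - y|) ->
 (lam (f @` (U `&` A)) <= ((2 * K) ^+ n.+1)%:E * box_gauge U)%E.
Proof.
move=> K0 fK; set C := (2 * K) ^+ n.+1.
have C0 : 0 < C by rewrite exprn_gt0// mulr_gt0.
rewrite -lee_pdivrMl//; apply: le_ereal_inf_tmp => _ [[a b] /= [ab Uab] <-].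
rewrite lee_pdivrMl//; apply/lee_addgt0Pr => e e0.
apply: (le_via (lam (f @` (box a b `&` A)))).
 by apply: le_lam => _ [x [Ux Ax] <-]; exists x => //; split => //; exact: Uab.
apply: le_trans (lam_box_image (ltW K0) (divr_gt0 e0 C0) ab fK) _.
by rewrite -EFinM -EFinD lee_fin mulrDr (mulrCA C e) divff ?gt_eqF// mulr1.
Qed.

Lemma lam_lipschitz (f : V -> V) (K : R) (A : set V) : 0 < K ->
 (forall x y, A x -> A y -> `|f x - f y| <= K * `|x - y|) ->
 (lam (f @` A) <= ((2 * K) ^+ n.+1)%:E * lam A)%E.
Proof.
move=> K0 fK; set C := (2 * K) ^+ n.+1.
have C0 : 0 < C by rewrite exprn_gt0// mulr_gt0.
rewrite -lee_pdivrMl//; apply: le_ereal_inf_tmp => _ [U AU <-].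
rewrite lee_pdivrMl// -nneseriesZl; last by move=> *; exact: box_gauge_ge0.
apply: (le_via (\sum_(k <oo) lam (f @` (U k `&` A)))%E).
 apply: le_trans (outer_measure_sigma_subadditive (@lebesgue_om R n) _).
 by apply: le_lam => _ [x Ax <-]; have [k _ Ukx] := AU _ Ax; exists k => //; exists x.
by apply: lee_nneseries => [*|k _]; [exact: lam_ge0|exact: lam_gauge_image].
Qed.

Lemma lam_separated (A B : set V) : separated_sets A B ->
 (lam A + lam B <= lam (A `|` B))%E.
Proof.
move=> [e0 e00 sep]; apply: (cover_outer_split (@box_gauge_ge0 R n)) => U.
apply: le_ereal_inf_tmp => _ [[a b] /= [ab Uab] <-]; apply/lee_addgt0Pr => eta eta0.
have [J [c [e [/andP[ep ee0] cov card]]]] := grid_cover ab eta0 (divr_gt0 e00 (ltr0Sn _ 1)).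
pose Q j := [set x : V | forall i, c j ord0 i <= x ord0 i <= c j ord0 i + e].
have cut D : (lam (U `&` D) <= \sum_j lam (Q j `&` D))%E.
 apply: le_trans (lam_finite_bigcup _); apply: le_lam => x [/Uab/cov[j _ Qx] Dx].
 by exists j.
apply: le_trans (leeD (cut A) (cut B)) _; rewrite -big_split/=.
apply: (le_via (\sum_(j : J) (e ^+ n.+1)%:E)%E); last first.
 by rewrite sumEFin -EFinD lee_fin sumr_const cardT -cardE -mulr_natl.
have lamQ j D : (lam (Q j `&` D) <= (e ^+ n.+1)%:E)%E.
 have := @lam_box (c j) (\row_i (c j ord0 i + e)) (Q j `&` D).
 rewrite (eq_bigr (fun=> e)); last by move=> i _; rewrite mxE addrAC subrr add0r.
 rewrite prodr_const card_ord; apply.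
 by move=> i; rewrite mxE lerDl ltW.
 by move=> x [Qx _] i; rewrite mxE; exact: Qx.
apply: lee_sum => j _.
have [QA|/set0P[x [Qx Ax]]] := eqVneq (Q j `&` A) set0; first by rewrite QA lam0 add0e.
have [QB|/set0P[y [Qy By]]] := eqVneq (Q j `&` B) set0; first by rewrite QB lam0 adde0.
exfalso; have := sep _ _ Ax By; apply/negP; rewrite -ltNge.
apply: le_lt_trans (_ : e < e0); last by apply: le_lt_trans ee0 _; lra.
apply: norm_le; first exact: ltW.
move=> i; rewrite !mxE ler_norml.
by have /andP[h1 h2] := Qx i; have /andP[h3 h4] := Qy i; apply/andP; split; lra.
Qed.

Lemma borel_lebesgue (A : set V) : <<s open >> A -> (@lebesgue_om R n).-caratheodory A.
Proof. by apply: borel_caratheodory; exact: lam_separated. Qed.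

End lebesgue_covers.

Section hausdorff_covers.
Context {R : realType} {n : nat}.
Local Notation V := 'rV[R]_n.+1.

Lemma ediam_ge0 (U : set V) : U !=set0 -> (0 <= ediam U)%E.
Proof.
move=> [x Ux]; apply: (le_via (enorm (x - x))%:E); first by rewrite lee_fin sqrtr_ge0.
by apply: ereal_sup_ubound; exists (x, x).
Qed.

Lemma ediam_norm (U : set V) (r : R) : (ediam U <= r%:E)%E ->
 forall x y, U x -> U y -> `|x - y| <= fine (ediam U).
Proof.
move=> Ur x y Ux Uy; apply: le_trans (norm_le_enorm _) _.
have dU : (ediam U \is a fin_num)%E.
 by rewrite ge0_fin_numE ?(le_lt_trans Ur) ?ltry// ediam_ge0//; exists x.
by rewrite -lee_fin fineK//; apply: ereal_sup_ubound; exists (x, y).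
Qed.

Lemma hausdorff_separated (s : nat) (A B : set V) : separated_sets A B ->
 (hausdorff s A + hausdorff s B <= hausdorff s (A `|` B))%E.
Proof.
move=> [e e0 sep].
pose mu (delta : R) := cover_outer (@hausdorff_gauge R n s delta).
have mu_ge0 delta D : (0 <= mu delta D)%E by apply: cover_outer_ge0; exact: hausdorff_gauge_ge0.
have mu_anti delta delta' D : delta <= delta' -> (mu delta' D <= mu delta D)%E.
 move=> dd; apply: le_ereal_inf_tmp => _ [U DU <-].
 apply: le_trans (ereal_inf_lbound _) _; first by exists U.
 apply: lee_nneseries => [*|k _]; first exact: hausdorff_gauge_ge0.
 rewrite /hausdorff_gauge; case: asboolP => // U0.
 have [h|h] := boolP (ediam (U k) <= delta%:E)%E; last by rewrite leey.
 by rewrite ifT//; apply: le_trans h _; rewrite lee_fin.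
have small delta : 0 < delta < e -> (mu delta A + mu delta B <= mu delta (A `|` B))%E.
 move=> /andP[d0 de]; apply: cover_outer_split; first exact: hausdorff_gauge_ge0.
 move=> U.
 have mu0 : mu delta set0 = 0%E.
 by apply: cover_outer0; [exact: hausdorff_gauge0|exact: hausdorff_gauge_ge0].
 have muU D : (mu delta (U `&` D) <= hausdorff_gauge s delta U)%E.
 apply: le_trans (cover_outer_le _ _ _).
 - by apply: le_cover_outer => x [].
 - exact: hausdorff_gauge0.
 - exact: hausdorff_gauge_ge0.
 have [UA|/set0P[x [Ux Ax]]] := eqVneq (U `&` A) set0; first by rewrite UA -/(mu _) mu0 add0e.
 have [UB|/set0P[y [Uy By]]] := eqVneq (U `&` B) set0; first by rewrite UB -/(mu _) mu0 adde0.
 rewrite /hausdorff_gauge; case: asboolP => [U0|_]; first by rewrite U0 in Ux.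
 case: ifPn => [Ud|_]; last by rewrite leey.
 exfalso; have := le_trans (sep _ _ Ax By) (ediam_norm Ud Ux Uy).
 apply/negP; rewrite -ltNge; apply: le_lt_trans de; rewrite -lee_fin fineK//.
 by rewrite ge0_fin_numE ?(le_lt_trans Ud) ?ltry// ediam_ge0//; exists x.
have [->|Hoo] := eqVneq (hausdorff s (A `|` B)) +oo%E; first exact: leey.
have both d1 d2 : 0 < d1 -> 0 < d2 -> (mu d1 A + mu d2 B <= hausdorff s (A `|` B))%E.
 move=> d10 d20; pose d := Num.min (Num.min d1 d2) (e / 2).
 have d0 : 0 < d < e by rewrite !lt_min d10 d20 divr_gt0//= gt_min; apply/orP; right; lra.
 apply: le_trans (leeD (mu_anti d d1 A _) (mu_anti d d2 B _)) _.
 - by rewrite !ge_min lexx.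
 - by rewrite !ge_min lexx orbT.
 apply: le_trans (small _ d0) _; apply: ereal_sup_ubound.
 by case/andP: d0 => d0 _; exists d.
have fin : hausdorff s (A `|` B) \is a fin_num by rewrite ge0_fin_numE ?hausdorff_ge0 ?ltey.
have finB : hausdorff s B \is a fin_num.
 rewrite ge0_fin_numE ?hausdorff_ge0//; apply: le_lt_trans (_ : hausdorff s (A `|` B) < +oo)%E; last by rewrite ltey.
 by apply: le_hausdorff; exact: subsetUr.
rewrite -leeBrDr//; apply: ge_ereal_sup => _ [d1 d10 <-].
have fin1 : mu d1 A \is a fin_num.
 rewrite ge0_fin_numE//; apply: le_lt_trans (_ : hausdorff s (A `|` B) < +oo)%E; last by rewrite ltey.
 apply: le_trans (both d1 1 d10 ltr01); by rewrite leeDl.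
rewrite leeBrDr// -leeBrDl//; apply: ge_ereal_sup => _ [d2 d20 <-].
by rewrite leeBrDl//; exact: both.
Qed.

Lemma borel_hausdorff (s : nat) (A : set V) : <<s open >> A ->
 (hausdorff s : {outer_measure set V -> \bar R}).-caratheodory A.
Proof. by apply: borel_caratheodory; exact: hausdorff_separated. Qed.

End hausdorff_covers.

Lemma unit_ball_volume_gt0 (R : realType) s : (0 < unit_ball_volume s :> R).
Proof.
have [m] := ubnP s; elim: m s => // m IH [|[|s]] //= sm.
rewrite !mulr_gt0 ?pi_gt0 ?invr_gt0//.
by apply: IH; rewrite ltnS in sm; exact: ltnW.
Qed.

Lemma lam_hausdorff_image {R : realType} {n : nat} (f : 'rV[R]_n.+2 -> 'rV[R]_n.+1)
 (K : R) (A : set 'rV[R]_n.+2) : 0 < K ->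
 (forall x y, A x -> A y -> `|f x - f y| <= K * `|x - y|) ->
 (lam (f @` A) <=
 ((4 * K) ^+ n.+1 / unit_ball_volume n.+1)%:E * hausdorff n.+1 A)%E.
Proof.
move=> K0 fK; set C := _ / _; pose w : R := unit_ball_volume n.+1.
have w0 : 0 < w := unit_ball_volume_gt0 R n.+1.
have C0 : 0 < C by rewrite divr_gt0// exprn_gt0// mulr_gt0.
apply: (le_via (C%:E * cover_outer (@hausdorff_gauge R n.+1 n.+1 1) A)%E); last first.
 rewrite lee_wpmul2l ?lee_fin ?(ltW C0)//.
 by apply: ereal_sup_ubound; exists 1 => /=.
rewrite -lee_pdivrMl//; apply: le_ereal_inf_tmp => _ [U AU <-].
rewrite lee_pdivrMl// -nneseriesZl; last by move=> *; exact: hausdorff_gauge_ge0.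
apply: (le_via (\sum_(k <oo) @lebesgue_outer R n (f @` (U k `&` A)))%E).
 apply: le_trans (outer_measure_sigma_subadditive (@lebesgue_om R n) _).
 by apply: le_lam => _ [x Ax <-]; have [k _ Ukx] := AU _ Ax; exists k => //; exists x.
apply: lee_nneseries => [*|k _]; first exact: lam_ge0.
rewrite /hausdorff_gauge; case: asboolP => [->|/eqP/set0P U0].
 by rewrite set0I image_set0 mule0 lam0.
case: ifPn => [Ud|_]; last by rewrite gt0_muley ?leey// lte_fin.
set r := fine (ediam (U k)).
have r0 : 0 <= r by rewrite fine_ge0// ediam_ge0.
apply: le_trans (@lam_diam _ _ _ (K * r) _ _) _.
- by rewrite mge0// ltW.
- move=> _ _ [x [Ux Ax] <-] [y [Uy Ay] <-]; apply: le_trans (fK _ _ Ax Ay) _.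
 by rewrite ler_wpM2l ?(ltW K0)//; exact: ediam_norm Ud _ _ Ux Uy.
have CE : C * w = (4 * K) ^+ n.+1 by rewrite /C divfK// gt_eqF.
rewrite -EFinM lee_fin [leRHS]mulrA (CE : C * unit_ball_volume n.+1 = _) -exprMn.
by rewrite le_eqVlt; apply/orP; left; apply/eqP; congr (_ ^+ _); field.
Qed.

Section borel_space.
Context {R : realType}.

Definition rVB (n : nat) := g_sigma_algebraType (open : set (set 'rV[R]_n.+1)).

Definition obox {n : nat} (a b : 'rV[R]_n.+1) : set 'rV[R]_n.+1 :=
 [set x | forall i, a ord0 i < x ord0 i < b ord0 i].

Context {n : nat}.
Local Notation V := 'rV[R]_n.+1.

Lemma open_bigcup_obox (U : set V) : open U ->
 exists a b : nat -> V, U = \bigcup_k obox (a k) (b k).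
Proof.
move=> oU; pose f (v : 'rV[rat]_n.+1) : V := map_mx ratr v.
pose g (k : nat) : V * V := if @unpickle ('rV[rat]_n.+1 * 'rV[rat]_n.+1)%type k is Some p then
 if `[< obox (f p.1) (f p.2) `<=` U >] then (f p.1, f p.2) else (0, 0) else (0, 0).
exists (fun k => (g k).1), (fun k => (g k).2); apply/seteqP; split=> [x Ux|x [k _]]; last first.
 rewrite /g; case: unpickle => [p|/=]; last by move=> /(_ ord0); rewrite mxE => /andP[]; lra.
 case: ifPn => [/asboolP h|_] /=; first exact: h.
 by move=> /(_ ord0); rewrite mxE => /andP[]; lra.
have /nbhs_ballP[r /= r0 hr] : nbhs x U by exact: open_nbhs_nbhs.
have [a ha] := choice (fun i : 'I_n.+1 => @rat_in_itvoo R (x ord0 i - r) (x ord0 i) (ltac:(lra))).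
have [b hb] := choice (fun i : 'I_n.+1 => @rat_in_itvoo R (x ord0 i) (x ord0 i + r) (ltac:(lra))).
exists (pickle (\row_i a i, \row_i b i)) => //.
rewrite /g pickleK.
have sub : obox (f (\row_i a i)) (f (\row_i b i)) `<=` U.
 move=> y hy; apply: hr; apply/ball_normP.
 have [i ->] := norm_coord (x - y); rewrite !mxE.
 have := hy i; rewrite !mxE; have := ha i; have := hb i; rewrite !in_itv/=.
 move=> /andP[h1 h2] /andP[h3 h4] /andP[h5 h6].
 by rewrite ltr_norml; apply/andP; split; lra.
rewrite (asboolT sub) => i; rewrite !mxE.
by have := ha i; have := hb i; rewrite !in_itv/= => /andP[-> _] /andP[_ ->].
Qed.

Lemma rVB_open (U : set V) : open U -> measurable (U : set (rVB n)).
Proof. exact: sub_sigma_algebra. Qed.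

Lemma rVB_closed (U : set V) : closed U -> measurable (U : set (rVB n)).
Proof.
by move=> cU; rewrite -[X in measurable X]setCK; apply: measurableC; apply: rVB_open; rewrite openC.
Qed.

Lemma obox_open (a b : V) : open (obox a b).
Proof.
rewrite openE => x hx; apply/nbhs_ballP.
pose e := \big[Num.min/1]_i Num.min (x ord0 i - a ord0 i) (b ord0 i - x ord0 i).
exists e => /=.
 by apply: lt_bigmin => // i _; rewrite lt_min !subr_gt0; exact: hx.
move=> y /ball_normP xy i.
have h : `|x ord0 i - y ord0 i| < Num.min (x ord0 i - a ord0 i) (b ord0 i - x ord0 i).
 apply: le_lt_trans (_ : `|x - y| < _).
 by have := coord_le (x - y) i; rewrite !mxE.
 by apply: lt_le_trans xy _; exact: bigmin_le_cond.
move: h; rewrite lt_min !ltr_norml => /andP[/andP[h1 h2] /andP[h3 h4]].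
by apply/andP; split; lra.
Qed.

Lemma cont_meas (f : V -> R) : continuous f -> mfunT (f : rVB n -> R).
Proof.
move=> /continuousP cf; apply: (measurability _ (measurable_realfun.RGenOpens.measurableE R)).
move=> _ [_ [a [b ->] <-]]; rewrite setTI.
by apply: rVB_open; apply: cf; exact: interval_open.
Qed.

Lemma measurable_coord (i : 'I_n.+1) : mfunT (fun x : rVB n => (x : V) ord0 i).
Proof. apply: (@cont_meas (fun x => x ord0 i)); exact: coord_continuous. Qed.

Lemma measurable_rV {d} {T : measurableType d} (f : T -> rVB n) :
 (forall i, mfunT (fun t => (f t : V) ord0 i)) -> mfunT f.
Proof.
move=> mf; apply: (@measurability _ _ _ _ _ _ (open : set (set (rVB n)))) => //.
move=> _ [U oU <-]; have [a [b ->]] := open_bigcup_obox oU.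
rewrite setTI preimage_bigcup; apply: bigcup_measurable => k _.
rewrite (_ : _ @^-1` _ = \big[setI/setT]_(i < n.+1)
 ((fun t => (f t : V) ord0 i) @^-1` `]a k ord0 i, b k ord0 i[)); last first.
 rewrite -bigcap_seq; apply/seteqP; split=> x h.
 by move=> i _ /=; rewrite in_itv; exact: h.
 by move=> i; have := h i; rewrite /= in_itv; apply; rewrite mem_index_enum.
apply: bigsetI_measurable => i _; rewrite -[mset]setTI.
by apply: mf => //; exact: measurable_itv.
Qed.

Definition lamB : set (rVB n) -> \bar R := @lebesgue_outer R n.

Let lamB0 : lamB set0 = 0%E. Proof. exact: lam0. Qed.
Let lamB_ge0 A : (0 <= lamB A)%E. Proof. exact: lam_ge0. Qed.
Let lamB_sigma_additive : semi_sigma_additive lamB.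
Proof.
move=> F mF tF mUF.
apply: (@measure_semi_sigma_additive _ _ _ (@lebesgueN R n)) => //.
- by move=> i; exact: (borel_lebesgue (mF i)).
- exact: (borel_lebesgue mUF).
Qed.

HB.instance Definition _ := isMeasure.Build _ (rVB n) R lamB lamB0 lamB_ge0 lamB_sigma_additive.

Definition cube (r : R) : set V := obox (const_mx (- r)) (const_mx r).

Lemma cubeE r x : cube r x <-> `|x| < r.
Proof.
split=> [h|h i].
 have [i ->] := norm_coord x; have := h i; rewrite !mxE ltr_norml//.
by rewrite !mxE -ltr_norml; exact: le_lt_trans (coord_le _ _) h.
Qed.

Lemma lamB_bounded (A : set V) (r : R) : (forall x, A x -> `|x| <= r) -> (lamB A < +oo)%E.
Proof.
move=> h; apply: (@le_lt_trans _ _ ((2 * (2 * `|r|)) ^+ n.+1)%:E); last exact: ltry.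
apply: lam_diam; first by rewrite mge0.
move=> x y /h hx /h hy; apply: le_trans (ler_normB _ _) _.
by have := ler_norm r; lra.
Qed.

Let lamB_sigma_finite : sigma_finite setT lamB.
Proof.
exists (fun k => cube k%:R); last first.
 move=> k; split; first by apply: rVB_open; exact: obox_open.
 by apply: (@lamB_bounded _ k%:R) => x /cubeE/ltW.
apply/esym; rewrite -subTset => x _; exists (Num.bound `|x|) => //; apply/cubeE.
exact: archi_boundP.
Qed.

HB.instance Definition _ := @Measure_isSigmaFinite.Build _ (rVB n) R lamB lamB_sigma_finite.

Lemma measure_le_lamB (m : {measure set (rVB n) -> \bar R}) :
 (forall a b : V, (forall i, a ord0 i <= b ord0 i) ->
 (m (box a b) <= (\prod_i (b ord0 i - a ord0 i))%:E)%E) ->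
 forall A : set (rVB n), measurable A -> (m A <= lamB A)%E.
Proof.
move=> mbox A mA; apply: le_ereal_inf_tmp => _ [U AU <-].
have [->|Uoo] := eqVneq (\sum_(k <oo) box_gauge (U k))%E +oo%E; first exact: leey.
have Ufin k : (box_gauge (U k) < +oo)%E.
 rewrite ltey; apply: contra Uoo => /eqP h; apply/eqP.
 rewrite (@nneseriesD1 _ (fun k => box_gauge (U k)) k xpredT)//; last by move=> *; exact: box_gauge_ge0.
 rewrite h addye// gt_eqF// (lt_le_trans (ltNyr 0))// nneseries_ge0// => *; exact: box_gauge_ge0.
apply/lee_addgt0Pr => e e0.
have P k : exists ab : V * V, [/\ forall i, ab.1 ord0 i <= ab.2 ord0 i, U k `<=` box ab.1 ab.2 &
 ((\prod_i (ab.2 ord0 i - ab.1 ord0 i))%:E <= box_gauge (U k) + (e / 2 ^+ k.+1)%:E)%E].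
 have Uk : box_gauge (U k) \is a fin_num by rewrite ge0_fin_numE ?box_gauge_ge0.
 have e0k : 0 < e / 2 ^+ k.+1 by rewrite divr_gt0// exprn_gt0.
 have [_ [[a b] /= [ab Uab] <-] lt] := lb_ereal_inf_adherent e0k Uk.
 by exists (a, b); split=> //; exact: ltW.
have [ab hab] := choice P.
have mB k : measurable (box (ab k).1 (ab k).2 : set (rVB n)).
 apply: rVB_closed.
 rewrite (_ : box _ _ = \bigcap_i ((fun x : V => x ord0 i) @^-1` `[(ab k).1 ord0 i, (ab k).2 ord0 i]%classic)).
 apply: closed_bigI => i _; apply: preimage_closed; last exact: interval_closed.
 by move=> x _; exact: coord_continuous.
 apply/seteqP; split=> [x h i _ /=|x h i]; first by rewrite in_itv; exact: h.
 by have := h i I; rewrite /= in_itv.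
apply: (le_via (\sum_(k <oo) m (box (ab k).1 (ab k).2))%E).
 apply: measure_sigma_subadditive => // x /AU[k _ Ukx]; exists k => //.
 by have [_ + _] := hab k; exact.
apply: (le_via (\sum_(k <oo) (box_gauge (U k) + (e / 2 ^+ k.+1)%:E))%E).
 apply: lee_nneseries => [*|k _]; first exact: measure_ge0.
 by have [h1 h2 h3] := hab k; exact: le_trans (mbox _ _ h1) h3.
rewrite (eq_eseriesr (g := fun k => box_gauge (U k) + (e / (2 ^ k.+1)%:R)%:E)%E); last first.
 by move=> k _; rewrite natrX.
by apply: epsilon_trick; [move=> *; exact: box_gauge_ge0|exact: ltW].
Qed.

End borel_space.
Arguments rVB : clear implicits.
Arguments lamB {R n}.

Section product_structure.
Context {R : realType}.
Local Notation mu := (@lebesgue_measure R).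

Lemma box_measurable {n : nat} (a b : 'rV[R]_n.+1) : measurable (box a b : set (rVB R n)).
Proof.
apply: rVB_closed.
rewrite (_ : box a b = \bigcap_i ((fun x : 'rV[R]_n.+1 => x ord0 i) @^-1` `[a ord0 i, b ord0 i]%classic)).
 apply: closed_bigI => i _; apply: preimage_closed; last exact: interval_closed.
 by move=> x _; exact: coord_continuous.
apply/seteqP; split=> [x h i _ /=|x h i]; first by rewrite in_itv; exact: h.
by have := h i I; rewrite /= in_itv.
Qed.

Definition pack {n : nat} (p : rVB R n * R) : rVB R n.+1 := spacetime (p.1 : 'rV[R]_n.+1) p.2.
Definition unpack {n : nat} (z : rVB R n.+1) : rVB R n * R := (xof (z : 'rV[R]_n.+2), tof (z : 'rV[R]_n.+2)).

Lemma xofE {n : nat} (x : 'rV[R]_n.+1) t : xof (spacetime x t) = x.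
Proof. by apply/rowP => i; rewrite !mxE liftK. Qed.

Lemma tofE {n : nat} (x : 'rV[R]_n.+1) t : tof (spacetime x t) = t.
Proof. by rewrite /time_of mxE unlift_none. Qed.

Lemma meas_pack {n : nat} : mfunT (@pack n).
Proof.
apply: measurable_rV => j.
have [i ->|->] := unliftP ord_max j.
 rewrite (_ : (fun _ => _) = (fun x : rVB R n => (x : 'rV[R]_n.+1) ord0 i) \o fst); last first.
 by apply/funext => p; rewrite /= !mxE liftK.
 by apply: measC => //; exact: measurable_coord.
rewrite (_ : (fun _ => _) = snd)//.
by apply/funext => p; rewrite /= mxE unlift_none.
Qed.

Lemma measurable_unpack {n : nat} : mfunT (@unpack n).
Proof.
apply: measurable_fun_pair; last exact: measurable_coord.
apply: measurable_rV => i.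
rewrite (_ : (fun _ => _) = (fun x : rVB R n.+1 => (x : 'rV[R]_n.+2) ord0 (lift ord_max i))).
 exact: measurable_coord.
by apply/funext => z; rewrite mxE.
Qed.

Lemma pack_preimage_box {n : nat} (a b : 'rV[R]_n.+2) :
 @pack n @^-1` box a b = box (xof a) (xof b) `*` `[tof a, tof b].
Proof.
apply/seteqP; split=> [[x t] h|[x t] [h1 h2] j]; rewrite /pack/=.
 split=> /= [i|]; last by have := h ord_max; rewrite /pack /= in_itv /= mxE unlift_none.
 by have := h (lift ord_max i); rewrite /pack /= !mxE liftK.
rewrite mxE; case: unliftP => [i ->|->]; first by have := h1 i; rewrite !mxE.
by move: h2; rewrite /= in_itv.
Qed.

Lemma pack_preimage_obox {n : nat} (a b : 'rV[R]_n.+2) :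
 @pack n @^-1` obox a b = obox (xof a) (xof b) `*` `]tof a, tof b[.
Proof.
apply/seteqP; split=> [[x t] h|[x t] [h1 h2] j]; rewrite /pack/=.
 split=> /= [i|]; last by have := h ord_max; rewrite /pack /= in_itv /= mxE unlift_none.
 by have := h (lift ord_max i); rewrite /pack /= !mxE liftK.
rewrite mxE; case: unliftP => [i ->|->]; first by have := h1 i; rewrite !mxE.
by move: h2; rewrite /= in_itv.
Qed.

Lemma prod_space_time {n : nat} (F : 'I_n.+2 -> R) :
 \prod_j F j = (\prod_(i < n.+1) F (lift ord_max i)) * F ord_max.
Proof. by rewrite big_ord_recr/=; congr (_ * _); apply: eq_bigr => i _; congr F; apply: val_inj; rewrite /= /bump leqNgt ltn_ord. Qed.

Definition packed_measure {n : nat} : {measure set (rVB R n.+1) -> \bar R}.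
Proof.
unshelve refine (pushforward (lamB \x mu)%E (@pack n) : {measure set (rVB R n.+1) -> \bar R}).
exact: meas_pack.
Defined.

Lemma packed_measureE {n : nat} (A : set (rVB R n.+1)) :
 packed_measure A = (lamB \x mu)%E (@pack n @^-1` A).
Proof. by []. Qed.

Definition row1_measure : {measure set (rVB R 0) -> \bar R}.
Proof.
unshelve refine (pushforward mu ((fun t => const_mx t) : R -> rVB R 0) : {measure set (rVB R 0) -> \bar R}).
by apply: measurable_rV => i; rewrite (_ : (fun _ => _) = id)//; apply/funext => t; rewrite mxE.
Defined.

Lemma row1_measureE (A : set (rVB R 0)) :
 row1_measure A = mu [set t | A (const_mx t)].
Proof. by []. Qed.

Lemma lebesgue_itvcc (a b : R) : a <= b -> mu `[a, b]%classic = (b - a)%:E.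
Proof.
move=> ab; rewrite lebesgue_measure_itv/= lte_fin.
by case: ltgtP ab => // -> _; rewrite subrr.
Qed.

Lemma lebesgue_itvoo (a b : R) : a <= b -> mu `]a, b[%classic = (b - a)%:E.
Proof.
move=> ab; rewrite lebesgue_measure_itv/= lte_fin.
by case: ltgtP ab => // -> _; rewrite subrr.
Qed.

Lemma lamB_box_le {n : nat} (a b : 'rV[R]_n.+1) : (forall i, a ord0 i <= b ord0 i) ->
 (lamB (box a b) <= (\prod_i (b ord0 i - a ord0 i))%:E)%E.
Proof. by move=> ab; exact: lam_box. Qed.

Lemma packed_le_lamB {n : nat} (A : set (rVB R n.+1)) : measurable A ->
 (packed_measure A <= lamB A)%E.
Proof.
apply: measure_le_lamB => a b ab; rewrite packed_measureE pack_preimage_box.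
rewrite product_measure1E//; last exact: box_measurable.
rewrite [X in (_ * X)%E](lebesgue_itvcc (ab ord_max)).
rewrite prod_space_time EFinM; apply: lee_wpmul2r.
 by rewrite lee_fin subr_ge0; exact: ab.
apply: le_trans (lamB_box_le _) _; first by move=> i; rewrite !mxE.
by rewrite lee_fin; under eq_bigr do rewrite !mxE.
Qed.

Lemma lamB_obox {n : nat} (a b : 'rV[R]_n.+1) : (forall i, a ord0 i <= b ord0 i) ->
 lamB (obox a b) = (\prod_i (b ord0 i - a ord0 i))%:E.
Proof.
move=> ab; apply/eqP; rewrite eq_le; apply/andP; split.
 apply: lam_box => // x h i; have /andP[h1 h2] := h i; by rewrite !ltW.
elim: n a b ab => [|n IH] a b ab.
 apply: le_trans (@measure_le_lamB _ _ row1_measure _ (obox a b) _); last 2 first.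
 - move=> a' b' ab'; rewrite row1_measureE.
 rewrite (_ : [set t | _] = `[a' ord0 ord0, b' ord0 ord0]%classic).
 by rewrite big_ord1 lebesgue_itvcc.
 apply/seteqP; split=> t; first by move=> /(_ ord0); rewrite mxE /= in_itv.
 by rewrite /= in_itv => h i; rewrite mxE (ord1 i).
 - apply: rVB_open; exact: obox_open.
 rewrite row1_measureE (_ : [set t | _] = `]a ord0 ord0, b ord0 ord0[%classic).
 by rewrite big_ord1 lebesgue_itvoo.
 apply/seteqP; split=> t; first by move=> /(_ ord0); rewrite mxE /= in_itv.
 by rewrite /= in_itv => h i; rewrite mxE (ord1 i).
apply: le_trans (packed_le_lamB _); last by apply: rVB_open; exact: obox_open.
rewrite packed_measureE pack_preimage_obox product_measure1E//; last first.
 by apply: rVB_open; exact: obox_open.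
rewrite [X in (_ * X)%E](lebesgue_itvoo (ab ord_max)).
rewrite prod_space_time EFinM; apply: lee_wpmul2r.
 by rewrite lee_fin subr_ge0; exact: ab.
apply: le_trans _ (IH _ _ _); first by rewrite lee_fin; under [leRHS]eq_bigr do rewrite !mxE.
by move=> i; rewrite !mxE.
Qed.

Lemma oboxI {n : nat} (a b c d : 'rV[R]_n.+1) : obox a b `&` obox c d =
 obox (\row_i Num.max (a ord0 i) (c ord0 i)) (\row_i Num.min (b ord0 i) (d ord0 i)).
Proof.
apply/seteqP; split=> x.
 move=> [h1 h2] i; rewrite !mxE gt_max lt_min.
 by have /andP[-> ->] := h1 i; have /andP[-> ->] := h2 i.
move=> h; split=> i; have := h i; rewrite !mxE gt_max lt_min.
 by move=> /andP[/andP[-> _] /andP[-> _]].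
by move=> /andP[/andP[_ ->] /andP[_ ->]].
Qed.

Lemma rVB_generated {n : nat} : (measurable : set (set (rVB R n))) =
 <<s [set A | exists a b : 'rV[R]_n.+1, A = obox a b] >>.
Proof.
apply/seteqP; split.
 apply: smallest_sub; first exact: smallest_sigma_algebra.
 move=> U /open_bigcup_obox[a [b ->]].
 apply: sigma_algebra_bigcup => k; apply: sub_gen_smallest; by exists (a k), (b k).
apply: smallest_sub; first exact: sigma_algebra_measurable.
by move=> _ [a [b ->]]; apply: rVB_open; exact: obox_open.
Qed.

Lemma setT_bigcup_cube {n : nat} : \bigcup_k (cube k%:R : set 'rV[R]_n.+1) = setT.
Proof.
rewrite -subTset => x _; exists (Num.bound `|x|) => //; apply/cubeE.
exact: archi_boundP.
Qed.

Lemma rVB_measure_unique {n : nat} (m1 m2 : {measure set (rVB R n) -> \bar R}) :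
 (forall a b : 'rV[R]_n.+1, (forall i, a ord0 i <= b ord0 i) -> m1 (obox a b) = m2 (obox a b)) ->
 (forall k : nat, (m1 (cube k%:R) < +oo)%E) ->
 forall A, measurable A -> m1 A = m2 A.
Proof.
move=> m12 fin; apply: (@measure_unique _ _ (rVB R n) _ (fun k => cube k%:R) rVB_generated _ _ _ m1 m2) => //.
- move=> _ _ [a [b ->]] [c [d ->]]; rewrite oboxI; by eexists; eexists.
- by move=> k; eexists; eexists.
- exact: setT_bigcup_cube.
move=> _ [a [b ->]]; have [ab|nab] := pselect (forall i, a ord0 i <= b ord0 i).
 exact: m12.
rewrite (_ : obox a b = set0) ?measure0//.
apply/seteqP; split=> // x h; apply: nab => i.
by have /andP[h1 h2] := h i; rewrite ltW// (lt_trans h1).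
Qed.

Lemma lamB_packed {n : nat} (A : set (rVB R n.+1)) : measurable A ->
 lamB A = packed_measure A.
Proof.
apply: rVB_measure_unique => [a b ab|k]; last first.
 by apply: (@lamB_bounded _ _ _ k%:R) => x /cubeE/ltW.
rewrite [LHS](lamB_obox ab) packed_measureE pack_preimage_obox product_measure1E//; last first.
 by apply: rVB_open; exact: obox_open.
rewrite [X in (_ * X)%E](lebesgue_itvoo (ab ord_max)).
rewrite [X in (X * _)%E]lamB_obox; last by move=> i; rewrite !mxE.
rewrite prod_space_time EFinM; congr (_ * _)%E; congr EFin.
by apply: eq_bigr => i _; rewrite !mxE.
Qed.

End product_structure.

Section borel_representatives.
Context {R : realType} {n : nat}.
Local Notation V := 'rV[R]_n.+1.
Local Notation BV := (rVB R n).
Local Notation lam := (@lebesgue_outer R n).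

Lemma lam_bigcup_null (I : countType) (F : I -> set V) :
 (forall i, lam (F i) = 0%E) -> lam (\bigcup_i F i) = 0%E.
Proof.
move=> F0; pose G (k : nat) : set V := if unpickle k is Some i then F i else set0.
apply/eqP; rewrite eq_le lam_ge0 andbT.
apply: (le_via (lam (\bigcup_k G k))).
 by apply: le_lam => x [q _ hq]; exists (pickle q) => //; rewrite /G pickleK.
apply: le_trans (lam_sub _) _.
rewrite eseries0// => k _ _; rewrite /G; case: unpickle => [q|]; last exact: lam0.
exact: F0.
Qed.

Lemma box_cover_outer (A : set V) (e : R) : (lam A < +oo)%E -> 0 < e ->
 exists2 B : set BV, measurable B /\ A `<=` B & (lam B <= lam A + e%:E)%E.
Proof.
move=> Aoo e0.
have Afin : lam A \is a fin_num by rewrite ge0_fin_numE ?lam_ge0.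
have e20 : 0 < e / 2 by rewrite divr_gt0.
have [_ [U AU <-] lt] := lb_ereal_inf_adherent e20 Afin.
have [Uoo Ufin] : (\sum_(k <oo) box_gauge (U k) < +oo)%E /\ forall k, (box_gauge (U k) < +oo)%E.
 have Uoo : (\sum_(k <oo) box_gauge (U k) < +oo)%E.
 by apply: lt_trans lt _; rewrite lte_add_pinfty ?ltry.
 split=> // k; apply: le_lt_trans Uoo.
 rewrite (@nneseriesD1 _ (fun k => box_gauge (U k)) k xpredT)//; last by move=> *; exact: box_gauge_ge0.
 by rewrite leeDl// nneseries_ge0// => *; exact: box_gauge_ge0.
have P k : exists ab : V * V, [/\ forall i, ab.1 ord0 i <= ab.2 ord0 i, U k `<=` box ab.1 ab.2 &
 ((\prod_i (ab.2 ord0 i - ab.1 ord0 i))%:E <= box_gauge (U k) + (e / 2 / 2 ^+ k.+1)%:E)%E].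
 have Uk : box_gauge (U k) \is a fin_num by rewrite ge0_fin_numE ?box_gauge_ge0.
 have e0k : 0 < e / 2 / 2 ^+ k.+1 by rewrite divr_gt0// exprn_gt0.
 have [_ [[a b] /= [ab Uab] <-] lt'] := lb_ereal_inf_adherent e0k Uk.
 by exists (a, b); split=> //; exact: ltW.
have [ab hab] := choice P.
exists (\bigcup_k box (ab k).1 (ab k).2); first split.
- by apply: bigcup_measurable => k _; exact: box_measurable.
- by move=> x /AU[k _ Ukx]; exists k => //; have [_ + _] := hab k; exact.
apply: (le_via (\sum_(k <oo) (box_gauge (U k) + (e / 2 / (2 ^ k.+1)%:R)%:E))%E).
 apply: (le_via (\sum_(k <oo) lam (box (ab k).1 (ab k).2))%E).
 by apply: lam_sub.
 apply: lee_nneseries => [*|k _]; first exact: lam_ge0.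
 have [h1 h2 h3] := hab k; apply: le_trans (lamB_box_le h1) _.
 by rewrite natrX.
apply: le_trans (epsilon_trick _ _ _) _; [move=> *; exact: box_gauge_ge0|exact: ltW|].
apply: le_trans (leeD2r _ (ltW lt)) _.
by rewrite -/(lam A) -addeA -EFinD -splitr.
Qed.

Lemma borel_hull (A : set V) : exists2 B : set BV, measurable B /\ A `<=` B & lam B = lam A.
Proof.
have [Aoo|Aoo] := ltP (lam A) +oo%E; last first.
 exists setT; first by [].
 apply/eqP; rewrite eq_le (le_trans _ Aoo) ?leey//=.
 exact: le_lam.
have P (k : nat) : exists B : set BV, [/\ measurable B, A `<=` B & (lam B <= lam A + (k.+1%:R^-1)%:E)%E].
 have k0 : 0 < k.+1%:R^-1 :> R by [].
 by have [B [h1 h2] h3] := box_cover_outer Aoo k0; exists B.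
have [B hB] := choice P.
exists (\bigcap_k B k); first split.
- by apply: bigcap_measurable => // k _; have [] := hB k.
- by move=> x Ax k _; have [_ + _] := hB k; exact.
apply/eqP; rewrite eq_le; apply/andP; split; last first.
 by apply: le_lam => x Ax k _; have [_ + _] := hB k; exact.
apply/lee_addgt0Pr => e e0.
have [k _ hk] := near_infty_natSinv_lt (PosNum e0).
apply: (le_via (lam (B k))); first by apply: le_lam => x; exact.
have [_ _ h] := hB k; apply: le_trans h _; rewrite leeD2l// lee_fin.
by have /= := hk k (leqnn _) => /ltW.
Qed.

Lemma null_borel (A : set V) : lam A = 0%E ->
 exists2 B : set BV, measurable B /\ A `<=` B & lam B = 0%E.
Proof. by have [B h1 h2] := borel_hull A => h; exists B => //; rewrite h2. Qed.

Lemma ae_lebesgueN (P : V -> Prop) : {ae lebesgueN, forall x, P x} <->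
 exists2 N : set BV, nullB N & forall x, ~ N x -> P x.
Proof.
split=> [[A [mA A0 sA]]|[N [mN N0] h]].
 have [B [mB AB] B0] := null_borel A0; exists B => // x Bx.
 by apply: contrapT => Px; apply: Bx; apply: AB; exact: sA.
exists N; split=> //; first exact: (borel_lebesgue mN).
by move=> x /= Px; apply: contrapT => /h.
Qed.

Lemma caratheodory_borel (A : set V) : (lebesgue_om n).-caratheodory A ->
 exists B N : set BV, [/\ measurable B, measurable N, lam N = 0%E & A `\` N = B `\` N].
Proof.
move=> cA; pose Q (k : nat) (p : set V * set V) :=
 [/\ measurable (p.1 : set BV), measurable (p.2 : set BV), lam p.2 = 0%E,
 A `&` cube k%:R `<=` p.1 & p.1 `\` A `<=` p.2 `|` ~` cube k%:R].
have P k : exists p, Q k p.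
 have mC : measurable (cube k%:R : set BV) by apply: rVB_open; exact: obox_open.
 have cC := borel_lebesgue mC.
 have cAk : (lebesgue_om n).-caratheodory (A `&` cube k%:R) by exact: caratheodory_measurable_setI.
 have [B [mB AB] B0] := borel_hull (A `&` cube k%:R).
 have Afin : (lam (A `&` cube k%:R) < +oo)%E.
 apply: le_lt_trans (le_lam _) (@lamB_bounded _ _ (cube k%:R) k%:R _); first exact: subIsetr.
 by move=> x /cubeE/ltW.
 have d0 : lam (B `\` (A `&` cube k%:R)) = 0%E.
 have := cAk B; rewrite -[lebesgue_om n B]/(lam B) B0.
 rewrite (setIidr AB) -[in X in X -> _]setDE.
 have : lam (A `&` cube k%:R) \is a fin_num by rewrite ge0_fin_numE ?lam_ge0.
 rewrite -[lebesgue_om n _]/(lam (A `&` cube k%:R)) -[lebesgue_om n (_ `\` _)]/(lam (B `\` (A `&` cube k%:R))).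
 move=> Af; rewrite -[in X in X -> _](fineK Af).
 case: (lam (B `\` _)) => [r|//|//] /eqP; rewrite -EFinD eqe => /eqP h; congr EFin; lra.
 have [N [mN DN] N0] := null_borel d0.
 exists (B, N); split=> // x [Bx nA]; left; apply: DN; split=> // -[].
 by move=> /nA.
have [p hp] := choice P.
exists (\bigcup_k ((p k).1 `&` cube k%:R)), (\bigcup_k (p k).2); split.
- apply: bigcup_measurable => k _; apply: measurableI; first by have [] := hp k.
 by apply: rVB_open; exact: obox_open.
- by apply: bigcup_measurable => k _; have [] := hp k.
- apply/eqP; rewrite eq_le lam_ge0 andbT.
 apply: le_trans (lam_sub _) _.
 rewrite eseries0// => k _ _; by have [_ _ + _ _] := hp k.
apply/seteqP; split=> x [h nN]; split=> //.
 have : (\bigcup_k (cube k%:R : set V)) x by rewrite setT_bigcup_cube.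
 move=> [k _ Ck]; exists k => //; split=> //.
 by have [_ _ _ + _] := hp k; apply.
move: h => [k _ [pk Ck]]; apply: contrapT => nA.
have [_ _ _ _ /(_ x (conj pk nA))[Nx|//]] := hp k.
by apply: nN; exists k.
Qed.

Lemma borel_representative (D : set V) (g : V -> R) : open D ->
 measurable_fun (D : set LM) g ->
 exists (g0 : BV -> R) (N : set BV),
 [/\ mfunT g0, measurable N, lam N = 0%E &
 forall x, D x -> ~ N x -> g x = g0 x].
Proof.
move=> oD mg.
have mD : measurable (D : set BV) by exact: rVB_open.
pose Q (q : rat) (p : set V * set V) :=
 [/\ measurable (p.1 : set BV), measurable (p.2 : set BV), lam p.2 = 0%E &
 (D `&` g @^-1` `]ratr q, +oo[) `\` p.2 = p.1 `\` p.2].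
have P q : exists p, Q q p.
 have cA : (lebesgue_om n).-caratheodory (D `&` g @^-1` `]ratr q, +oo[).
 apply: mg; first exact: (borel_lebesgue mD).
 exact: measurable_itv.
 by have [B [N [h1 h2 h3 h4]]] := caratheodory_borel cA; exists (B, N).
have [p hp] := choice P.
pose N : set BV := \bigcup_(q : rat) (p q).2.
have mN : measurable N by apply: bigcupT_measurable_rat => q; have [] := hp q.
have N0 : lam N = 0%E.
 by apply: lam_bigcup_null => q; have [] := hp q.
have mE : measurable_fun (D `\` N : set BV) (g : BV -> R).
 apply: (measurability _ (measurable_realfun.RGenOInfty.measurableE R)).
 move=> _ [_ [x ->] <-].
 rewrite (_ : _ `&` _ = \bigcup_(q in [set q : rat | x < ratr q]) ((p q).1 `\` N)).
 rewrite bigcup_mkcond; apply: bigcupT_measurable_rat => q; case: ifPn => // _.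
 by apply: measurableD => //; have [] := hp q.
 apply/seteqP; split=> y.
 move=> [[Dy Ny]]; rewrite /= in_itv/= andbT => xy.
 have [q] := rat_in_itvoo xy; rewrite in_itv/= => /andP[xq qy].
 exists q => //; split=> //.
 have [_ _ _ e] := hp q.
 suff : ((D `&` g @^-1` `]ratr q, +oo[) `\` (p q).2) y by rewrite e => -[].
 split; first by split=> //=; rewrite in_itv/= andbT.
 by move=> pq; apply: Ny; exists q.
 move=> [q /= xq [pq Ny]]; have [_ _ _ e] := hp q.
 have : ((p q).1 `\` (p q).2) y by split=> // pq2; apply: Ny; exists q.
 rewrite -e => -[[Dy]]; rewrite /= in_itv/= andbT => qy _.
 by split=> //; rewrite in_itv/= andbT (lt_trans xq).
exists (g \_ (D `\` N)), N; split=> //.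
 apply/(measurable_restrictT _ _).1 => //; exact: measurableD.
by move=> x Dx Nx; rewrite patchE mem_set.
Qed.

End borel_representatives.

Section integral_transfer.
Context {R : realType} {n : nat}.
Local Notation V := 'rV[R]_n.+1.
Local Notation lam := (@lebesgue_outer R n).
Local Open Scope ereal_scope.

Section borel_restriction.
Variables (om : {outer_measure set V -> \bar R}).
Hypothesis omB : forall A : set (rVB R n), measurable A -> om.-caratheodory A.
Variables (m : {measure set (caratheodory_type om) -> \bar R}) (mB : {measure set (rVB R n) -> \bar R}).
Hypothesis mBE : forall A : set (rVB R n), measurable A -> mB A = m A.

Let mid : mfunT (id : caratheodory_type om -> rVB R n).
Proof. by move=> _ A mA; rewrite setTI; exact: omB. Qed.

Lemma ge0_integral_borel_restriction (D : set (rVB R n)) (F : rVB R n -> \bar R) :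
 measurable D -> measurable_fun D F -> (forall x, D x -> 0 <= F x) ->
 \int[m]_(x in D) F x = \int[mB]_(x in D) F x.
Proof.
move=> mD mF F0.
rewrite -[LHS](@ge0_integral_pushforward _ _ (caratheodory_type om) (rVB R n) R id mid m D F)//; last first.
 by move=> x; rewrite inE; exact: F0.
by apply: eq_measure_integral => A mA _; rewrite mBE.
Qed.

End borel_restriction.

Lemma lebesgueN_measurable (A : set (rVB R n)) : measurable A ->
 measurable (A : set LM).
Proof. exact: borel_lebesgue. Qed.

Lemma lebesgueN_measurable_fun {d} {T : measurableType d} (D : set (rVB R n)) (F : rVB R n -> T) :
 measurable D -> measurable_fun D F ->
 measurable_fun (D : set LM) (F : caratheodory_type (lebesgue_om n) -> T).
Proof. by move=> mD mF _ A mA; apply: lebesgueN_measurable; apply: mF. Qed.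

Lemma ge0_integral_lebesgueN (D : set (rVB R n)) (F : rVB R n -> \bar R) :
 measurable D -> measurable_fun D F -> (forall x, D x -> 0 <= F x) ->
 \int[lebesgueN]_(x in D) F x = \int[lamB]_(x in D) F x.
Proof.
by apply: ge0_integral_borel_restriction => // A mA; exact: lebesgueN_measurable.
Qed.

Lemma integral_lebesgueN (D : set (rVB R n)) (F : rVB R n -> \bar R) :
 measurable D -> measurable_fun D F ->
 \int[lebesgueN]_(x in D) F x = \int[lamB]_(x in D) F x.
Proof.
move=> mD mF; rewrite integralE [RHS]integralE; congr (_ - _).
- by apply: ge0_integral_lebesgueN => //; exact: measurable_funepos.
- by apply: ge0_integral_lebesgueN => //; exact: measurable_funeneg.
Qed.

Lemma integral_representative (D : set V) (F : V -> R) (F0 : rVB R n -> R) (N : set (rVB R n)) :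
 open D -> measurable_fun (D : set LM) F ->
 mfunT F0 -> measurable N -> lam N = 0 -> (forall x, D x -> ~ N x -> F x = F0 x) ->
 \int[lebesgueN]_(x in D) (F x)%:E = \int[lamB]_(x in D) (F0 x)%:E.
Proof.
move=> oD mF mF0 mN N0 FF0; have mD : measurable (D : set (rVB R n)) by exact: rVB_open.
have mF0' : measurable_fun (D : set (rVB R n)) (EFin \o F0) by apply/mEF; exact: measurable_funS mF0.
rewrite -(integral_lebesgueN mD mF0'); apply: ae_eq_integral.
- exact: lebesgueN_measurable.
- exact/mEF.
- exact: lebesgueN_measurable_fun.
apply/ae_lebesgueN; exists N => // x Nx Dx; by rewrite FF0.
Qed.

End integral_transfer.

Section Lp_norms.
Local Open Scope ereal_scope.

Lemma Lp_norm2E {d} {T : measurableType d} {R : realType} (m : {measure set T -> \bar R})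
 (D : set T) (f : T -> R) :
 Lp_norm m D 2%:E f = (\int[m]_(x in D) (f x ^+ 2)%:E) `^ (2^-1)%R.
Proof.
rewrite /Lp_norm unlock; congr (_ `^ _); rewrite [RHS]integral_mkcond; apply: eq_integral => x _.
rewrite !patchE; case: ifPn => _ /=; last by rewrite normr0 powR0.
by rewrite powR_mulrn// real_normK// num_real.
Qed.

Lemma Lp_norm2_sqr {d} {T : measurableType d} {R : realType} (m : {measure set T -> \bar R})
 (D : set T) (f : T -> R) :
 Lp_norm m D 2%:E f `^ 2 = \int[m]_(x in D) (f x ^+ 2)%:E.
Proof.
rewrite Lp_norm2E -poweRrM mulVf// poweRe1//.
by apply: integral_ge0 => x _; rewrite lee_fin sqr_ge0.
Qed.

Lemma Lp_norm2_le {d d'} {T : measurableType d} {T' : measurableType d'} {R : realType}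
 (m : {measure set T -> \bar R}) (m' : {measure set T' -> \bar R})
 (D : set T) (D' : set T') (f : T -> R) (g : T' -> R) (C : R) : (0 <= C)%R ->
 \int[m]_(x in D) (f x ^+ 2)%:E <= (C ^+ 2)%:E * \int[m']_(x in D') (g x ^+ 2)%:E ->
 Lp_norm m D 2%:E f <= C%:E * Lp_norm m' D' 2%:E g.
Proof.
move=> C0 h; have i0 : 0 <= \int[m']_(x in D') (g x ^+ 2)%:E.
 by apply: integral_ge0 => x _; rewrite lee_fin sqr_ge0.
rewrite !Lp_norm2E; have -> : C%:E = (C ^+ 2)%:E `^ (2^-1)%R.
 by rewrite poweR_EFin -powR_mulrn// -powRrM mulfV// powRr1.
rewrite -poweRM ?lee_fin ?sqr_ge0//.
apply: gt0_ler_poweR => //; rewrite in_itv/= leey andbT.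
 by apply: integral_ge0 => x _; rewrite lee_fin sqr_ge0.
by rewrite mule_ge0// lee_fin sqr_ge0.
Qed.

Lemma Lp_norm2_cvg0 {d} {T : measurableType d} {R : realType} (m : {measure set T -> \bar R})
 (D : set T) (f : nat -> T -> R) :
 Lp_norm m D 2%:E (f k) @[k --> \oo] --> 0 ->
 forall e : R, (0 < e)%R -> \forall k \near \oo, \int[m]_(x in D) (f k x ^+ 2)%:E <= e%:E.
Proof.
move=> /fine_cvgP[fin h] e e0.
have s0 : (0 < Num.sqrt e)%R by rewrite sqrtr_gt0.
have {}h : \forall k \near \oo, (fine (Lp_norm m D 2%:E (f k)) < Num.sqrt e)%R.
 near=> k; have : (`|0 - fine (Lp_norm m D 2%:E (f k))| < Num.sqrt e)%R.
 by near: k; move/cvgrPdist_lt : h; exact.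
 by rewrite sub0r normrN; apply: le_lt_trans; exact: ler_norm.
near=> k; rewrite -Lp_norm2_sqr.
have hf : Lp_norm m D 2%:E (f k) \is a fin_num by near: k.
have h0 : (0 <= fine (Lp_norm m D 2%:E (f k)))%R by rewrite fine_ge0// Lp_norm2E poweR_ge0.
rewrite -(fineK hf) poweR_EFin lee_fin powR_mulrn//.
rewrite -(sqr_sqrtr (ltW e0)) ler_pXn2r ?nnegrE ?sqrtr_ge0//.
by apply: ltW; near: k.
Unshelve. all: by end_near. Qed.

Lemma in_Lp2_lty {d} {T : measurableType d} {R : realType} (m : {measure set T -> \bar R})
 (D : set T) (f : T -> R) :
 Lp_norm m D 2%:E f < +oo -> \int[m]_(x in D) (f x ^+ 2)%:E < +oo.
Proof. by move=> h; rewrite -Lp_norm2_sqr; exact: poweR_lty. Qed.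

Lemma Lp_oo_bound {R : realType} {n : nat} (D : set 'rV[R]_n.+1) (p : 'rV[R]_n.+1 -> R) (M : R) :
 Lp_norm lebesgueN D +oo%E p <= M%:E ->
 exists2 N : set (rVB R n), nullB N &
 forall x, D x -> ~ N x -> (`|p x| <= M)%R.
Proof.
rewrite /Lp_norm unlock; case: ifPn => [_|/negP[]]; last first.
 apply: (@lt_le_trans _ _ (lam (cube 1 : set 'rV[R]_n.+1))); last exact: le_lam.
 rewrite -[lam _]/(lamB _) lamB_obox; last by move=> i; rewrite !mxE; lra.
 by rewrite lte_fin prodr_gt0// => i _; rewrite !mxE; lra.
move=> /ess_sup_inf.ess_supP/ae_lebesgueN[N hN h]; exists N => // x Dx /h.
by rewrite /= patchE mem_set.
Qed.

End Lp_norms.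

Section thin_sets.
Context {R : realType} {n : nat}.
Local Notation V := 'rV[R]_n.+1.
Local Notation lam := (@lebesgue_outer R n).

Lemma rational_obox (U : set V) (x : V) : open_nbhs x U ->
 exists ab : 'rV[rat]_n.+1 * 'rV[rat]_n.+1,
 obox (map_mx ratr ab.1) (map_mx ratr ab.2) x /\ obox (map_mx ratr ab.1) (map_mx ratr ab.2) `<=` U.
Proof.
move=> xU; have /nbhs_ballP[r /= r0 hr] : nbhs x U by exact: open_nbhs_nbhs.
have [a ha] := choice (fun i : 'I_n.+1 => @rat_in_itvoo R (x ord0 i - r) (x ord0 i) (ltac:(lra))).
have [b hb] := choice (fun i : 'I_n.+1 => @rat_in_itvoo R (x ord0 i) (x ord0 i + r) (ltac:(lra))).
exists (\row_i a i, \row_i b i); split=> [i|y hy]; last first.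
 apply: hr; apply/ball_normP.
 have [i ->] := norm_coord (x - y); rewrite !mxE.
 have := hy i; rewrite !mxE; have := ha i; have := hb i; rewrite !in_itv/=.
 move=> /andP[h1 h2] /andP[h3 h4] /andP[h5 h6].
 by rewrite ltr_norml; apply/andP; split; lra.
rewrite !mxE.
by have := ha i; have := hb i; rewrite !in_itv/= => /andP[-> _] /andP[_ ->].
Qed.

Lemma measurable_subr (a : V) : mfunT ((fun x : V => x - a) : rVB R n -> rVB R n).
Proof.
apply: measurable_rV => i.
rewrite (_ : (fun _ => _) = (fun x : rVB R n => (x : V) ord0 i - a ord0 i)).
 by apply: measB; [exact: measurable_coord|exact: measK].
by apply/funext => x; rewrite !mxE.
Qed.

Lemma disjoint_translates (W : set (rVB R n)) (I : finType) (v : I -> V) (r : R) :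
 0 <= r -> measurable W -> (forall x i, W x -> `|x + v i| <= r) ->
 (forall i j x y, W x -> W y -> x + v i = y + v j -> i = j) ->
 ((#|I|%:R)%:E * lam W <= ((2 * (2 * r)) ^+ n.+1)%:E)%E.
Proof.
move=> r0 mW hr inj.
pose F (k : 'I_#|I|) : set (rVB R n) := [set x + v (enum_val k) | x in W].
have mF k : measurable (F k).
 have -> : F k = (fun x : V => x - v (enum_val k)) @^-1` W.
 apply/seteqP; split=> [_ [x Wx <-] /=|x /= Wx]; first by rewrite addrK.
 by exists (x - v (enum_val k)) => //; rewrite subrK.
 rewrite -[mset]setTI.
 exact: (measurable_subr (v (enum_val k))).
have tF : trivIset setT F.
 apply/trivIsetP => i j _ _ ij; apply/seteqP; split=> // _ [[x Wx <-] [y Wy e]].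
 have /enum_val_inj/eqP := inj _ _ _ _ Wy Wx e.
 by rewrite eq_sym (negbTE ij).
apply: (le_via (\sum_(k < #|I|) lamB (F k))%E).
 apply: (le_via (\sum_(k < #|I|) lam W)%E).
 have -> m : ((m%:R)%:E * lam W = \sum_(k < m) lam W)%E; last exact: lexx.
 elim: m => [|m IH]; first by rewrite mul0e big_ord0.
 by rewrite big_ord_recr/= -IH -natr1 EFinD ge0_muleDl ?lee_fin// mul1e.
 apply: lee_sum => k _; have := lam_translate (F k) (- v (enum_val k)).
 apply: le_trans; apply: le_lam => x Wx; exists (x + v (enum_val k)); first by exists x.
 by rewrite addrK.
rewrite -(measure_bigsetU_ord lamB xpredT mF tF); apply: lam_diam; first by rewrite mge0.
have H x : (\big[setU/set0]_(i < #|I|) F i) x -> `|x| <= r.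
 by rewrite -bigcup_seq => -[k _ [z Wz <-]]; exact: hr.
move=> x y /H hx /H hy; apply: le_trans (ler_normB _ _) _; lra.
Qed.

Lemma norm_natB_ge1 (a b : nat) : a != b -> 1 <= `|a%:R - b%:R : R|.
Proof.
by case: ltngtP => // ab _; [rewrite distrC|]; rewrite -natrB ?(ltnW ab)// normr_nat ler1n subn_gt0.
Qed.

(* For k functions with independent gradients at y, the dual vectors e give
 about t^-k disjoint translates of the set where all of them are at most t. *)
Lemma thin_set {k : nat} (psi : 'I_k -> V -> R) (g e : 'I_k -> V) (y : V) :
 (forall i, strict_at (psi i) y (g i)) -> (forall i j, dot (g i) (e j) = (i == j)%:R) ->
 exists r C : R, [/\ 0 < r, 0 <= C & forall t : R, 0 < t -> t <= 1 ->
 (lam [set x : V | (`|x - y| <= r)%R /\ forall i, (`|psi i x| <= t)%R] <= (C * t ^+ k)%:E)%E].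
Proof.
move=> sp ge.
pose E := \sum_j `|e j|; have E0 : 0 <= E by apply: sumr_ge0.
pose eta := (2 * (E + 1))^-1; have eta0 : 0 < eta by rewrite invr_gt0; lra.
have etaE : eta * E <= 1 / 2.
 rewrite /eta mulrC ler_pdivrMr; last lra.
 by rewrite mul1r mulrA mulVf// mul1r; lra.
have P i : exists r : R, 0 < r /\ forall x z, ball y r x -> ball y r z ->
 `|psi i x - psi i z - dot (g i) (x - z)| <= eta * `|x - z|.
 by have [r r0 hr] := sp i _ eta0; exists r.
have [q hq] := choice P.
have [r r0 hr] : exists2 r : R, 0 < r & forall i, r < q i.
 exists (\big[Num.min/1]_i q i / 2).
 by rewrite divr_gt0//; apply: lt_bigmin => // i _; have [] := hq i.
 move=> i; have [q0 _] := hq i.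
 have : \big[Num.min/1]_i q i <= q i by exact: bigmin_le_cond.
 lra.
have bl x i : `|x - y| <= r -> ball y (q i) x.
 by move=> xy; apply/ball_normP; rewrite /= distrC; apply: le_lt_trans xy _; exact: hr.
pose r1 := `|y| + r + 10 * E.
have r10 : 0 <= r1 by rewrite /r1; have := normr_ge0 y; lra.
exists r, ((2 * (2 * r1)) ^+ n.+1); split=> //; first by rewrite exprn_ge0// !mge0.
move=> t t0 t1; set W := [set x | _].
have mW : measurable (W : set (rVB R n)).
 apply: rVB_closed; rewrite -openC openE => x nWx; apply/nbhs_ballP.
 have [rx|xr] := ltP r `|x - y|.
 exists (`|x - y| - r) => /=; first by rewrite subr_gt0.
 move=> z /ball_normP xz [zy _].
 have := ler_distD z x y; have : `|x - z| < `|x - y| - r by []. lra.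
 have [i hi] : exists i, t < `|psi i x|.
 apply: contrapT => /forallNP h; apply: nWx; split=> // i.
 by rewrite leNgt; apply/negP; exact: h.
 have [_ qi] := hq i.
 pose L := eta + n.+1%:R * `|g i| + 1.
 have L0 : 0 < L by rewrite /L ltr_wpDl// addr_ge0// ?(ltW eta0)// mge0.
 exists (Num.min (q i - r) ((`|psi i x| - t) / L)) => /=.
 by rewrite lt_min subr_gt0 hr divr_gt0// subr_gt0.
 move=> z /ball_normP/=; rewrite lt_min => /andP[xz1 xz2] [zy hz].
 have /(_ (bl _ _ xr) (bl _ _ zy)) h1 := qi x z.
 have h2 := dot_le_norm (g i) (x - z).
 have h3 : `|psi i x - psi i z| <= L * `|x - z|.
 rewrite -(subrK (dot (g i) (x - z)) (psi i x - psi i z)).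
 apply: le_trans (ler_normD _ _) _; rewrite /L !mulrDl; have := normr_ge0 (x - z); lra.
 have h4 : L * `|x - z| < `|psi i x| - t by rewrite mulrC -ltr_pdivlMr.
 have := hz i; have := ler_normD (psi i x - psi i z) (psi i z); rewrite subrK; lra.
have [N hN] : exists N : nat, t^-1 <= N.+1%:R <= t^-1 + 1.
 exists (Num.truncn t^-1); have /truncn_itv/andP[h1 h2] : 0 <= t^-1 by rewrite invr_ge0 ltW.
 by rewrite (ltW h2)/= -natr1 lerD2r.
move: hN => /andP[N1 N2].
have tN : t * N.+1%:R <= 2.
 apply: (le_via (t * (t^-1 + 1))); first by rewrite ler_pM2l.
 by rewrite mulrDr mulfV ?gt_eqF// mulr1; lra.
pose v (f : {ffun 'I_k -> 'I_N.+1}) : V := \sum_j (5 * t * (f j)%:R) *: e j.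
have vE f : `|v f| <= 10 * E.
 apply: le_trans (ler_norm_sum _ _ _) _.
 rewrite /E mulr_sumr; apply: ler_sum => j _; rewrite normrZ ler_wpM2r//.
 rewrite ger0_norm; last by rewrite !mge0// ltW.
 apply: (le_via (5 * t * N.+1%:R)); last by lra.
 by rewrite ler_pM2l ?mulr_gt0// ler_nat ltnW.
have := @disjoint_translates W {ffun 'I_k -> 'I_N.+1} v r1 r10 mW.
rewrite card_ffun !card_ord => /(_ _ _)/wrap[||h].
- move=> x f [xy _]; rewrite /r1; apply: le_trans (ler_normD _ _) _; rewrite lerD//.
 by have := ler_normD (x - y) y; rewrite subrK; lra.
- move=> f f' x z [xy hx] [zy hz] exz; apply: contrapT => /eqP ff.
 have [i0 fi0] : exists i0, f i0 != f' i0.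
 apply: contrapT => /forallNP h; move/negP: ff; apply; apply/eqP/ffunP => i.
 by apply/eqP; apply: contrapT => /negP; exact: h.
 pose a (j : 'I_k) : R := (f' j)%:R - (f j)%:R.
 have [i _ imax] := @arg_maxP _ _ _ i0 xpredT (fun j => `|a j|) isT.
 have ai1 : 1 <= `|a i|.
 apply: le_trans (imax i0 isT); rewrite /a; apply: norm_natB_ge1.
 by rewrite eq_sym; apply: contra fi0 => /eqP/val_inj ->.
 have xz : x - z = \sum_j (5 * t * a j) *: e j.
 have -> : x - z = v f' - v f.
 by apply/eqP; rewrite subr_eq addrAC [v f' + z]addrC -exz addrK.
 rewrite /v -sumrB; apply: eq_bigr => j _; by rewrite -scalerBl -mulrBr.
 have nxz : `|x - z| <= 5 * t * `|a i| * E.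
 rewrite xz; apply: le_trans (ler_norm_sum _ _ _) _; rewrite /E mulr_sumr.
 apply: ler_sum => j _; rewrite normrZ ler_wpM2r// normrM (ger0_norm (_ : 0 <= 5 * t)); last lra.
 by rewrite ler_pM2l; [exact: imax|lra].
 have gxz : dot (g i) (x - z) = 5 * t * a i.
 rewrite xz dotC (bigD1 i)//= dotDl dotZl dotC ge eqxx mulr1.
 rewrite [X in _ + X](_ : _ = 0) ?addr0//.
 elim/big_rec : _ => [|j s ji IH]; first by rewrite dot0l.
 by rewrite dotDl IH dotZl dotC ge eq_sym (negbTE ji) mulr0 add0r.
 have [_ qi] := hq i; have := qi x z (bl _ _ xy) (bl _ _ zy).
 have b1 : eta * `|x - z| <= 5 * t * `|a i| * (1 / 2).
 apply: (le_via (eta * (5 * t * `|a i| * E))); first by rewrite ler_pM2l.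
 rewrite mulrCA; apply: ler_wpM2l => //; by rewrite !mge0// ltW.
 have h1 := hx i; have h2 := hz i.
 have : `|5 * t * a i| = 5 * t * `|a i| by rewrite normrM ger0_norm//; lra.
 rewrite gxz => n5 h3.
 have : `|5 * t * a i| <= `|psi i x - psi i z - 5 * t * a i| + (`|psi i x| + `|psi i z|).
 rewrite -[X in `|X| <= _](_ : - (psi i x - psi i z - 5 * t * a i) + (psi i x - psi i z) = _); last ring.
 by apply: le_trans (ler_normD _ _) _; rewrite normrN lerD2l ler_normB.
 rewrite n5 => h4.
 have : t <= t * `|a i| by rewrite ler_peMr// ltW.
 lra.
have tk : 0 < t ^+ k by rewrite exprn_gt0.
have Nk : 1 <= t ^+ k * (N.+1 ^ k)%:R.
 rewrite natrX -exprMn exprn_ege1//.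
 by apply: (le_via (t * t^-1)); [rewrite mulfV// gt_eqF|rewrite ler_pM2l].
have l0 := lam_ge0 W.
apply: (le_via ((t ^+ k * (N.+1 ^ k)%:R)%:E * lam W)%E).
 by rewrite -[leLHS]mul1e lee_wpmul2r// lee_fin.
rewrite EFinM -muleA mulrC EFinM; apply: lee_wpmul2l => //; by rewrite lee_fin ltW.
Qed.

End thin_sets.

Section sweeping.
Context {R : realType} {n : nat}.
Local Notation V := 'rV[R]_n.+1.
Local Notation lam := (@lebesgue_outer R n).
Variables (F : V -> V) (Phi : R -> V -> V).
Hypothesis fl : is_flow F Phi.

Definition sweep (S : R) (A : set V) : set V := [set x | exists2 t, 0 <= t <= S & A (Phi t x)].

Lemma flow_invl t x : Phi (- t) (Phi t x) = x.
Proof. by rewrite -(flow_add fl) addNr (flow_init fl). Qed.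

Lemma le_sweep S (A B : set V) : A `<=` B -> sweep S A `<=` sweep S B.
Proof. by move=> AB x [t tS /AB Bt]; exists t. Qed.

Lemma sweep_steps (S : R) : 0 <= S -> exists2 C : R, 0 < C &
 forall (dl : R) (A : set V), 0 < dl -> dl <= 1 ->
 (lam (sweep S A) <= (C / dl)%:E * lam (sweep dl A))%E.
Proof.
move=> S0; have [K K0 hK] := flow_lipschitz fl S.
pose C0 := (2 * K) ^+ n.+1; have C00 : 0 < C0 by rewrite exprn_gt0// mulr_gt0.
exists ((S + 1) * C0); first by rewrite mulr_gt0//; lra.
move=> dl A d0 d1.
have Sd0 : 0 <= S / dl by rewrite divr_ge0// ltW.
have /truncn_itv/andP[N1 N2] := Sd0; set N := Num.truncn (S / dl) in N1 N2.
have sub : sweep S A `<=` \bigcup_(m in [set: 'I_N.+1]) (Phi (- (m%:R * dl)) @` sweep dl A).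
 move=> x [t /andP[t0 tS] At].
 have td0 : 0 <= t / dl by rewrite divr_ge0// ltW.
 have /truncn_itv/andP[m1 m2] := td0; set m := Num.truncn (t / dl) in m1 m2.
 have mN : (m < N.+1)%N.
 rewrite ltnS truncn_ge_nat// (le_trans m1)// ler_pM2r ?invr_gt0//.
 exists (Ordinal mN) => //=; exists (Phi (m%:R * dl) x); last exact: flow_invl.
 exists (t - m%:R * dl); last by rewrite -(flow_add fl) subrK.
 move: m1 m2; rewrite ler_pdivlMr// ltr_pdivrMr// -natr1 mulrDl mul1r => m1 m2.
 by apply/andP; split; lra.
apply: le_trans (le_lam sub) _; apply: le_trans (lam_finite_bigcup _) _.
apply: (le_via (\sum_(m < N.+1) C0%:E * lam (sweep dl A))%E).
 apply: lee_sum => m _; apply: lam_lipschitz => // x y _ _; apply: hK.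
 rewrite normrN ger0_norm; last by rewrite mge0// ltW.
 rewrite -ler_pdivlMr//; apply: le_trans N1; by rewrite ler_nat -ltnS.
have -> m : (\sum_(k < m) C0%:E * lam (sweep dl A) = (m%:R * C0)%:E * lam (sweep dl A))%E.
 elim: m => [|m IH]; first by rewrite !mul0r mul0e big_ord0.
 rewrite big_ord_recr/= IH -natr1 mulrDl mul1r EFinD ge0_muleDl ?lee_fin ?mge0// ltW//.
apply: lee_wpmul2r; first exact: lam_ge0.
rewrite lee_fin mulrAC ler_pM2r// -natr1.
rewrite ler_pdivlMr// mulrDl mul1r.
have : N%:R * dl <= S by rewrite -ler_pdivlMr.
lra.
Qed.

Lemma sweep_null (S C d0 : R) (A : set V) : 0 <= S -> 0 <= C -> 0 < d0 ->
 (forall dl, 0 < dl -> dl < d0 -> (lam (sweep dl A) <= (C * dl ^+ 2)%:E)%E) ->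
 lam (sweep S A) = 0%E.
Proof.
move=> S0 C0 d00 h; have [C1 C10 h1] := sweep_steps S0.
apply/eqP; rewrite eq_le lam_ge0 andbT; apply/lee_addgt0Pr => e e0; rewrite add0e.
pose D := C1 * C + 1; have D0 : 0 < D by rewrite /D ltr_wpDl// mge0// ltW.
pose dl := Num.min (Num.min 1 (d0 / 2)) (e / D).
have dl0 : 0 < dl by rewrite !lt_min ltr01 !divr_gt0.
have dl1 : dl <= 1 by rewrite !ge_min lexx.
have dld : dl < d0 by rewrite (@le_lt_trans _ _ (d0 / 2))//; [rewrite !ge_min lexx !orbT|lra].
have dle : dl <= e / D by rewrite ge_min lexx orbT.
apply: le_trans (h1 _ A dl0 dl1) _.
apply: (le_via ((C1 / dl)%:E * (C * dl ^+ 2)%:E)%E).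
 by apply: lee_wpmul2l; [rewrite lee_fin divr_ge0// ltW|exact: h].
rewrite -EFinM lee_fin.
have -> : C1 / dl * (C * dl ^+ 2) = C1 * C * dl by field; rewrite gt_eqF.
apply: (le_via (D * dl)); first by rewrite ler_pM2r// /D; lra.
by rewrite mulrC -ler_pdivlMr.
Qed.

Lemma sweep_null_local (S : R) (A : set V) :
 (forall y, A y -> exists2 U, open_nbhs y U & lam (sweep S (A `&` U)) = 0%E) ->
 lam (sweep S A) = 0%E.
Proof.
move=> h; pose B (q : 'rV[rat]_n.+1 * 'rV[rat]_n.+1) : set V :=
 obox (map_mx ratr q.1) (map_mx ratr q.2).
pose G q : set V := if `[< lam (sweep S (A `&` B q)) = 0%E >] then sweep S (A `&` B q) else set0.
apply/eqP; rewrite eq_le lam_ge0 andbT.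
apply: (le_via (lam (\bigcup_q G q))); last first.
 rewrite lam_bigcup_null// => q; rewrite /G; case: asboolP => // _; exact: lam0.
apply: le_lam => x [t tS At]; have [U Ut U0] := h _ At.
have [q [qt qU]] := rational_obox Ut; exists q => //; rewrite /G asboolT; first by exists t.
apply/eqP; rewrite eq_le lam_ge0 andbT -U0; apply: le_lam; apply: le_sweep.
by apply: setIS.
Qed.

Lemma sweepU (S : R) (A B : set V) : sweep S (A `|` B) = sweep S A `|` sweep S B.
Proof.
apply/seteqP; split=> [x [t tS [At|Bt]]|x [|] [t tS At]].
- by left; exists t.
- by right; exists t.
- by exists t => //; left.
- by exists t => //; right.
Qed.

Lemma sweep_bigcup (S : R) {I : Type} (A : I -> set V) :
 sweep S (\bigcup_i A i) = \bigcup_i sweep S (A i).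
Proof.
apply/seteqP; split=> [x [t tS [i _ At]]|x [i _ [t tS At]]].
 by exists i => //; exists t.
by exists t => //; exists i.
Qed.

Lemma sweep_hausdorff (S : R) (A : set V) : 0 <= S -> hausdorff n A = 0%E ->
 lam (sweep S A) = 0%E.
Proof.
move=> S0 A0; have [C1 C10 h1] := sweep_steps S0.
have [B B0 hB] := flow_speed fl.
pose w : R := unit_ball_volume n; have w0 : 0 < w := unit_ball_volume_gt0 R n.
pose C2 := C1 * (2 * (2 * B + 1)) ^+ n.+1.
have C20 : 0 < C2 by rewrite mulr_gt0// exprn_gt0//; lra.
pose C3 := C2 * (2 ^+ n / w + 1).
have C30 : 0 < C3 by rewrite mulr_gt0// ltr_wpDl// divr_ge0// ltW.
have c0 : cover_outer (hausdorff_gauge n (1 / 2)) A = 0%E.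
 apply/eqP; rewrite eq_le -{1}A0; apply/andP; split.
 by apply: ereal_sup_ubound; exists (1 / 2) => //=; lra.
 by apply: cover_outer_ge0; exact: hausdorff_gauge_ge0.
apply/eqP; rewrite eq_le lam_ge0 andbT; apply/lee_addgt0Pr => e' e'0; rewrite add0e.
pose e := e' / (2 * C3); have e0 : 0 < e by rewrite divr_gt0// mulr_gt0.
have cfin : cover_outer (hausdorff_gauge n (1 / 2)) A \is a fin_num by rewrite c0.
have [_ [U AU <-] lt] := lb_ereal_inf_adherent e0 cfin.
rewrite -[ereal_inf _]/(cover_outer (hausdorff_gauge n (1 / 2)) A) c0 add0e in lt.
have gfin k : (hausdorff_gauge n (1 / 2) (U k) < +oo)%E.
 apply: le_lt_trans (lt_trans lt (ltry _)).
 rewrite (@nneseriesD1 _ (fun k => hausdorff_gauge n (1 / 2) (U k)) k xpredT)//; last by move=> *; exact: hausdorff_gauge_ge0.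
 by rewrite leeDl// nneseries_ge0// => *; exact: hausdorff_gauge_ge0.
have step k : (lam (sweep S (U k)) <=
 C3%:E * (hausdorff_gauge n (1 / 2) (U k) + (e / (2 ^ k.+1)%:R)%:E))%E.
 have ek0 : 0 < e / (2 ^ k.+1)%:R by rewrite divr_gt0// ltr0n expn_gt0.
 move: (gfin k); rewrite /hausdorff_gauge; case: asboolP => [->|/eqP/set0P U0].
 move=> _; rewrite (_ : sweep S set0 = set0); last by apply/seteqP; split=> // x [].
 by rewrite lam0 mule_ge0// lee_fin ?add0r ltW.
 case: ifPn => // dU _.
 pose rho := fine (ediam (U k)).
 have dU' := ediam_norm dU.
 have rho0 : 0 <= rho by rewrite fine_ge0// ediam_ge0.
 have rho1 : rho <= 1 / 2.
 have : ediam (U k) \is a fin_num by rewrite ge0_fin_numE ?ediam_ge0// (le_lt_trans dU)// ltry.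
 by move=> f; rewrite -lee_fin fineK.
 have [rho' [r1 r2 r3]] : exists rho', [/\ rho < rho', rho' <= 1 & rho' ^+ n <= rho ^+ n + e / (2 ^ k.+1)%:R].
 have cX : {for rho, continuous (fun x : R => x ^+ n)} by exact: exprn_continuous.
 move/cvgrPdist_lt : cX => /(_ _ ek0)/nbhs_ballP[q /= q0 hq].
 exists (rho + Num.min (1 / 2) (q / 2)).
 have m0 : 0 < Num.min (1 / 2) (q / 2) by rewrite lt_min !divr_gt0.
 have m1 : Num.min (1 / 2) (q / 2) <= 1 / 2 by rewrite ge_min lexx.
 have m2 : Num.min (1 / 2) (q / 2) <= q / 2 by rewrite ge_min lexx orbT.
 split; [lra|lra|].
 have : ball rho q (rho + Num.min (1 / 2) (q / 2)).
 rewrite /ball/= opprD addNKr normrN gtr0_norm//; lra.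
 by move=> /hq; rewrite distrC => h; have := le_lt_trans (ler_norm _) h; lra.
 have rp0 : 0 < rho' by lra.
 apply: le_trans (h1 _ (U k) rp0 r2) _.
 apply: (le_via ((C1 / rho')%:E * ((2 * ((2 * B + 1) * rho')) ^+ n.+1)%:E)%E).
 apply: lee_wpmul2l; first by rewrite lee_fin divr_ge0// ltW.
 apply: lam_diam; first by rewrite mge0//; lra.
 move=> x y [s /andP[s0 sr] Us] [t /andP[t0 tr] Ut].
 have hx : `|x - Phi s x| <= B * rho'.
 have := hB 0 s x; rewrite (flow_init fl) sub0r normrN (ger0_norm s0) => h.
 by apply: le_trans h _; rewrite ler_wpM2l.
 have hy : `|Phi t y - y| <= B * rho'.
 have := hB t 0 y; rewrite (flow_init fl) subr0 (ger0_norm t0) => h.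
 by apply: le_trans h _; rewrite ler_wpM2l.
 have hu := dU' _ _ Us Ut; rewrite -/rho in hu.
 have -> : x - y = (x - Phi s x) + (Phi s x - Phi t y) + (Phi t y - y) by rvring.
 apply: le_trans (ler_normD _ _) _; apply: le_trans (lerD (ler_normD _ _) (lexx _)) _.
 rewrite mulrDl mul1r; lra.
 rewrite -EFinM -EFinD -EFinM lee_fin.
 have -> : C1 / rho' * (2 * ((2 * B + 1) * rho')) ^+ n.+1 = C2 * rho' ^+ n.
 rewrite /C2 [2 * (_ * _)]mulrA exprMn (exprS rho' n); field; rewrite gt_eqF//.
 rewrite -/rho -/w (_ : C3 * _ = C2 * ((2 ^+ n / w + 1) * (w * (rho / 2) ^+ n + e / (2 ^ k.+1)%:R))); last by rewrite /C3 -mulrA.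
 apply: ler_wpM2l; first exact: ltW.
 apply: le_trans r3 _; rewrite mulrDl mul1r mulrDr.
 have -> : 2 ^+ n / w * (w * (rho / 2) ^+ n) = rho ^+ n.
 by rewrite mulrA divfK ?gt_eqF// -exprMn mulrCA mulfV// mulr1.
 have : 0 <= 2 ^+ n / w * (e / (2 ^ k.+1)%:R).
 by apply: mge0; [apply: divr_ge0; [exact: exprn_ge0|exact: ltW]|exact: ltW].
 have : 0 <= w * (rho / 2) ^+ n.
 by apply: mge0; [exact: ltW|apply: exprn_ge0; exact: divr_ge0].
 lra.
apply: (le_via (lam (\bigcup_k sweep S (U k)))).
 by apply: le_lam; rewrite -sweep_bigcup; exact: le_sweep.
apply: le_trans (lam_sub _) _.
apply: (le_via (\sum_(k <oo) (C3%:E * (hausdorff_gauge n (1 / 2) (U k) + (e / (2 ^ k.+1)%:R)%:E)))%E).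
 by apply: lee_nneseries => [*|k _]; [exact: lam_ge0|exact: step].
rewrite nneseriesZl; last first.
 by move=> k _; rewrite adde_ge0 ?hausdorff_gauge_ge0// lee_fin divr_ge0// ltW.
apply: (le_via (C3%:E * (e + e)%:E)%E).
 apply: lee_wpmul2l; first by rewrite lee_fin ltW.
 apply: le_trans (epsilon_trick _ _ _) _; [move=> *; exact: hausdorff_gauge_ge0|exact: ltW|].
 by rewrite EFinD leeD2r// ltW.
rewrite -EFinM lee_fin /e.
have key (c a : R) : 0 < c -> c * (a / (2 * c) + a / (2 * c)) = a.
 by move=> cp; field; rewrite gt_eqF.
by rewrite key.
Qed.

End sweeping.

Section interface_geometry.
Context {R : realType} {n : nat}.
Local Notation V := 'rV[R]_n.+1.
Local Notation lam := (@lebesgue_outer R n).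

Lemma is_derive_linear (c t : R) : is_derive t 1 (fun s : R => c * s) c.
Proof.
apply/is_derive_eps => e e0; exists 1 => // h _.
rewrite (_ : _ - _ = 0); last by ring.
by rewrite normr0 mge0// ltW.
Qed.

Lemma strict_segment (f : V -> R) (x g : V) (v w : V) (e : R) : strict_at f x g -> 0 < e ->
 exists2 r : R, 0 < r & forall s t : R, `|s| < r -> `|t| < r ->
 `|f (x + s *: v + t *: w) - f x - (s * dot g v + t * dot g w)| <= e * (`|s| + `|t|).
Proof.
move=> sf e0; pose D := `|v| + `|w| + 1; have D0 : 0 < D by rewrite ltr_wpDl// addr_ge0.
have [r r0 hr] := sf (e / D) (divr_gt0 e0 D0).
exists (r / (2 * D)); first by rewrite divr_gt0// mulr_gt0.
move=> s t sr tr.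
have le1 : `|s *: v + t *: w| <= (`|s| + `|t|) * D.
 apply: le_trans (ler_normD _ _) _; rewrite !normrZ mulrDl; apply: lerD; apply: ler_wpM2l => //.
 by rewrite /D -addrA lerDl addr_ge0.
 by rewrite /D addrAC addrC lerDl addr_ge0.
have le2 : `|s *: v + t *: w| < r.
 apply: le_lt_trans le1 _.
 have : `|s| + `|t| < r / D.
 have -> : r / D = r / (2 * D) + r / (2 * D) by field; rewrite gt_eqF.
 exact: ltrD.
 by rewrite ltr_pdivlMr.
have := hr (x + s *: v + t *: w) x.
rewrite (_ : x + s *: v + t *: w - x = s *: v + t *: w); last by rvring.
rewrite dotDr !dotZr => /(_ _ _)/wrap[||h].
- apply/ball_normP => /=; rewrite (_ : x - _ = - (s *: v + t *: w)); last by rvring.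
 by rewrite normrN.
- exact: ballxx.
apply: le_trans h _; apply: (le_via (e / D * ((`|s| + `|t|) * D))).
 by apply: ler_wpM2l => //; rewrite divr_ge0// ltW.
by rewrite mulrCA mulfVK ?gt_eqF// mulrC.
Qed.

Lemma strict_continuous_line (f : V -> R) (x g v w : V) : strict_at f x g ->
 exists2 r : R, 0 < r & forall s t : R, `|s| < r -> `|t| < r ->
 {for t, continuous (fun t : R => f (x + s *: v + t *: w))}.
Proof.
move=> /strict_at_bound[r [K [r0 K0 h]]].
pose D := `|v| + `|w| + 1; have D0 : 0 < D by rewrite ltr_wpDl// addr_ge0.
exists (r / (2 * D)); first by rewrite divr_gt0// mulr_gt0.
have inb s t : `|s| < r / (2 * D) -> `|t| < r / (2 * D) -> ball x r (x + s *: v + t *: w).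
 move=> sr tr; apply/ball_normP => /=; rewrite (_ : x - _ = - (s *: v + t *: w)); last by rvring.
 rewrite normrN; apply: le_lt_trans (ler_normD _ _) _; rewrite !normrZ.
 have : (`|s| + `|t|) * D < r.
 rewrite -ltr_pdivlMr//.
 have -> : r / D = r / (2 * D) + r / (2 * D) by field; rewrite gt_eqF.
 exact: ltrD.
 apply: le_lt_trans; rewrite mulrDl; apply: lerD; apply: ler_wpM2l => //.
 by rewrite /D -addrA lerDl addr_ge0.
 by rewrite /D addrAC addrC lerDl addr_ge0.
move=> s t sr tr; apply/cvgrPdist_le => e e0; apply/nbhs_ballP.
exists (Num.min (r / (2 * D) - `|t|) (e / (K * D))) => /=.
 by rewrite lt_min subr_gt0 tr divr_gt0// mulr_gt0.
move=> t'; rewrite /ball/= lt_min => /andP[tt1 /ltW tt].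
have t'r : `|t'| < r / (2 * D).
 by have := ler_distD t 0 t'; rewrite !sub0r !normrN; lra.
apply: le_trans (h _ _ (inb _ _ sr tr) (inb _ _ sr t'r)) _.
rewrite (_ : _ - _ = (t - t') *: w); last by rvring.
rewrite normrZ.
apply: (le_via (K * (`|t - t'| * D))).
 by rewrite ler_pM2l// ler_wpM2l// /D addrAC addrC lerDl addr_ge0.
by move: tt; rewrite ler_pdivlMr ?mulr_gt0//; lra.
Qed.

Lemma parallel_gradients (psi chi : V -> R) (y g h : V) (U : set V) :
 strict_at psi y g -> strict_at chi y h -> g != 0 -> open_nbhs y U -> psi y = 0 ->
 (forall z, U z -> psi z = 0 -> chi z = 0) -> exists c : R, h = c *: g.
Proof.
move=> sp sc g0 yU py pc.
have gg : 0 < dot g g by rewrite dot_gt0.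
pose c := dot h g / dot g g; exists c; apply/eqP; rewrite -subr_eq0; apply: contrapT => /negP k0.
set k := h - c *: g in k0.
have kk : 0 < dot k k by rewrite dot_gt0.
have gk : dot g k = 0.
 by rewrite /k dotBr dotZr /c divfK ?gt_eqF// dotC subrr.
have hk : dot h k = dot k k.
 by rewrite -[h](subrK (c *: g)) -/k dotDl dotZl gk mulr0 addr0.
pose al := dot k k / (4 * (`|dot h g| + 1)).
have hg1 : 0 < `|dot h g| + 1 by rewrite ltr_wpDl.
have al0 : 0 < al by rewrite divr_gt0// mulr_gt0.
have alh : al * `|dot h g| <= dot k k / 4.
 have -> : dot k k / 4 = al * (`|dot h g| + 1) by rewrite /al; field; rewrite gt_eqF.
 by rewrite ler_pM2l// lerDl.
pose m := Num.min (dot k k / 4) (al * dot g g).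
have m0 : 0 < m by rewrite lt_min !mulr_gt0// invr_gt0.
pose e := m / (2 * (1 + al)).
have e0 : 0 < e by rewrite divr_gt0// mulr_gt0//; lra.
have em : e * (1 + al) = m / 2 by rewrite /e; field; rewrite gt_eqF//; lra.
have [r1 r10 h1] := strict_segment k g sp e0.
have [r2 r20 h2] := strict_segment k g sc e0.
have [r3 r30 h3] := strict_continuous_line k g sp.
have /nbhs_ballP[q /= q0 hq] : nbhs y U by exact: open_nbhs_nbhs.
have D0 : 0 < `|k| + al * `|g| + 1 by rewrite ltr_wpDl// addr_ge0// mge0// ltW.
pose s := Num.min (Num.min (Num.min r1 r2) r3 / (2 * (1 + al))) (q / (`|k| + al * `|g| + 1)).
have s0 : 0 < s.
 rewrite !lt_min divr_gt0 ?divr_gt0//; first by rewrite !lt_min r10 r20 r30.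
 by rewrite mulr_gt0//; lra.
have sle : s * (2 * (1 + al)) <= Num.min (Num.min r1 r2) r3.
 rewrite -ler_pdivlMr; last by rewrite mulr_gt0//; lra.
 by rewrite ge_min lexx.
have sq : s * (`|k| + al * `|g| + 1) <= q by rewrite -ler_pdivlMr// ge_min lexx orbT.
have [sr1 sr2 sr3] : [/\ s * (1 + al) < r1, s * (1 + al) < r2 & s * (1 + al) < r3].
 have : s * (1 + al) < s * (2 * (1 + al)) by rewrite ltr_pM2l//; lra.
 move=> lt; have lt' := lt_le_trans lt sle; move: lt'; rewrite !lt_min => /andP[/andP[-> ->] ->]//.
have sal : 0 < s * al by rewrite mulr_gt0.
have ns (r : R) : s * (1 + al) < r -> `|s| < r by rewrite gtr0_norm// mulrDr mulr1; lra.
have nt (r t : R) : s * (1 + al) < r -> `|t| <= s * al -> `|t| < r.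
 by move=> lt le; apply: le_lt_trans le (lt_trans _ lt); rewrite mulrDr mulr1; lra.
have chipos t : `|t| <= s * al -> 0 < chi (y + s *: k + t *: g).
 move=> ht; have := h2 s t (ns _ sr2) (nt _ _ sr2 ht).
 rewrite (pc y yU.2 py).
 rewrite subr0 hk ler_norml => /andP[+ _].
 have : e * (`|s| + `|t|) <= s * (m / 2).
 rewrite -em mulrCA (gtr0_norm s0); apply: ler_wpM2l; first exact: ltW.
 by rewrite mulrDr mulr1 lerD2l.
 have : m <= dot k k / 4 by rewrite ge_min lexx.
 have : - (s * (dot k k / 4)) <= t * dot h g.
 rewrite lerNl -mulNr; apply: le_trans (ler_norm _) _.
 rewrite normrM normrN; apply: (le_via (s * al * `|dot h g|)); first exact: ler_wpM2r.
 by rewrite -mulrA ler_pM2l.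
 move=> a1 a2 a3 a4.
 have : s * (m / 2) <= s * (dot k k / 8) by rewrite ler_pM2l//; lra.
 have : 0 < s * dot k k by rewrite mulr_gt0.
 lra.
have psie t : `|t| = s * al -> `|psi (y + s *: k + t *: g) - t * dot g g| < s * al * dot g g.
 move=> ht; have := h1 s t (ns _ sr1) (nt _ _ sr1 _); rewrite ht lexx => /(_ isT).
 rewrite py subr0 gk mulr0 add0r => le; apply: le_lt_trans le _.
 rewrite (gtr0_norm s0) (_ : s + s * al = s * (1 + al)); last ring.
 rewrite mulrCA em -mulrA ltr_pM2l//.
 have : m <= al * dot g g by rewrite ge_min lexx orbT.
 lra.
have pp : 0 < psi (y + s *: k + (s * al) *: g).
 have := psie (s * al); rewrite gtr0_norm// => /(_ erefl).
 by rewrite ltr_norml => /andP[+ _]; lra.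
have pn : psi (y + s *: k + (- (s * al)) *: g) < 0.
 have := psie (- (s * al)); rewrite normrN gtr0_norm// => /(_ erefl).
 by rewrite ltr_norml => /andP[_ +]; lra.
have [|||t] := @IVT R (fun t => psi (y + s *: k + t *: g)) (- (s * al)) (s * al) 0.
- by lra.
- apply: continuous_in_subspaceT => t; rewrite inE/= in_itv/= => tin.
 by apply: h3; [exact: ns|apply: nt => //; rewrite ler_norml].
- by rewrite ge_min le_max (ltW pn) (ltW pp) orbT.
rewrite in_itv/= => tin pt0.
have ht : `|t| <= s * al by rewrite ler_norml.
have := chipos _ ht; rewrite pc ?ltxx//; apply: hq; apply/ball_normP => /=.
rewrite (_ : y - _ = - (s *: k + t *: g)); last by rvring.
rewrite normrN; apply: le_lt_trans (ler_normD _ _) _; rewrite !normrZ (gtr0_norm s0).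
have : `|t| * `|g| <= s * al * `|g| by exact: ler_wpM2r.
move: sq; rewrite !mulrDr mulr1; lra.
Qed.

Lemma strict_zero_ray (psi : V -> R) (y g v : V) : strict_at psi y g -> psi y = 0 ->
 (\forall s \near 0^'+, psi (y + s *: v) = 0) -> dot g v = 0.
Proof.
move=> sp py near0; apply/eqP; apply: contrapT => /negP gv.
have e0 : 0 < `|dot g v| / 2 by rewrite divr_gt0// normr_gt0.
have [r r0 hr] := strict_segment v 0 sp e0.
have : \forall s \near (0:R)^'+, False.
 near=> s.
 have s0 : 0 < s by near: s; exact: nbhs_right_gt.
 have sr : `|s| < r by rewrite gtr0_norm//; near: s; exact: nbhs_right_lt.
 have p0 : psi (y + s *: v) = 0 by near: s.
 have := hr s 0 sr; rewrite normr0 r0 scale0r addr0 p0 py subrr mul0r !addr0 sub0r normrN => /(_ isT).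
 rewrite normrM -mulrC [leRHS]mulrC (gtr0_norm s0) mulrC ler_pM2l//.
 have : 0 < `|dot g v| by rewrite normr_gt0.
 lra.
by move=> h; have [] := @filter_ex _ _ _ _ h.
Unshelve. all: by end_near. Qed.

Lemma dual_vectors (g h : V) : g != 0 -> (forall c : R, h != c *: g) ->
 exists e1 e2 : V, [/\ dot g e1 = 1, dot g e2 = 0, dot h e1 = 0 & dot h e2 = 1].
Proof.
move=> g0 hg; have gg : 0 < dot g g by rewrite dot_gt0.
pose c := dot h g / dot g g; pose k := h - c *: g.
have kk : 0 < dot k k by rewrite dot_gt0// subr_eq0 hg.
have gk : dot g k = 0 by rewrite /k dotBr dotZr /c divfK ?gt_eqF// dotC subrr.
have hk : dot h k = dot k k by rewrite -[h](subrK (c *: g)) -/k dotDl dotZl gk mulr0 addr0.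
pose e2 := (dot k k)^-1 *: k; pose e1 := (dot g g)^-1 *: g - c *: e2.
have ge2 : dot g e2 = 0 by rewrite dotZr gk mulr0.
have he2 : dot h e2 = 1 by rewrite dotZr hk mulVf// gt_eqF.
exists e1, e2; split=> //.
 by rewrite /e1 dotBr dotZr [dot g (c *: _)]dotZr ge2 mulr0 subr0 mulVf// gt_eqF.
by rewrite /e1 dotBr dotZr [dot h (c *: _)]dotZr he2 mulr1 /c mulrC subrr.
Qed.

Section sweep_interfaces.
Variables (F : V -> V) (L : R) (Phi : R -> V -> V).
Hypothesis FL : forall x y, `|F x - F y| <= L * `|x - y|.
Hypothesis L0 : 0 <= L.
Hypothesis fl : is_flow F Phi.

(* Where two independent C^1 functions vanish, points that reach the set within
 time dl lie in a set of measure O(dl^2). *)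
Lemma sweep_codim2 (S : R) (A : set V) (psi chi : V -> R) (y g h : V) : 0 <= S ->
 strict_at psi y g -> strict_at chi y h -> g != 0 -> (forall c : R, h != c *: g) ->
 (forall z, A z -> psi z = 0 /\ chi z = 0) ->
 exists2 U, open_nbhs y U & lam (sweep Phi S (A `&` U)) = 0%E.
Proof.
move=> S0 sp sc g0 hg Az; have [e1 [e2 [h1 h2 h3 h4]]] := dual_vectors g0 hg.
pose f (i : 'I_2) := if i == ord0 then psi else chi.
pose gr (i : 'I_2) := if i == ord0 then g else h.
pose e (i : 'I_2) := if i == ord0 then e1 else e2.
have [||r [C [r0 C0 hC]]] := @thin_set R n 2 f gr e y.
- by move=> i; rewrite /f /gr; case: ifP.
- move=> i j; rewrite /gr /e; case: (unliftP ord0 i) => [i'|] ->; case: (unliftP ord0 j) => [j'|] ->;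
 by rewrite ?eqxx ?(ord1 i') ?(ord1 j')/= ?h1 ?h2 ?h3 ?h4.
have [r1 [K1 [r10 K10 hK1]]] := strict_at_bound sp.
have [r2 [K2 [r20 K20 hK2]]] := strict_at_bound sc.
have [B B0 hB] := flow_speed fl.
pose q := Num.min r (Num.min r1 r2).
have q0 : 0 < q by rewrite !lt_min r0 r10 r20.
have [qr qr1 qr2] : [/\ q <= r, q <= r1 & q <= r2] by rewrite !ge_min !lexx !orbT.
pose K := (K1 + K2) * (B + 1).
have K0 : 0 < K by rewrite mulr_gt0//; lra.
exists (ball y (q / 2)); first by split; [exact: ball_open|exact: ballxx (divr_gt0 _ _)].
pose d0 := Num.min (q / 2 / (B + 1)) (K^-1).
have d00 : 0 < d0 by rewrite lt_min invr_gt0 K0 !divr_gt0//; lra.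
apply: (@sweep_null _ _ F Phi fl S (C * K ^+ 2) d0) => //; first by rewrite mge0// sqr_ge0.
move=> dl dl0; rewrite lt_min => /andP[dl1 dl2].
have dlK : K * dl <= 1 by rewrite -(mulfV (lt0r_neq0 K0)) ler_pM2l// ltW.
have := hC (K * dl) (mulr_gt0 K0 dl0) dlK; rewrite exprMn mulrA; apply: le_trans; apply: le_lam.
move=> x [t /andP[t0 tdl] [/Az[pz cz] /ball_normP/= yz]].
have xz : `|x - Phi t x| <= (B + 1) * dl.
 have := hB 0 t x; rewrite (flow_init fl) sub0r normrN (ger0_norm t0) => le.
 apply: le_trans le _; apply: (le_via (B * dl)); first exact: ler_wpM2l.
 by rewrite ler_pM2r// lerDl.
have Bq : (B + 1) * dl < q / 2 by rewrite mulrC -ltr_pdivlMr//; lra.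
have xy : `|x - y| < q by have := ler_distD (Phi t x) x y; rewrite (distrC (Phi t x)); lra.
have bx (r' : R) : q <= r' -> ball y r' x by move=> le; apply/ball_normP; rewrite /= distrC; exact: lt_le_trans xy le.
have bz (r' : R) : q <= r' -> ball y r' (Phi t x) by move=> le; apply/ball_normP => /=; lra.
split; first by rewrite ltW// (lt_le_trans xy).
move=> i; rewrite /f; case: ifP => _.
 have := hK1 _ _ (bx _ qr1) (bz _ qr1); rewrite pz subr0 => le; apply: le_trans le _.
 apply: (le_via (K1 * ((B + 1) * dl))); first by rewrite ler_pM2l.
 rewrite mulrA ler_pM2r// ler_wpM2r//; lra.
have := hK2 _ _ (bx _ qr2) (bz _ qr2); rewrite cz subr0 => le; apply: le_trans le _.
apply: (le_via (K2 * ((B + 1) * dl))); first by rewrite ler_pM2l.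
rewrite mulrA ler_pM2r// ler_wpM2r//; lra.
Qed.

Lemma grad_flux_lipschitz (U : set V) (psi : V -> R) (y : V) : open_nbhs y U -> Ck_on 2 U psi ->
 exists r K : R, [/\ 0 < r, 0 <= K, ball y r `<=` U & forall z w, ball y r z -> ball y r w ->
 `|dot (grad psi z) (F z) - dot (grad psi w) (F w)| <= K * `|z - w|].
Proof.
move=> [oU Uy] [cpsi c2].
have P i : exists rK : R * R, [/\ 0 < rK.1, 0 < rK.2 & forall z w, ball y rK.1 z -> ball y rK.1 w ->
 `|partial i psi z - partial i psi w| <= rK.2 * `|z - w|].
 have [_ c1] := c2 i; have := Ck_strict oU c1 Uy => /strict_at_bound[r [K [r0 K0 h]]].
 by exists (r, K).
have [rK hrK] := choice P.
have /nbhs_ballP[q /= q0 hq] : nbhs y U by exact: open_nbhs_nbhs.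
pose r := Num.min (Num.min q 1) (\big[Num.min/1]_i (rK i).1).
have r0 : 0 < r.
 rewrite !lt_min q0 ltr01/=; apply: lt_bigmin => // i _; by have [] := hrK i.
have ri i : r <= (rK i).1.
 by apply: (le_via (\big[Num.min/1]_i (rK i).1)); [rewrite ge_min lexx orbT|exact: bigmin_le_cond].
pose K1 := \sum_i (rK i).2.
have K10 : 0 <= K1 by apply: sumr_ge0 => i _; have [_ /ltW] := hrK i.
have K1i i : (rK i).2 <= K1.
 rewrite /K1 (bigD1 i)//= lerDl; apply: sumr_ge0 => j _; by have [_ /ltW] := hrK j.
have gl z w : ball y r z -> ball y r w -> `|grad psi z - grad psi w| <= K1 * `|z - w|.
 move=> bz bw; have [i ->] := norm_coord (grad psi z - grad psi w); rewrite !mxE.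
 have [_ _ h] := hrK i; apply: le_trans (h _ _ _ _) _; [exact: le_ball bz|exact: le_ball bw|].
 by rewrite ler_wpM2r.
pose G := `|grad psi y| + K1; have G0 : 0 <= G by rewrite addr_ge0.
pose H := `|F y| + L; have H0 : 0 <= H by rewrite addr_ge0.
have byy : ball y r y by exact: ballxx.
have dist1 z : ball y r z -> `|z - y| <= 1.
 move=> /ball_normP/=; rewrite distrC => /ltW h; apply: le_trans h _; by rewrite !ge_min lexx orbT.
have gb z : ball y r z -> `|grad psi z| <= G.
 move=> bz; have := gl _ _ bz byy; have := ler_distD 0 (grad psi z) (grad psi y).
 have := ler_normD (grad psi z - grad psi y) (grad psi y); rewrite subrK => h1 _ h2.
 have : K1 * `|z - y| <= K1 * 1 by apply: ler_wpM2l => //; exact: dist1.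
 rewrite /G; lra.
have Fb z : ball y r z -> `|F z| <= H.
 move=> bz; have := FL z y; have := ler_normD (F z - F y) (F y); rewrite subrK => h1 h2.
 have : L * `|z - y| <= L * 1 by apply: ler_wpM2l => //; exact: dist1.
 rewrite /H; lra.
exists r, (n.+1%:R * (K1 * H + G * L)); split=> //.
- by rewrite mge0// addr_ge0// mge0.
- by move=> z bz; apply: hq; apply: le_ball bz; rewrite !ge_min lexx.
move=> z w bz bw.
have -> : dot (grad psi z) (F z) - dot (grad psi w) (F w) =
 dot (grad psi z - grad psi w) (F z) + dot (grad psi w) (F z - F w).
 by rewrite dotBl dotBr; ring.
apply: le_trans (ler_normD _ _) _.
apply: le_trans (lerD (dot_le_norm _ _) (dot_le_norm _ _)) _.
rewrite -!mulrA -mulrDr; apply: ler_wpM2l => //.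
have := gl _ _ bz bw; have := gb _ bw; have := Fb _ bz; have := FL z w.
move=> a1 a2 a3 a4.
have b1 : `|grad psi z - grad psi w| * `|F z| <= K1 * `|z - w| * H by exact: ler_pM.
have b2 : `|grad psi w| * `|F z - F w| <= G * (L * `|z - w|) by exact: ler_pM.
lra.
Qed.

(* Along a trajectory through a tangency point psi stays O(dl^2). *)
Lemma sweep_tangent (S : R) (A U : set V) (psi : V -> R) (y : V) : 0 <= S ->
 open_nbhs y U -> Ck_on 2 U psi -> grad psi y != 0 ->
 (forall z, A z -> U z -> psi z = 0 /\ dot (grad psi z) (F z) = 0) ->
 exists2 U, open_nbhs y U & lam (sweep Phi S (A `&` U)) = 0%E.
Proof.
move=> S0 yU c2 g0 Az.
have oU : open U by case: yU.
have st z : U z -> strict_at psi z (grad psi z) by move=> Uz; apply: (Ck_strict oU) => //; exact: CkS.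
have Uy : U y by case: yU.
pose e (i : 'I_1) := (dot (grad psi y) (grad psi y))^-1 *: grad psi y.
have [||r [C [r0 C0 hC]]] := @thin_set R n 1 (fun=> psi) (fun=> grad psi y) e y.
- by move=> i; exact: st.
- by move=> i j; rewrite !ord1 eqxx dotZr mulVf// gt_eqF// dot_gt0.
have [r1 [K1 [r10 K10 r1U hK1]]] := grad_flux_lipschitz yU c2.
have [B B0 hB] := flow_speed fl.
pose q := Num.min r r1.
have q0 : 0 < q by rewrite !lt_min r0 r10.
have [qr qr1] : q <= r /\ q <= r1 by rewrite !ge_min !lexx !orbT.
pose K := K1 * B + 1.
have K0 : 0 < K by rewrite ltr_wpDl// mge0.
exists (ball y (q / 2)); first by split; [exact: ball_open|exact: ballxx (divr_gt0 _ _)].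
pose d0 := Num.min (Num.min (q / 2 / (B + 1)) (K^-1)) 1.
have d00 : 0 < d0 by rewrite !lt_min invr_gt0 K0 !divr_gt0//; lra.
apply: (@sweep_null _ _ F Phi fl S (C * K) d0) => //; first by rewrite mge0// ltW.
move=> dl dl0; rewrite !lt_min => /andP[/andP[dl1 dl2] dl3].
have dlK : K * dl ^+ 2 <= 1.
 rewrite expr2 mulrA; apply: (le_via (1 * dl)); last by lra.
 by rewrite ler_pM2r// -(mulfV (lt0r_neq0 K0)) ler_pM2l// ltW.
have := hC (K * dl ^+ 2) (mulr_gt0 K0 (exprn_gt0 _ dl0)) dlK; rewrite expr1 mulrA; apply: le_trans; apply: le_lam.
move=> x [t /andP[t0 tdl] [Az' /ball_normP/= yz]].
have spd s : 0 <= s <= t -> `|Phi s x - Phi t x| <= B * dl.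
 move=> /andP[s0 st']; apply: le_trans (hB _ _ _) _; apply: ler_wpM2l => //.
 by rewrite ler_norml; apply/andP; split; lra.
have Bq : (B + 1) * dl < q / 2 by rewrite mulrC -ltr_pdivlMr//; lra.
have Bq' : B * dl < q / 2 by apply: le_lt_trans Bq; rewrite ler_pM2r// lerDl.
have bs s : 0 <= s <= t -> `|Phi s x - y| < q.
 move=> /spd h; have := ler_distD (Phi t x) (Phi s x) y; rewrite (distrC (Phi t x) y); lra.
have bs1 s : 0 <= s <= t -> ball y r1 (Phi s x).
 by move=> /bs h; apply/ball_normP => /=; rewrite distrC (lt_le_trans h).
have t0t : 0 <= t <= t by rewrite t0 lexx.
have [pz qz] := Az _ Az' (r1U _ (bs1 _ t0t)).
split; first by have := bs 0; rewrite lexx t0 (flow_init fl) => /(_ isT) h; rewrite ltW// (lt_le_trans h).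
move=> _.
have der s : 0 <= s <= t -> is_derive s 1 (fun s : R => psi (Phi s x)) (dot (grad psi (Phi s x)) (F (Phi s x))).
 move=> hs; apply: (is_derive_comp_strict (c := fun s => Phi s x)); last exact: flow_derive.
 by apply: st; apply: r1U; exact: bs1.
have dle s : 0 <= s <= t -> `|dot (grad psi (Phi s x)) (F (Phi s x))| <= K1 * (B * dl).
 move=> hs; have := hK1 _ _ (bs1 _ hs) (bs1 _ t0t); rewrite qz subr0 => h; apply: le_trans h _.
 by apply: ler_wpM2l => //; exact: spd.
have := derive_abs_le t0 der (fun s _ => is_derive_linear (K1 * (B * dl)) s) dle.
rewrite pz sub0r normrN (flow_init fl) mulr0 subr0 => h; apply: le_trans h _.
rewrite /K mulrDl mul1r expr2.
have : K1 * (B * dl) * t <= K1 * (B * dl) * dl by apply: ler_wpM2l => //; rewrite !mge0// ltW.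
have : 0 <= dl * dl by rewrite mge0 ?ltW.
lra.
Qed.

End sweep_interfaces.
End interface_geometry.

Section real_induction.
Context {R : realType}.

Lemma local_to_global (P : R -> R -> Prop) (a b : R) : a < b ->
 (forall r s t, a <= r -> r <= s -> s <= t -> t <= b -> P r s -> P s t -> P r t) ->
 (forall t, a <= t -> t < b -> exists2 e : R, 0 < e & forall s, 0 < s -> s < e -> P t (t + s)) ->
 (forall t, a < t -> t <= b -> exists2 e : R, 0 < e & forall s, 0 < s -> s < e -> P (t - s) t) ->
 P a b.
Proof.
move=> ab tr rt lt.
pose A := [set t | a < t <= b /\ P a t].
have [e0 e00 he0] := rt a (lexx _) ab.
have A0 : A !=set0.
 exists (a + Num.min (e0 / 2) (b - a)).
 have m0 : 0 < Num.min (e0 / 2) (b - a) by rewrite lt_min divr_gt0// subr_gt0.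
 have m1 : Num.min (e0 / 2) (b - a) <= e0 / 2 by rewrite ge_min lexx.
 have m2 : Num.min (e0 / 2) (b - a) <= b - a by rewrite ge_min lexx orbT.
 split; first by apply/andP; split; lra.
 by apply: he0 => //; lra.
have ubA : has_ubound A by exists b => t [/andP[]].
have supA : has_sup A by split.
set c := sup A.
have [t0 [/andP[at0 t0b] Pt0]] := A0.
have ac : a < c.
 by apply: (lt_le_trans at0); apply: (ub_le_sup ubA); split=> //; rewrite at0.
have cb : c <= b by apply: ge_sup => // t [/andP[]].
have Pc : P a c.
 have [e ee he] := lt c ac cb.
 have [t [/andP[at_ tb] Pt] tc] := sup_adherent ee supA.
 have tlec : t <= c by apply: ub_le_sup => //; split=> //; rewrite at_.
 move: tlec; rewrite le_eqVlt => /predU1P[<-//|tltc].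
 apply: (tr a t c) Pt _ => //; [exact: ltW|exact: ltW|]; have := he (c - t); rewrite subKr; apply; first by rewrite subr_gt0.
 by rewrite -/c in tc; lra.
move: cb; rewrite le_eqVlt => /predU1P[<-//|cltb].
have [e ee he] := rt c (ltW ac) cltb.
have m0 : 0 < Num.min (e / 2) (b - c) by rewrite lt_min divr_gt0// subr_gt0.
have m1 : Num.min (e / 2) (b - c) <= e / 2 by rewrite ge_min lexx.
have m2 : Num.min (e / 2) (b - c) <= b - c by rewrite ge_min lexx orbT.
have : c + Num.min (e / 2) (b - c) <= c.
 apply: ub_le_sup => //; split; first by apply/andP; split; lra.
 by apply: (tr a c) Pc (he _ m0 _) => //; lra.
lra.
Qed.

End real_induction.

Lemma acyclic_rank (T : finType) (e : rel T) :
 (forall c : seq T, ucycle e c -> c = [::]) ->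
 exists rk : T -> nat, forall x y, e x y -> (rk x < rk y)%N.
Proof.
move=> acyc; exists (fun x => #|[pred z | connect e z x]|) => x y xy.
apply: proper_card; apply/properP; split.
 by apply/fintype.subsetP => z; rewrite !inE => zx; apply: connect_trans zx (connect1 xy).
exists y; rewrite inE ?connect0//; apply/negP => /connectP[p ep lp].
case/shortenP: ep lp => p' ep' up' _ lp.
have : ucycle e (y :: p') by rewrite /ucycle up' andbT /= rcons_path ep' -lp xy.
by move=> /acyc.
Qed.

Section exit.
Context {R : realType} {d N : nat}.
Local Notation V := 'rV[R]_d.+1.
Local Notation lam := (@lebesgue_outer R d).
Variables (Om : set V) (H : V -> V) (Oi : 'I_N -> set V) (nu : 'I_N -> 'I_N -> V -> V).
Hypotheses (dom : is_domain Om) (bnd : bounded_set Om).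
Hypotheses (part : domain_partition Om Oi nu) (condB : condition_B H Oi nu)
 (condC : condition_C H Oi nu).
Variables (Ht : V -> V) (L : R) (Phi : R -> V -> V).
Hypothesis HtL : forall x y, `|Ht x - Ht y| <= L * `|x - y|.
Hypothesis L0 : 0 <= L.
Hypothesis HtH : forall x, Om x -> Ht x = H x.
Hypothesis fl : is_flow Ht Phi.
Local Notation Fi i := (closure (Oi i)).

Let oOm : open Om. Proof. by case: dom. Qed.

Lemma gamma_closure i j x : i != j -> (gamma Oi i j x <-> Fi i x /\ Fi j x).
Proof.
move=> ij; have oO k : open (Oi k) by have [[]] := partition_domain part k.
split=> [[[ix _] [jx _]]//|[ix jx]].
have P k l : k != l -> Fi k x -> Fi l x -> ~ interior (Oi k) x.
 move=> kl kx lx /interior_subset Ok.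
 have [z []] := lx (Oi k) (open_nbhs_nbhs (conj (oO k) Ok)).
 by move=> Ol Ok'; have : (Oi k `&` Oi l) z by []; rewrite (partition_disjoint part kl).
by split; split=> //; [apply: P ij _ _|apply: P _ jx ix => //; rewrite eq_sym].
Qed.

Lemma near_index y : Om y -> exists r : R, [/\ 0 < r, ball y r `<=` Om &
 forall z k, ball y r z -> Fi k z -> Fi k y].
Proof.
move=> Oy; have /nbhs_ballP[r0 /= r00 h0] : nbhs y Om by exact: open_nbhs_nbhs.
have P k : exists r : R, 0 < r /\ forall z, ball y r z -> Fi k z -> Fi k y.
 have [ky|ky] := pselect (Fi k y); first by exists 1.
 have : nbhs y (~` Fi k) by apply: open_nbhs_nbhs; split=> //; rewrite openC; exact: closed_closure.
 by move=> /nbhs_ballP[r /= r1 hr]; exists r; split=> // z /hr.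
have [r hr] := choice P.
exists (Num.min r0 (\big[Num.min/1]_k r k)); split.
- by rewrite lt_min r00; apply: lt_bigmin => // k _; have [] := hr k.
- by move=> z bz; apply: h0; apply: le_ball bz; rewrite ge_min lexx.
move=> z k bz; have [_] := hr k; apply; apply: le_ball bz.
by apply: (le_via (\big[Num.min/1]_k r k)); [rewrite ge_min lexx orbT|exact: bigmin_le_cond].
Qed.

Lemma cover_index y : Om y -> exists k, Fi k y.
Proof.
move=> Oy; have : closure Om y by exact: subset_closure.
by rewrite (partition_cover part) => -[k _ ky]; exists k.
Qed.

Lemma unit_normal_sym i j y v : unit_normal (Oi i) (Oi j) y v -> unit_normal (Oi j) (Oi i) y (- v).
Proof.
move=> [nv [U [psi [c [yU c2 [c0 g] zU]]]] nr]; split.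
- by rewrite /enorm dotNl dotNr opprK.
- exists U, psi, (- c); split=> //; first by rewrite oppr_eq0 c0 g scalerN scaleNr opprK.
 by move=> z /zU; rewrite /interface setIC.
- by apply: filterS nr => s [h1 h2]; rewrite !scalerN opprK; split; [exact: h2|exact: h1].
Qed.

Lemma unit_normal_data i j y v : gamma Oi i j y -> unit_normal (Oi i) (Oi j) y v ->
 exists U psi c, [/\ open_nbhs y U, Ck_on 2 U psi, c != 0 & [/\ grad psi y = c *: v,
 strict_at psi y (c *: v), c *: v != 0, psi y = 0 & forall z, U z -> (gamma Oi i j z <-> psi z = 0)]].
Proof.
move=> yg [nv [U [psi [c [yU c2 [c0 g] zU]]]] nr]; exists U, psi, c; split=> //; split=> //.
- by rewrite -g; apply: (Ck_strict yU.1 (CkS c2)) yU.2.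
- rewrite scaler_eq0 negb_or c0; apply/eqP => v0; move: nv; rewrite v0 /enorm dot0l sqrtr0 => /esym/eqP.
 by rewrite oner_eq0.
- by apply/zU => //; exact: yU.2.
Qed.

Lemma segment_side (F G : set V) (p z : V) : closed F -> closed G ->
 (forall th : R, 0 <= th <= 1 -> F (p + th *: (z - p)) \/ G (p + th *: (z - p))) ->
 (forall th : R, 0 <= th <= 1 -> ~ (F (p + th *: (z - p)) /\ G (p + th *: (z - p)))) ->
 G p -> G z.
Proof.
move=> cF cG cov nboth Gp; pose q (th : R) := p + th *: (z - p).
have cont (A : set V) (t : R) : closed A -> ~ A (q t) ->
 exists2 e : R, 0 < e & forall s, `|s - t| < e -> ~ A (q s).
 move=> cA nA; have : nbhs (q t) (~` A).
 by apply: open_nbhs_nbhs; split=> //; rewrite openC.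
 move=> /nbhs_ballP[e /= e1 he].
 have D0 : 0 < `|z - p| + 1 by rewrite ltr_wpDl.
 exists (e / (`|z - p| + 1)); first by rewrite divr_gt0.
 move=> s st; apply: he; apply/ball_normP => /=.
 rewrite (_ : q t - q s = (t - s) *: (z - p)); last by rewrite /q; rvring.
 rewrite normrZ distrC; move: st; rewrite ltr_pdivlMr// => h; apply: le_lt_trans h.
 by apply: ler_wpM2l => //; rewrite lerDl.
have -> : z = q 1 by rewrite /q scale1r addrC subrK.
have q0 : G (q 0) by rewrite /q scale0r addr0.
apply: (@local_to_global R (fun s t => G (q s) -> G (q t)) 0 1 ltr01 _ _ _ q0).
- by move=> r s t _ _ _ _ rs st' /rs.
- move=> t t0 t1; have [Gt|nG] := pselect (G (q t)); last by exists 1.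
 have tin : 0 <= t <= 1 by rewrite t0 ltW.
 have nF : ~ F (q t) by move=> Ft; exact: (nboth t tin (conj Ft Gt)).
 have [e e1 he] := cont F t cF nF.
 exists (Num.min e (1 - t)); first by rewrite lt_min e1 subr_gt0.
 move=> s s0; rewrite lt_min => /andP[se s1] _.
 have [|Fs|//] := cov (t + s); first by apply/andP; split; lra.
 by exfalso; apply: (he _ _ Fs); rewrite addrAC subrr add0r gtr0_norm.
- move=> t t0 t1; have [Gt|nG] := pselect (G (q t)); first by exists 1.
 have [e e1 he] := cont G t cG nG; exists e => // s s0 se Gs; exfalso; apply: (he _ _ Gs).
 by rewrite addrAC subrr add0r normrN gtr0_norm.
Qed.

(* On the segment from y + |z - y| v to z the function psi does not vanish, so
 the segment stays in one of the two regions meeting along gamma. *)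
Lemma interface_side i j y v (kap : R) : i != j -> Om y -> 0 < kap ->
 (forall k, Fi k y -> k = i \/ k = j) -> gamma Oi i j y ->
 unit_normal (Oi i) (Oi j) y v ->
 exists2 r : R, 0 < r & forall z, 0 < `|z - y| -> `|z - y| < r ->
 kap * `|z - y| <= dot v (z - y) -> Fi j z /\ ~ Fi i z.
Proof.
move=> ij Oy kap0 Iy gy un; have [nv _ nr] := un.
have [U [psi [c [yU c2 c0 [_ st _ py zU]]]]] := unit_normal_data gy un.
have [r0 [r00 r0O r0I]] := near_index Oy.
have /nbhs_ballP[r1 /= r10 r1U] : nbhs y U by exact: open_nbhs_nbhs.
pose m := Num.min kap 1; have m0 : 0 < m by rewrite lt_min kap0 ltr01.
have cp : 0 < `|c| by rewrite normr_gt0.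
have e0 : 0 < `|c| * m / 2 by rewrite divr_gt0// mulr_gt0.
have [r2 r20 hr2] := st _ e0.
have [r3 /= r30 hr3] : \forall s \near (0:R)^'+, closure (Oi j) (y + s *: v).
 by apply: filterS nr => s [].
have v1 : `|v| <= 1 by rewrite -nv; exact: norm_le_enorm.
have vv : dot v v = 1 by rewrite -[LHS]enorm_sqr nv expr1n.
exists (Num.min (Num.min r0 r1) (Num.min r2 r3)); first by rewrite !lt_min r00 r10 r20 r30.
move=> z a0; rewrite !lt_min => /andP[/andP[ar0 ar1] /andP[ar2 ar3]] zk.
pose p := y + `|z - y| *: v; pose q (th : R) := p + th *: (z - p).
have qE th : q th - y = th *: (z - y) + ((1 - th) * `|z - y|) *: v by rewrite /q /p; rvring.
have qy th : 0 <= th <= 1 -> `|q th - y| <= `|z - y|.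
 move=> /andP[t0 t1]; rewrite qE; apply: le_trans (ler_normD _ _) _.
 rewrite !normrZ (ger0_norm t0) ger0_norm ?mge0 ?subr_ge0// ?normr_id.
 apply: (le_via (th * `|z - y| + (1 - th) * `|z - y| * 1)); last by rewrite mulr1 -mulrDl subrKC mul1r.
 by rewrite lerD2l ler_wpM2l// mge0// subr_ge0.
have qb th (r : R) : `|z - y| < r -> 0 <= th <= 1 -> ball y r (q th).
 by move=> ar /qy h; apply/ball_normP; rewrite /= distrC; exact: le_lt_trans h ar.
have dq th : 0 <= th <= 1 -> m * `|z - y| <= dot v (q th - y).
 move=> /andP[t0 t1]; rewrite qE dotDr !dotZr vv mulr1.
 rewrite -[leLHS]mul1r -[1 in leLHS](subrKC th) mulrDl; apply: lerD; apply: ler_wpM2l.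
 - exact: t0.
 - by apply: (le_trans _ zk); rewrite ler_pM2r// ge_min lexx.
 - by rewrite subr_ge0.
 - by rewrite ler_piMl// ge_min lexx orbT.
have qn th : 0 <= th <= 1 -> psi (q th) != 0.
 move=> tin; have := hr2 _ _ (qb _ _ ar2 tin) (ballxx _ r20); rewrite py subr0 => h.
 apply/eqP => p0; move: h; rewrite p0 sub0r normrN dotZl normrM leNgt => /negP; apply.
 apply: (@le_lt_trans _ _ (`|c| * m / 2 * `|z - y|)).
 by apply: ler_wpM2l; [exact: ltW|exact: qy].
 apply: (@lt_le_trans _ _ (`|c| * (m * `|z - y|))).
 by rewrite -!mulrA ltr_pM2l// ltr_pM2l// ltr_pdivrMl// ltr_pMl// ltr1n.
 by rewrite ler_pM2l//; apply: le_trans (dq _ tin) (ler_norm _).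
have nboth th : 0 <= th <= 1 -> ~ (Fi i (q th) /\ Fi j (q th)).
 move=> tin /(gamma_closure _ ij)/(zU _ (r1U _ (qb _ _ ar1 tin)))/eqP.
 by apply/negP; exact: qn.
have cov th : 0 <= th <= 1 -> Fi i (q th) \/ Fi j (q th).
 move=> tin; have qr := qb _ _ ar0 tin.
 have [k hk] := cover_index (r0O _ qr).
 by have [<-|<-] := Iy k (r0I _ _ qr hk); [left|right].
have Fjz : Fi j z.
 apply: (@segment_side (Fi i) (Fi j) p z) => //; try exact: closed_closure.
 by apply: hr3; [rewrite /ball/= sub0r normrN gtr0_norm|].
have q1 : q 1 = z by rewrite /q scale1r addrC subrK.
split=> // Fiz; apply: (nboth 1); rewrite ?q1//; by rewrite ler01 lexx.
Qed.

Definition regular i j y := [/\ proper_interface Oi i j, unit_normal (Oi i) (Oi j) y (nu i j y) &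
 [\/ outflow H Oi nu i j /\ 0 < flux H nu i j y, inflow H Oi nu i j /\ flux H nu i j y < 0 |
 flux H nu i j y = 0]].

Lemma ae_surface_null (A : set V) (P : V -> Prop) : ae_on surface A P ->
 hausdorff d [set y | A y /\ ~ P y] = 0%E.
Proof.
move=> [Nu [_ N0 sub]]; apply/eqP; rewrite eq_le hausdorff_ge0 andbT -N0.
by apply: le_hausdorff => y [Ay nP]; apply: sub => /= h; apply: nP; exact: h.
Qed.

Lemma irregular_null i j : i != j ->
 hausdorff d [set y | gamma Oi i j y /\ ~ regular i j y] = 0%E.
Proof.
move=> ij; apply/eqP; rewrite eq_le hausdorff_ge0 andbT.
have [pij|nij] := pselect (proper_interface Oi i j); last first.
 have g0 : hausdorff d (gamma Oi i j) = 0%E.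
 apply/eqP; rewrite eq_le hausdorff_ge0 andbT leNgt; apply/negP => g0.
 by apply: nij; split.
 by rewrite -g0; apply: le_hausdorff => y [].
have n1 := ae_surface_null (partition_normal part pij).
have [P [hP n2]] : exists P : V -> Prop, (forall y, P y ->
 [\/ outflow H Oi nu i j /\ 0 < flux H nu i j y, inflow H Oi nu i j /\ flux H nu i j y < 0 |
 flux H nu i j y = 0]) /\ hausdorff d [set y | gamma Oi i j y /\ ~ P y] = 0%E.
 have [w|w|w] := condB.1 i j pij.
 - exists (fun y => 0 < flux H nu i j y); split; last exact: ae_surface_null.
 by move=> y fy; apply: Or31.
 - exists (fun y => flux H nu i j y < 0); split; last exact: ae_surface_null.
 by move=> y fy; apply: Or32.
 - exists (fun y => flux H nu i j y = 0); split; last exact: ae_surface_null.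
 by move=> y fy; apply: Or33.
apply: (le_via (hausdorff d ([set y | gamma Oi i j y /\ ~ unit_normal (Oi i) (Oi j) y (nu i j y)] `|`
 [set y | gamma Oi i j y /\ ~ P y]))).
 apply: le_hausdorff => y [gy nr].
 have [un|un] := pselect (unit_normal (Oi i) (Oi j) y (nu i j y)); last by left.
 by right; split=> // Py; apply: nr; split=> //; exact: hP.
apply: le_trans (outer_measureU2 _ _ _) _.
by rewrite [X in (X + _)%E]n1 [X in (_ + X)%E]n2 adde0.
Qed.

Definition tangency i j : set V := [set y | [/\ Om y, gamma Oi i j y,
 unit_normal (Oi i) (Oi j) y (nu i j y) & flux H nu i j y = 0]].

Lemma tangency_swept S i j : 0 <= S -> lam (sweep Phi S (tangency i j)) = 0%E.
Proof.
move=> S0; apply: sweep_null_local => y [Oy gy un _].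
have [U [psi [c [yU c2 c0 [gr st cv py zU]]]]] := unit_normal_data gy un.
apply: (sweep_tangent HtL L0 fl S0 yU c2); first by rewrite gr.
move=> z [Oz gz unz fz] Uz; split; first exact/zU.
have [U' [psi' [c' [zU' _ _ [_ st' cv' pz' zU'']]]]] := unit_normal_data gz unz.
have sz : strict_at psi z (grad psi z) by exact: (Ck_strict yU.1 (CkS c2)).
have zUU : open_nbhs z (U `&` U').
 by split; [apply: openI; [exact: yU.1|exact: zU'.1]|split=> //; exact: zU'.2].
have [w [Uw Uw'] pw|k ->] := parallel_gradients st' sz cv' zUU pz'.
 by apply/(zU _ Uw)/(zU'' _ Uw').
by rewrite !dotZl dotC HtH// -[dot _ _]/(flux H nu i j z) fz !mulr0.
Qed.

Definition triple i j k : set V := [set y | [/\ gamma Oi i j y, gamma Oi i k y & gamma Oi j k y] /\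
 [/\ unit_normal (Oi i) (Oi j) y (nu i j y), unit_normal (Oi i) (Oi k) y (nu i k y) &
 unit_normal (Oi j) (Oi k) y (nu j k y)]].

Lemma unit_not_multiple (v w : V) (c : R) : enorm v = 1 -> enorm w = 1 -> w <> v -> w <> - v ->
 w != c *: v.
Proof.
move=> v1 w1 nvw nvw'; apply/eqP => wcv.
have /eqP : c ^+ 2 = 1.
 have : dot w w = 1 by rewrite -enorm_sqr w1 expr1n.
 have vv : dot v v = 1 by rewrite -enorm_sqr v1 expr1n.
 by rewrite wcv dotZl dotZr vv mulr1 expr2.
rewrite sqrf_eq1 => /orP[]/eqP c1; move: wcv; rewrite c1 ?scale1r ?scaleN1r.
 exact: nvw.
exact: nvw'.
Qed.

Lemma triple_swept S i j k : 0 <= S -> i != j -> i != k -> j != k ->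
 lam (sweep Phi S (triple i j k)) = 0%E.
Proof.
move=> S0 ij ik jk; apply: sweep_null_local => y [[g1 g2 g3] [u1 u2 u3]].
have [U1 [p1 [c1 [yU1 _ c10 [_ s1 v1 y1 z1]]]]] := unit_normal_data g1 u1.
have [U2 [p2 [c2 [yU2 _ c20 [_ s2 v2 y2 z2]]]]] := unit_normal_data g2 u2.
have [U3 [p3 [c3 [yU3 _ c30 [_ s3 v3 y3 z3]]]]] := unit_normal_data g3 u3.
have nbhsI (U U' : set V) : open_nbhs y U -> open_nbhs y U' -> open_nbhs y (U `&` U').
 by move=> [oU Uy] [oU' Uy']; split; [exact: openI|].
have near_in (U : set V) (v : V) : open_nbhs y U -> \forall s \near (0:R)^'+, U (y + s *: v).
 move=> yU; have /nbhs_ballP[r /= r0 hr] : nbhs y U by exact: open_nbhs_nbhs.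
 have D0 : 0 < `|v| + 1 by rewrite ltr_wpDl.
 near=> s; apply: hr; apply/ball_normP => /=.
 rewrite (_ : y - _ = - (s *: v)); last by rvring.
 have s0 : 0 < s by near: s; exact: nbhs_right_gt.
 have sr : s < r / (`|v| + 1) by near: s; apply: nbhs_right_lt; rewrite divr_gt0.
 rewrite normrN normrZ gtr0_norm//; apply: le_lt_trans (_ : s * (`|v| + 1) < r).
 by rewrite ler_pM2l// lerDl.
 by rewrite -ltr_pdivlMr.
have fin (q1 q2 : V -> R) (h1 h2 : V) (W1 W2 : set V) : strict_at q1 y h1 -> strict_at q2 y h2 ->
 open_nbhs y W1 -> open_nbhs y W2 -> h1 != 0 -> (forall c : R, h2 != c *: h1) ->
 (forall z, triple i j k z -> W1 z -> q1 z = 0) -> (forall z, triple i j k z -> W2 z -> q2 z = 0) ->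
 exists2 U, open_nbhs y U & lam (sweep Phi S (triple i j k `&` U)) = 0%E.
 move=> sq1 sq2 yW1 yW2 h10 h12 t1 t2.
 have [U yU U0] := @sweep_codim2 _ _ _ _ fl S (triple i j k `&` (W1 `&` W2)) _ _ _ _ _ S0 sq1 sq2 h10 h12
 (fun z hz => conj (t1 z hz.1 hz.2.1) (t2 z hz.1 hz.2.2)).
 exists ((W1 `&` W2) `&` U); first exact: (nbhsI _ _ (nbhsI _ _ yW1 yW2) yU).
 by rewrite setIA.
have mult (a b : V) (ca cb : R) : cb != 0 -> (forall c : R, b != c *: a) -> forall c : R, cb *: b != c *: (ca *: a).
 move=> cb0 h c; apply/eqP => e; move: (h (cb^-1 * (c * ca))); rewrite -scalerA -scalerA -e scalerA mulVf// scale1r.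
 by rewrite eqxx.
have [e1 n1 r1] := u1; have [e2 n2 r2] := u2; have [e3 n3 r3] := u3.
have [eq12|ne12] := pselect (nu i k y = nu i j y).
 apply: (fin p1 p3 _ _ U1 U3 s1 s3 yU1 yU3 v1).
 - apply: mult => [//|c]; apply/eqP => e.
 have : dot (c3 *: nu j k y) (nu i j y) = 0.
 apply: (strict_zero_ray s3 y3).
 apply: filterS3 r1 r2 (near_in U3 (nu i j y) yU3) => s [_ a1] [_ a2] Us.
 apply/(z3 _ Us).
 by apply/(gamma_closure _ jk); split; [exact: a1|rewrite -eq12; exact: a2].
 rewrite dotZl => /eqP; rewrite mulf_eq0 (negbTE c30)/= => /eqP h.
 have : dot (nu j k y) (nu j k y) = 1 by rewrite -enorm_sqr e3 expr1n.
 by rewrite [in X in dot _ X]e dotZr h mulr0 => /esym/eqP; rewrite oner_eq0.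
 - by move=> z [[gz _ _] _] Uz; exact/z1.
 - by move=> z [[_ _ gz] _] Uz; exact/z3.
have [eq12|ne12'] := pselect (nu i k y = - nu i j y).
 exfalso; have : dot (c1 *: nu i j y) (nu i j y) = 0.
 apply: (strict_zero_ray s1 y1).
 apply: filterS3 r1 r2 (near_in U1 (nu i j y) yU1) => s [_ a1] [a2 _] Us.
 apply/(z1 _ Us).
 apply/(gamma_closure _ ij); split; [|exact: a1].
 by move: a2; rewrite eq12 scalerN opprK.
 rewrite dotZl -enorm_sqr e1 expr1n mulr1 => c1z; by rewrite c1z eqxx in c10.
apply: (fin p1 p2 _ _ U1 U2 s1 s2 yU1 yU2 v1).
- by apply: mult => // c; exact: unit_not_multiple.
- by move=> z [[gz _ _] _] Uz; exact/z1.
- by move=> z [[_ gz _] _] Uz; exact/z2.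
Unshelve. all: by end_near. Qed.


Lemma swept_all S : 0 <= S -> exists2 Z : set V, lam (sweep Phi S Z) = 0%E &
 forall y i j, Om y -> ~ Z y -> i != j -> Fi i y -> Fi j y ->
 (forall k, Fi k y -> k = i \/ k = j) /\
 exists i' j' v, [/\ (i' = i /\ j' = j) \/ (i' = j /\ j' = i), Lambda H Oi nu i' j',
 unit_normal (Oi i') (Oi j') y v & 0 < dot (Ht y) v].
Proof.
move=> S0.
pose Z1 (p : 'I_N * 'I_N) : set V :=
 if p.1 == p.2 then set0 else [set y | gamma Oi p.1 p.2 y /\ ~ regular p.1 p.2 y].
pose Z2 (p : 'I_N * 'I_N) := tangency p.1 p.2.
pose Z3 (p : 'I_N * 'I_N * 'I_N) : set V :=
 if [&& p.1.1 != p.1.2, p.1.1 != p.2 & p.1.2 != p.2] then triple p.1.1 p.1.2 p.2 else set0.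
exists ((\bigcup_p Z1 p) `|` (\bigcup_p Z2 p) `|` (\bigcup_p Z3 p)).
 have U0 (A B : set V) : lam A = 0%E -> lam B = 0%E -> lam (A `|` B) = 0%E.
 move=> A0 B0; apply/eqP; rewrite eq_le lam_ge0 andbT.
 by apply: le_trans (outer_measureU2 (lebesgue_om d) _ _) _; rewrite [X in (X + _)%E]A0 [X in (_ + X)%E]B0 adde0.
 have s0 : lam (sweep Phi S set0) = 0%E.
 by rewrite (_ : sweep Phi S set0 = set0) ?lam0//; apply/seteqP; split=> // x [].
 rewrite !sweepU !sweep_bigcup; apply: (U0); [apply: (U0)|]; apply: lam_bigcup_null => p.
 - rewrite /Z1; case: ifPn => // ij; apply: (sweep_hausdorff fl S0); exact: irregular_null.
 - exact: tangency_swept.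
 - by rewrite /Z3; case: ifPn => // /and3P[h1 h2 h3]; exact: triple_swept.
move=> y i j Oy nZ ij iy jy.
have reg k l : k != l -> Fi k y -> Fi l y -> regular k l y /\ gamma Oi k l y.
 move=> kl ky ly; have gkl : gamma Oi k l y by exact/gamma_closure.
 split=> //; apply: contrapT => nr; apply: nZ; left; left; exists (k, l) => //.
 by rewrite /Z1 /= (negbTE kl).
have [[pij un fx] gij] := reg _ _ ij iy jy.
split.
 move=> k ky; apply: contrapT => /not_orP[/eqP ki /eqP kj]; apply: nZ; right.
 rewrite eq_sym in ki; rewrite eq_sym in kj.
 exists (i, j, k) => //; rewrite /Z3 /= ij ki kj; split.
 by have [_ h1] := reg _ _ ki iy ky; have [_ h2] := reg _ _ kj jy ky.
 by have [[_ h1 _] _] := reg _ _ ki iy ky; have [[_ h2 _] _] := reg _ _ kj jy ky.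
case: fx => [[out f0]|[inn f0]|f0].
- exists i, j, (nu i j y); split; [by left|by apply/asboolP; left|exact: un|by rewrite HtH].
- exists j, i, (- nu i j y).
 by split; [by right|by apply/asboolP; right|exact: (unit_normal_sym un)|rewrite dotNr HtH// oppr_gt0].
- exfalso; apply: nZ; left; right; exists (i, j); first exact: I.
 split; [exact: Oy|exact: gij|exact: un|exact: f0].
Qed.

Lemma exit_time_ae : exists2 S : R, 0 < S & exists2 Z : set V, lam Z = 0%E &
 forall x, ~ Z x -> exists2 t, 0 <= t <= S & ~ Om (Phi t x).
Proof.
have [rk rkP] := acyclic_rank condC.
have [dl0 hdl] := choice (fun i => let: ex_intro2 a h1 h2 := condB.2 i in
 ex_intro (fun a => 0 < a /\ exists2 v : V, enorm v = 1 & forall x, Fi i x -> a < dot (H x) v) a (conj h1 h2)).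
have [v hv] := choice (fun i => let: conj _ (ex_intro2 w h1 h2) := hdl i in
 ex_intro (fun w => enorm w = 1 /\ forall x, Fi i x -> dl0 i < dot (H x) w) w (conj h1 h2)).
pose dl := \big[Num.min/1]_i dl0 i.
have dlp : 0 < dl by apply: lt_bigmin => // i _; have [] := hdl i.
have dlv i x : Fi i x -> dl < dot (H x) (v i).
 by move=> ix; have [_ h] := hv i; apply: le_lt_trans (h _ ix); exact: bigmin_le_cond.
have [M [M0 hM]] : exists M : R, 0 <= M /\ forall x, Om x -> `|x| <= M.
 have [M [_ h]] := bnd; exists (`|M| + 1); split; first by rewrite addr_ge0.
 move=> x /(h (`|M| + 1)); apply; by rewrite (le_lt_trans (ler_norm M))// ltrDl.
pose D := d.+1%:R * M.
have D0 : 0 <= D by rewrite mge0.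
have hD x i : Om x -> `|dot x (v i)| <= D.
 move=> Ox; apply: le_trans (dot_le_norm _ _) _; rewrite /D -mulrA; apply: ler_wpM2l => //.
 rewrite -[leRHS]mulr1; apply: ler_pM => //; first exact: hM.
 by have [<- _] := hv i; exact: norm_le_enorm.
pose K := 2 * D + dl; have K0 : 0 < K by rewrite /K; lra.
pose W := (\sum_i rk i)%N.
have rkW i : (rk i <= W)%N by rewrite /W (bigD1 i)//= leq_addr.
pose S := (2 * D + K * W%:R) / dl + 1.
have KW0 : 0 <= K * W%:R by apply: mge0 => //; exact: ltW.
have S0 : 0 < S by rewrite /S ltr_wpDl// divr_ge0 ?(ltW dlp)//; lra.
have [Z Z0 hZ] := swept_all (ltW S0).
exists S => //; exists (sweep Phi S Z) => // x nZx; apply: contrapT => nex.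
have stay t : 0 <= t <= S -> Om (Phi t x).
 by move=> tS; apply: contrapT => nO; apply: nex; exists t.
have nZ t : 0 <= t <= S -> ~ Z (Phi t x) by move=> tS Zt; apply: nZx; exists t.
pose val k t := dot (Phi t x) (v k) + K * (rk k)%:R.
have [B B0 hB] := flow_speed fl.
have grow t k : 0 <= t <= S -> Fi k (Phi t x) -> exists2 e : R, 0 < e & forall s, 0 < s -> s < e ->
 val k t + dl * s <= val k (t + s) /\ val k (t - s) + dl * s <= val k t.
 move=> tS kt; have dk := dlv _ _ kt.
 have der : is_derive t 1 (fun s : R => dot (v k) (Phi s x)) (dot (v k) (Ht (Phi t x))).
 apply: (is_derive_comp_strict (f := dot (v k)) (c := fun s => Phi s x)); last exact: flow_derive.
 move=> e e0; exists 1 => // y z _ _; rewrite dotBr subrr normr0; apply: mge0 => //; exact: ltW.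
 move: der => /is_derive_eps/(_ (dot (H (Phi t x)) (v k) - dl))[|e e0 he]; first by rewrite subr_gt0.
 exists e => // s s0 se; rewrite /val ![dot (Phi _ _) (v k)]dotC.
 have := he s; have := he (- s); rewrite normrN (gtr0_norm s0) => /(_ se) + /(_ se).
 rewrite (dotC (v k) (Ht _)) HtH; last exact: stay.
 rewrite !ler_norml => /andP[a1 a2] /andP[a3 a4].
 rewrite mulNr in a1 a2; split; lra.
have right t : 0 <= t -> t < S -> exists2 e : R, 0 < e & forall s, 0 < s -> s < e ->
 forall k, Fi k (Phi t x) -> exists2 l, Fi l (Phi (t + s) x) & val k t + dl * s <= val l (t + s).
 move=> t0 tS; have tin : 0 <= t <= S by rewrite t0 ltW.
 have Oy := stay _ tin.
 have [r [r0 rO rI]] := near_index Oy.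
 have [e1 e10 inb] : exists2 e : R, 0 < e & forall s, 0 < s -> s < e -> ball (Phi t x) r (Phi (t + s) x).
 exists (r / (B + 1)); first by rewrite divr_gt0//; lra.
 move=> s s0; rewrite ltr_pdivlMr; last lra.
 move=> sr; apply/ball_normP => /=; apply: le_lt_trans (hB _ _ _) _.
 by rewrite opprD addNKr normrN gtr0_norm//; lra.
 have [[i [j [ij iy jy]]]|single] := pselect (exists i j, [/\ i != j, Fi i (Phi t x) & Fi j (Phi t x)]).
 have [two [i' [j' [w [ij' lam_ij un fw]]]]] := hZ _ _ _ Oy (nZ _ tin) ij iy jy.
 have [ij2 two' iy' jy'] : [/\ i' != j', forall k, Fi k (Phi t x) -> k = i' \/ k = j',
 Fi i' (Phi t x) & Fi j' (Phi t x)].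
 case: ij' => -[-> ->]; first by [].
 split=> //; first by rewrite eq_sym.
 by move=> k /two[]; [right|left].
 pose kap := dot (Ht (Phi t x)) w / (2 * (B + 1)).
 have kap0 : 0 < kap by rewrite divr_gt0// mulr_gt0//; lra.
 have gy : gamma Oi i' j' (Phi t x) by exact/gamma_closure.
 have [r1 r10 side] := interface_side ij2 Oy kap0 two' gy un.
 have [e2 e20 growj] := grow t j' tin jy'.
 have f20 : 0 < dot w (Ht (Phi t x)) / 2 by rewrite divr_gt0// dotC.
 have der : is_derive t 1 (fun s : R => dot w (Phi s x)) (dot w (Ht (Phi t x))).
 apply: (is_derive_comp_strict (f := dot w) (c := fun s => Phi s x)); last exact: flow_derive.
 move=> e e0; exists 1 => // y z _ _; rewrite dotBr subrr normr0; apply: mge0 => //; exact: ltW.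
 move: der => /is_derive_eps/(_ _ f20)[e3 e30 he3].
 exists (Num.min (Num.min (Num.min 1 (S - t)) e2) (Num.min e3 (r1 / (B + 1)))).
 by rewrite !lt_min ltr01 subr_gt0 tS e20 e30 divr_gt0//; lra.
 move=> s s0; rewrite !lt_min => /andP[/andP[/andP[s1 sS] se2] /andP[se3]].
 rewrite ltr_pdivlMr; last lra.
 move=> sr1.
 have zy : `|Phi (t + s) x - Phi t x| <= B * s.
 by apply: le_trans (hB _ _ _) _; rewrite addrAC subrr add0r gtr0_norm.
 have dz : dot w (Ht (Phi t x)) / 2 * s <= dot w (Phi (t + s) x - Phi t x).
 have := he3 s; rewrite gtr0_norm// => /(_ se3); rewrite dotBr ler_norml => /andP[+ _]; lra.
 have [Fj _] : Fi j' (Phi (t + s) x) /\ ~ Fi i' (Phi (t + s) x).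
 apply: side; last 2 first.
 - by apply: le_lt_trans zy _; lra.
 - apply: le_trans dz; rewrite /kap (dotC _ w).
 apply: (le_via (dot w (Ht (Phi t x)) / (2 * (B + 1)) * ((B + 1) * s))).
 apply: ler_wpM2l; first by rewrite divr_ge0 ?mge0//; lra.
 apply: le_trans zy _; rewrite ler_pM2r//; lra.
 rewrite le_eqVlt; apply/orP; left; apply/eqP; field; lra.
 rewrite normr_gt0; apply: contraTneq dz => ->; rewrite dot0r -ltNge mulr_gt0//.
 have [gj _] := growj s s0 se2.
 move=> k ky; exists j' => //.
 have [->|->] := two' k ky; last exact: gj.
 have rkl : (rk i').+1%:R <= (rk j')%:R :> R by rewrite ler_nat; exact: rkP.
 have Os : Om (Phi (t + s) x) by apply: stay; apply/andP; split; lra.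
 have := hD _ i' Oy; have := hD _ j' Os; rewrite !ler_norml /val => /andP[a1 _] /andP[_ a2].
 have : K * (rk i').+1%:R <= K * (rk j')%:R by rewrite ler_pM2l.
 rewrite -natr1 mulrDr mulr1 /K => a3.
 have : dl * s <= dl by rewrite ler_piMr// ltW.
 rewrite /K in a3 *; lra.
 have [k ky] := cover_index Oy.
 have [e2 e20 growk] := grow t k tin ky.
 exists (Num.min e1 e2); first by rewrite lt_min e10.
 move=> s s0; rewrite lt_min => /andP[se1 se2] k' ky'.
 have -> : k' = k by apply/eqP; apply: contrapT => kk; apply: single; exists k', k; split; [exact/negP|exact: ky'|exact: ky].
 have bs := inb s s0 se1.
 have [l ls] := cover_index (rO _ bs); exists l => //.
 have -> : l = k; last by have [] := growk s s0 se2.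
 by apply/eqP; apply: contrapT => kk; apply: single; exists l, k; split; [exact/negP|exact: rI bs ls|exact: ky].
have left t : 0 < t -> t <= S -> exists2 e : R, 0 < e & forall s, 0 < s -> s < e ->
 forall k, Fi k (Phi (t - s) x) -> exists2 l, Fi l (Phi t x) & val k (t - s) + dl * s <= val l t.
 move=> t0 tS; have tin : 0 <= t <= S by rewrite tS ltW.
 have Oy := stay _ tin.
 have [r [r0 rO rI]] := near_index Oy.
 have P k : exists e : R, 0 < e /\ (Fi k (Phi t x) -> forall s, 0 < s -> s < e -> val k (t - s) + dl * s <= val k t).
 have [ky|nk] := pselect (Fi k (Phi t x)); last by exists 1.
 by have [e e0 he] := grow t k tin ky; exists e; split=> // _ s s0 /(he s s0)[].
 have [e he] := choice P.
 exists (Num.min (r / (B + 1)) (\big[Num.min/1]_k e k)).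
 rewrite lt_min divr_gt0//=; last lra.
 by apply: lt_bigmin => // k _; have [] := he k.
 move=> s s0; rewrite lt_min ltr_pdivlMr; last lra.
 move=> /andP[sr se] k ks.
 have bs : ball (Phi t x) r (Phi (t - s) x).
 apply/ball_normP => /=; apply: le_lt_trans (hB _ _ _) _.
 by rewrite subKr gtr0_norm//; lra.
 have ky := rI _ _ bs ks; exists k => //.
 have [_ h] := he k; apply: h => //; apply: lt_le_trans se _; exact: bigmin_le_cond.
have := @local_to_global R (fun s t => forall k, Fi k (Phi s x) ->
 exists2 l, Fi l (Phi t x) & val k s + dl * (t - s) <= val l t) 0 S S0.
have trans (r s t : R) : 0 <= r -> r <= s -> s <= t -> t <= S ->
 (forall k, Fi k (Phi r x) -> exists2 l, Fi l (Phi s x) & val k r + dl * (s - r) <= val l s) ->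
 (forall k, Fi k (Phi s x) -> exists2 l, Fi l (Phi t x) & val k s + dl * (t - s) <= val l t) ->
 (forall k, Fi k (Phi r x) -> exists2 l, Fi l (Phi t x) & val k r + dl * (t - r) <= val l t).
 move=> _ _ _ _ h1 h2 k /h1[l /h2[m mt a1] a2]; exists m => //; lra.
move=> /(_ trans) {}trans.
have O0 : Om (Phi 0 x) by apply: stay; apply/andP; split => //; exact: ltW.
have OS : Om (Phi S x) by apply: stay; apply/andP; split => //; exact: ltW.
have [k k0] := cover_index O0.
have [t t0 tS|t t0 tS|l lS] := trans _ _ k k0.
- have [e e0 h] := right t t0 tS; exists e => // s s0 se.
 by rewrite addrAC subrr add0r; exact: h.
- have [e e0 h] := left t t0 tS; exists e => // s s0 se.
 by rewrite subKr; exact: h.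
have := hD _ k O0; have := hD _ l OS.
rewrite subr0 /val !ler_norml => /andP[_ a1] /andP[a2 _] a3.
have a4 : K * (rk l)%:R <= K * W%:R by rewrite ler_pM2l// ler_nat.
have a5 : 0 <= K * (rk k)%:R by rewrite mge0// ltW.
have : dl * S = 2 * D + K * W%:R + dl by rewrite /S; field; rewrite gt_eqF.
lra.
Qed.

End exit.

Section exit_everywhere.
Context {R : realType} {d : nat}.
Local Notation V := 'rV[R]_d.+1.
Local Notation lam := (@lebesgue_outer R d).
Variables (Om : set V) (F : V -> V) (Phi : R -> V -> V).
Hypotheses (oOm : open Om) (fl : is_flow F Phi).

Lemma trajectory_margin (S : R) (x : V) : 0 <= S -> (forall t, 0 <= t <= S -> Om (Phi t x)) ->
 exists2 r : R, 0 < r & forall t, 0 <= t <= S -> ball (Phi t x) r `<=` Om.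
Proof.
move=> S0 stay; have [B B0 hB] := flow_speed fl.
have loc t : 0 <= t <= S -> exists2 r : R, 0 < r & forall s, `|s - t| < r -> ball (Phi s x) r `<=` Om.
 move=> /stay Ot; have /nbhs_ballP[r /= r0 hr] : nbhs (Phi t x) Om by exact: open_nbhs_nbhs.
 have r20 : 0 < r / (2 * (B + 1)) by rewrite divr_gt0// mulr_gt0//; lra.
 exists (r / (2 * (B + 1))) => // s st z /ball_normP/= zs; apply: hr; apply/ball_normP => /=.
 have h1 : r / (2 * (B + 1)) <= r / 2.
 rewrite ler_pM2l// lef_pV2 ?posrE ?mulr_gt0//; lra.
 have h2 : `|Phi t x - Phi s x| <= r / 2 - r / (2 * (B + 1)).
 apply: le_trans (hB _ _ _) _; rewrite distrC.
 apply: (le_via (B * (r / (2 * (B + 1))))); first by rewrite ler_wpM2l// ltW.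
 by rewrite le_eqVlt; apply/orP; left; apply/eqP; field; lra.
 have := ler_distD (Phi s x) (Phi t x) z; lra.
have [S0'|Spos] := leP S 0.
 have -> : S = 0 by apply/eqP; rewrite eq_le S0'.
 have [|r r0 hr] := loc 0; first by rewrite lexx.
 exists r => // t; rewrite -eq_le => /eqP <-; apply: hr; by rewrite subrr normr0.
apply: (@local_to_global R (fun s t => exists2 r : R, 0 < r & forall u, s <= u <= t -> ball (Phi u x) r `<=` Om) 0 S) => //.
- move=> r s t _ rs st _ [a a0 ha] [b b0 hb]; exists (Num.min a b); first by rewrite lt_min a0.
 move=> u /andP[ru ut]; have [us|/ltW su] := leP u s.
 by move=> z hz; apply: (ha u); [rewrite ru|apply: le_ball hz; rewrite ge_min lexx].
 by move=> z hz; apply: (hb u); [rewrite su|apply: le_ball hz; rewrite ge_min lexx orbT].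
- move=> t t0 tS; have [|r r0 hr] := loc t; first by rewrite t0 ltW.
 exists r => // s s0 sr; exists r => // u /andP[tu uts]; apply: hr.
 by rewrite ger0_norm ?subr_ge0//; lra.
- move=> t t0 tS; have [|r r0 hr] := loc t; first by rewrite tS ltW.
 exists r => // s s0 sr; exists r => // u /andP[tu uts]; apply: hr.
 by rewrite ler0_norm ?subr_le0//; lra.
Qed.

Lemma staying_open (S : R) : 0 <= S -> open [set x | forall t, 0 <= t <= S -> Om (Phi t x)].
Proof.
move=> S0; rewrite openE => x stay; apply/nbhs_ballP.
have [r r0 hr] := trajectory_margin S0 stay.
have [K K0 hK] := flow_lipschitz fl S.
exists (r / K) => /=; first by rewrite divr_gt0.
move=> y /ball_normP/= xy t tS; apply: (hr t tS); apply/ball_normP => /=.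
apply: le_lt_trans (hK _ _ _ _) _; first by move/andP: tS => [t0 tS]; rewrite ger0_norm.
by rewrite mulrC -ltr_pdivlMr.
Qed.

Lemma open_lebesgue_gt0 (U : set V) : open U -> U !=set0 -> (0 < lam U)%E.
Proof.
move=> oU [x Ux]; have /nbhs_ballP[r /= r0 hr] : nbhs x U by exact: open_nbhs_nbhs.
pose a : V := \row_i (x ord0 i - r); pose b : V := \row_i (x ord0 i + r).
apply: (@lt_le_trans _ _ (lam (obox a b))).
 rewrite -[lam _]/(lamB _) lamB_obox; last by move=> i; rewrite !mxE; lra.
 by rewrite lte_fin prodr_gt0// => i _; rewrite !mxE; lra.
apply: le_lam => y hy; apply: hr; apply/ball_normP => /=.
have [i ->] := norm_coord (x - y); have := hy i; rewrite !mxE ltr_norml => /andP[h1 h2].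
by apply/andP; split; lra.
Qed.

Lemma exit_from_ae (S : R) (Z : set V) : 0 <= S -> lam Z = 0%E ->
 (forall x, ~ Z x -> exists2 t, 0 <= t <= S & ~ Om (Phi t x)) ->
 forall x, exists2 t, 0 <= t <= S & ~ Om (Phi t x).
Proof.
move=> S0 Z0 h x; apply: contrapT => nex.
have Wx : [set x | forall t, 0 <= t <= S -> Om (Phi t x)] x.
 by move=> t tS; apply: contrapT => nO; apply: nex; exists t.
have := open_lebesgue_gt0 (staying_open S0) (ex_intro _ x Wx).
rewrite ltNge => /negP; apply; rewrite -Z0; apply: le_lam => y /= stay.
apply: contrapT => /h[t tS]; apply; exact: stay.
Qed.

End exit_everywhere.

Section integral_comparison.
Local Open Scope ereal_scope.
Context {R : realType}.

Lemma integral_mrestr {d} {T : measurableType d} (m : {measure set T -> \bar R}) (D : set T)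
 (mD : measurable D) (F : T -> \bar R) :
 mfunT F -> (forall x, 0 <= F x) ->
 \int[mrestr m mD]_x F x = \int[m]_(x in D) F x.
Proof.
move=> mF F0; have mCD : measurable (~` D) by exact: measurableC.
rewrite -(setUv D) ge0_integral_setU//=; last 2 first.
- by rewrite setUv.
- exact/disj_setPCl.
rewrite [X in _ + X]null_set_integral//; last 2 first.
- exact: measurable_funS mF.
- by change (m (~` D `&` D) = 0); rewrite setICl measure0.
rewrite adde0; apply: eq_measure_integral => A mA AD.
by change (m (A `&` D) = m A); rewrite (setIidl AD).
Qed.

Lemma integral_pushforward_le {d1 d2} {T1 : measurableType d1} {T2 : measurableType d2}
 (m1 : {measure set T1 -> \bar R}) (m2 : {measure set T2 -> \bar R}) (phi : T1 -> T2)
 (D1 : set T1) (D2 : set T2) (C : R) : (0 <= C)%R ->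
 mfunT phi -> measurable D1 -> measurable D2 ->
 (forall A, measurable A -> m1 (D1 `&` phi @^-1` A) <= C%:E * m2 (D2 `&` A)) ->
 forall F : T2 -> \bar R, mfunT F -> (forall y, 0 <= F y) ->
 \int[m1]_(x in D1) F (phi x) <= C%:E * \int[m2]_(y in D2) F y.
Proof.
move=> C0 mphi mD1 mD2 h F mF F0.
have mFphi : mfunT (F \o phi) by exact: measC.
rewrite -(integral_mrestr m1 mD1 mFphi); last by move=> x; exact: F0.
rewrite -(integral_mrestr m2 mD2 mF)//.
have := @ge0_integral_mscale _ T2 R (mrestr m2 mD2) setT measurableT (NngNum C0) F mF.
move=> /(_ (fun x _ => F0 x)) /= <-.
rewrite -(@ge0_integral_pushforward _ _ T1 T2 R phi mphi (mrestr m1 mD1) setT F)//.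
apply: ge0_le_measure_integral => // A mA.
change (m1 (phi @^-1` A `&` D1) <= C%:E * m2 (A `&` D2)); rewrite setIC [X in _ <= _ * m2 X]setIC.
exact: h.
Qed.

Lemma integral_mulI {d} {T : measurableType d} (m : {measure set T -> \bar R}) (D : set T)
 (f : T -> R) :
 \int[m]_(x in D) (f x)%:E = \int[m]_x (\1_D x * f x)%:E.
Proof.
rewrite integral_mkcond; apply: eq_integral => x _; rewrite patchE indicE.
by case: ifPn => _; rewrite ?mul1r ?mul0r.
Qed.

Local Notation mu := (@lebesgue_measure R).

Lemma lamB_pack {n : nat} (F : rVB R n.+1 -> \bar R) : mfunT F -> (forall z, 0 <= F z) ->
 \int[lamB]_z F z = \int[lamB \x mu]_p F (pack p).
Proof.
move=> mF F0.
pose m : {measure set (rVB R n * measurableTypeR R) -> \bar R} := (lamB \x mu)%E.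
have := @ge0_integral_pushforward _ _ (rVB R n * measurableTypeR R)%type (rVB R n.+1) R pack meas_pack m setT F measurableT mF.
move=> /(_ _)/wrap[|<-]; first by move=> z _; exact: F0.
apply: eq_measure_integral; first exact: meas_pack.
by move=> mp A mA _; exact: lamB_packed.
Qed.

Lemma lamB_tonelli1 {n : nat} (F : rVB R n.+1 -> \bar R) : mfunT F -> (forall z, 0 <= F z) ->
 \int[lamB]_z F z = \int[lamB]_x \int[mu]_t F (pack (x, t)).
Proof.
move=> mF F0; rewrite lamB_pack// fubini_tonelli1//.
by apply: measC => //; exact: meas_pack.
Qed.

Lemma lamB_tonelli2 {n : nat} (F : rVB R n.+1 -> \bar R) : mfunT F -> (forall z, 0 <= F z) ->
 \int[lamB]_z F z = \int[mu]_t \int[lamB]_x F (pack (x, t)).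
Proof.
move=> mF F0; rewrite lamB_pack// fubini_tonelli2//.
by apply: measC => //; exact: meas_pack.
Qed.

End integral_comparison.

Section exit_time.
Context {R : realType} {d : nat}.
Local Notation V := 'rV[R]_d.+1.
Local Notation lam := (@lebesgue_outer R d).
Local Notation mu := (@lebesgue_measure R).
Variables (Om : set V) (F : V -> V) (Phi : R -> V -> V) (S : R).
Hypotheses (oOm : open Om) (fl : is_flow F Phi) (S0 : 0 < S).
Hypothesis exits : forall x, exists2 t, 0 <= t <= S & ~ Om (Phi t x).

Definition staying (s : R) : set V := [set x | forall t, 0 <= t <= s -> Om (Phi t x)].

(* Outside Om this is the supremum of the empty set, which is 0. *)
Definition exit_time (x : V) : R := sup [set s | 0 <= s /\ staying s x].
Local Notation tau := exit_time.

Lemma staying_le s s' x : s' <= s -> staying s x -> staying s' x.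
Proof. by move=> ss h t /andP[t0 ts]; apply: h; rewrite t0 (le_trans ts). Qed.

Lemma staying_lt s x : 0 <= s -> staying s x -> s < S.
Proof.
move=> s0 h; rewrite ltNge; apply/negP => Ss.
by have [t /andP[t0 tS]] := exits x; apply; apply: h; rewrite t0 (le_trans tS).
Qed.

Let ubS x : has_ubound [set s | 0 <= s /\ staying s x].
Proof. by exists S => s [s0 /(staying_lt s0)/ltW]. Qed.

Lemma staying_margin s x : 0 <= s -> staying s x -> exists2 e : R, 0 < e & staying (s + e) x.
Proof.
move=> s0 st; have [r r0 hr] := trajectory_margin oOm fl s0 st.
have [B B0 hB] := flow_speed fl.
exists (r / (2 * (B + 1))); first by rewrite divr_gt0// mulr_gt0//; lra.
move=> t /andP[t0 te]; have [ts|st'] := leP t s; first by apply: st; rewrite t0.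
apply: (hr s); first by rewrite s0 lexx.
apply/ball_normP => /=; apply: le_lt_trans (hB _ _ _) _.
rewrite ltr0_norm ?subr_lt0//.
have h : r / (2 * (B + 1)) * (2 * (B + 1)) = r by rewrite divfK// gt_eqF// mulr_gt0//; lra.
have : B * - (s - t) <= B * (r / (2 * (B + 1))) by apply: ler_wpM2l => //; lra.
have : 0 < r / (2 * (B + 1)) by rewrite divr_gt0// mulr_gt0//; lra.
lra.
Qed.

Lemma lt_exit_time s x : 0 <= s -> (s < tau x <-> staying s x).
Proof.
move=> s0; split=> [st|st]; last first.
 have [e e0 he] := staying_margin s0 st.
 by apply: (@lt_le_trans _ _ (s + e)); [lra|apply: (ub_le_sup (ubS x)); split=> //; lra].
have [A0|/set0P A0] := eqVneq [set s | 0 <= s /\ staying s x] set0.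
 by move: st; rewrite /tau A0 sup0; lra.
have [t [t0 stt] ts] := sup_adherent (ltac:(by rewrite subr_gt0) : 0 < tau x - s) (conj A0 (ubS x)).
by apply: staying_le stt; rewrite -/(tau x) in ts; lra.
Qed.

Lemma exit_time_ge0 x : 0 <= tau x.
Proof.
have [A0|/set0P[s [s0 st]]] := eqVneq [set s | 0 <= s /\ staying s x] set0.
 by rewrite /tau A0 sup0.
by apply: (le_trans s0); apply: (ub_le_sup (ubS x)).
Qed.

Lemma exit_time_le x : tau x <= S.
Proof.
rewrite leNgt; apply/negP => /(lt_exit_time _ (ltW S0)) st.
by have := staying_lt (ltW S0) st; rewrite ltxx.
Qed.

Lemma exit_time_gt0 x : Om x -> 0 < tau x.
Proof.
move=> Ox; apply/lt_exit_time => // t /andP[t0 t0'].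
by rewrite (_ : t = 0) ?(flow_init fl)//; apply/eqP; rewrite eq_le t0 t0'.
Qed.

Lemma exit_time_in s x : 0 <= s -> s < tau x -> Om (Phi s x).
Proof. by move=> s0 /(lt_exit_time _ s0); apply; rewrite s0 lexx. Qed.

Lemma exit_time_bdry x : Om x -> bdry Om (Phi (tau x) x).
Proof.
move=> Ox; have t0 := exit_time_gt0 Ox; split; last first.
 move=> /interior_subset Ot.
 have : staying (tau x) x.
 move=> t /andP[u0]; rewrite le_eqVlt => /predU1P[->//|]; exact: exit_time_in.
 by move=> /(lt_exit_time _ (ltW t0)); rewrite ltxx.
have [B B0 hB] := flow_speed fl.
move=> U /nbhs_ballP[r /= r0 hr].
have e0 : 0 < Num.min (tau x) (r / (B + 1)) by rewrite lt_min t0 divr_gt0//; lra.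
set e := Num.min _ _ in e0.
have e1 : e <= tau x by rewrite ge_min lexx.
have e2 : e <= r / (B + 1) by rewrite ge_min lexx orbT.
exists (Phi (tau x - e / 2) x); split; first by apply: exit_time_in; lra.
apply: hr; apply/ball_normP => /=; apply: le_lt_trans (hB _ _ _) _.
rewrite subKr gtr0_norm ?divr_gt0//.
move: e2; rewrite ler_pdivlMr; last lra.
move=> e2; lra.
Qed.

Lemma exit_time_flow s x : 0 <= s -> s < tau x -> tau (Phi s x) = tau x - s.
Proof.
move=> s0 st; have key u : 0 <= u -> (u < tau (Phi s x) <-> u + s < tau x).
 move=> u0; split=> [/(lt_exit_time _ u0) h|/(lt_exit_time _ (addr_ge0 u0 s0)) h].
 apply/lt_exit_time; first exact: addr_ge0.
 move=> t /andP[t0 tus]; have [ts|ts] := leP t s.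
 by move/(lt_exit_time _ s0) : st; apply; rewrite t0.
 rewrite -[t](subrK s) (flow_add fl); apply: h.
 by apply/andP; split; lra.
 apply/lt_exit_time => // t /andP[t0 tu]; rewrite -(flow_add fl); apply: h.
 by apply/andP; split; lra.
apply/eqP; rewrite eq_le !leNgt; apply/andP; split; apply/negP => h.
 have u0 : 0 <= tau x - s by lra.
 by have /(key _ u0) := h; rewrite subrK ltxx.
have u0 := exit_time_ge0 (Phi s x).
have : tau (Phi s x) < tau (Phi s x) by apply/(key _ u0); lra.
by rewrite ltxx.
Qed.

Lemma measurable_exit_time : mfunT (tau : rVB R d -> R).
Proof.
apply: (measurability _ (measurable_realfun.RGenOInfty.measurableE R)).
move=> _ [_ [c ->] <-]; rewrite setTI.
have [c0|c0] := ltP c 0.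
 rewrite (_ : _ @^-1` _ = setT)//; apply/seteqP; split=> // x _ /=.
 by rewrite in_itv/= andbT (lt_le_trans c0)// exit_time_ge0.
rewrite (_ : _ @^-1` _ = staying c).
 by apply: rVB_open; exact: (staying_open oOm fl c0).
by apply/seteqP; split=> x; rewrite /= in_itv/= andbT => /(lt_exit_time _ c0).
Qed.

Lemma measurable_flow2 : mfunT (fun p : rVB R d * R => Phi p.2 p.1 : rVB R d).
Proof.
apply: measurable_rV => i.
rewrite (_ : (fun _ => _) = (fun z : rVB R d.+1 => Phi (tof z) (xof z) ord0 i) \o pack); last first.
 by apply/funext => -[x t]; rewrite /= /pack/= xofE tofE.
apply: measC; last exact: meas_pack.
apply: cont_meas => z; apply/continuous_ballP => e e0.
have [B B0 hB] := flow_speed fl.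
have [K K0 hK] := flow_lipschitz fl (`|tof z|).
have KB : 0 < K + B + 1 by lra.
exists (e / (K + B + 1)); first by rewrite divr_gt0.
move=> z' /ball_normP/=; rewrite ltr_pdivlMr// => zz.
have h1 : `|xof z - xof z'| <= `|z - z'|.
 have [j ->] := norm_coord (xof z - xof z').
 by have := coord_le (z - z') (lift ord_max j); rewrite !mxE.
have h2 : `|tof z - tof z'| <= `|z - z'|.
 by have := coord_le (z - z') ord_max; rewrite !mxE.
have := coord_le (Phi (tof z) (xof z) - Phi (tof z') (xof z')) i; rewrite !mxE.
have := ler_distD (Phi (tof z) (xof z')) (Phi (tof z) (xof z)) (Phi (tof z') (xof z')).
have := hK _ (xof z) (xof z') (lexx `|tof z|).
have := hB (tof z) (tof z') (xof z').
have : K * `|xof z - xof z'| <= K * `|z - z'| by rewrite ler_pM2l.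
have : B * `|tof z - tof z'| <= B * `|z - z'| by apply: ler_wpM2l.
have := normr_ge0 (z - z').
move: zz; clear; rewrite !mulrDr mulr1 => *; lra.
Qed.

Lemma flow_distortion : exists2 C : R, 0 < C & forall (s : R) (A : set (rVB R d)), `|s| <= S ->
 (lam (Phi s @^-1` A) <= C%:E * lam A)%E.
Proof.
have [K K0 hK] := flow_lipschitz fl S.
exists ((2 * K) ^+ d.+1); first by rewrite exprn_gt0// mulr_gt0.
move=> s A sS; rewrite (_ : Phi s @^-1` A = Phi (- s) @` A).
 by apply: lam_lipschitz => // x y _ _; apply: hK; rewrite normrN.
apply/seteqP; split=> [x Ax|_ [x Ax <-]]; first by exists (Phi s x) => //; exact: (flow_invl fl).
by rewrite /= -(flow_add fl) subrr (flow_init fl).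
Qed.

Lemma measurable_flow (s : R) : mfunT (Phi s : rVB R d -> rVB R d).
Proof.
exact: (measurable_fun_pair1 s measurable_flow2).
Qed.

End exit_time.

Section surface_measure.
Context {R : realType} {n : nat}.
Local Notation V := 'rV[R]_n.+1.

Definition surfB : set (rVB R n) -> \bar R := hausdorff n.

Let surfB0 : surfB set0 = 0%E. Proof. exact: hausdorff0. Qed.
Let surfB_ge0 A : (0 <= surfB A)%E. Proof. exact: hausdorff_ge0. Qed.
Let surfB_sigma_additive : semi_sigma_additive surfB.
Proof.
move=> F mF tF mUF.
apply: (@measure_semi_sigma_additive _ _ _ (@surface R n)) => //.
- by move=> i; exact: (borel_hausdorff n (mF i)).
- exact: (borel_hausdorff n mUF).
Qed.

HB.instance Definition _ := isMeasure.Build _ (rVB R n) R surfB surfB0 surfB_ge0 surfB_sigma_additive.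

Lemma ge0_integral_surface (D : set (rVB R n)) (F : rVB R n -> \bar R) :
 measurable D -> measurable_fun D F -> (forall x, D x -> (0 <= F x)%E) ->
 (\int[surface]_(x in D) F x = \int[surfB]_(x in D) F x)%E.
Proof.
apply: ge0_integral_borel_restriction => // A mA; exact: (borel_hausdorff n).
Qed.

End surface_measure.

Lemma energy_growth {R : realType} (M u v g z : R) : - (u * (M * u + g)) <= v * z -> 0 <= (u - g) ^+ 2 ->
 - (g ^+ 2) <= (2 * M + 1) * u ^+ 2 + 2 * v * z.
Proof. rewrite !expr2; nra. Qed.

Lemma excess_square {R : realType} (om q om' g k f eps : R) : om = q * om' -> 0 < om -> om <= 1 -> 0 <= g -> 0 <= eps ->
 g <= k * `|f| + eps -> om ^+ 2 * g ^+ 2 <= 2 * (k * q) ^+ 2 * (om' * f) ^+ 2 + 2 * eps ^+ 2.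
Proof.
move=> oq o0 o1 g0 e0 ge.
have a1 : om * g <= om * (k * `|f|) + eps.
 apply: (le_via (om * (k * `|f| + eps))); first by rewrite ler_pM2l.
 by rewrite mulrDr lerD2l ler_piMl.
have a2 : (om * g) ^+ 2 <= (om * (k * `|f|) + eps) ^+ 2.
 by rewrite ler_sqr ?nnegrE ?(le_trans _ a1)// mge0// ltW.
have a3 : (om * (k * `|f|)) ^+ 2 = (k * q) ^+ 2 * (om' * f) ^+ 2.
 by rewrite oq !exprMn real_normK ?num_real//; ring.
have a4 := sqr_ge0 (om * (k * `|f|) - eps).
rewrite -exprMn -mulrA -a3; move: a2 a4; rewrite !expr2; lra.
Qed.

Section exit_estimates.
Context {R : realType} {d : nat}.
Local Notation V := 'rV[R]_d.+1.
Local Notation BV := (rVB R d).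
Local Notation VT := 'rV[R]_d.+2.
Local Notation BT := (rVB R d.+1).
Local Notation lam := (@lebesgue_outer R d).
Local Notation mu := (@lebesgue_measure R).
Variables (Om : set V) (F : V -> V) (Phi : R -> V -> V) (S : R).
Hypotheses (oOm : open Om) (fl : is_flow F Phi) (S0 : 0 < S).
Hypothesis exits : forall x, exists2 t, 0 <= t <= S & ~ Om (Phi t x).
Local Notation tau := (exit_time Om Phi).

Lemma meas_xof : mfunT (xof : BT -> BV).
Proof. by have /measurable_fun_pairP[] := @measurable_unpack R d. Qed.

Lemma meas_tof : mfunT (tof : BT -> R).
Proof. exact: measurable_coord. Qed.

Lemma measurable_cylinder T : measurable (cylinder Om T : set BT).
Proof.
rewrite (_ : cylinder Om T = (xof @^-1` Om) `&` (tof @^-1` `]0, T[)); last first.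
 by apply/seteqP; split=> z [h1 h2]; split=> //; move: h2; rewrite /= in_itv.
apply: measurableI; rewrite -[mset]setTI.
 by apply: meas_xof => //; exact: rVB_open.
by apply: meas_tof => //; exact: measurable_itv.
Qed.

Lemma measurable_lateral T : measurable (lateral Om T : set BT).
Proof.
rewrite (_ : lateral Om T = (xof @^-1` (bdry Om)) `&` (tof @^-1` `]0, T[)); last first.
 by apply/seteqP; split=> z [h1 h2]; split=> //; move: h2; rewrite /= in_itv.
apply: measurableI; rewrite -[mset]setTI.
 apply: meas_xof => //; apply: measurableD; first by apply: rVB_closed; exact: closed_closure.
 by apply: rVB_open; exact: open_interior.
by apply: meas_tof => //; exact: measurable_itv.
Qed.

Lemma measurable_flow_comp {dT} {T : measurableType dT} (a : T -> BV) (b : T -> R) :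
 mfunT a -> mfunT b -> mfunT (fun t => Phi (b t) (a t) : BV).
Proof.
move=> ma mb; apply: (measC (f := fun p : BV * R => Phi p.2 p.1 : BV) (g := fun t => (a t, b t))).
 exact: (measurable_flow2 fl).
exact: measurable_fun_pair.
Qed.

Lemma measurable_exit_point (eta : R) :
 mfunT (fun x : BV => pack (Phi (tau x) x : BV, tau x + eta)).
Proof.
have mt := measurable_exit_time oOm fl exits.
apply: measC; first exact: meas_pack.
apply: measurable_fun_pair; last by apply: measurable_funD => //; exact: measK.
by apply: measurable_flow_comp; [exact: measurable_id|exact: mt].
Qed.

(* The backward flow is a Lipschitz left inverse of x |-> (exit point, exit time). *)
Lemma exit_trace (T : R) : exists2 C : R, 0 < C & forall (eta : R) (G : BT -> \bar R), 0 < eta -> eta + S < T ->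
 mfunT G -> (forall z, (0 <= G z)%E) ->
 (\int[lamB]_(x in Om) G (pack (Phi (tau x) x : BV, tau x + eta)%R) <=
 C%:E * \int[surfB]_(z in lateral Om T) G z)%E.
Proof.
have [B B0 hB] := flow_speed fl.
have [K K0 hK] := flow_lipschitz fl T.
have KB : 0 < K + B + 1 by lra.
exists ((4 * (K + B + 1)) ^+ d.+1 / unit_ball_volume d.+1).
 by rewrite divr_gt0 ?unit_ball_volume_gt0// exprn_gt0// mulr_gt0.
move=> eta G eta0 etaT mG G0.
pose p (z : VT) : V := Phi (- (tof z - eta)) (xof z).
apply: (@integral_pushforward_le _ _ _ _ _ lamB surfB (fun x : BV => pack (Phi (tau x) x : BV, tau x + eta)) Om (lateral Om T)) => //.
- by rewrite divr_ge0 ?unit_ball_volume_ge0// exprn_ge0// mge0// ltW.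
- exact: measurable_exit_point.
- exact: rVB_open.
- exact: measurable_lateral.
move=> A mA; apply: le_trans (@lam_hausdorff_image _ _ p (K + B + 1) (lateral Om T `&` A) KB _); last first.
 move=> z z' [[_ /andP[z0 zT]] _] [[_ /andP[z0' zT']] _].
 have h1 : `|xof z - xof z'| <= `|z - z'|.
 have [j ->] := norm_coord (xof z - xof z').
 by have := coord_le (z - z') (lift ord_max j); rewrite !mxE.
 have h2 : `|tof z - tof z'| <= `|z - z'|.
 by have := coord_le (z - z') ord_max; rewrite !mxE.
 have tT : `|- (tof z - eta)| <= T.
 have key (t e u v : R) : 0 < t -> t < u -> 0 < e -> e + v < u -> 0 < v -> `|- (t - e)| <= u.
 by move=> *; rewrite normrN ler_norml; apply/andP; split; lra.
 exact: key z0 zT eta0 etaT S0.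
 have a1 := hK _ (xof z) (xof z') tT.
 have a2 := hB (- (tof z - eta)) (- (tof z' - eta)) (xof z').
 have e : - (tof z - eta) - - (tof z' - eta) = - (tof z - tof z') by ring.
 rewrite e normrN in a2.
 have := ler_distD (Phi (- (tof z - eta)) (xof z')) (p z) (p z').
 have : K * `|xof z - xof z'| <= K * `|z - z'| by rewrite ler_pM2l.
 have : B * `|tof z - tof z'| <= B * `|z - z'| by apply: ler_wpM2l.
 have := normr_ge0 (z - z').
 rewrite -/(p z) in a1; rewrite -/(p z') in a2.
 move: a1 a2; clear; rewrite !mulrDl mul1r => *; lra.
apply: le_lam => x [Ox Ax]; exists (pack (Phi (tau x) x : BV, tau x + eta)).
 split=> //; split; rewrite /pack/= ?xofE ?tofE.
 exact: (exit_time_bdry oOm fl exits).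
 have := exit_time_ge0 exits x; have := exit_time_le oOm fl S0 exits x.
 by move=> h1 h2; apply/andP; split; lra.
by rewrite /p /pack/= xofE tofE addrK (flow_invl fl).
Qed.

Let inside (eta : R) : set (BV * R) := [set p | eta <= p.2 < eta + tau p.1].

Let minside eta : measurable (inside eta).
Proof.
have mt := measurable_exit_time oOm fl exits.
rewrite (_ : inside eta = [set p | eta <= p.2] `&` [set p | p.2 < eta + tau p.1]); last first.
 by apply/seteqP; split=> p; rewrite /inside/=; [move=> /andP[]|move=> [-> ->]].
apply: measurableI.
 rewrite (_ : [set p | _] = snd @^-1` `[eta, +oo[); last by apply/seteqP; split=> p; rewrite /= in_itv/= andbT.
 by rewrite -[mset]setTI; apply: measurable_snd => //; exact: measurable_itv.
rewrite (_ : [set p | _] = (fun p : BV * R => eta + tau p.1 - p.2) @^-1` `]0, +oo[); last first.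
 by apply/seteqP; split=> p; rewrite /= in_itv/= andbT subr_gt0.
rewrite -[mset]setTI; apply: (_ : mfunT _) => //.
apply: measB; last exact: measurable_snd.
apply: measurable_funD; first exact: measK.
by apply: measC; [exact: mt|exact: measurable_fst].
Qed.

Let through (eta : R) (G : BV * R -> R) (p : BV * R) : R :=
 (eta <= p.2 < eta + tau p.1)%R%:R * G (Phi (p.2 - eta) p.1 : BV, p.2).

Let mthrough eta G : mfunT G -> mfunT (through eta G).
Proof.
move=> mG.
apply: measM.
 rewrite (_ : (fun _ => _) = \1_(inside eta)); first exact: measI.
 by apply/funext => p; rewrite indicE /inside mem_setE.
apply: (measC mG); apply: measurable_fun_pair; last exact: measurable_snd.
apply: measurable_flow_comp; first exact: measurable_fst.
by apply: measB; [exact: measurable_snd|exact: measK].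
Qed.

Lemma measurable_flow_integral (eta : R) (G : BV * R -> R) :
 mfunT G -> (forall p, 0 <= G p) ->
 mfunT (fun x : BV =>
 \int[mu]_t ((eta <= t < eta + tau x)%R%:R * G (Phi (t - eta) x : BV, t))%:E)%E.
Proof.
move=> mG G0; have mE : mfunT (EFin \o through eta G) by (apply/mEF; exact: mthrough).
apply: (measurable_fun_fubini_tonelli_F (m2 := mu) _ mE) => p.
by rewrite lee_fin mge0.
Qed.

Lemma flow_tonelli : exists2 C : R, 0 < C & forall (eta : R) (G : BV * R -> R),
 mfunT G -> (forall p, 0 <= G p) ->
 (\int[lamB]_x \int[mu]_t ((eta <= t < eta + tau x)%R%:R * G (Phi (t - eta) x : BV, t))%:E <=
 C%:E * \int[mu]_t \int[lamB]_y ((eta <= t <= eta + S)%R%:R * (\1_Om y * G (y, t)))%:E)%E.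
Proof.
have [C C0 hC] := flow_distortion S fl; exists C => // eta G mG G0.
pose G1 := through eta G; have mG1 : mfunT G1 by exact: mthrough.
have G10 p : (0 <= (G1 p)%:E)%E by rewrite lee_fin mge0.
pose G2 (p : BV * R) : R := (eta <= p.2 <= eta + S)%R%:R * (\1_Om p.1 * G p).
have mG2 : mfunT G2.
 apply: measM.
 rewrite (_ : (fun _ => _) = \1_`[eta, eta + S] \o snd).
 by apply: measC; [exact: measI|exact: measurable_snd].
 by apply/funext => p; rewrite /= indicE mem_setE in_itv.
 apply: measM => //.
 rewrite (_ : (fun _ => _) = \1_(Om : set BV) \o fst)//.
 by apply: measC; [apply: measI; exact: rVB_open|exact: measurable_fst].
have G20 p : (0 <= (G2 p)%:E)%E by rewrite lee_fin !mge0.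
have mE1 : mfunT (EFin \o G1) by exact/mEF.
have mE2 : mfunT (EFin \o G2) by exact/mEF.
have FT := fubini_tonelli (m1 := lamB) (m2 := mu) (EFin \o G1) mE1 G10.
rewrite [leLHS](_ : _ = \int[mu]_t \int[lamB]_x (EFin \o G1) (x, t))%E; last exact: FT.
rewrite [X in (_ <= _ * X)%E](_ : _ = \int[mu]_t \int[lamB]_y (EFin \o G2) (y, t))%E//.
have mF2 := measurable_fun_fubini_tonelli_G (m1 := lamB) _ mE2 G20.
rewrite -intZl//; try (by rewrite lee_fin ltW); try (by move=> t _; apply: integral_ge0 => y _; exact: G20).
apply: ge0_le_integral => //.
- by move=> t _; apply: integral_ge0 => y _; exact: G10.
- exact: (measurable_fun_fubini_tonelli_G (m1 := lamB) _ mE1 G10).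
- exact: measeM.
move=> t _; have [tin|tout] := boolP (eta <= t <= eta + S); last first.
 rewrite integral0_eq ?mule_ge0//; first by rewrite lee_fin ltW.
 by apply: integral_ge0 => y _; exact: G20.
 move=> x _; rewrite /G1/through /=; have [/andP[t1 t2]|_] := boolP (eta <= t < eta + tau x); last by rewrite mul0r.
 have := exit_time_le oOm fl S0 exits x => h.
 by move/negP: tout; case; rewrite t1/= ltW// (lt_le_trans t2)// lerD2l.
move/andP: (tin) => [t1 t2].
pose H (y : BV) : R := \1_Om y * G (y, t).
have mH : mfunT (EFin \o H).
 apply/mEF; apply: measM.
 by apply: measI; exact: rVB_open.
 exact: (measurable_fun_pair1 t mG).
apply: (le_via (\int[lamB]_x (EFin \o H) (Phi (t - eta) x : BV)))%E.
 apply: ge0_le_integral => //.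
 - by move=> x _; exact: G10.
 - exact: (measurable_fun_pair1 t mE1).
 - exact: (measC mH (measurable_flow fl _)).
 move=> x _; rewrite lee_fin /G1/through/H/=.
 have [/andP[_ tx]|_] := boolP (eta <= t < eta + tau x); last by rewrite mul0r mge0.
 rewrite indicE mem_set//; apply: (exit_time_in oOm fl exits); lra.
apply: le_trans (@integral_pushforward_le _ _ _ _ _ lamB lamB (Phi (t - eta) : BV -> BV) setT setT C _ _ _ _ _ (EFin \o H) mH _) _ => //.
- exact: ltW.
- exact: (measurable_flow fl).
- move=> A mA; rewrite !setTI; apply: hC.
 by rewrite ger0_norm; lra.
- by move=> y; rewrite lee_fin mge0.
apply: lee_wpmul2l; first by rewrite lee_fin ltW.
apply: ge0_le_integral => //.
- by move=> y _; rewrite lee_fin mge0.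
- exact: (measurable_fun_pair1 t mE2).
by move=> y _; rewrite lee_fin /G2/= tin mul1r.
Qed.

Lemma integral_antiderivative (g G : R -> R) (a b : R) : a < b -> continuous g ->
 (forall t : R, is_derive t 1 G (g t)) ->
 (\int[mu]_(t in `[a, b]) (g t)%:E = (G b - G a)%:E)%E.
Proof.
move=> ab cg dG.
have cG : continuous G by move=> t; apply/differentiable_continuous/derivable1_diffP; have [] := dG t.
rewrite EFinB; apply: continuous_FTC2 => //.
- exact: continuous_subspaceT.
- split=> [t _||]; first by have [] := dG t.
 exact: cvg_at_right_filter (cG a).
 exact: cvg_at_left_filter (cG b).
- by move=> t _; rewrite derive1E; have [_ ->] := dG t.
Qed.

Definition along (phi : VT -> R) (z : VT) : R := dot (grad phi z) (spacetime (F (xof z)) 1).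

Definition excess (M : R) (phi : VT -> R) (z : VT) : R := Num.max 0 (`|along phi z| - M * `|phi z|).

Lemma curve_derive (x : V) (eta t : R) :
 is_derive_rV (fun t => spacetime (Phi (t - eta) x) t) t (spacetime (F (Phi (t - eta) x)) 1).
Proof.
move=> j; rewrite mxE; case: unliftP => [i ->|->].
 rewrite (_ : (fun _ => _) = (fun s : R => Phi (s - eta) x ord0 i)); last first.
 by apply/funext => s; rewrite mxE liftK.
 have /is_derive_eps h := flow_derive fl (t - eta) x i; apply/is_derive_eps => e e0.
 have [r r0 hr] := h e e0; exists r => // u ur.
 by rewrite (_ : t + u - eta = t - eta + u); [exact: hr|ring].
rewrite (_ : (fun _ => _) = id); last by apply/funext => s; rewrite mxE unlift_none.
exact: is_derive_id.
Qed.

Lemma curve_lipschitz (x : V) (eta : R) : exists2 B : R, 0 <= B &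
 forall s t : R, `|spacetime (Phi (s - eta) x) s - spacetime (Phi (t - eta) x) t| <= B * `|s - t|.
Proof.
have [B B0 hB] := flow_speed fl; exists (B + 1); first by lra.
move=> s t; have [j ->] := norm_coord (spacetime (Phi (s - eta) x) s - spacetime (Phi (t - eta) x) t).
rewrite !mxE; case: unliftP => [i _|_]; last first.
 by rewrite mulrDl mul1r lerDr mge0.
have := coord_le (Phi (s - eta) x - Phi (t - eta) x) i; rewrite !mxE => h; apply: le_trans h _.
have := hB (s - eta) (t - eta) x; rewrite (_ : s - eta - (t - eta) = s - t); last by ring.
by move=> h; apply: le_trans h _; rewrite ler_wpM2r// lerDl.
Qed.

Variable L : R.
Hypotheses (L0 : 0 <= L) (FL : forall x y, `|F x - F y| <= L * `|x - y|).

Lemma excess_continuous (M : R) (phi : VT -> R) (x : V) (eta : R) : Ck_on 1 setT phi ->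
 continuous (fun t => excess M phi (spacetime (Phi (t - eta) x) t)).
Proof.
move=> [cphi c1].
have [B B0 hB] := curve_lipschitz x eta.
pose c (t : R) : VT := spacetime (Phi (t - eta) x) t.
have cc : continuous c by exact: lipschitz_curve_continuous hB.
have cF : continuous (fun t => F (Phi (t - eta) x)).
 have [B1 B10 hB1] := flow_speed fl.
 apply: (@lipschitz_curve_continuous _ _ _ (L * B1)) => s t.
 apply: le_trans (FL _ _) _; rewrite -mulrA; apply: ler_wpM2l => //.
 by apply: le_trans (hB1 _ _ _) _; rewrite (_ : s - eta - (t - eta) = s - t)//; ring.
have cphic : continuous (phi \o c).
 by move=> t; apply: continuous_comp; [exact: cc|exact: (cphi (c t))].
have calong : continuous (fun t => along phi (c t)).
 apply: (@continuous_big _ _ _ 0 _ (@add_continuous R)) => j _ t; apply: cvgM.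
 rewrite (_ : (fun t => _) = partial j phi \o c); last by apply/funext => s; rewrite /= mxE.
 by rewrite mxE; apply: continuous_comp; [exact: cc|have [_ [+ _]] := c1 j; exact].
 rewrite /c; case: (unliftP ord_max j) => [i ->|->].
 rewrite (_ : (fun t => _) = (fun t => F (Phi (t - eta) x) ord0 i)); last first.
 by apply/funext => s; rewrite mxE liftK xofE.
 rewrite mxE liftK xofE.
 apply: (continuous_comp (f := fun t => F (Phi (t - eta) x)) (g := fun v : V => v ord0 i)); first exact: cF.
 exact: coord_continuous.
 rewrite (_ : (fun t => _) = (fun=> 1)); last by apply/funext => s; rewrite mxE unlift_none.
 by rewrite mxE unlift_none; exact: cvg_cst.
pose g (t : R) := `|along phi (c t)| - M * `|phi (c t)|.
have cg : continuous g.
 move=> t; apply: cvgB; first by apply: cvg_norm; exact: calong.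
 by apply: cvgMr; apply: cvg_norm; exact: cphic.
rewrite (_ : (fun t => _) = (fun t => (g t + `|g t|) / 2)); last first.
 apply/funext => t; rewrite /excess -/(c t) -/(g t).
 have [g0|g0] := leP 0 (g t); first by rewrite ger0_norm//; lra.
 by rewrite ltr0_norm//; lra.
by move=> t; apply: cvgMl; apply: cvgD; [exact: cg|apply: cvg_norm; exact: cg].
Qed.

Lemma transport_bound (M : R) (phi : VT -> R) (x : V) (eta : R) : Ck_on 1 setT phi -> 0 <= M -> Om x ->
 ((phi (spacetime x eta) ^+ 2)%:E <= (expR ((2 * M + 1) * S))%:E *
 ((phi (spacetime (Phi (tau x) x) (tau x + eta)) ^+ 2)%:E +
 \int[mu]_t ((eta <= t < eta + tau x)%R%:R * excess M phi (spacetime (Phi (t - eta) x) t) ^+ 2)%:E))%E.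
Proof.
move=> cphi M0 Ox; have t0 := exit_time_gt0 oOm fl exits Ox.
have tS := exit_time_le oOm fl S0 exits x.
pose c (t : R) : VT := spacetime (Phi (t - eta) x) t.
pose g (t : R) := excess M phi (c t).
have cg : continuous g by exact: excess_continuous.
have cg2 : continuous (fun t => g t ^+ 2).
 by move=> t; apply: (cvgM (cg t) (cg t)).
have [G G0 dG] := continuous_antiderivative cg2.
pose k := 2 * M + 1; have k0 : 0 < k by rewrite /k; lra.
pose b (t : R) := phi (c t); pose db (t : R) := along phi (c t).
have dbP (t : R) : is_derive t 1 b (db t).
 rewrite /db /along /c xofE.
 apply: (is_derive_comp_strict (c := c)); last exact: curve_derive.
 exact: (Ck_strict openT cphi).
have dble (t : R) : `|db t| <= M * `|b t| + g t.
 by rewrite -lerBlDl /g /excess le_max lexx orbT.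
have g0 (t : R) : 0 <= g t by rewrite /g /excess le_max lexx.
pose y (t : R) := expR (k * t) * b t ^+ 2 + expR (k * (eta + S)) * G t.
pose dy (t : R) := expR (k * t) * (k * b t ^+ 2 + 2 * b t * db t) + expR (k * (eta + S)) * g t ^+ 2.
have dyP (t : R) : is_derive t 1 y (dy t).
 have d1 := is_deriveM (dbP t) (dbP t).
 have d2 := is_deriveM (is_derive_expRM k t) d1.
 have d3 := is_deriveM (is_derive_cst (expR (k * (eta + S))) t 1) (dG t).
 have d4 := is_deriveD d2 d3.
 rewrite (_ : y = (fun s => expR (k * s)) * (b * b) + cst (expR (k * (eta + S))) * G); last first.
 by apply/funext => s; rewrite /y expr2.
 apply: is_derive_eq d4 _.
 rewrite /dy; rewrite /GRing.scale/= /cst/= !mulr0 addr0 !expr2.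
 by rewrite (_ : (b * b) t = b t * b t)//; ring.
have dy0 (t : R) : t <= eta + tau x -> 0 <= dy t.
 move=> tt; have e1 : expR (k * t) <= expR (k * (eta + S)).
 by rewrite ler_expR ler_pM2l//; lra.
 have e0 := expR_gt0 (k * t).
 have h1 : - (g t ^+ 2) <= k * b t ^+ 2 + 2 * b t * db t.
 have a1 : - (`|b t| * (M * `|b t| + g t)) <= b t * db t.
 rewrite lerNl; apply: le_trans (ler_norm _) _; rewrite normrN normrM; exact: ler_wpM2l.
 have a2 : `|b t| ^+ 2 = b t ^+ 2 by rewrite real_normK// num_real.
 have a3 : 0 <= (`|b t| - g t) ^+ 2 by exact: sqr_ge0.
 rewrite -a2; exact: (@energy_growth _ M).
 have h2 : expR (k * t) * - (g t ^+ 2) <= expR (k * t) * (k * b t ^+ 2 + 2 * b t * db t).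
 by rewrite ler_pM2l.
 have h3 : expR (k * t) * (g t ^+ 2) <= expR (k * (eta + S)) * (g t ^+ 2).
 by apply: ler_wpM2r => //; exact: sqr_ge0.
 rewrite /dy; rewrite mulrN in h2; move: (h2) (h3); lra.
have le_et : eta <= eta + tau x by rewrite lerDl ltW.
have := @derive_nonneg_le _ y dy eta (eta + tau x) le_et (fun t _ => dyP t).
move=> /(_ _)/wrap[|yle]; first by move=> t /andP[_]; exact: dy0.
have IG : (\int[mu]_t ((eta <= t < eta + tau x)%R%:R * g t ^+ 2)%:E = (G (eta + tau x) - G eta)%:E)%E.
 rewrite -(@integral_antiderivative (fun t => g t ^+ 2) G)//; last by rewrite ltrDl.
 rewrite -integral_itv_bndo_bndc; last first.
 apply/mEF; apply: measTS; exact: measF.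
 rewrite [RHS]integral_mulI; apply: eq_integral => t _.
 by rewrite indicE mem_setE in_itv.
rewrite [X in (_ <= _ * (_ + X))%E]IG -EFinD -EFinM lee_fin.
have ce : spacetime x eta = c eta by rewrite /c subrr (flow_init fl).
have ce' : spacetime (Phi (tau x) x) (tau x + eta) = c (eta + tau x).
 by rewrite /c addrAC subrr add0r addrC.
rewrite ce ce' -/(b eta) -/(b (eta + tau x)).
have ek : expR (k * (eta + S)) = expR (k * eta) * expR (k * S) by rewrite mulrDr expRD.
have e0 := expR_gt0 (k * eta).
rewrite -(ler_pM2l e0) mulrA -ek -/k.
have h3 : expR (k * (eta + tau x)) * b (eta + tau x) ^+ 2 <= expR (k * (eta + S)) * b (eta + tau x) ^+ 2.
 apply: ler_wpM2r; first exact: sqr_ge0.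
 by rewrite ler_expR ler_pM2l// lerD2l.
have key (A E1 B g0' g1 b1 : R) : A + E1 * g0' <= B + E1 * g1 -> B <= E1 * b1 -> A <= E1 * (b1 + (g1 - g0')).
 by move=> *; lra.
exact: key yle h3.
Qed.

Lemma exp_exit_flow (l eta t : R) (x : V) : eta <= t < eta + tau x ->
 expR (- l * tau x) = expR (- l * (t - eta)) * expR (- l * tau (Phi (t - eta) x)).
Proof.
move=> /andP[t1 t2]; rewrite (exit_time_flow oOm fl exits); [|lra..].
by rewrite -expRD; congr expR; ring.
Qed.

Lemma slab_estimate (M T : R) : 0 <= M -> exists2 C : R, 0 < C &
 forall (phi : VT -> R) (k : R -> R) (f : BV -> R) (eps : BT -> R) (l eta : R),
 Ck_on 1 setT phi -> mfunT k -> mfunT f -> mfunT eps ->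
 (forall z, 0 <= eps z) -> (forall z, excess M phi z <= k (tof z) * `|f (xof z)| + eps z) ->
 0 < eta -> eta + S < T -> 0 <= l ->
 (\int[lamB]_(x in Om) ((expR (- l * tau x) * phi (spacetime x eta)) ^+ 2)%:E <=
 C%:E * (\int[surfB]_(z in lateral Om T) (phi z ^+ 2)%:E +
 (\int[mu]_t ((eta <= t <= eta + S)%R%:R * (k t * expR (- l * (t - eta))) ^+ 2)%:E) *
 \int[lamB]_(x in Om) ((expR (- l * tau x) * f x) ^+ 2)%:E +
 \int[lamB]_(z in cylinder Om T) (eps z ^+ 2)%:E))%E.
Proof.
move=> M0; have [C1 C10 hC1] := exit_trace T; have [C2 C20 hC2] := flow_tonelli.
set E := expR ((2 * M + 1) * S); have E0 : 0 < E by exact: expR_gt0.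
exists (E * (C1 + 2 * C2)); first by rewrite mulr_gt0// addr_gt0// mulr_gt0.
move=> phi k f eps l eta cphi mk mf me e0 hex eta0 etaT l0.
have mt := measurable_exit_time oOm fl exits.
pose om (x : BV) := expR (- l * tau x).
have mom : mfunT om by apply: measC => //; apply: measM.
pose a t := (eta <= t <= eta + S)%R%:R * (k t * expR (- l * (t - eta))) ^+ 2.
pose G (p : BV * R) := 2 * (k p.2 * expR (- l * (p.2 - eta))) ^+ 2 * (om p.1 * f p.1) ^+ 2 + 2 * eps (pack p) ^+ 2.
have mke : mfunT (fun t : R => k t * expR (- l * (t - eta))).
 apply: measM => //; apply: measC => //.
 by apply: measM => //; apply: measB.
have mof : mfunT (fun x => om x * f x) by exact: measM.
have mG : mfunT G.
 apply: measurable_funD.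
 apply: measM; first apply: measM => //.
 by apply: measX; apply: (measC mke); exact: measurable_snd.
 by apply: measX; apply: (measC mof); exact: measurable_fst.
 apply: measM => //; apply: measX.
 by apply: (measC me); exact: meas_pack.
have G0 (p : BV * R) : 0 <= G p by rewrite addr_ge0// mge0// ?sqr_ge0// mge0// sqr_ge0.
have mphi : mfunT (phi : BT -> R).
 by apply: cont_meas => z; have [+ _] := cphi; apply.
have mA : mfunT (fun z : BT => (phi z ^+ 2)%:E).
 by apply/mEF; exact: measX.
pose J (x : BV) := (\int[mu]_t ((eta <= t < eta + tau x)%R%:R * G (Phi (t - eta) x : BV, t))%:E)%E.
have mJ : mfunT J by exact: measurable_flow_integral.
have J0 x : (0 <= J x)%E by apply: integral_ge0 => t _; rewrite lee_fin mge0.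
have om0 x : 0 < om x by exact: expR_gt0.
have om1 x : om x <= 1.
 by rewrite /om mulNr -[leRHS]expR0 ler_expR oppr_le0 mge0// (exit_time_ge0 exits).
have omsq x : om x ^+ 2 <= 1 by rewrite expr_le1// ltW.
have point x : Om x -> (((om x * phi (spacetime x eta)) ^+ 2)%:E <=
 E%:E * ((phi (pack (Phi (tau x) x : BV, tau x + eta)) ^+ 2)%:E + J x))%E.
 move=> Ox; rewrite exprMn EFinM.
 apply: le_trans (lee_wpmul2l _ (transport_bound eta cphi M0 Ox)) _; first by rewrite lee_fin sqr_ge0.
 rewrite muleCA; apply: lee_wpmul2l; first by rewrite lee_fin ltW.
 rewrite ge0_muleDr; [|by rewrite lee_fin sqr_ge0|]; last first.
 by apply: integral_ge0 => t _; rewrite lee_fin mge0 ?sqr_ge0.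
 apply: leeD.
 by rewrite -EFinM lee_fin ler_piMl// sqr_ge0.
 have mex : mfunT (fun t : R => ((eta <= t < eta + tau x)%R%:R * excess M phi (spacetime (Phi (t - eta) x) t) ^+ 2)%:E).
 apply/mEF; apply: measM.
 rewrite (_ : (fun _ => _) = \1_`[eta, eta + tau x[); first exact: measI.
 by apply/funext => t; rewrite indicE mem_setE in_itv.
 apply: measX; apply: measF; exact: excess_continuous.
 have mth : mfunT (fun t : R => ((eta <= t < eta + tau x)%R%:R * G (Phi (t - eta) x : BV, t))%:E).
 by apply/mEF; exact: (measurable_fun_pair2 (x : BV) (mthrough eta mG)).
 rewrite -intZl//; last 2 first.
 - by move=> t _; rewrite lee_fin mge0 ?sqr_ge0.
 - by rewrite lee_fin sqr_ge0.
 apply: ge0_le_integral => //.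
 - by move=> t _; rewrite -EFinM lee_fin mge0 ?sqr_ge0// mge0 ?sqr_ge0.
 - exact: measeM.
 move=> t _; rewrite -EFinM lee_fin mulrCA; have [tin|] := boolP (eta <= t < eta + tau x); last by rewrite !mul0r.
 rewrite !mul1r /G/=; apply: (@excess_square R (om x) (expR (- l * (t - eta))) (om (Phi (t - eta) x)) _ (k t) (f (Phi (t - eta) x))) => //.
 - exact: exp_exit_flow.
 - by rewrite /excess le_max lexx.
 - by have := hex (spacetime (Phi (t - eta) x) t); rewrite tofE xofE.
have mOm : measurable (Om : set BV) by exact: rVB_open.
have mAe : mfunT (fun x : BV => (phi (pack (Phi (tau x) x : BV, tau x + eta)) ^+ 2)%:E).
 by apply: (measC mA); exact: measurable_exit_point.
have mphieta : mfunT (fun x : BV => phi (spacetime x eta)).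
 apply: (measC mphi (g := fun x : BV => pack (x, eta))).
 by apply: (measurable_fun_pair1 eta); exact: meas_pack.
apply: (le_via (\int[lamB]_(x in Om) (E%:E * ((phi (pack (Phi (tau x) x : BV, tau x + eta)) ^+ 2)%:E + J x)))%E).
 apply: ge0_le_integral => //.
 - by move=> x _; rewrite lee_fin sqr_ge0.
 - by apply: measTS; apply/mEF; apply: measX; exact: measM.
 - by apply: measTS; apply: measeM; exact: emeasurable_funD.
rewrite intZl//; try (by apply: measTS; exact: emeasurable_funD);
 try (by move=> x _; rewrite adde_ge0// lee_fin sqr_ge0); try (by rewrite lee_fin ltW).
rewrite [X in (_ <= X * _)%E]EFinM -muleA; apply: lee_wpmul2l; first by rewrite lee_fin ltW.
rewrite ge0_integralD//; try (by move=> x _; rewrite lee_fin sqr_ge0); try exact: measTS.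
set I1 := (\int[surfB]_(z in lateral Om T) _)%E.
set I2 := (integral mu _ _ * _)%E; set I3 := (\int[lamB]_(z in cylinder _ _) _)%E.
have I10 : (0 <= I1)%E by apply: integral_ge0 => z _; rewrite lee_fin sqr_ge0.
have I20 : (0 <= I2)%E.
 apply: mule_ge0; first by apply: integral_ge0 => t _; rewrite lee_fin; apply: mge0 => //; exact: sqr_ge0.
 by apply: integral_ge0 => t _; rewrite lee_fin sqr_ge0.
have I30 : (0 <= I3)%E by apply: integral_ge0 => z _; rewrite lee_fin sqr_ge0.
have b1 := hC1 eta _ eta0 etaT mA (fun z => ltac:(by rewrite lee_fin sqr_ge0)).
have b2 : (\int[lamB]_(x in Om) J x <= C2%:E * (2%:E * I2 + 2%:E * I3))%E.
 apply: (le_via (\int[lamB]_x J x)%E); first by apply: ge0_subset_integral.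
 apply: le_trans (hC2 eta G mG G0) _; apply: lee_wpmul2l; first by rewrite lee_fin ltW.
 pose h (y : BV) : R := \1_Om y * (om y * f y) ^+ 2.
 pose e (y : BV) (t : R) : R := \1_(cylinder Om T) (pack (y, t)) * eps (pack (y, t)) ^+ 2.
 have h0 y : 0 <= h y by rewrite mge0 ?sqr_ge0.
 have ee0 y t : 0 <= e y t by rewrite mge0 ?sqr_ge0.
 have a0 t : 0 <= a t by rewrite mge0 ?sqr_ge0.
 have mh : mfunT h.
 by apply: measM; [exact: measI|exact: measX].
 have mez : mfunT (fun z : BT => (\1_(cylinder Om T) z * eps z ^+ 2)%:E).
 apply/mEF; apply: measM; last exact: measX.
 by apply: measI; exact: measurable_cylinder.
 have mep : mfunT (fun p : BV * R => (e p.1 p.2)%:E).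
 by rewrite (_ : (fun _ => _) = (fun z : BT => (\1_(cylinder Om T) z * eps z ^+ 2)%:E) \o pack);
 [apply: (measC mez); exact: meas_pack|apply/funext => -[]].
 have mae : mfunT a.
 apply: measM; last exact: measX.
 rewrite (_ : (fun _ => _) = \1_`[eta, eta + S]); first exact: measI.
 by apply/funext => t; rewrite indicE mem_setE in_itv.
 have mee : mfunT (fun t : R => \int[lamB]_y (e y t)%:E)%E.
 by apply: (measurable_fun_fubini_tonelli_G (m1 := lamB) _ mep) => p; rewrite lee_fin.
 pose g (p : BV * R) : R := (eta <= p.2 <= eta + S)%R%:R * (\1_Om p.1 * G p).
 have g0 p : (0 <= (g p)%:E)%E by rewrite lee_fin mge0// mge0.
 have mg : mfunT (EFin \o g).
 apply/mEF; apply: measM.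
 rewrite (_ : (fun _ => _) = \1_`[eta, eta + S] \o snd).
 by apply: measC; [exact: measI|exact: measurable_snd].
 by apply/funext => p; rewrite /= indicE mem_setE in_itv.
 apply: measM => //.
 rewrite (_ : (fun _ => _) = \1_(Om : set BV) \o fst)//.
 by apply: measC; [exact: measI|exact: measurable_fst].
 have Ih : (0 <= \int[lamB]_y (h y)%:E)%E by apply: integral_ge0 => y _; rewrite lee_fin.
 have Ie t : (0 <= \int[lamB]_y (e y t)%:E)%E by apply: integral_ge0 => y _; rewrite lee_fin.
 have mhe : mfunT (fun y => (h y)%:E) by exact/mEF.
 have mat : mfunT (fun t => ((2 * a t)%:E * \int[lamB]_y (h y)%:E)%E).
 by apply: emeasurable_funM => //; apply/mEF; exact: measM.
 apply: (le_via (\int[mu]_t ((2 * a t)%:E * \int[lamB]_y (h y)%:E + 2%:E * \int[lamB]_y (e y t)%:E))%E).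
 apply: ge0_le_integral => //.
 - by move=> t _; apply: integral_ge0 => y _; exact: (g0 (y, t)).
 - exact: (measurable_fun_fubini_tonelli_G (m1 := lamB) _ mg g0).
 - by apply: emeasurable_funD => //; exact: measeM.
 move=> t _; have met : mfunT (fun y => (e y t)%:E) by exact: (measurable_fun_pair1 t mep).
 have m1 : mfunT (fun y => (2 * a t)%:E * (h y)%:E)%E by exact: measeM.
 have m2 : mfunT (fun y => 2%:E * (e y t)%:E)%E by exact: measeM.
 rewrite -intZl//; [|by move=> y _; rewrite lee_fin|by rewrite lee_fin mge0].
 rewrite -intZl//; [|by move=> y _; rewrite lee_fin].
 have n1 y : (0 <= (2 * a t)%:E * (h y)%:E)%E.
 by rewrite -EFinM lee_fin; apply: mge0 => //; exact: mge0.
 have n2 y : (0 <= 2%:E * (e y t)%:E)%E by rewrite -EFinM lee_fin; exact: mge0.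
 rewrite -ge0_integralD//; try (by move=> y _; exact: n1); try (by move=> y _; exact: n2).
 apply: ge0_le_integral => //.
 - by move=> y _; exact: (g0 (y, t)).
 - exact: (measurable_fun_pair1 t mg).
 - exact: emeasurable_funD.
 move=> y _; rewrite -!EFinM -EFinD lee_fin; have [tin|] := boolP (eta <= t <= eta + S); last first.
 by move=> _; rewrite mul0r; have := adde_ge0 (n1 y) (n2 y); rewrite -!EFinM -EFinD lee_fin.
 rewrite mul1r; have [Oy|nOy] := pselect (Om y); last first.
 by rewrite indicE memNset// mul0r; have := adde_ge0 (n1 y) (n2 y); rewrite -!EFinM -EFinD lee_fin.
 have cy : cylinder Om T (pack (y, t)).
 rewrite /cylinder/pack/= xofE tofE; split => //.
 by move/andP: tin => [t1 t2]; apply/andP; split; [apply: lt_le_trans t1|apply: le_lt_trans t2 _].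
 by rewrite /h /e /a /G tin !indicE !mem_set// !mul1r.
 have n3 t : (0 <= (2 * a t)%:E * \int[lamB]_y (h y)%:E)%E by apply: mule_ge0 => //; rewrite lee_fin; exact: mge0.
 have n4 t : (0 <= 2%:E * \int[lamB]_y (e y t)%:E)%E by exact: mule_ge0.
 rewrite ge0_integralD//; try (by move=> t _; exact: n3); try (by move=> t _; exact: n4); try exact: measeM.
 apply: leeD.
 rewrite ge0_integralZr//; try (by apply/mEF; exact: measM);
 try (by move=> t _; rewrite lee_fin mge0).
 rewrite /I2 muleA [X in (_ <= _ * X)%E]integral_mulI; apply: lee_wpmul2r; first exact: Ih.
 under eq_integral do rewrite EFinM.
 by rewrite intZl//; [exact/mEF|move=> t _; rewrite lee_fin].
 rewrite intZl//; apply: lee_wpmul2l => //.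
 rewrite /I3 integral_mulI lamB_tonelli2//; last by move=> z; rewrite lee_fin mge0 ?sqr_ge0.
rewrite EFinD EFinM.
apply: le_trans (leeD b1 b2) _.
have C1e : (0 <= C1%:E)%E by rewrite lee_fin ltW.
have C2e : (0 <= C2%:E)%E by rewrite lee_fin ltW.
rewrite -ge0_muleDr// muleA (muleC C2%:E).
have I23 : (0 <= I2 + I3)%E by exact: adde_ge0.
rewrite -addeA ge0_muleDl//; last by rewrite mule_ge0.
by rewrite leeD// lee_wpmul2l ?mule_ge0// ?leeDl ?leeDr.
Qed.

End exit_estimates.

Section smooth_functions.
Context {R : realType}.

Fixpoint ndiff (k : nat) (g : R -> R) : Prop :=
 if k is k'.+1 then exists2 g' : R -> R, (forall t : R, is_derive t 1 g (g' t)) & ndiff k' g'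
 else continuous g.

Definition smooth1 (g : R -> R) := forall k, ndiff k g.

Lemma is_derive_continuous (g g' : R -> R) : (forall t : R, is_derive t 1 g (g' t)) -> continuous g.
Proof. by move=> dg t; apply/differentiable_continuous/derivable1_diffP; have [] := dg t. Qed.

Lemma ndiff_weaken k g : ndiff k.+1 g -> ndiff k g.
Proof.
elim: k g => [|k IH] g [g' dg sg]; first exact: is_derive_continuous dg.
by exists g' => //; exact: IH.
Qed.

Lemma smooth1_derive g : smooth1 g -> exists2 g', (forall t : R, is_derive t 1 g (g' t)) & smooth1 g'.
Proof.
move=> sg; have [g' dg _] := sg 1%N; exists g' => // k.
have [g1 dg1 sg1] := sg k.+1; rewrite (_ : g' = g1)//.
by apply/funext => t; have [_ <-] := dg t; have [_ <-] := dg1 t.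
Qed.

Lemma smooth1_intro g g' : (forall t : R, is_derive t 1 g (g' t)) -> smooth1 g' -> smooth1 g.
Proof. by move=> dg sg [|k]; [exact: is_derive_continuous dg|exists g']. Qed.

Lemma smooth1_cont g : smooth1 g -> continuous g.
Proof. by move=> /(_ 0). Qed.

Lemma ndiff_cst k (c : R) : ndiff k (cst c).
Proof.
elim: k c => [|k IH] c; first by move=> t; exact: cvg_cst.
by exists (cst 0) => // t; exact: is_derive_cst.
Qed.

Lemma ndiffD k f g : ndiff k f -> ndiff k g -> ndiff k (fun t => f t + g t).
Proof.
elim: k f g => [f g cf cg t|k IH f g [f' df sf] [g' dg sg]]; first by apply: cvgD; [exact: cf|exact: cg].
exists (fun t => f' t + g' t); last exact: IH.
by move=> t; have := is_deriveD (df t) (dg t).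
Qed.

Lemma ndiffM k f g : ndiff k f -> ndiff k g -> ndiff k (fun t => f t * g t).
Proof.
elim: k f g => [f g cf cg t|k IH f g nf ng]; first by apply: cvgM; [exact: cf|exact: cg].
have [f' df sf] := nf; have [g' dg sg] := ng.
exists (fun t => f t * g' t + g t * f' t); first by move=> t; have := is_deriveM (df t) (dg t).
by apply: ndiffD; apply: IH => //; exact: ndiff_weaken.
Qed.

Lemma is_derive_affine (c e t : R) : is_derive t 1 (fun s : R => c * s + e) c.
Proof. by have := is_deriveD (is_derive_linear c t) (is_derive_cst e t 1); rewrite addr0. Qed.

Lemma ndiff_affine k g (c e : R) : ndiff k g -> ndiff k (fun t => g (c * t + e)).
Proof.
elim: k g => [g cg t|k IH g [g' dg sg]].
 apply: (continuous_comp (f := fun t : R => c * t + e)); last exact: cg.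
 by apply: is_derive_continuous => s; exact: is_derive_affine.
exists (fun t => c * g' (c * t + e)); last by apply: ndiffM; [exact: ndiff_cst|exact: IH].
move=> t; have := @is_derive1_comp _ g (fun s => c * s + e) t _ _ (dg _) (is_derive_affine c e t).
by rewrite mulrC.
Qed.

Lemma smooth1M f g : smooth1 f -> smooth1 g -> smooth1 (fun t => f t * g t).
Proof. by move=> sf sg k; exact: ndiffM. Qed.

Lemma smooth1_affine g (c e : R) : smooth1 g -> smooth1 (fun t => g (c * t + e)).
Proof. by move=> sg k; exact: ndiff_affine. Qed.

Lemma smooth1_scale g (c : R) : smooth1 g -> smooth1 (fun t => c * g t).
Proof. by move=> sg k; apply: ndiffM => //; exact: ndiff_cst. Qed.

Definition flat (m : nat) (t : R) : R := if 0 < t then t^-1 ^+ m * expR (- t^-1) else 0.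

Lemma flat_ge0 m t : 0 <= flat m t.
Proof.
rewrite /flat; case: ifP => // t0; apply: mge0; last exact: expR_ge0.
by rewrite exprn_ge0// invr_ge0 ltW.
Qed.

Lemma flat_bound m t : flat m t <= (m.+2)`!%:R * t ^+ 2.
Proof.
rewrite /flat; case: ifPn => t0; last by rewrite mge0// sqr_ge0.
have s0 : 0 <= t^-1 by rewrite invr_ge0 ltW.
have h := expR_ge1Dxn m.+1 s0.
have f0 : 0 < (m.+2)`!%:R :> R by rewrite ltr0n fact_gt0.
have h2 : t^-1 ^+ m.+2 <= (m.+2)`!%:R * expR t^-1.
 by rewrite mulrC -ler_pdivrMr//; lra.
rewrite expRN -(ler_pM2r (expR_gt0 t^-1)) mulfVK ?gt_eqF ?expR_gt0//.
have t2 : 0 < t ^+ 2 by rewrite exprn_gt0.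
rewrite -(ler_pM2r (_ : 0 < t ^- 2)) ?invr_gt0//.
rewrite [leRHS](_ : _ = (m.+2)`!%:R * expR t^-1); last by field; rewrite gt_eqF.
by apply: le_trans h2; rewrite -exprVn -exprD addn2.
Qed.

Lemma flat_derive m (t : R) : is_derive t 1 (flat m) (flat m.+2 t - m%:R * flat m.+1 t).
Proof.
have [t0|t0|t0] := ltgtP 0 t.
- have d1 : is_derive t 1 (fun s : R => s^-1 ^+ m * expR (- s^-1)) (flat m.+2 t - m%:R * flat m.+1 t).
 have tn : t != 0 by rewrite gt_eqF.
 have di : is_derive t 1 (fun s : R => s^-1) (- t^-1 ^+ 2).
 by apply: is_derive_eq (@is_deriveV _ id t 1 1 tn (is_derive_id t 1)) _; rewrite [_ *: _]mulr1 exprVn.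
 have dn := is_deriveN di.
 have de := @is_derive1_comp _ expR (fun s => - s^-1) t _ _ (is_derive_expR _) dn.
 case: m => [|m].
 rewrite (_ : (fun _ => _) = (fun s : R => expR (- s^-1))); last by apply/funext => s; rewrite mul1r.
 apply: is_derive_eq de _; rewrite /flat t0 /=.
 by rewrite /GRing.scale/=; ring.
 have dX := is_deriveX m.+1 di.
 have d2 := is_deriveM dX de.
 rewrite (_ : (fun _ => _) = (fun s : R => s^-1) ^+ m.+1 * (expR \o (fun s : R => - s^-1))); last first.
 by rewrite exprfctE.
 by apply: is_derive_eq d2 _; rewrite exprfctE /flat t0 /= /GRing.scale/= !exprS /=; ring.
 move/is_derive_eps: d1 => d1; apply/is_derive_eps => e e0.
 have [r r0 hr] := d1 e e0; exists (Num.min r t); first by rewrite lt_min r0.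
 move=> u; rewrite lt_min => /andP[ur ut].
 have tu : 0 < t + u by move: ut; rewrite ltr_norml => /andP[]; lra.
 have fE s : 0 < s -> flat m s = s^-1 ^+ m * expR (- s^-1) by rewrite /flat => ->.
 by rewrite !fE//; exact: hr.
- apply/is_derive_eps => e e0; exists (- t); first by rewrite oppr_gt0.
 move=> u ut; have tu : t + u <= 0 by move: ut; rewrite ltr_norml => /andP[]; lra.
 by rewrite /flat !(ltNge 0) tu (ltW t0)/= !(mulr0, subr0) normr0 mge0// ltW.
rewrite -t0; apply/is_derive_eps => e e0.
have f0 : 0 < (m.+2)`!%:R :> R by rewrite ltr0n fact_gt0.
exists (e / (m.+2)`!%:R); first exact: divr_gt0.
have f00 k : flat k 0 = 0 by rewrite /flat ltxx.
move=> u ur; rewrite add0r !f00 !(mulr0, subr0) ger0_norm ?flat_ge0//.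
apply: le_trans (flat_bound _ _) _; rewrite -real_normK ?num_real// expr2 mulrA ler_wpM2r//.
by rewrite mulrC -ler_pdivlMr// ltW.
Qed.

Lemma smooth1_flat m : smooth1 (flat m).
Proof.
move=> k; elim: k m => [|k IH] m; first by apply: is_derive_continuous => t; exact: flat_derive.
exists (fun t => flat m.+2 t - m%:R * flat m.+1 t); first by move=> t; exact: flat_derive.
rewrite (_ : (fun _ => _) = (fun t => flat m.+2 t + (- m%:R) * flat m.+1 t)); last first.
 by apply/funext => t; rewrite mulNr.
by apply: ndiffD => //; apply: ndiffM => //; exact: ndiff_cst.
Qed.

Definition hump (a b : R) (n : nat) (t : R) : R := flat 0 (n.+1%:R * (t - a)) * flat 0 (n.+1%:R * (b - t)).

Lemma flat0_le1 t : flat 0 t <= 1.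
Proof.
rewrite /flat; case: ifP => // t0; rewrite mul1r -[leRHS]expR0 ler_expR oppr_le0 invr_ge0 ltW//.
Qed.

Lemma bump_smooth a b n : smooth1 (hump a b n).
Proof.
rewrite (_ : hump a b n = fun t => flat 0 (n.+1%:R * t + - (n.+1%:R * a)) * flat 0 ((- n.+1%:R) * t + n.+1%:R * b)).
 by apply: smooth1M; apply: smooth1_affine; exact: smooth1_flat.
by apply/funext => t; rewrite /hump; congr (flat _ _ * flat _ _); ring.
Qed.

Lemma bump_ge0 a b n t : 0 <= hump a b n t.
Proof. by apply: mge0; exact: flat_ge0. Qed.

Lemma bump_le1 a b n t : hump a b n t <= 1.
Proof. by rewrite /hump mulr_ile1// ?flat_ge0 ?flat0_le1. Qed.

Lemma bump_out a b n t : ~ (a < t < b) -> hump a b n t = 0.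
Proof.
move=> h; rewrite /hump /flat !pmulr_rgt0// !subr_gt0.
by case: ifP => at_; case: ifP => tb; rewrite ?mul0r ?mulr0//; case: h; rewrite at_ tb.
Qed.

Lemma bump_gt0 a b n t : a < t < b -> 0 < hump a b n t.
Proof.
by move=> /andP[h1 h2]; apply: mulr_gt0; rewrite /flat pmulr_rgt0// subr_gt0 ?h1 ?h2 mul1r expR_gt0.
Qed.

Lemma flat_cvg (t : R) : flat 0 (n.+1%:R * t) @[n --> \oo] --> ((0 < t)%R%:R : R).
Proof.
have [t0|t0] := ltP 0 t; last first.
 rewrite (_ : (fun _ => _) = cst 0); first exact: cvg_cst.
 by apply/funext => n; rewrite /flat pmulr_rgt0// ltNge t0.
rewrite (_ : (fun _ => _) = expR \o (fun n => - t^-1 * (@harmonic R n))); last first.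
 by apply/funext => n; rewrite /flat pmulr_rgt0// t0 mul1r /= invfM mulrC mulNr.
rewrite -[true%:R]expR0; apply: continuous_cvg; first exact: continuous_expR.
by rewrite -[0](mulr0 (- t^-1)); apply: cvgMr; exact: cvg_harmonic.
Qed.

Lemma bump_cvg (a b t : R) : hump a b n t @[n --> \oo] --> ((a < t < b)%R%:R : R).
Proof.
rewrite (_ : (a < t < b)%R%:R = (0 < t - a)%R%:R * (0 < b - t)%R%:R); last first.
 by rewrite !subr_gt0; do 2 case: (_ < _); rewrite ?mulr0 ?mul0r ?mulr1.
by apply: cvgM; exact: flat_cvg.
Qed.

Lemma unit_bump (a b : R) : a < b -> exists be G : R -> R,
 [/\ smooth1 be, forall t : R, is_derive t 1 G (be t), forall t, 0 <= be t,
 forall t, ~ (a < t < b) -> be t = 0 &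
 [/\ forall t, t <= a -> G t = 0, forall t, b <= t -> G t = 1 & forall t, 0 <= G t <= 1]].
Proof.
move=> ab; have sb := bump_smooth a b 0; have cb := smooth1_cont sb.
have [G0 _ dG0] := continuous_antiderivative cb.
have mono s t : s <= t -> G0 s <= G0 t.
 by move=> st; apply: (derive_nonneg_le st (fun u _ => dG0 u)) => u _; exact: bump_ge0.
have const s t : s <= t -> (forall u : R, s <= u <= t -> ~ (a < u < b)) -> G0 s = G0 t.
 move=> st out; have := derive_abs_le (h := cst 0) (dh := cst 0) st (fun u _ => dG0 u) (fun u _ => is_derive_cst 0 u 1).
 move=> /(_ _)/wrap[|]; first by move=> u ust; rewrite bump_out ?normr0//; exact: out.
 by rewrite subrr normr_le0 subr_eq0 => /eqP.
have flatl t : t <= a -> G0 t = G0 a.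
 by move=> ta; apply: const => // u /andP[_ ua] /andP[]; rewrite ltNge ua.
have flatr t : b <= t -> G0 t = G0 b.
 by move=> tb; symmetry; apply: const => // u /andP[bu _] /andP[_]; rewrite ltNge bu.
pose m := (a + b) / 2.
have am : a < m < b by rewrite /m; apply/andP; split; lra.
have c0 : 0 < G0 b - G0 a.
 rewrite subr_gt0 lt_neqAle mono ?ltW// andbT; apply/eqP => eab.
 have cst_ t : a <= t <= b -> G0 t = G0 a.
 by move=> /andP[at_ tb]; apply/eqP; rewrite eq_le (mono _ _ at_) andbT eab mono.
 have := bump_gt0 0 am; rewrite ltNge => /negP; apply.
 have /is_derive_eps h := dG0 m; rewrite leNgt; apply/negP => bm.
 have [r r0 hr] := h (hump a b 0 m / 2) (divr_gt0 bm (ltr0Sn _ 1)).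
 pose u := Num.min (r / 2) ((b - a) / 4).
 have u0 : 0 < u by rewrite lt_min; apply/andP; split; lra.
 have ur : u < r by rewrite gt_min; apply/orP; left; lra.
 have ub : u <= (b - a) / 4 by rewrite ge_min lexx orbT.
 have := hr u; rewrite gtr0_norm// => /(_ ur).
 rewrite !cst_ ?subrr ?sub0r ?normrN; [|by rewrite /m; apply/andP; split; lra..].
 by have q := mulr_gt0 u0 bm; rewrite (gtr0_norm q); move: q; lra.
pose c := G0 b - G0 a.
exists (fun t => c^-1 * hump a b 0 t), (fun t => c^-1 * G0 t + - (c^-1 * G0 a)).
have ci : 0 <= c^-1 by rewrite invr_ge0 ltW.
have GE t : c^-1 * G0 t + - (c^-1 * G0 a) = (G0 t - G0 a) / c by rewrite -mulrBr mulrC.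
split.
- exact: smooth1_scale.
- move=> t; have := is_deriveD (is_deriveM (is_derive_cst c^-1 t 1) (dG0 t)) (is_derive_cst (- (c^-1 * G0 a)) t 1).
 by move=> h; apply: is_derive_eq h _; rewrite /GRing.scale/= mulr0 !addr0.
- by move=> t; rewrite mge0// bump_ge0.
- by move=> t h; rewrite bump_out// mulr0.
- split=> t.
 + by move=> ta; rewrite flatl// subrr.
 + by move=> tb; rewrite GE flatr// divff// gt_eqF.
 + rewrite GE divr_ge0 ?(ltW c0)//=; last first.
 by rewrite subr_ge0; have [ta|/ltW ta] := leP t a; [rewrite flatl|exact: mono].
 rewrite ler_pdivrMr// mul1r lerD2r.
 by have [tb|/ltW tb] := leP b t; [rewrite flatr|exact: mono].
Qed.

End smooth_functions.

Section tensor_products.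
Context {R : realType} {n : nat}.
Local Notation V := 'rV[R]_n.+1.

Definition tensor (g : 'I_n.+1 -> R -> R) (z : V) : R := \prod_j g j (z ord0 j).

Lemma tensor_derive (g : 'I_n.+1 -> R -> R) (g' : R -> R) (i : 'I_n.+1) (z : V) :
 (forall t : R, is_derive t 1 (g i) (g' t)) ->
 is_derive z (basis_vec i) (tensor g) (tensor (fun j => if j == i then g' else g j) z).
Proof.
move=> dg; pose P := \prod_(j | j != i) g j (z ord0 j).
have e1 (h : R) : tensor g (h *: basis_vec i + z) = P * g i (1 * h + z ord0 i).
 rewrite /tensor (bigD1 i)//= mulrC; congr (_ * _); last by rewrite !mxE !eqxx mulr1 mul1r.
 by apply: eq_bigr => j ji; rewrite !mxE !eqxx (negbTE ji) mulr0 add0r.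
have -> : tensor (fun j => if j == i then g' else g j) z = P * g' (z ord0 i).
 rewrite /tensor (bigD1 i)//= eqxx mulrC; congr (_ * _).
 by apply: eq_bigr => j ji; rewrite (negbTE ji).
have d1 : is_derive (0 : R) 1 (fun h : R => tensor g (h *: basis_vec i + z)) (P * g' (z ord0 i)).
 rewrite (_ : (fun _ => _) = (fun h : R => P * g i (1 * h + z ord0 i))); last exact/funext.
 have d2 := @is_derive1_comp _ (g i) (fun s => 1 * s + z ord0 i) 0 _ _ (dg _) (is_derive_affine 1 (z ord0 i) 0).
 have d3 := is_deriveM (is_derive_cst P (0 : R) 1) d2.
 rewrite (_ : (fun _ => _) = cst P * (g i \o (fun s => 1 * s + z ord0 i)))//.
 by apply: is_derive_eq d3 _; rewrite /GRing.scale/= !mulr0 addr0 add0r mulr1.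
have [dv1 dv2] := d1; split; first exact/derivable1P.
have e : (fun h : R => h^-1 *: (((fun s : R => tensor g (s *: basis_vec i + z)) \o shift 0) (h *: 1) -
 (fun s : R => tensor g (s *: basis_vec i + z)) 0)) =
 (fun h : R => h^-1 *: ((tensor g \o shift z) (h *: basis_vec i) - tensor g z)).
 by apply/funext => h; rewrite /= !addr0 scale0r add0r [_%:A]mulr1.
by move: dv2; rewrite /derive e.
Qed.

Lemma tensor_partial (g : 'I_n.+1 -> R -> R) (g' : R -> R) (i : 'I_n.+1) :
 (forall t : R, is_derive t 1 (g i) (g' t)) ->
 partial i (tensor g) = tensor (fun j => if j == i then g' else g j).
Proof. by move=> dg; apply/funext => z; have [_] := tensor_derive z dg. Qed.

Lemma tensor_continuous (g : 'I_n.+1 -> R -> R) : (forall j, continuous (g j)) -> continuous (tensor g).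
Proof.
move=> cg; change (continuous (fun z : V => \prod_j g j (z ord0 j))).
have mc := @mul_continuous R; apply: (@continuous_big R 'I_n.+1 *%R 1 xpredT mc) => j _ z.
by apply: continuous_comp; [exact: coord_continuous|exact: cg].
Qed.

Lemma tensor_smooth (g : 'I_n.+1 -> R -> R) : (forall j, smooth1 (g j)) -> smooth_on setT (tensor g).
Proof.
move=> sg k; elim: k g sg => [|k IH] g sg; split=> //.
- by move=> z _; apply: tensor_continuous => j; exact: smooth1_cont.
- by move=> z _; apply: tensor_continuous => j; exact: smooth1_cont.
move=> i; have [g' dg sg'] := smooth1_derive (sg i); split.
 by move=> z _; have [] := tensor_derive z dg.
by rewrite (tensor_partial dg); apply: IH => j; case: ifP.
Qed.

Lemma tensor_test (Q : set V) (g : 'I_n.+1 -> R -> R) (a b : V) : (forall j, smooth1 (g j)) ->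
 box a b `<=` Q -> (forall j t, ~ (a ord0 j <= t <= b ord0 j) -> g j t = 0) -> test_function Q (tensor g).
Proof.
move=> sg abQ out; split; first exact: tensor_smooth.
exists (box a b); first split=> //.
 pose c : V := \row_j ((a ord0 j + b ord0 j) / 2); pose r : R := \sum_j `|b ord0 j - a ord0 j|.
 apply: (@subclosed_compact V (box a b) [set y | `|c - y| <= r]); [|exact: compact_rVball|].
 rewrite (_ : box a b = \bigcap_j ((fun z : V => z ord0 j) @^-1` `[a ord0 j, b ord0 j])); last first.
 by apply/seteqP; split=> z h j => [_|]; have := h j; rewrite /= in_itv/=; [exact|apply].
 apply: closed_bigI => j _; apply: closed_comp; last exact: interval_closed.
 by move=> z _; exact: coord_continuous.
 move=> z zab; apply: norm_le; first by apply: sumr_ge0.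
 move=> j; rewrite !mxE.
 have h1 : `|b ord0 j - a ord0 j| <= r by rewrite /r (bigD1 j)//= lerDl sumr_ge0.
 apply: le_trans h1; have /andP[z1 z2] := zab j.
 by rewrite (ger0_norm (_ : 0 <= b ord0 j - a ord0 j)) ?ler_norml; [apply/andP; split|]; lra.
move=> z nz; have [j nj] : exists j, ~ (a ord0 j <= z ord0 j <= b ord0 j).
 by apply: contrapT => h; apply: nz => j; apply: contrapT => nj; apply: h; exists j.
by rewrite /tensor (bigD1 j)//= out// mul0r.
Qed.

End tensor_products.

Section weighted_measures.
Context {R : realType}.
Local Notation mu := (@lebesgue_measure R).

(* The measure P dz transported by pi is the image of the region under the graph of P. *)
Lemma weighted_pushforward {m n : nat} (pi : rVB R m -> (rVB R n)) (P : rVB R m -> R) :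
 mfunT pi -> mfunT P -> (forall z, 0 <= P z) ->
 exists nu : {measure set (rVB R n) -> \bar R}, forall g : (rVB R n) -> R,
 mfunT g -> (forall x, 0 <= g x) ->
 (\int[nu]_x (g x)%:E = \int[lamB]_z (P z * g (pi z))%:E)%E.
Proof.
move=> mpi mP P0; pose U : set (rVB R m * R) := [set p | 0 <= p.2 < P p.1].
have mU : measurable U.
 rewrite (_ : U = [set p | 0 <= p.2] `&` [set p | p.2 < P p.1]); last first.
 by apply/seteqP; split=> p; rewrite /U/=; [move=> /andP[]|move=> [-> ->]].
 apply: measurableI.
 rewrite (_ : [set p | _] = snd @^-1` `[0, +oo[); last by apply/seteqP; split=> p; rewrite /= in_itv/= andbT.
 by rewrite -[mset]setTI; apply: measurable_snd => //; exact: measurable_itv.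
 rewrite (_ : [set p | _] = (fun p : rVB R m * R => P p.1 - p.2) @^-1` `]0, +oo[); last first.
 by apply/seteqP; split=> p; rewrite /= in_itv/= andbT subr_gt0.
 rewrite -[mset]setTI; apply: (_ : mfunT _) => //.
 by apply: measB; [exact: (measC mP measurable_fst)|exact: measurable_snd].
have mpf : mfunT (fun p : rVB R m * R => pi p.1) by exact: (measC mpi measurable_fst).
pose M : {measure set (rVB R m * measurableTypeR R) -> \bar R} := (lamB \x mu)%E.
have [nu nuE] : exists nu : {measure set (rVB R n) -> \bar R}, forall A, nu A = pushforward (mrestr M mU) (fun p => pi p.1) A.
 by unshelve eexists (pushforward (mrestr M mU) (fun p => pi p.1) : {measure set (rVB R n) -> \bar R}).
exists nu => g mg g0; have mge : mfunT (EFin \o g) by exact/mEF.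
have mgp : mfunT (fun p : rVB R m * R => g (pi p.1)) by exact: (measC mg mpf).
transitivity (\int[pushforward (mrestr M mU) (fun p => pi p.1)]_x (EFin \o g) x)%E.
 by apply: eq_measure_integral => A mA _.
rewrite (@ge0_integral_pushforward _ _ (rVB R m * measurableTypeR R)%type (rVB R n) R _ mpf (mrestr M mU) setT (EFin \o g))//; last first.
 by move=> x _; rewrite /= lee_fin.
rewrite preimage_setT (integral_mrestr M mU); [|by apply/mEF|by move=> p; rewrite lee_fin].
have mI : mfunT (fun p : rVB R m * R => \1_U p * g (pi p.1)).
 by apply: measM => //; exact: measI.
rewrite (integral_mulI M U (fun p => g (pi p.1))).
have FT := fubini_tonelli1 (m1 := lamB) (m2 := mu) (fun p => (\1_U p * g (pi p.1))%:E).
rewrite [LHS]FT; [|exact/mEF|by move=> p; rewrite lee_fin mge0].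
apply: eq_integral => z _.
transitivity (\int[mu]_t ((g (pi z))%:E * (\1_`[0%R, P z[ t)%:E))%E.
 apply: eq_integral => t _; change ((\1_U (z, t) * g (pi z))%:E = ((g (pi z))%:E * (\1_`[0%R, P z[ t)%:E)%E).
 have -> : \1_U (z, t) = \1_`[0, P z[ t :> R by rewrite !indicE /U !mem_setE/= in_itv.
 by rewrite -EFinM mulrC.
rewrite intZl//; last 2 first.
- by apply/mEF; exact: measI.
- by rewrite lee_fin.
have e : mu `[0, P z[%classic = (P z)%:E.
 rewrite lebesgue_measure_itv/= lte_fin oppr0 adde0.
 by case: ltgtP (P0 z) => // <-.
transitivity ((g (pi z))%:E * (P z)%:E)%E; last by rewrite -EFinM mulrC.
by congr (_ * _)%E; rewrite integral_indic// setIT; exact: e.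
Qed.

Context {n : nat}.
Local Notation V := 'rV[R]_n.+1.
Local Notation BV := (rVB R n).

Definition bumps (a b : V) (k : nat) : V -> R := tensor (fun j => hump (a ord0 j) (b ord0 j) k).

Lemma bumps_ge0 a b k x : 0 <= bumps a b k x.
Proof. by apply: prodr_ge0 => j _; exact: bump_ge0. Qed.

Lemma bumps_le1 a b k x : bumps a b k x <= 1.
Proof. by apply: prodr_ile1 => j _; rewrite bump_ge0 bump_le1. Qed.

Lemma measurable_bumps a b k : mfunT (bumps a b k : BV -> R).
Proof.
apply: cont_meas; apply: tensor_continuous => j; exact/smooth1_cont/bump_smooth.
Qed.

Lemma bumps_cvg a b (x : V) : bumps a b k x @[k --> \oo] --> (\1_(obox a b) x : R).
Proof.
rewrite (_ : \1_(obox a b) x = \prod_j ((a ord0 j < x ord0 j < b ord0 j)%R%:R : R)); last first.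
 rewrite indicE; have [/set_mem xab|/negP nx] := boolP (x \in obox a b).
 by rewrite big1// => j _; rewrite xab.
 have [j nj] : exists j, ~ (a ord0 j < x ord0 j < b ord0 j).
 by apply: contrapT => h; apply: nx; apply/mem_set => j; apply: contrapT => nj; apply: h; exists j.
 by rewrite (bigD1 j)//= (negbTE (introN idP nj)) mul0r.
have mc := @mul_continuous R; apply: (@cvg_big R 'I_n.+1 *%R 1 xpredT mc) => j _; exact: bump_cvg.
Qed.

Lemma integrable_mulb {m : nat} (Q h : rVB R m -> R) (K : R) : lamB.-integrable setT (EFin \o Q) ->
 mfunT h -> (forall z, `|h z| <= K) -> lamB.-integrable setT (fun z => (Q z * h z)%:E).
Proof.
move=> iQ mh hK; have mQ : mfunT Q by apply/mEF; exact: measurable_int iQ.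
have iK : lamB.-integrable setT (fun z => (K%:E * `|(Q z)%:E|)%E) by apply: integrableZl => //; exact: integrable_abse.
apply: (le_integrable measurableT _ _ iK); first by apply/mEF; exact: measM.
have K0 : 0 <= K by apply: le_trans (hK 0).
by move=> z _; rewrite /= lee_fin normrM mulrC normrM normr_id (ger0_norm K0) ler_wpM2r.
Qed.

Lemma cover_boxes (D : set V) : open D -> exists B : nat -> set V,
 D = \bigcup_k B k /\ forall k, exists a b : V, B k = obox a b /\ (forall x, obox a b x -> box a b `<=` D).
Proof.
move=> oD; pose f (v : 'rV[rat]_n.+1) : V := map_mx ratr v.
pose G (k : nat) : V * V := if @unpickle ('rV[rat]_n.+1 * 'rV[rat]_n.+1)%type k is Some p then
 if `[< box (f p.1) (f p.2) `<=` D >] then (f p.1, f p.2) else (0, 0) else (0, 0).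
exists (fun k => obox (G k).1 (G k).2); split; last first.
 move=> k; exists (G k).1, (G k).2; split=> // x; rewrite /G; case: unpickle => [p|] /=; last first.
 by move=> /(_ ord0); rewrite mxE => /andP[]; lra.
 case: ifPn => [/asboolP//|_ /=]; by move=> /(_ ord0); rewrite mxE => /andP[]; lra.
apply/seteqP; split=> [x Dx|x [k _]]; last first.
 rewrite /G; case: unpickle => [p|] /=; last by move=> /(_ ord0); rewrite mxE => /andP[]; lra.
 case: ifPn => [/asboolP h|_] /=; last by move=> /(_ ord0); rewrite mxE => /andP[]; lra.
 by move=> xo; apply: h => j; have /andP[h1 h2] := xo j; rewrite !ltW.
have /nbhs_ballP[r /= r0 hr] : nbhs x D by exact: open_nbhs_nbhs.
have r20 : 0 < r / 2 by rewrite divr_gt0.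
have [[p q] /= [xpq pqb]] := @rational_obox R n (ball x (r / 2)) x (ltac:(split; [exact: ball_open|exact: ballxx])).
exists (pickle (p, q)) => //; rewrite /G pickleK /= asboolT// => y yb.
pose y2 : V := 2^-1 *: (x + y).
have : obox (f p) (f q) y2.
 move=> j; have /andP[h1 h2] := xpq j; have /andP[h3 h4] := yb j.
 by rewrite /y2 !mxE; move: h1 h2 h3 h4; rewrite /f !mxE => *; apply/andP; split; lra.
move/pqb/ball_normP => h; apply: hr; apply/ball_normP.
rewrite (_ : x - y = 2 *: (x - y2)); last first.
 by rewrite /y2 scalerBr scalerA divff// scale1r scaler_nat opprD addrA mulr2n addrK.
by rewrite normrZ ger0_norm//; move: h; rewrite ltr_pdivlMr// mulrC.
Qed.

Lemma oboxes_measure_unique (m1 m2 : {measure set BV -> \bar R}) (D : set V) : open D ->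
 (m1 setT < +oo)%E -> (m2 setT < +oo)%E ->
 (forall a b : V, (forall x, obox a b x -> box a b `<=` D) -> m1 (obox a b) = m2 (obox a b)) ->
 forall A : set BV, measurable A -> m1 (A `&` D) = m2 (A `&` D).
Proof.
move=> oD f1 f2 h.
have local (a b : V) (A : set BV) : (forall x, obox a b x -> box a b `<=` D) -> measurable A ->
 m1 (A `&` obox a b) = m2 (A `&` obox a b).
 move=> abD; have mB : measurable (obox a b : set BV) by apply: rVB_open; exact: obox_open.
 apply: (@rVB_measure_unique _ _ (mrestr m1 mB) (mrestr m2 mB)) => [c e ce|k].
 change (m1 (obox c e `&` obox a b) = m2 (obox c e `&` obox a b)).
 rewrite oboxI; apply: h => x; rewrite -oboxI => -[_ xab]; apply: subset_trans (abD _ xab) => y yb j.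
 by have := yb j; rewrite !mxE ge_max le_min => /andP[/andP[_ ->] /andP[_ ->]].
 change (m1 (cube k%:R `&` obox a b) < +oo)%E; apply: le_lt_trans f1; apply: le_measure => //; rewrite inE//.
 by apply: measurableI => //; apply: rVB_open; exact: obox_open.
move=> A mA; have [B [DB Bab]] := cover_boxes oD.
have mB k : measurable (B k : set BV).
 by have [a [b [-> _]]] := Bab k; apply: rVB_open; exact: obox_open.
have mS k : measurable (seqDU B k : set BV).
 by apply: measurableD => //; apply: bigsetU_measurable.
have eS (m : {measure set BV -> \bar R}) : m (A `&` D) = (\sum_(k <oo) m (A `&` seqDU B k))%E.
 rewrite {1}DB seqDU_bigcup_eq setI_bigcupr measure_bigcup//; last first.
 - exact/trivIset_setIl/trivIset_seqDU.
 - by move=> k _; exact: measurableI.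
 by apply: eq_eseriesl => k; rewrite in_setT.
rewrite !eS; apply: eq_eseriesr => k _.
have [a [b [eB abD]]] := Bab k.
have e : A `&` seqDU B k = (A `&` seqDU B k) `&` obox a b.
 by apply/seteqP; split=> [x [Ax [Bx nx]]|x [] //]; split=> //; rewrite -eB.
by rewrite e; apply: local => //; exact: measurableI.
Qed.

Lemma bump_dense {m : nat} (pi : rVB R m -> BV) (Q : rVB R m -> R) (D : set V) :
 open D -> mfunT pi -> lamB.-integrable setT (EFin \o Q) ->
 (forall a b k, (forall x, obox a b x -> box a b `<=` D) -> (\int[lamB]_z (Q z * bumps a b k (pi z))%:E = 0)%E) ->
 forall (g : BV -> R) (K : R), mfunT g -> (forall x, `|g x| <= K) -> (forall x, ~ D x -> g x = 0) ->
 (\int[lamB]_z (Q z * g (pi z))%:E = 0)%E.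
Proof.
move=> oD mpi iQ h0.
have mQ : mfunT Q by apply/mEF; exact: measurable_int iQ.
pose P (z : rVB R m) : R := Num.max (Q z) 0; pose N (z : rVB R m) : R := Num.max (- Q z) 0.
have mP : mfunT P by exact: measurable_maxr.
have mN : mfunT N by apply: measurable_maxr => //; exact: measurable_funN.
have P0 z : 0 <= P z by rewrite le_max lexx orbT.
have N0 z : 0 <= N z by rewrite le_max lexx orbT.
have QPN z : Q z = P z - N z by rewrite /P/N; case: (leP (Q z) 0) => q; case: (leP (- Q z) 0) => q'; lra.
have leQ (F : rVB R m -> R) : mfunT F -> (forall z, 0 <= F z) -> (forall z, F z <= `|Q z|) ->
 lamB.-integrable setT (EFin \o F).
 move=> mF F0 FQ; apply: (le_integrable measurableT _ _ iQ); first exact/mEF.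
 by move=> z _; rewrite /= lee_fin ger0_norm.
have iP : lamB.-integrable setT (EFin \o P).
 by apply: leQ => // z; rewrite ge_max normr_ge0 ler_norm.
have iN : lamB.-integrable setT (EFin \o N).
 by apply: leQ => // z; rewrite ge_max normr_ge0 -normrN ler_norm.
have split_int (g : BV -> R) (K : R) : mfunT g -> (forall x, `|g x| <= K) ->
 (\int[lamB]_z (Q z * g (pi z))%:E =
 \int[lamB]_z (P z * g (pi z))%:E - \int[lamB]_z (N z * g (pi z))%:E)%E.
 move=> mg gK; have mgp := measC mg mpi.
 rewrite -integralB_EFin//; [|exact: integrable_mulb mgp (fun z => gK (pi z))..].
 by apply: eq_integral => z _; rewrite -EFinB QPN mulrBl.
have [n1 n1E] := weighted_pushforward mpi mP P0; have [n2 n2E] := weighted_pushforward mpi mN N0.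
have finW (W : rVB R m -> R) (nu : {measure set BV -> \bar R}) : lamB.-integrable setT (EFin \o W) ->
 (forall g : BV -> R, mfunT g -> (forall x, 0 <= g x) ->
 (\int[nu]_x (g x)%:E = \int[lamB]_z (W z * g (pi z))%:E)%E) -> (forall z, 0 <= W z) -> (nu setT < +oo)%E.
 move=> iW nuE W0; have := nuE (cst 1) (measK _) (fun _ => ler01).
 rewrite (_ : (\int[nu]_x _)%E = nu setT); last first.
 by transitivity (\int[nu]_x (cst 1%E x))%E; rewrite ?integral_cst// mul1e.
 move=> ->; under eq_integral do rewrite mulr1.
 by rewrite ltey_eq (integrable_fin_num measurableT iW).
have box12 (a b : V) : (forall x, obox a b x -> box a b `<=` D) -> n1 (obox a b) = n2 (obox a b).
 move=> abD; have mB : measurable (obox a b : set BV) by apply: rVB_open; exact: obox_open.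
 have m1 : mfunT (\1_(obox a b) : BV -> R) by exact: measI.
 have i0 (x : BV) : 0 <= \1_(obox a b) x :> R by [].
 have := n1E _ m1 i0; rewrite integral_indic// setIT => ->.
 have := n2E _ m1 i0; rewrite integral_indic// setIT => ->.
 have conv (W : rVB R m -> R) : mfunT W -> lamB.-integrable setT (EFin \o W) -> (forall z, 0 <= W z) ->
 (\int[lamB]_z (W z * bumps a b k (pi z))%:E @[k --> \oo] --> \int[lamB]_z (W z * \1_(obox a b) (pi z))%:E)%E.
 move=> mW iW W0.
 have [] // := @dominated_convergence _ _ _ lamB setT measurableT
 (fun k z => (W z * bumps a b k (pi z))%:E) (fun z => (W z * \1_(obox a b) (pi z))%:E) (EFin \o W).
 - by move=> k; apply/mEF; apply: measM => //; apply: measC => //; exact: measurable_bumps.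
 - by apply/mEF; apply: measM => //; exact: measC.
 - apply: aeW => z _; apply: cvg_EFin; first exact: nearW.
 by apply: cvgMr; exact: bumps_cvg.
 - apply: aeW => z k _; rewrite lee_fin normrM !ger0_norm ?bumps_ge0//.
 by rewrite ler_piMr// bumps_le1.
 have e k : (\int[lamB]_z (P z * bumps a b k (pi z))%:E = \int[lamB]_z (N z * bumps a b k (pi z))%:E)%E.
 have mb := @measurable_bumps a b k.
 have bK x : `|bumps a b k x| <= 1 by rewrite ger0_norm ?bumps_ge0// bumps_le1.
 have := split_int _ _ mb bK; rewrite h0// => /esym/eqP; rewrite sube_eq ?add0e.
 by move=> /eqP.
 - exact: (integrable_fin_num measurableT (integrable_mulb iP (measC mb mpi) (fun z => bK (pi z)))).
 - by apply/fin_num_adde_defr.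
 have := conv P mP iP P0; under eq_cvg do rewrite e; move=> c1.
 exact: (cvg_unique _ c1 (conv N mN iN N0)).
have agree := oboxes_measure_unique oD (finW _ _ iP n1E P0) (finW _ _ iN n2E N0) box12.
have pos (g : BV -> R) (K : R) : mfunT g -> (forall x, 0 <= g x <= K) -> (forall x, ~ D x -> g x = 0) ->
 (\int[lamB]_z (Q z * g (pi z))%:E = 0)%E.
 move=> mg gK gD; have g0 x : 0 <= g x by have /andP[] := gK x.
 have gK' x : `|g x| <= K by rewrite ger0_norm//; have /andP[] := gK x.
 rewrite (split_int _ _ mg gK') -n1E// -n2E//.
 have mD : measurable (D : set BV) by exact: rVB_open.
 have eD (nu : {measure set BV -> \bar R}) : (\int[nu]_x (g x)%:E = \int[nu]_(x in D) (g x)%:E)%E.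
 rewrite [RHS]integral_mulI; apply: eq_integral => x _; rewrite indicE.
 by have [Dx|nDx] := pselect (D x); [rewrite mem_set// mul1r|rewrite gD// mulr0].
 rewrite !eD; have e12 : (\int[n1]_(x in D) (g x)%:E = \int[n2]_(x in D) (g x)%:E)%E.
 by apply: eq_measure_integral => A mA AD; have := agree A mA; rewrite (setIidl AD).
 rewrite -e12 subee// -eD n1E//.
 exact: (integrable_fin_num measurableT (integrable_mulb iP (measC mg mpi) (fun z => gK' (pi z)))).
move=> g K mg gK gD.
have K0 : 0 <= K by apply: le_trans (gK 0).
pose g1 (x : BV) : R := Num.max (g x) 0; pose g2 (x : BV) : R := Num.max (- g x) 0.
have mg1 : mfunT g1 by exact: measurable_maxr.
have mg2 : mfunT g2 by apply: measurable_maxr => //; exact: measurable_funN.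
have b1 x : 0 <= g1 x <= K.
 by rewrite le_max lexx orbT ge_max K0 andbT/=; apply: le_trans (gK x); exact: ler_norm.
have b2 x : 0 <= g2 x <= K.
 by rewrite le_max lexx orbT ge_max K0 andbT/=; apply: le_trans (gK x); rewrite -normrN ler_norm.
have z1 x : ~ D x -> g1 x = 0 by move=> /gD; rewrite /g1 => ->; rewrite maxxx.
have z2 x : ~ D x -> g2 x = 0 by move=> /gD; rewrite /g2 => ->; rewrite oppr0 maxxx.
have n1' (x : BV) : `|g1 x| <= K by have /andP[p q] := b1 x; rewrite ger0_norm.
have n2' (x : BV) : `|g2 x| <= K by have /andP[p q] := b2 x; rewrite ger0_norm.
transitivity (\int[lamB]_z (Q z * g1 (pi z))%:E - \int[lamB]_z (Q z * g2 (pi z))%:E)%E; last first.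
 by rewrite (pos _ _ mg1 b1 z1) (pos _ _ mg2 b2 z2) sube0.
rewrite -integralB_EFin//; [|exact: integrable_mulb iQ (measC mg1 mpi) (fun z => n1' (pi z))|
 exact: integrable_mulb iQ (measC mg2 mpi) (fun z => n2' (pi z))].
apply: eq_integral => z _; rewrite -EFinB -mulrBr; congr (_ * _)%:E.
rewrite /g1/g2; case: (leP (g (pi z)) 0) => q; case: (leP (- g (pi z)) 0) => q'; lra.
Qed.

End weighted_measures.

Section space_time_identities.
Context {R : realType} {d : nat}.
Local Notation V := 'rV[R]_d.+1.
Local Notation VT := 'rV[R]_d.+2.
Local Notation BT := (rVB R d.+1).
Local Notation mu := (@lebesgue_measure R).
Local Notation intg F := (lamB.-integrable setT (EFin \o (F : BT -> R))).

Lemma test_bounded {n : nat} (Q : set 'rV[R]_n.+1) (th : 'rV[R]_n.+1 -> R) : test_function Q th ->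
 exists2 K : R, 0 <= K & forall z, `|th z| <= K.
Proof.
move=> [sm [K [cK KQ] K0]]; have cth : continuous th by move=> z; have [+ _] := sm 0; exact.
have /compact_bounded[M [Mr hM]] := continuous_compact (continuous_subspaceT cth) cK.
exists (Num.max (M + 1) 0); first by rewrite le_max lexx orbT.
move=> z; rewrite le_max; apply/orP; have [Kz|nKz] := pselect (K z).
 by left; apply: (hM (M + 1)); [rewrite ltrDl|exists z].
by right; rewrite K0// normr0.
Qed.

Lemma test_measurable {n : nat} (Q : set 'rV[R]_n.+1) (th : 'rV[R]_n.+1 -> R) : test_function Q th ->
 mfunT (th : rVB R n -> R).
Proof. by move=> [sm _]; apply: cont_meas => z; have [+ _] := sm 0; exact. Qed.

Variables (Om : set V) (T : R).
Hypotheses (oOm : open Om) (bOm : bounded_set Om).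
Local Notation Q := (cylinder Om T).

Lemma cylinder_open : open Q.
Proof.
rewrite openE => z [Oz /andP[z0 zT]].
have /nbhs_ballP[r /= r0 hr] : nbhs (xof z) Om by exact: open_nbhs_nbhs.
apply/nbhs_ballP; exists (Num.min r (Num.min (tof z) (T - tof z))) => /=.
 by rewrite !lt_min r0 z0 subr_gt0.
move=> w /ball_normP; rewrite !lt_min => /andP[wr /andP[w1 w2]]; split.
 apply: hr; apply/ball_normP; apply: le_lt_trans wr; apply: norm_le => // i.
 by have := coord_le (z - w) (lift ord_max i); rewrite !mxE.
have wt : `|tof z - tof w| <= `|z - w| by have := coord_le (z - w) ord_max; rewrite !mxE.
have := le_lt_trans wt w1; have := le_lt_trans wt w2; rewrite !ltr_norml => /andP[h1 h2] /andP[h3 h4].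
by apply/andP; split; lra.
Qed.

Lemma cylinder_finite : (lamB Q < +oo)%E.
Proof.
move: bOm => [M [Mr hM]]; apply: (@lamB_bounded _ _ _ (`|M| + 1 + `|T|)) => z [Oz /andP[z0 zT]].
have h1 : `|xof z| <= `|M| + 1 by apply: hM => //; rewrite ltr_pwDr// ler_norm.
have [j ->] := norm_coord z; case: (unliftP ord_max j) => [i ->|->].
 have := coord_le (xof z) i; rewrite mxE => h.
 by apply: le_trans h _; apply: le_trans h1 _; rewrite lerDl.
have key (t B m : R) : 0 < t -> t < T -> T <= B -> 0 <= m -> t <= m + 1 + B by lra.
rewrite gtr0_norm//; exact: key z0 zT (ler_norm T) (normr_ge0 M).
Qed.

Definition L2rep (u : VT -> R) (u0 : BT -> R) :=
 [/\ mfunT u0, forall z, ~ Q z -> u0 z = 0, (\int[lamB]_z (u0 z ^+ 2)%:E < +oo)%E &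
 exists2 N : set BT, nullB N & forall z, Q z -> ~ N z -> u z = u0 z].

Lemma borel_zero_extension {n : nat} (D : set 'rV[R]_n.+1) (u : 'rV[R]_n.+1 -> R) : open D ->
 measurable_fun (D : set LM) u ->
 exists u0 : rVB R n -> R, [/\ mfunT u0, forall z, ~ D z -> u0 z = 0,
 (\int[lebesgueN]_(z in D) (u z ^+ 2)%:E = \int[lamB]_z (u0 z ^+ 2)%:E)%E &
 exists2 N : set (rVB R n), nullB N & forall z, D z -> ~ N z -> u z = u0 z].
Proof.
move=> oD mu_; have [g [N [mg mN N0 ug]]] := borel_representative oD mu_.
have mD : measurable (D : set (rVB R n)) by exact: rVB_open.
exists (fun z => \1_D z * g z); split.
- by apply: measM => //; exact: measI.
- by move=> z nz; rewrite indicE memNset// mul0r.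
- have m2 : measurable_fun (D : set LM) (fun z => u z ^+ 2) by exact: measX.
 have e := @integral_representative R n D (fun z => u z ^+ 2) (fun z => g z ^+ 2) N oD m2 (measX 2 mg) mN N0.
 rewrite e => [|z Dz Nz]; last by rewrite ug.
 rewrite integral_mulI; apply: eq_integral => z _; rewrite exprMn indicE.
 by case: (z \in D); rewrite ?expr1n ?expr0n.
- by exists N => // z Dz Nz; rewrite indicE mem_set// mul1r ug.
Qed.

Lemma L2rep_exists (u : VT -> R) : in_Lp lebesgueN Q 2%:E u -> exists u0, L2rep u u0.
Proof.
move=> [mu_ fu]; have [u0 [m0 z0 e0 N0]] := borel_zero_extension cylinder_open mu_.
by exists u0; split=> //; rewrite -e0; exact: in_Lp2_lty.
Qed.

Lemma L2_integrable (u0 : BT -> R) : mfunT u0 -> (forall z, ~ Q z -> u0 z = 0) ->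
 (\int[lamB]_z (u0 z ^+ 2)%:E < +oo)%E -> intg u0.
Proof.
move=> m0 z0 f0.
have iQ : lamB.-integrable setT (EFin \o \1_Q).
 apply/integrableP; split; first by apply/mEF; apply: measI; exact: measurable_cylinder.
 under eq_integral do rewrite /= ger0_norm//.
 by rewrite integral_indic ?setIT//; [exact: cylinder_finite|exact: measurable_cylinder].
have i2 : lamB.-integrable setT (EFin \o (fun z => u0 z ^+ 2)).
 apply/integrableP; split; first by apply/mEF; exact: measX.
 by under eq_integral do rewrite /= ger0_norm ?sqr_ge0//.
apply: (le_integrable measurableT _ _ (integrableD measurableT iQ i2)); first exact/mEF.
move=> z _; rewrite /= lee_fin.
have s0 := sqr_ge0 (u0 z); have [Qz|nQz] := pselect (Q z); last first.
 by rewrite z0// normr0.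
rewrite indicE mem_set// (ger0_norm (_ : 0 <= 1 + u0 z ^+ 2)); last by rewrite addr_ge0.
have := sqr_ge0 (`|u0 z| - 1); rewrite -(real_normK (num_real (u0 z))).
have := normr_ge0 (u0 z); rewrite !expr2; nra.
Qed.

Lemma weak_rep (i : 'I_d.+2) (u v : VT -> R) u0 v0 (th th' : VT -> R) :
 measurable_fun (Q : set LM) u ->
 measurable_fun (Q : set LM) v ->
 L2rep u u0 -> L2rep v v0 -> weak_partial Q i u v ->
 test_function Q th -> test_function Q th' -> partial i th = th' ->
 \int[lamB]_z (u0 z * th' z) = - \int[lamB]_z (v0 z * th z).
Proof.
move=> mu_ mv ru rv h tt tt' e.
have tr (w : VT -> R) w0 (s : VT -> R) : measurable_fun (Q : set LM) w ->
 L2rep w w0 -> test_function Q s -> \int[lebesgueN]_(z in Q) (w z * s z) = \int[lamB]_z (w0 z * s z).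
 move=> mw [m0 z0 _ [N [mN N0] wN]] ts; rewrite /Rintegral; congr fine.
 have ms := test_measurable ts.
 have mws : measurable_fun (Q : set (caratheodory_type (lebesgue_om d.+1))) (fun z => w z * s z).
 apply: measM => //; apply: lebesgueN_measurable_fun; first exact: measurable_cylinder.
 exact: measTS.
 have e1 := @integral_representative R d.+1 Q (fun z => w z * s z) (fun z => w0 z * s z) N cylinder_open mws
 (measM m0 ms) mN N0.
 rewrite e1 => [|z Qz Nz]; last by rewrite wN.
 rewrite [LHS]integral_mulI; apply: eq_integral => z _; rewrite indicE.
 have [Qz|nQz] := pselect (Q z); first by rewrite mem_set// mul1r.
 by rewrite memNset// mul0r z0// mul0r.
rewrite -(tr u u0)// -(tr v v0)// -e; exact: h.
Qed.

Definition weakly (i : 'I_d.+2) (u0 v0 : BT -> R) := exists u v : VT -> R,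
 [/\ measurable_fun (Q : set LM) u,
 measurable_fun (Q : set LM) v,
 L2rep u u0, L2rep v v0 & weak_partial Q i u v].

Definition join (g : 'I_d.+1 -> R -> R) (c : R -> R) (j : 'I_d.+2) : R -> R :=
 if unlift ord_max j is Some i then g i else c.

Lemma tensor_join g c (z : VT) : tensor (join g c) z = tensor g (xof z) * c (tof z).
Proof.
rewrite /tensor prod_space_time /join unlift_none; congr (_ * _).
by apply: eq_bigr => i _; rewrite liftK mxE.
Qed.

Definition box_test (g : 'I_d.+1 -> R -> R) :=
 (forall j, smooth1 (g j)) /\ exists a b : V, box a b `<=` Om /\ forall j t, ~ (a ord0 j <= t <= b ord0 j) -> g j t = 0.

Definition time_test (c : R -> R) :=
 smooth1 c /\ exists s0 s1 : R, [/\ 0 < s0, s1 < T & forall t, ~ (s0 <= t <= s1) -> c t = 0].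

Lemma join_test g c : box_test g -> time_test c -> test_function Q (tensor (join g c)).
Proof.
move=> [sg [a [b [ab ga]]]] [sc [s0 [s1 [s00 s1T cs]]]].
apply: (@tensor_test _ _ _ _ (spacetime a s0) (spacetime b s1)).
- by move=> j; rewrite /join; case: unlift.
- move=> z zb; split.
 by apply: ab => i; have := zb (lift ord_max i); rewrite !mxE liftK.
 by have := zb ord_max; rewrite !mxE unlift_none => /andP[h1 h2]; apply/andP; split;
 [exact: lt_le_trans h1|exact: le_lt_trans h2 _].
- move=> j t; rewrite /join !mxE; case: unliftP => [i _|_]; first exact: ga.
 exact: cs.
Qed.

Lemma derive_vanish (g g' : R -> R) (s0 s1 : R) : (forall t : R, is_derive t 1 g (g' t)) ->
 (forall t, ~ (s0 <= t <= s1) -> g t = 0) -> forall t, ~ (s0 <= t <= s1) -> g' t = 0.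
Proof.
move=> dg g0 t nt.
have [r r0 hr] : exists2 r : R, 0 < r & forall u, `|u| < r -> ~ (s0 <= t + u <= s1).
 have [h1|h1] := ltP t s0.
 exists (s0 - t); first by rewrite subr_gt0.
 by move=> u; rewrite ltr_norml => /andP[_ h2] /andP[h3 _]; lra.
 have h2 : s1 < t by rewrite ltNge; apply/negP => h2; apply: nt; rewrite h1.
 exists (t - s1); first by rewrite subr_gt0.
 by move=> u; rewrite ltr_norml => /andP[h3 _] /andP[_ h4]; lra.
have /is_derive_eps h := dg t; apply/eqP; rewrite -normr_eq0 eq_le normr_ge0 andbT leNgt; apply/negP => n0.
have [r' r'0 hr'] := h (`|g' t| / 2) (divr_gt0 n0 (ltr0Sn _ 1)).
pose u := Num.min r r' / 2.
have u0 : 0 < u by rewrite divr_gt0// lt_min r0.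
have u1 : u < r by rewrite /u ltr_pdivrMr// gt_min ltr_pMr// ltr1n.
have u2 : u < r' by rewrite /u ltr_pdivrMr// gt_min [X in _ || X]ltr_pMr// ltr1n orbT.
have un : `|u| = u by rewrite gtr0_norm.
have := hr' u; rewrite un => /(_ u2); rewrite (g0 _ nt) (g0 (t + u)); last by apply: hr; rewrite un.
rewrite !(subr0, sub0r, normrN) normrM un [u * _]mulrC ler_pM2r// => ?; lra.
Qed.

Lemma box_test_derive g i (g' : R -> R) : box_test g -> (forall t : R, is_derive t 1 (g i) (g' t)) ->
 box_test (fun j => if j == i then g' else g j).
Proof.
move=> [sg [a [b [ab ga]]]] dg; split.
 move=> j; case: ifP => // _; have [g1 dg1 sg1] := smooth1_derive (sg i).
 rewrite (_ : g' = g1)//; apply/funext => t; have [_ <-] := dg t; by have [_ <-] := dg1 t.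
exists a, b; split=> // j t nt; case: ifPn => [/eqP ji|_]; last exact: ga.
by rewrite ji in nt; exact: derive_vanish dg (ga i) t nt.
Qed.

Lemma time_test_derive c (c' : R -> R) : time_test c -> (forall t : R, is_derive t 1 c (c' t)) -> time_test c'.
Proof.
move=> [sc [s0 [s1 [s00 s1T cs]]]] dc; split.
 have [c1 dc1 sc1] := smooth1_derive sc.
 rewrite (_ : c' = c1)//; apply/funext => t; have [_ <-] := dc t; by have [_ <-] := dc1 t.
by exists s0, s1; split=> //; exact: derive_vanish dc cs.
Qed.

Lemma weak_time u0 v0 g c (c' : R -> R) :
 weakly ord_max u0 v0 -> box_test g -> time_test c ->
 (forall t : R, is_derive t 1 c (c' t)) ->
 \int[lamB]_z (u0 z * (tensor g (xof z) * c' (tof z))) =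
 - \int[lamB]_z (v0 z * (tensor g (xof z) * c (tof z))).
Proof.
move=> [u [v [mu_ mv ru rv h]]] tg tc dc; have tc' := time_test_derive tc dc.
have dj (t : R) : is_derive t 1 (join g c ord_max) (c' t) by rewrite /join unlift_none.
have := @weak_rep ord_max u v u0 v0 (tensor (join g c)) (tensor (join g c')) mu_ mv ru rv h
 (join_test tg tc) (join_test tg tc').
move=> /(_ _)/wrap[|].
 rewrite (tensor_partial dj); congr tensor; apply/funext => j; rewrite /join.
 by case: unliftP => [k ->|->]; [rewrite eq_sym (negbTE (neq_lift _ _))|rewrite eqxx].
by under eq_Rintegral do rewrite tensor_join; under [in RHS]eq_Rintegral do rewrite tensor_join.
Qed.

Lemma weak_space (i : 'I_d.+1) u0 v0 g (g' : R -> R) c :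
 weakly (lift ord_max i) u0 v0 -> box_test g -> time_test c ->
 (forall t : R, is_derive t 1 (g i) (g' t)) ->
 \int[lamB]_z (u0 z * (tensor (fun j => if j == i then g' else g j) (xof z) * c (tof z))) =
 - \int[lamB]_z (v0 z * (tensor g (xof z) * c (tof z))).
Proof.
move=> [u [v [mu_ mv ru rv h]]] tg tc dg; have tg' := box_test_derive tg dg.
have dj (t : R) : is_derive t 1 (join g c (lift ord_max i)) (g' t) by rewrite /join liftK.
have := @weak_rep (lift ord_max i) u v u0 v0 (tensor (join g c)) (tensor (join (fun j => if j == i then g' else g j) c)) mu_ mv ru rv h
 (join_test tg tc) (join_test tg' tc).
move=> /(_ _)/wrap[|].
 rewrite (tensor_partial dj); congr tensor; apply/funext => j; rewrite /join.
 case: (unliftP ord_max j) => [k ->|->]; last by rewrite (negbTE (neq_lift _ _)).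
 by rewrite (inj_eq lift_inj).
by under eq_Rintegral do rewrite tensor_join; under [in RHS]eq_Rintegral do rewrite tensor_join.
Qed.

Local Notation "'al' g" := (fun z : BT => tensor g (xof z)) (at level 10, g at level 9).

Definition L2Q (q : BT -> R) :=
 [/\ mfunT q, forall z, ~ Q z -> q z = 0 & (\int[lamB]_z (q z ^+ 2)%:E < +oo)%E].

Lemma weakly_L2 i u0 v0 : weakly i u0 v0 -> L2Q u0 /\ L2Q v0.
Proof. by move=> [u [v [_ _ [a b c _] [a' b' c' _] _]]]. Qed.

Lemma L2Q_mul q (h : BT -> R) (K : R) : L2Q q -> mfunT h -> (forall z, `|h z| <= K) ->
 intg (fun z => q z * h z).
Proof. by move=> [m0 z0 f0] mh hK; apply: integrable_mulb hK => //; exact: L2_integrable. Qed.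

Lemma gradient_time (i : 'I_d.+1) u a w b g c (c' : R -> R) :
 weakly (lift ord_max i) u a -> weakly ord_max u w -> weakly (lift ord_max i) w b ->
 box_test g -> time_test c -> (forall t : R, is_derive t 1 c (c' t)) ->
 \int[lamB]_z (a z * (tensor g (xof z) * c' (tof z))) =
 - \int[lamB]_z (b z * (tensor g (xof z) * c (tof z))).
Proof.
move=> ua uw wb tg tc dc; have [g' dg _] := smooth1_derive (tg.1 i).
have e1 := weak_space ua tg (time_test_derive tc dc) dg.
have e2 := weak_time uw (box_test_derive tg dg) tc dc.
have e3 := weak_space wb tg tc dg.
by apply: oppr_inj; rewrite -e1 e2 e3.
Qed.

Lemma Rintegral_dominated (F : nat -> BT -> R) (f g : BT -> R) :
 (forall n, mfunT (F n)) -> mfunT f -> (forall z, F n z @[n --> \oo] --> f z) ->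
 intg g -> (forall n z, `|F n z| <= g z) ->
 \int[lamB]_z F n z @[n --> \oo] --> \int[lamB]_z f z.
Proof.
move=> mF mf Ff ig Fg.
have [|||||if_ _ c] := @dominated_convergence _ _ _ lamB setT measurableT (fun n => EFin \o F n) (EFin \o f) (EFin \o g).
- by move=> n; exact/mEF.
- exact/mEF.
- by apply: aeW => z _; apply: cvg_EFin; [exact: nearW|exact: Ff].
- exact: ig.
- by apply: aeW => z n _; rewrite lee_fin.
apply: fine_cvg; rewrite fineK//; exact: integrable_fin_num.
Qed.

Lemma measurable_below (s : R) : mfunT (fun z : BT => (tof z < s)%R%:R : R).
Proof.
rewrite (_ : (fun _ => _) = \1_(`]-oo, s[ : set R) \o tof); last first.
 by apply/funext => z; rewrite /= indicE mem_setE in_itv.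
by apply: measC; [exact: measI|exact: meas_tof].
Qed.

Lemma layer_vanish (q : BT -> R) : (forall z, 0 <= q z) -> (forall z, ~ Q z -> q z = 0) -> intg q ->
 \int[lamB]_z (q z * (tof z < 2 / n.+1%:R)%R%:R) @[n --> \oo] --> (0 : R).
Proof.
move=> q0 qQ iq; have mq : mfunT q by apply/mEF; exact: measurable_int iq.
have e0 : \int[lamB]_z (cst (0 : R) (z : BT)) = 0 by rewrite /Rintegral integral0.
rewrite -[X in _ --> X]e0; apply: (@Rintegral_dominated _ (cst 0) q) => //.
- by move=> n; apply: measM => //; exact: measurable_below.
- move=> z; have [[_ /andP[z0 _]]|nQz] := pselect (Q z); last first.
 by rewrite qQ//; under eq_cvg do rewrite mul0r; exact: cvg_cst.
 rewrite /cst -[X in _ --> X](mulr0 (q z)); apply: cvgMr; apply: cvg_near_cst.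
 have [N hN] : exists N : nat, 2 / tof z < N%:R.
 by exists (Num.bound (2 / tof z)); apply: archi_boundP; rewrite divr_ge0// ltW.
 near=> n; have nN : (N <= n)%N by near: n; exact: nbhs_infty_ge.
 have h : 2 / tof z < n.+1%:R.
 by apply: lt_le_trans hN _; rewrite ler_nat; exact: leqW.
 have : 2 / n.+1%:R < tof z by move: h; rewrite ltr_pdivrMr// => h; rewrite ltr_pdivrMr// mulrC.
 by move=> /ltW; rewrite leNgt => /negbTE ->.
- by move=> n z; rewrite normrM ger0_norm// ger0_norm// ler_piMr//; case: (_ < _).
Unshelve. all: by end_near. Qed.

Lemma measurable_tests g (c : R -> R) : box_test g -> mfunT c ->
 mfunT (fun z : BT => tensor g (xof z) * c (tof z)).
Proof.
move=> tg mc; apply: measM.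
 apply: (measC (f := (tensor g : rVB R d -> R))); last exact: meas_xof.
 by apply: cont_meas; apply: tensor_continuous => j; apply: smooth1_cont; have [+ _] := tg.
by apply: (measC mc); exact: meas_tof.
Qed.

Lemma box_test_bounded g : box_test g -> exists2 K : R, 0 <= K & forall x, `|tensor g x| <= K.
Proof. by move=> [sg [a [b [ab ga]]]]; apply: (@test_bounded _ Om); exact: tensor_test ab ga. Qed.

Lemma bounded_support (c : R -> R) (s0 s1 : R) : continuous c -> (forall t, ~ (s0 <= t <= s1) -> c t = 0) ->
 exists2 K : R, 0 <= K & forall t, `|c t| <= K.
Proof.
move=> cc c0; have /compact_bounded[M [Mr hM]] := continuous_compact (continuous_subspaceT cc) (@segment_compact R s0 s1).
exists (Num.max (M + 1) 0); first by rewrite le_max lexx orbT.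
move=> t; rewrite le_max; apply/orP; have [t12|t12] := boolP (s0 <= t <= s1).
 left; apply: (hM (M + 1)); first by rewrite ltrDl.
 by exists t => //; rewrite /= in_itv.
by right; rewrite c0 ?normr0//; exact/negP.
Qed.

Lemma time_test_bounded c : time_test c -> exists2 K : R, 0 <= K & forall t, `|c t| <= K.
Proof.
by move=> [sc [s0 [s1 [_ _ c0]]]]; apply: bounded_support c0; exact: smooth1_cont.
Qed.

Section initial_layer.
Variables (u w : BT -> R).
Hypothesis uw : weakly ord_max u w.
Variable E : R.
Hypothesis E0 : 0 <= E.
Hypothesis early : forall s : R, 0 < s -> s < T ->
 \int[lamB]_z (u z ^+ 2 * (tof z < s)%R%:R) <= E * s ^+ 2 * \int[lamB]_z (w z ^+ 2 * (tof z < s)%R%:R).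
Variables (a h : R) (be G : R -> R).
Hypotheses (a0 : 0 < a) (ah : a < h) (hT : h < T).
Hypotheses (sbe : smooth1 be) (dG : forall t : R, is_derive t 1 G (be t)).
Hypotheses (beout : forall t, ~ (a < t < h) -> be t = 0).
Hypotheses (Gl : forall t, t <= a -> G t = 0) (Gr : forall t, h <= t -> G t = 1) (G01 : forall t, 0 <= G t <= 1).

Lemma time_test_be : time_test be.
Proof.
split=> //; exists a, h; split=> // t nt; apply: beout => /andP[h1 h2]; apply: nt.
by rewrite !ltW.
Qed.

Lemma cutoff_exists : exists ct dct : nat -> R -> R,
 [/\ forall n, time_test (fun t => ct n t * (1 - G t)),
 forall n (t : R), 2 / n.+1%:R <= a -> is_derive t 1 (fun t => ct n t * (1 - G t)) (dct n t - be t),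
 forall n t, 0 <= ct n t <= 1,
 forall t, 0 < t -> ct n t @[n --> \oo] --> (1 : R) &
 (forall n, continuous (ct n)) /\ (forall n, continuous (dct n)) /\
 exists2 K : R, 0 <= K & forall n t, `|dct n t| <= K * n.+1%:R * (t < 2 / n.+1%:R)%R%:R].
Proof.
have [b1 [G1 [sb1 dG1 b10 b1out [G1l G1r G101]]]] := @unit_bump R 1 2 ltac:(lra).
have sG1 := smooth1_intro dG1 sb1; have sG := smooth1_intro dG sbe.
have n0 n : 0 < n.+1%:R :> R by rewrite ltr0n.
exists (fun n t => G1 (n.+1%:R * t + 0)), (fun n t => n.+1%:R * b1 (n.+1%:R * t + 0)).
have s1G : smooth1 (fun t => 1 - G t).
 rewrite (_ : (fun _ => _) = (fun t => cst 1 t + (-1) * G t)); last by apply/funext => t; rewrite mulN1r.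
 by move=> k; apply: ndiffD; [exact: ndiff_cst|exact: smooth1_scale].
split.
- move=> n; split; first by apply: smooth1M => //; exact: smooth1_affine.
 exists (n.+1%:R^-1), h; split=> //.
 move=> t nt; have [th|th] := leP t h; last by rewrite (Gr (ltW th)) subrr mulr0.
 rewrite addr0 G1l ?mul0r//; rewrite leNgt; apply/negP => n1; apply: nt; rewrite th andbT.
 by rewrite -[n.+1%:R^-1]mul1r ler_pdivrMr// mulrC ltW.
- move=> n t na.
 have d1 := @is_derive1_comp _ G1 (fun s => n.+1%:R * s + 0) t _ _ (dG1 _) (is_derive_affine n.+1%:R 0 t).
 have d2 := is_deriveB (is_derive_cst (1 : R) t (1 : R)) (dG t).
 rewrite (_ : (fun _ => _) = (G1 \o (fun s => n.+1%:R * s + 0)) * (cst 1 - G))//.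
 apply: is_derive_eq (is_deriveM d1 d2) _; rewrite /GRing.scale/= sub0r.
 have [ta|ta] := leP t a.
 rewrite (beout (t := t)); last by move=> /andP[]; rewrite ltNge ta.
 rewrite (_ : (cst 1 - G) t = 1 - G t)// (Gl ta); ring.
 rewrite addr0 (b1out (n.+1%:R * t)); last first.
 move=> /andP[_]; rewrite ltNge => /negP; apply; rewrite mulrC -ler_pdivrMr//.
 by apply: le_trans na _; exact: ltW.
 rewrite G1r; last by rewrite mulrC -ler_pdivrMr//; apply: le_trans na _; exact: ltW.
 by ring.
- by move=> n t; exact: G101.
- move=> t t0; apply: cvg_near_cst.
 have [N hN] : exists N : nat, 2 / t < N%:R.
 by exists (Num.bound (2 / t)); apply: archi_boundP; rewrite divr_ge0// ltW.
 near=> n; have nN : (N <= n)%N by near: n; exact: nbhs_infty_ge.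
 rewrite addr0 G1r// -ler_pdivrMr//; apply: le_trans (ltW hN) _.
 by rewrite ler_nat; exact: leqW.
split; [|split].
- by move=> n; apply: smooth1_cont; exact: smooth1_affine.
- by move=> n; apply: smooth1_cont; apply: smooth1_scale; exact: smooth1_affine.
have [K K0 hK] : exists2 K : R, 0 <= K & forall t, `|b1 t| <= K.
 apply: (@bounded_support _ 1 2); first exact: smooth1_cont.
 by move=> t nt; apply: b1out => /andP[p q]; apply: nt; rewrite !ltW.
exists K => // n t; rewrite normrM ger0_norm ?(ltW (n0 n))// addr0.
have [tn|tn] := ltP t (2 / n.+1%:R); first by rewrite mulr1 mulrC ler_wpM2r// ltW.
rewrite b1out ?normr0 ?mulr0// => /andP[_]; rewrite ltNge => /negP; apply.
by rewrite mulrC -ler_pdivrMr.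
Unshelve. all: by end_near. Qed.

Lemma initial_layer_vanish (f : BT -> R) (dct : nat -> R -> R) (K L : R) : 0 <= K -> 0 <= L ->
 mfunT f -> (forall z, `|f z| <= L) -> (forall n, continuous (dct n)) ->
 (forall n t, `|dct n t| <= K * n.+1%:R * (t < 2 / n.+1%:R)%R%:R) ->
 \int[lamB]_z (u z * (f z * dct n (tof z))) @[n --> \oo] --> (0 : R).
Proof.
move=> K0 L0 mf fL cd dK; have [[mu_ zu fu] [mw zw fw]] := weakly_L2 uw.
have iw : intg (fun z => w z ^+ 2).
 apply/integrableP; split; first by apply/mEF; exact: measX.
 by under eq_integral do rewrite /= ger0_norm ?sqr_ge0//.
have iu : intg (fun z => u z ^+ 2).
 apply/integrableP; split; first by apply/mEF; exact: measX.
 by under eq_integral do rewrite /= ger0_norm ?sqr_ge0//.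
have iQ : intg (\1_Q : BT -> R).
 apply/integrableP; split; first by apply/mEF; apply: measI; exact: measurable_cylinder.
 under eq_integral do rewrite /= ger0_norm//.
 by rewrite integral_indic ?setIT//; [exact: cylinder_finite|exact: measurable_cylinder].
pose low n (z : BT) : R := (tof z < 2 / n.+1%:R)%R%:R.
have mlow n : mfunT (low n) by exact: measurable_below.
have low1 n z : `|low n z| <= 1 by rewrite /low; case: (_ < _); rewrite ?normr1 ?normr0.
have low0 n z : 0 <= low n z by rewrite /low; case: (_ < _).
have md n : mfunT (fun z : BT => dct n (tof z)).
 by apply: measC; [exact: measF|exact: meas_tof].
have zw2 (z : BT) : ~ Q z -> w z ^+ 2 = 0 by move=> nz; rewrite zw// expr0n.
have cW := layer_vanish (fun z => sqr_ge0 (w z)) zw2 iw.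
have q0 (z : BT) : 0 <= \1_Q z :> R by rewrite indicE.
have qz (z : BT) : ~ Q z -> \1_Q z = 0 :> R by move=> nz; rewrite indicE memNset.
have cQ := layer_vanish q0 qz iQ.
pose B n : R := L * K * (E * 4 * \int[lamB]_z (w z ^+ 2 * low n z) + \int[lamB]_z (\1_Q z * low n z)).
have cB : B n @[n --> \oo] --> (0 : R).
 rewrite -(mulr0 (L * K)); apply: cvgMr; rewrite -[0 in X in _ --> X](addr0 0).
 by apply: cvgD => //; rewrite -(mulr0 (E * 4)); exact: cvgMr.
apply: (@squeeze_cvgr _ _ _ _ (fun n => - B n) B) => //; last by rewrite -oppr0; exact: cvgN.
have [N hN] : exists N : nat, 2 / T < N%:R.
 by exists (Num.bound (2 / T)); apply: archi_boundP; rewrite divr_ge0// ltW//; move: a0 ah hT; lra.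
have T0 : 0 < T by move: a0 ah hT; lra.
near=> n; have nN : (N <= n)%N by near: n; exact: nbhs_infty_ge.
have n0 : 0 < n.+1%:R :> R by rewrite ltr0n.
rewrite -ler_norml.
have mF : mfunT (fun z => f z * dct n (tof z)) by exact: measM.
have dKn t : `|dct n t| <= K * n.+1%:R.
 apply: le_trans (dK n t) _; rewrite ler_piMr//; first by rewrite mge0// ltW.
 by case: (_ < _).
have FK z : `|f z * dct n (tof z)| <= L * (K * n.+1%:R) by rewrite normrM ler_pM.
have iuF := L2Q_mul (And3 mu_ zu fu) mF FK.
apply: le_trans (le_normr_Rintegral measurableT iuF) _.
have i1 := integrable_mulb iu (mlow n) (low1 n).
have i2 := integrable_mulb iQ (mlow n) (low1 n).
have s0 : 0 < 2 / n.+1%:R :> R by rewrite divr_gt0.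
have sT : 2 / n.+1%:R < T.
 have : 2 / T < n.+1%:R by apply: lt_le_trans hN _; rewrite ler_nat; exact: leqW.
 by rewrite ltr_pdivrMr// => q; rewrite ltr_pdivrMr// mulrC.
have iR : intg (fun z => L * K * (n.+1%:R ^+ 2 * (u z ^+ 2 * low n z) + \1_Q z * low n z)).
 have j1 := integrableZl measurableT (n.+1%:R ^+ 2) i1.
 by have := integrableZl measurableT (L * K) (integrableD measurableT j1 i2).
apply: (le_via (\int[lamB]_z (L * K * (n.+1%:R ^+ 2 * (u z ^+ 2 * low n z) + \1_Q z * low n z)))).
 apply: le_Rintegral => //; first exact: integrable_abse iuF.
 move=> z _; rewrite normrM normrM.
 have [Qz|nQz] := pselect (Q z); last first.
 rewrite zu// normr0 mul0r mge0 ?(mge0 L0 K0)// addr_ge0// ?mge0 ?sqr_ge0//.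
 rewrite indicE mem_set// mul1r.
 apply: (le_via (`|u z| * (L * (K * n.+1%:R * low n z)))).
 by rewrite ler_wpM2l// ler_pM.
 have key (x : R) (v : R) : 0 <= x -> x * v <= v ^+ 2 * x ^+ 2 + 1 by move=> _; have := sqr_ge0 (v * x - 1); rewrite !expr2; nra.
 have := key `|u z| n.+1%:R (normr_ge0 _); rewrite real_normK ?num_real// => k1.
 rewrite [leLHS](_ : _ = L * K * ((`|u z| * n.+1%:R) * low n z)); last by ring.
 rewrite [X in _ <= _ * X](_ : _ = (n.+1%:R ^+ 2 * u z ^+ 2 + 1) * low n z); last by ring.
 by rewrite ler_wpM2l ?mge0// ler_wpM2r.
rewrite RintegralZl//; last first.
 by have := integrableD measurableT (integrableZl measurableT (n.+1%:R ^+ 2) i1) i2.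
rewrite RintegralD//; last by have := integrableZl measurableT (n.+1%:R ^+ 2) i1.
rewrite RintegralZl// /B ler_wpM2l ?mge0// lerD2r.
have e := early s0 sT.
apply: (le_via (n.+1%:R ^+ 2 * (E * (2 / n.+1%:R) ^+ 2 * \int[lamB]_z (w z ^+ 2 * low n z)))).
 by rewrite ler_wpM2l ?sqr_ge0.
rewrite mulrA (_ : _ ^+ 2 * (_ * _ ^+ 2) = E * 4)//.
by rewrite mulrCA -exprMn [n.+1%:R * _]mulrC divfK ?gt_eqF// expr2 -natrM.
Unshelve. all: by end_near. Qed.

Lemma cutoff_cvg (q f : BT -> R) (ct : nat -> R -> R) (L : R) : L2Q q -> mfunT f ->
 (forall z, `|f z| <= L) -> (forall n, continuous (ct n)) -> (forall n t, 0 <= ct n t <= 1) ->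
 (forall t, 0 < t -> ct n t @[n --> \oo] --> (1 : R)) ->
 \int[lamB]_z (q z * (f z * ct n (tof z))) @[n --> \oo] --> \int[lamB]_z (q z * f z).
Proof.
move=> [mq zq fq] mf fL cc c01 c1.
have iqf := L2Q_mul (And3 mq zq fq) mf fL.
apply: (@Rintegral_dominated _ _ (fun z => `|q z * f z|)) => //.
- move=> n; apply: measM => //; apply: measM => //.
 by apply: measC; [exact: measF|exact: meas_tof].
- exact: measM.
- move=> z; have [[_ /andP[z0 _]]|nQz] := pselect (Q z); last first.
 by rewrite zq// mul0r; under eq_cvg do rewrite mul0r; exact: cvg_cst.
 rewrite -[X in _ --> X](mulr1 (q z * f z)); under eq_cvg do rewrite mulrA.
 by apply: cvgMr; exact: c1.
- exact: integrable_abse iqf.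
- by move=> n z; rewrite mulrA normrM ler_piMr// ger0_norm; have /andP[] := c01 n (tof z).
Qed.

Lemma near_small : \forall n \near \oo, 2 / n.+1%:R <= a.
Proof.
have [N hN] : exists N : nat, 2 / a < N%:R.
 by exists (Num.bound (2 / a)); apply: archi_boundP; rewrite divr_ge0// ltW.
near=> n; have nN : (N <= n)%N by near: n; exact: nbhs_infty_ge.
have : 2 / a < n.+1%:R by apply: lt_le_trans hN _; rewrite ler_nat; exact: leqW.
by rewrite ltr_pdivrMr// => /ltW q; rewrite ler_pdivrMr// mulrC.
Unshelve. all: by end_near. Qed.

Lemma measurable_rise g : box_test g ->
 mfunT (fun z : BT => tensor g (xof z) * (1 - G (tof z))).
Proof.
move=> tg; apply: (measurable_tests (c := fun t => 1 - G t)) => //.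
apply: measB => //; apply: measF; exact: is_derive_continuous dG.
Qed.

Lemma rise_bounded g K : (forall x, `|tensor g x| <= K) ->
 forall z : VT, `|tensor g (xof z) * (1 - G (tof z))| <= K.
Proof.
move=> gK z; rewrite normrM -[leRHS]mulr1 ler_pM//.
by have /andP[h1 h2] := G01 (tof z); rewrite ger0_norm; lra.
Qed.

Lemma initial_time g : box_test g ->
 \int[lamB]_z (u z * (tensor g (xof z) * be (tof z))) =
 \int[lamB]_z (w z * (tensor g (xof z) * (1 - G (tof z)))).
Proof.
move=> tg; have [Lu Lw] := weakly_L2 uw; have [K K0 gK] := box_test_bounded tg.
have [ct [dct [tt dtt c01 c1 [cc [cd [C C0 hC]]]]]] := cutoff_exists.
have mg : mfunT (fun z : BT => tensor g (xof z)).
 have := measurable_tests tg (measK (1 : R)); congr measurable_fun; apply/funext => z; exact: mulr1.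
have c2 := cutoff_cvg Lw (measurable_rise tg) (rise_bounded gK) cc c01 c1.
have c3 := initial_layer_vanish C0 K0 mg (fun z => gK (xof z)) cd hC.
have [B B0 hB] := test_bounded (join_test tg time_test_be).
have mbe : mfunT be by apply: measF; exact: smooth1_cont.
have ib : intg (fun z => u z * (tensor g (xof z) * be (tof z))).
 by apply: (L2Q_mul Lu (measurable_tests tg mbe) (K := B)) => z; rewrite -tensor_join.
have c4 : (\int[lamB]_z (u z * (tensor g (xof z) * dct n (tof z))) +
 \int[lamB]_z (w z * (tensor g (xof z) * (1 - G (tof z)) * ct n (tof z)))) @[n --> \oo] -->
 \int[lamB]_z (u z * (tensor g (xof z) * be (tof z))).
 apply: cvg_near_cst; near=> n; have na : 2 / n.+1%:R <= a by near: n; exact: near_small.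
 have := weak_time uw tg (tt n) (dtt n ^~ na).
 have id_ : intg (fun z => u z * (tensor g (xof z) * dct n (tof z))).
 apply: (L2Q_mul Lu (measurable_tests tg _) (K := K * (C * n.+1%:R))); first exact: measF.
 move=> z; rewrite normrM ler_pM//; apply: le_trans (hC n _) _; rewrite ler_piMr//; last by case: (_ < _).
 by rewrite mge0.
 rewrite (_ : \int[lamB]_z (u z * (tensor g (xof z) * (dct n (tof z) - be (tof z)))) =
 \int[lamB]_z (u z * (tensor g (xof z) * dct n (tof z))) -
 \int[lamB]_z (u z * (tensor g (xof z) * be (tof z)))); last first.
 by rewrite -RintegralB//; apply: eq_Rintegral => z _; ring.
 rewrite (_ : \int[lamB]_z (w z * (tensor g (xof z) * (ct n (tof z) * (1 - G (tof z))))) =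
 \int[lamB]_z (w z * (tensor g (xof z) * (1 - G (tof z)) * ct n (tof z)))); last first.
 by apply: eq_Rintegral => z _; ring.
 by move=> /eqP; rewrite subr_eq => /eqP ->; rewrite addrAC addNr add0r.
by have := cvg_unique _ c4 (cvgD c3 c2); rewrite add0r; apply.
Unshelve. all: by end_near. Qed.

Lemma initial_gradient (i : 'I_d.+1) p q g : weakly (lift ord_max i) u p -> weakly (lift ord_max i) w q ->
 box_test g ->
 \int[lamB]_z (p z * (tensor g (xof z) * be (tof z))) =
 \int[lamB]_z (q z * (tensor g (xof z) * (1 - G (tof z)))).
Proof.
move=> up wq tg; have [g' dg _] := smooth1_derive (tg.1 i); have tg' := box_test_derive tg dg.
have e1 := weak_space up tg time_test_be dg.
rewrite (initial_time tg') in e1.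
have [ct [dct [tt dtt c01 c1 [cc [cd _]]]]] := cutoff_exists.
have [Lu Lw] := weakly_L2 uw; have [_ Lq] := weakly_L2 wq.
have [K K0 gK] := box_test_bounded tg; have [K' K'0 gK'] := box_test_bounded tg'.
have c2 := cutoff_cvg Lw (measurable_rise tg') (rise_bounded gK') cc c01 c1.
have c3 := cutoff_cvg Lq (measurable_rise tg) (rise_bounded gK) cc c01 c1.
have e n : \int[lamB]_z (w z * (tensor (fun j => if j == i then g' else g j) (xof z) * (1 - G (tof z)) * ct n (tof z))) =
 - \int[lamB]_z (q z * (tensor g (xof z) * (1 - G (tof z)) * ct n (tof z))).
 have hs := weak_space wq tg (tt n) dg.
 transitivity (\int[lamB]_z (w z * (tensor (fun j => if j == i then g' else g j) (xof z) * (ct n (tof z) * (1 - G (tof z)))))).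
 by apply: eq_Rintegral => z _; ring.
 by rewrite hs; congr (- _); apply: eq_Rintegral => z _; ring.
move: c2; under eq_cvg do rewrite e; move=> c2.
by apply: oppr_inj; rewrite -e1; have := cvg_unique _ c2 (cvgN c3); apply.
Qed.

End initial_layer.

Lemma multiplier (q1 q2 : BT -> R) (c1 c2 : R -> R) (K : R) (e : R) : L2Q q1 -> L2Q q2 ->
 mfunT c1 -> mfunT c2 -> (forall t, `|c1 t| <= K) -> (forall t, `|c2 t| <= K) ->
 (forall g, box_test g ->
 \int[lamB]_z (q1 z * (tensor g (xof z) * c1 (tof z))) =
 e * \int[lamB]_z (q2 z * (tensor g (xof z) * c2 (tof z)))) ->
 forall (f : rVB R d -> R) (L : R), mfunT f -> (forall x, `|f x| <= L) -> (forall x, ~ Om x -> f x = 0) ->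
 \int[lamB]_z (q1 z * (f (xof z) * c1 (tof z))) =
 e * \int[lamB]_z (q2 z * (f (xof z) * c2 (tof z))).
Proof.
move=> L1 L2 m1 m2 k1 k2 h f L mf fL fOm.
have mc (c : R -> R) : mfunT c -> mfunT (fun z : BT => c (tof z)).
 by move=> m; apply: measC => //; exact: meas_tof.
pose q z := q1 z * c1 (tof z) - e * (q2 z * c2 (tof z)).
have i1 := L2Q_mul L1 (mc _ m1) (fun z => k1 (tof z)).
have i2 := L2Q_mul L2 (mc _ m2) (fun z => k2 (tof z)).
have iq : intg q by have := integrableB measurableT i1 (integrableZl measurableT e i2).
have split_int (F : rVB R d -> R) (B : R) : mfunT F -> (forall x, `|F x| <= B) ->
 \int[lamB]_z (q z * F (xof z)) =
 \int[lamB]_z (q1 z * (F (xof z) * c1 (tof z))) - e * \int[lamB]_z (q2 z * (F (xof z) * c2 (tof z))).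
 move=> mF FB; have mFs : mfunT (fun z : BT => F (xof z)).
 by apply: (measC mF); exact: meas_xof.
 have j1 := integrable_mulb i1 mFs (fun z => FB (xof z)).
 have j2 := integrable_mulb i2 mFs (fun z => FB (xof z)).
 transitivity (\int[lamB]_z (q1 z * c1 (tof z) * F (xof z)) - e * \int[lamB]_z (q2 z * c2 (tof z) * F (xof z))).
 rewrite -RintegralZl// -RintegralB//; last by have := integrableZl measurableT e j2.
 by apply: eq_Rintegral => z _; rewrite /q; ring.
 by congr (_ - e * _); apply: eq_Rintegral => z _; ring.
have key : \int[lamB]_z (q z * f (xof z)) = 0.
 rewrite /Rintegral (bump_dense oOm meas_xof iq _ mf fL fOm)// => a b k abO.
 have [[x xab]|nab] := pselect (exists x, obox a b x); last first.
 rewrite integral0_eq// => z _; rewrite (_ : bumps a b k (xof z) = 0) ?mulr0//.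
 have [j nj] : exists j, ~ (a ord0 j < xof z ord0 j < b ord0 j).
 by apply: contrapT => hh; apply: nab; exists (xof z) => j; apply: contrapT => nj; apply: hh; exists j.
 by rewrite /bumps /tensor (bigD1 j)//= bump_out// mul0r.
 have tb : box_test (fun j => hump (a ord0 j) (b ord0 j) k).
 split; first by move=> j; exact: bump_smooth.
 exists a, b; split; first exact: abO xab.
 by move=> j t nt; apply: bump_out => /andP[h1 h2]; apply: nt; rewrite !ltW.
 have mb := @measurable_bumps R d a b k.
 have bK x' : `|bumps a b k x'| <= 1 by rewrite ger0_norm ?bumps_ge0// bumps_le1.
 have s := split_int _ _ mb bK; rewrite (h _ tb) subrr in s.
 have ib := integrable_mulb iq (measC mb meas_xof) (fun z => bK (xof z)).
 by rewrite -(fineK (integrable_fin_num measurableT ib)) -[fine _]/(\int[lamB]_z (q z * bumps a b k (xof z))) s.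
by move: key; rewrite (split_int _ _ mf fL) => /eqP; rewrite subr_eq0 => /eqP.
Qed.


Lemma Rintegral_sum (I : eqType) (s : seq I) (F : I -> BT -> R) : (forall i, intg (F i)) ->
 intg (fun z => \sum_(i <- s) F i z) /\ \int[lamB]_z (\sum_(i <- s) F i z) = \sum_(i <- s) \int[lamB]_z F i z.
Proof.
move=> iF; elim: s => [|i s [ih1 ih2]].
 rewrite big_nil; under eq_Rintegral do rewrite big_nil.
 rewrite (_ : (fun z => _) = cst 0); last by apply/funext => z; rewrite big_nil.
 by split; [exact: integrable0|rewrite /Rintegral integral0].
have e : (fun z => \sum_(j <- i :: s) F j z) = (fun z => F i z + \sum_(j <- s) F j z).
 by apply/funext => z; rewrite big_cons.
rewrite e big_cons -ih2 -RintegralD//; split=> //; by have := integrableD measurableT (iF i) ih1.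
Qed.

Section differentiated_equation.
Variables (u w wt r rt : BT -> R) (a b : 'I_d.+1 -> BT -> R).
Variables (H : 'I_d.+1 -> rVB R d -> R) (p f : rVB R d -> R) (B : R).
Hypotheses (uw : weakly ord_max u w) (wwt : weakly ord_max w wt) (rrt : weakly ord_max r rt).
Hypotheses (ua : forall i, weakly (lift ord_max i) u (a i)) (wb : forall i, weakly (lift ord_max i) w (b i)).
Hypotheses (mH : forall i, mfunT (H i)) (mp : mfunT p) (mf : mfunT f).
Hypotheses (HB : forall i x, `|H i x| <= B) (pB : forall x, `|p x| <= B).
Hypothesis eqn : exists2 N : set BT, nullB N & forall z, Q z -> ~ N z ->
 w z + \sum_i H i (xof z) * a i z + p (xof z) * u z = r z * f (xof z).

Let cut (n : nat) (x : rVB R d) : R := (`|f x| <= n%:R)%R%:R.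

Let mcut n : mfunT (cut n).
Proof.
rewrite (_ : cut n = \1_(`[- n%:R, n%:R] : set R) \o f); last first.
 by apply/funext => x; rewrite /cut /= indicE mem_setE in_itv ler_norml.
by apply: measC => //; exact: measI.
Qed.

Let cut01 n x : 0 <= cut n x <= 1.
Proof. by rewrite /cut ler0n lern1 leq_b1. Qed.

Let defect z := wt z + \sum_i H i (xof z) * b i z + p (xof z) * w z - rt z * f (xof z).

Lemma tested_equation (g : rVB R d -> R) (L : R) (n : nat) (c c' : R -> R) :
 mfunT g -> (forall x, `|g x| <= L) -> (forall x, ~ Om x -> g x = 0) ->
 time_test c -> (forall t : R, is_derive t 1 c (c' t)) ->
 \int[lamB]_z (defect z * (g (xof z) * cut n (xof z) * c (tof z))) = 0.
Proof.
move=> mg gL gOm tc dc; have tc' := time_test_derive tc dc.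
have [K1 K10 hK1] := time_test_bounded tc; have [K2 K20 hK2] := time_test_bounded tc'.
pose K := Num.max K1 K2.
have k1 t : `|c t| <= K by apply: le_trans (hK1 t) _; rewrite le_max lexx.
have k2 t : `|c' t| <= K by apply: le_trans (hK2 t) _; rewrite le_max lexx orbT.
have mc : mfunT c by apply: measF; apply: smooth1_cont; have [] := tc.
have mc' : mfunT c' by apply: measF; apply: smooth1_cont; have [] := tc'.
have L0 : 0 <= L by apply: le_trans (gL 0).
have B0 : 0 <= B by apply: le_trans (pB 0).
pose G x := g x * cut n x.
have mG : mfunT G by exact: measM.
have GL x : `|G x| <= L.
 rewrite normrM -[leRHS]mulr1 ler_pM// ger0_norm; by have /andP[] := cut01 n x.
have mul (q q' : BT -> R) (s : rVB R d -> R) (C : R) : L2Q q -> L2Q q' ->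
 (forall g0, box_test g0 -> \int[lamB]_z (q z * (tensor g0 (xof z) * c' (tof z))) =
 - \int[lamB]_z (q' z * (tensor g0 (xof z) * c (tof z)))) ->
 mfunT s -> (forall x, `|s x * cut n x| <= C) ->
 [/\ intg (fun z => q' z * (G (xof z) * s (xof z) * c (tof z))),
 intg (fun z => q z * (G (xof z) * s (xof z) * c' (tof z))) &
 \int[lamB]_z (q' z * (G (xof z) * s (xof z) * c (tof z))) =
 - \int[lamB]_z (q z * (G (xof z) * s (xof z) * c' (tof z)))].
 move=> Lq Lq' h ms sC.
 have mGs : mfunT (fun x => G x * s x) by exact: measM.
 have GsB x : `|G x * s x| <= L * C.
 rewrite (_ : G x * s x = g x * (s x * cut n x)); last by rewrite /G; ring.
 by rewrite normrM ler_pM.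
 have bd (e : R -> R) : (forall t, `|e t| <= K) -> forall z, `|G (xof z) * s (xof z) * e (tof z)| <= L * C * K.
 by move=> eK z; rewrite normrM ler_pM.
 have mm (e : R -> R) : mfunT e ->
 mfunT (fun z : BT => G (xof z) * s (xof z) * e (tof z)).
 move=> me; apply: measM.
 by apply: (measC mGs); exact: meas_xof.
 by apply: (measC me); exact: meas_tof.
 split; [exact: L2Q_mul Lq' (mm _ mc) (bd _ k1)|exact: L2Q_mul Lq (mm _ mc') (bd _ k2)|].
 have := @multiplier q q' c' c K (-1) Lq Lq' mc' mc k2 k1 _ (fun x => G x * s x) _ mGs GsB.
 move=> ->; rewrite ?mulN1r ?opprK//; last by move=> x nx; rewrite /G gOm// !mul0r.
 by move=> g0 tg0; rewrite h// mulN1r.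
have cB (s : rVB R d -> R) : (forall x, `|s x| <= B) -> forall x, `|s x * cut n x| <= B.
 move=> sB x; rewrite normrM -[leRHS]mulr1 ler_pM// ger0_norm; by have /andP[] := cut01 n x.
have cf x : `|f x * cut n x| <= n%:R.
 by rewrite /cut; case: (leP `|f x| n%:R) => [h|_]; rewrite ?mulr1// mulr0 normr0.
have [Lu Lw] := weakly_L2 uw; have [_ Lwt] := weakly_L2 wwt; have [Lr Lrt] := weakly_L2 rrt.
have [x1 x2 x3] := mul w wt (cst 1) 1 Lw Lwt (fun g0 tg0 => weak_time wwt tg0 tc dc) (measK _)
 (fun x => ltac:(by rewrite mul1r ger0_norm; have /andP[] := cut01 n x)).
have [y1 y2 y3] := mul u w p B Lu Lw (fun g0 tg0 => weak_time uw tg0 tc dc) mp (cB _ pB).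
have [z1 z2 z3] := mul r rt f n%:R Lr Lrt (fun g0 tg0 => weak_time rrt tg0 tc dc) mf cf.
have hi i := mul (a i) (b i) (H i) B (weakly_L2 (ua i)).2 (weakly_L2 (wb i)).2
 (fun g0 tg0 => gradient_time (ua i) uw (wb i) tg0 tc dc) (mH i) (cB _ (HB i)).
have [s1 s2] := @Rintegral_sum _ (index_enum 'I_d.+1) (fun i z => b i z * (G (xof z) * H i (xof z) * c (tof z)))
 (fun i => let: And3 h _ _ := hi i in h).
have [s3 s4] := @Rintegral_sum _ (index_enum 'I_d.+1) (fun i z => a i z * (G (xof z) * H i (xof z) * c' (tof z)))
 (fun i => let: And3 _ h _ := hi i in h).
have s5 : \sum_i \int[lamB]_z (b i z * (G (xof z) * H i (xof z) * c (tof z))) =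
 - \sum_i \int[lamB]_z (a i z * (G (xof z) * H i (xof z) * c' (tof z))).
 by rewrite -sumrN; apply: eq_bigr => i _; have [] := hi i.
have four (q1 q2 q3 q4 : BT -> R) : intg q1 -> intg q2 -> intg q3 -> intg q4 ->
 \int[lamB]_z (q1 z + q2 z + q3 z - q4 z) =
 \int[lamB]_z q1 z + \int[lamB]_z q2 z + \int[lamB]_z q3 z - \int[lamB]_z q4 z.
 move=> i1 i2 i3 i4; have i12 : intg (fun z => q1 z + q2 z) by have := integrableD measurableT i1 i2.
 have i123 : intg (fun z => q1 z + q2 z + q3 z) by have := integrableD measurableT i12 i3.
 by rewrite RintegralB// RintegralD// RintegralD.
have lhs : \int[lamB]_z (defect z * (g (xof z) * cut n (xof z) * c (tof z))) =
 \int[lamB]_z (wt z * (G (xof z) * 1 * c (tof z)) +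
 \sum_i b i z * (G (xof z) * H i (xof z) * c (tof z)) +
 w z * (G (xof z) * p (xof z) * c (tof z)) -
 rt z * (G (xof z) * f (xof z) * c (tof z))).
 apply: eq_Rintegral => z _; rewrite /defect /G.
 rewrite (_ : \sum_i b i z * _ = (\sum_i H i (xof z) * b i z) * (g (xof z) * cut n (xof z) * c (tof z))).
 by ring.
 by rewrite mulr_suml; apply: eq_bigr => i _; ring.
rewrite lhs four// s2 s5 x3 y3 z3 -s4.
have [N [mN N0] eN] := eqn.
have rhs : \int[lamB]_z (w z * (G (xof z) * 1 * c' (tof z)) +
 \sum_i a i z * (G (xof z) * H i (xof z) * c' (tof z)) +
 u z * (G (xof z) * p (xof z) * c' (tof z)) -
 r z * (G (xof z) * f (xof z) * c' (tof z))) = 0.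
 rewrite /Rintegral (@ae_eq_integral _ _ _ lamB setT (cst 0%E)) ?integral0//.
 - have i12 := integrableD measurableT x2 s3; have i123 := integrableD measurableT i12 y2.
 by have /integrableP[] := integrableB measurableT i123 z2.
 - exists N; split=> // z /= nz; apply: contrapT => Nz; apply: nz => _; rewrite /cst; congr EFin.
 have [Qz|nQz] := pselect (Q z); last first.
 have q0 q : L2Q q -> q z = 0 by move=> [_ + _]; exact.
 rewrite big1 => [|i _]; last by rewrite (q0 _ (weakly_L2 (ua i)).2) mul0r.
 by rewrite (q0 _ Lw) (q0 _ Lu) (q0 _ Lr) !mul0r !addr0 subr0.
 have := eN z Qz Nz => e.
 rewrite (_ : \sum_i a i z * _ = (\sum_i H i (xof z) * a i z) * (G (xof z) * c' (tof z))); last first.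
 by rewrite mulr_suml; apply: eq_bigr => i _; ring.
 transitivity ((w z + \sum_i H i (xof z) * a i z + p (xof z) * u z - r z * f (xof z)) *
 (G (xof z) * c' (tof z))); first by ring.
 by rewrite e subrr mul0r.
have := rhs; rewrite four//.
rewrite -[\int[lamB]_z (w z * (G (xof z) * cst 1 (xof z) * c' (tof z)))]/(\int[lamB]_z (w z * (G (xof z) * 1 * c' (tof z)))).
lra.
Qed.

Lemma differentiated_equation : exists2 N : set BT, nullB N &
 forall z, Q z -> ~ N z ->
 wt z + \sum_i H i (xof z) * b i z + p (xof z) * w z = rt z * f (xof z).
Proof.
have [Lu Lw] := weakly_L2 uw; have [_ Lwt] := weakly_L2 wwt; have [Lr Lrt] := weakly_L2 rrt.
have Lb i : L2Q (b i) := (weakly_L2 (wb i)).2.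
have mm (s : rVB R d -> R) : mfunT s -> mfunT (fun z : BT => s (xof z)).
 by move=> ms; apply: (measC ms); exact: meas_xof.
have iH i : intg (fun z => b i z * H i (xof z)) := L2Q_mul (Lb i) (mm _ (mH i)) (fun z => HB i (xof z)).
have ip : intg (fun z => w z * p (xof z)) := L2Q_mul Lw (mm _ mp) (fun z => pB (xof z)).
have [iS _] := @Rintegral_sum _ (index_enum 'I_d.+1) _ iH.
have mF n : mfunT (fun x => f x * cut n x) by exact: measM.
have Fn n x : `|f x * cut n x| <= n%:R.
 by rewrite /cut; case: (leP `|f x| n%:R) => [h|_]; rewrite ?mulr1// mulr0 normr0.
have icut n (q : BT -> R) : intg q -> intg (fun z => q z * cut n (xof z)).
 move=> iq; apply: (@integrable_mulb _ _ _ _ 1 iq); first exact: mm.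
 by move=> z; rewrite ger0_norm; have /andP[] := cut01 n (xof z).
pose q n z := defect z * cut n (xof z).
have iq n : intg (q n).
 have iwt : intg wt by have [? ? ?] := Lwt; exact: L2_integrable.
 have j1 := integrableD measurableT iwt iS; have j2 := integrableD measurableT j1 ip.
 have j3 := icut n _ j2; have j4 := L2Q_mul Lrt (mm _ (mF n)) (fun z => Fn n (xof z)).
 have := integrableB measurableT j3 j4; congr integrable; apply/funext => z /=.
 rewrite -EFinB /q /defect; congr EFin.
 rewrite [\sum_i H i _ * b i z](eq_bigr (fun i => b i z * H i (xof z))); last by move=> i _; rewrite mulrC.
 by ring.
have qQ n z : ~ Q z -> q n z = 0.
 move=> nz; have z0 (v : BT -> R) : L2Q v -> v z = 0 by move=> [_ + _]; exact.
 rewrite /q /defect big1 => [|i _]; last by rewrite (z0 _ (Lb i)) mulr0.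
 by rewrite (z0 _ Lwt) (z0 _ Lw) (z0 _ Lrt) mulr0 mul0r !addr0 subr0 mul0r.
have tests n (A B' : VT) k : (forall z, obox A B' z -> box A B' `<=` Q) ->
 (\int[lamB]_z (q n z * bumps A B' k z)%:E = 0)%E.
 move=> AQ; have bE z : bumps A B' k z = bumps (xof A) (xof B') k (xof z) * hump (tof A) (tof B') k (tof z).
 rewrite /bumps /tensor prod_space_time; congr (_ * _).
 by apply: eq_bigr => i _; rewrite !mxE.
 have [[z0 z0AB]|nAB] := pselect (exists z, obox A B' z); last first.
 rewrite integral0_eq// => z _; rewrite (_ : bumps A B' k z = 0) ?mulr0//.
 have [j nj] : exists j, ~ (A ord0 j < z ord0 j < B' ord0 j).
 by apply: contrapT => hh; apply: nAB; exists z => j; apply: contrapT => nj; apply: hh; exists j.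
 by rewrite /bumps /tensor (bigD1 j)//= bump_out// mul0r.
 have ABQ := AQ _ z0AB.
 have z0c j : A ord0 j <= z0 ord0 j <= B' ord0 j by have /andP[h1 h2] := z0AB j; rewrite !ltW.
 have inQ (x : V) (t : R) : (forall i, xof A ord0 i <= x ord0 i <= xof B' ord0 i) ->
 tof A <= t <= tof B' -> Om x /\ 0 < t < T.
 move=> xb tb; have : Q (spacetime x t).
 apply: ABQ => j; rewrite !mxE; case: unliftP => [i ->|->]; last exact: tb.
 by have := xb i; rewrite !mxE.
 by rewrite /cylinder/= xofE tofE.
 have sz0 i : xof A ord0 i <= xof z0 ord0 i <= xof B' ord0 i by rewrite !mxE; exact: z0c.
 have tAB : tof A <= tof B' by have /andP[h1 h2] := z0c ord_max; exact: le_trans h1 h2.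
 have tA := inQ _ (tof A) sz0 (ltac:(by rewrite lexx)).
 have tB := inQ _ (tof B') sz0 (ltac:(by rewrite lexx tAB)).
 have tc : time_test (hump (tof A) (tof B') k).
 split; first exact: bump_smooth.
 exists (tof A), (tof B'); split; [by have [_ /andP[]] := tA|by have [_ /andP[]] := tB|].
 by move=> t nt; apply: bump_out => /andP[h1 h2]; apply: nt; rewrite !ltW.
 have [c' dc _] := smooth1_derive (bump_smooth (tof A) (tof B') k).
 have bK x' : `|bumps (xof A) (xof B') k x'| <= 1 by rewrite ger0_norm ?bumps_ge0// bumps_le1.
 have offOm x : ~ Om x -> bumps (xof A) (xof B') k x = 0.
 move=> nx; have [j nj] : exists j, ~ (xof A ord0 j < x ord0 j < xof B' ord0 j).
 apply: contrapT => hh; apply: nx; apply: (inQ x (tof z0) _ (z0c ord_max)).1 => i.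
 have /andP[h1 h2] : xof A ord0 i < x ord0 i < xof B' ord0 i.
 by apply: contrapT => nj; apply: hh; exists i.
 by rewrite !ltW.
 by rewrite /bumps /tensor (bigD1 j)//= bump_out// mul0r.
 have := tested_equation n (@measurable_bumps R d (xof A) (xof B') k) bK offOm tc dc.
 have mb := @measurable_bumps R d.+1 A B' k.
 have bK2 x' : `|bumps A B' k x'| <= 1 by rewrite ger0_norm ?bumps_ge0// bumps_le1.
 have ib := integrable_mulb (iq n) mb bK2.
 rewrite -(fineK (integrable_fin_num measurableT ib)) => h; congr EFin; rewrite -[RHS]h.
 by apply: eq_Rintegral => z _; rewrite /q bE; ring.
have vanish n : {ae (@lamB R d.+1), forall z, q n z = 0}.
 have mq : mfunT (q n) by apply/mEF; exact: measurable_int (iq n).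
 pose g z : R := (0 < q n z)%R%:R - (q n z < 0)%R%:R.
 have mg : mfunT g.
 rewrite (_ : g = (fun z => \1_(`]0, +oo[ : set R) (q n z) - \1_(`]-oo, 0[ : set R) (q n z))); last first.
 by apply/funext => z; rewrite /g !indicE !mem_setE !in_itv/= andbT.
 have mi (S : set R) : measurable S -> mfunT ((\1_S : R -> R) \o q n).
 by move=> mS; apply: measC; [exact: measI|exact: mq].
 by apply: measB; apply: mi; exact: measurable_itv.
 have gE z : q n z * g z = `|q n z|.
 rewrite /g; case: (ltgtP (q n z) 0) => [h|h|->].
 - by rewrite sub0r mulrN1 ltr0_norm.
 - by rewrite subr0 mulr1 gtr0_norm.
 - by rewrite mul0r normr0.
 have g1 z : `|g z| <= 1.
 by rewrite /g; case: (ltgtP (q n z) 0); rewrite ?subr0 ?sub0r ?normrN ?normr1 ?normr0.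
 have gQ z : ~ Q z -> g z = 0 by move=> nz; rewrite /g qQ// ltxx subr0.
 have := bump_dense cylinder_open (@measurable_id _ _ setT) (iq n) (tests n) mg g1 gQ.
 under eq_integral do rewrite gE.
 move=> h; have := (ae_eq_integral_abs lamB measurableT (measurable_int _ (iq n))).1 h.
 by apply: filterS => z /(_ I) /= [].
pose N' n := [set z | q n z <> 0].
have mN' n : measurable (N' n : set BT).
 have mq : mfunT (q n) by apply/mEF; exact: measurable_int (iq n).
 rewrite (_ : N' n = ~` (q n @^-1` [set 0]))//; apply: measurableC.
 by rewrite -[mset]setTI; apply: mq.
exists (\bigcup_n N' n); first split.
- exact: bigcup_measurable.
- apply: lam_bigcup_null => n; have [A [mA A0 sA]] := vanish n.
 by apply/eqP; rewrite eq_le lam_ge0 andbT -A0; apply: le_lam => z; exact: sA.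
move=> z Qz nz; have [n hn] : exists n : nat, `|f (xof z)| <= n%:R.
 by exists (Num.bound `|f (xof z)|); apply/ltW/archi_boundP.
have : q n z = 0 by apply: contrapT => h; apply: nz; exists n.
by rewrite /q /cut hn mulr1 /defect => /eqP; rewrite subr_eq0 => /eqP.
Qed.

End differentiated_equation.

End space_time_identities.

Section slices.
Context {R : realType} {d : nat}.
Local Notation V := 'rV[R]_d.+1.
Local Notation BV := (rVB R d).
Local Notation VT := 'rV[R]_d.+2.
Local Notation BT := (rVB R d.+1).
Local Notation mu := (@lebesgue_measure R).

Definition slice (A : set VT) (t : R) : set V := [set x | A (spacetime x t)].

Lemma measurable_slice (A : set BT) (t : R) : measurable A -> measurable (slice A t : set BV).
Proof.
move=> mA; rewrite -[mset]setTI.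
exact: (measurable_fun_pair1 t (@meas_pack R d)).
Qed.

Lemma measurable_indic_set (A : set BT) : measurable A ->
 mfunT (fun z : BT => (\1_A z)%:E : \bar R).
Proof. by move=> mA; apply/mEF; exact: measI. Qed.

Lemma slice_indic (A : set VT) (t : R) (x : V) : \1_A (pack (x : BV, t)) = \1_(slice A t) x :> R.
Proof. by rewrite !indicE; congr (_%:R); apply/idP/idP => /set_mem h; exact/mem_set. Qed.

Lemma measurable_slice_mass (A : set BT) : measurable A ->
 mfunT (fun t : R => lamB (slice A t)).
Proof.
move=> mA; have m := measC (measurable_indic_set mA) (@meas_pack R d).
have := measurable_fun_fubini_tonelli_G (m1 := lamB) _ m (fun p => ltac:(by rewrite /= lee_fin)).
congr measurable_fun; apply/funext => t; rewrite /fubini_G /=.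
transitivity (\int[lamB]_x (\1_(slice A t) x)%:E)%E; first by apply: eq_integral => x _; rewrite slice_indic.
by rewrite integral_indic ?setIT//; exact: measurable_slice.
Qed.

Lemma lamB_slices (A : set BT) : measurable A -> (lamB A = \int[mu]_t lamB (slice A t))%E.
Proof.
move=> mA; transitivity (\int[lamB]_z (\1_A z)%:E)%E; first by rewrite integral_indic ?setIT.
rewrite lamB_tonelli2//; last exact: measurable_indic_set.
apply: eq_integral => t _; transitivity (\int[lamB]_x (\1_(slice A t) x)%:E)%E.
 by apply: eq_integral => x _; rewrite slice_indic.
by rewrite integral_indic ?setIT//; exact: measurable_slice.
Qed.

Lemma null_slices (A : set BT) : measurable A -> lamB A = 0%E ->
 {ae mu, forall t, lamB (slice A t) = 0%E}.
Proof.
move=> mA A0; have m := measurable_slice_mass mA.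
have := (ae_eq_integral_abs mu measurableT m).1; move=> /(_ _)/wrap[|].
 by under eq_integral do rewrite gee0_abs//; rewrite -lamB_slices.
by apply: filterS => t /(_ I).
Qed.

Lemma slices_null (A : set BT) : measurable A -> {ae mu, forall t, lamB (slice A t) = 0%E} -> lamB A = 0%E.
Proof.
move=> mA h; have m := measurable_slice_mass mA.
rewrite lamB_slices// -[RHS](@integral0 _ _ _ mu setT); apply: ae_eq_integral => //.
by case: h => N [mN N0 sN]; exists N; split=> // t nt; apply: sN => h; apply: nt => _; exact: h.
Qed.

Lemma space_null (N : set BV) : measurable N -> lam N = 0%E ->
 measurable (xof @^-1` N : set BT) /\ lam (xof @^-1` N : set VT) = 0%E.
Proof.
move=> mN N0; have m : measurable (xof @^-1` N : set BT).
 by rewrite -[mset]setTI; apply: meas_xof.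
split=> //; apply: (slices_null m); apply: aeW => t.
rewrite (_ : slice _ t = N)//; apply/seteqP; split=> x; by rewrite /slice/= xofE.
Qed.

Variables (Om : set V) (T : R).
Hypotheses (oOm : open Om) (bOm : bounded_set Om).
Local Notation Q := (cylinder Om T).

Lemma measurable_initial : measurable (initial_slice Om : set BT).
Proof.
rewrite (_ : initial_slice Om = (xof @^-1` Om) `&` (tof @^-1` [set 0])); last by apply/seteqP; split.
apply: measurableI; rewrite -[mset]setTI.
 by apply: meas_xof => //; exact: rVB_open.
by apply: meas_tof.
Qed.

Lemma initial_trace : exists2 C : R, 0 < C & forall G : BT -> \bar R,
 mfunT G -> (forall z, (0 <= G z)%E) ->
 (\int[lamB]_(x in Om) G (pack (x : BV, 0%R)) <= C%:E * \int[surfB]_(z in initial_slice Om) G z)%E.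
Proof.
exists ((4 * 1) ^+ d.+1 / unit_ball_volume d.+1).
 by rewrite divr_gt0 ?unit_ball_volume_gt0// exprn_gt0// mulr_gt0.
move=> G mG G0.
apply: (@integral_pushforward_le _ _ _ _ _ lamB surfB (fun x : BV => pack (x, 0)) Om (initial_slice Om)) => //.
- by rewrite divr_ge0 ?unit_ball_volume_ge0// exprn_ge0// mge0.
- exact: (measurable_fun_pair1 (0 : R) (@meas_pack R d)).
- exact: rVB_open.
- exact: measurable_initial.
move=> A mA; apply: le_trans (@lam_hausdorff_image _ _ xof 1 (initial_slice Om `&` A) ltr01 _); last first.
 move=> z z' _ _; rewrite mul1r; apply: norm_le => // i.
 by have := coord_le (z - z') (lift ord_max i); rewrite !mxE.
apply: le_lam => x [Ox Ax]; exists (pack (x : BV, 0)); last by rewrite /pack/= xofE.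
by split=> //; split; rewrite /pack/= ?xofE ?tofE.
Qed.

Lemma L2rep_diff (u : VT -> R) u0 (psi : VT -> R) :
 measurable_fun (Q : set LM) u -> L2rep Om T u u0 -> continuous psi ->
 (\int[lebesgueN]_(z in Q) ((psi z - u z) ^+ 2)%:E = \int[lamB]_(z in Q) ((psi z - u0 z) ^+ 2)%:E)%E.
Proof.
move=> mu_ [m0 z0 f0 [N [mN N0] uN]] cpsi.
have mpsi : mfunT (psi : BT -> R) by exact: cont_meas.
apply: (@integral_representative R d.+1 Q (fun z => (psi z - u z) ^+ 2) (fun z => (psi z - u0 z) ^+ 2) N).
- exact: cylinder_open.
- apply: measX; apply: measB => //.
 apply: lebesgueN_measurable_fun; first exact: measurable_cylinder.
 exact: measTS.
- by apply: measX; exact: measB.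
- by [].
- by [].
by move=> z Qz Nz; rewrite uN.
Qed.

Lemma time_derive (psi : VT -> R) (x : V) (t : R) : Ck_on 1 setT psi ->
 is_derive t 1 (fun s : R => psi (spacetime x s)) (partial ord_max psi (spacetime x t)).
Proof.
move=> [_ c1]; have e (s : R) : spacetime x s = spacetime x 0 + s *: basis_vec ord_max.
 apply/rowP => j; rewrite !mxE !eqxx /=; case: (unliftP ord_max j) => [i ->|->].
 by rewrite eq_sym (negbTE (neq_lift _ _)) mulr0 addr0.
 by rewrite eqxx mulr1 add0r.
rewrite (_ : (fun s => _) = (fun s : R => psi (spacetime x 0 + s *: basis_vec ord_max))); last first.
 by apply/funext => s; rewrite -e.
rewrite [X in partial _ _ X]e; apply: is_derive_line; rewrite -e.
by have [+ _] := c1 ord_max; exact.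
Qed.

(* With D the increment from time 0, [s e G - e^(1 - t/s) D^2] is nondecreasing in t. *)
Lemma poincare_1d (f g G : R -> R) (s t : R) : 0 < s -> 0 <= t <= s -> (forall t : R, is_derive t 1 f (g t)) ->
 G 0 = 0 -> (forall t : R, is_derive t 1 G (g t ^+ 2)) -> f t ^+ 2 <= 2 * f 0 ^+ 2 + 2 * (s * expR 1 * G t).
Proof.
move=> s0 /andP[t0 ts] df G0 dG.
pose D (r : R) : R := f r - f 0.
pose y (r : R) : R := s * expR 1 * G r - expR 1 * (expR (- s^-1 * r) * D r ^+ 2).
pose dy (r : R) : R := s * expR 1 * g r ^+ 2 - expR 1 * (expR (- s^-1 * r) * (2 * D r * g r) + D r ^+ 2 * (- s^-1 * expR (- s^-1 * r))).
have dD (r : R) : is_derive r 1 D (g r).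
 have := is_deriveB (df r) (is_derive_cst (f 0) r (1 : R)); by rewrite subr0.
have dyP (r : R) : is_derive r 1 y (dy r).
 have d1 := is_deriveM (is_derive_cst (s * expR 1) r (1 : R)) (dG r).
 have d2 := is_deriveM (dD r) (dD r).
 have d3 := is_deriveM (is_derive_cst (expR 1) r (1 : R)) (is_deriveM (is_derive_expRM (- s^-1) r) d2).
 rewrite (_ : y = cst (s * expR 1) * G - cst (expR 1) * ((fun q : R => expR (- s^-1 * q)) * (D * D))); last first.
 by apply/funext => q; rewrite /y expr2.
 apply: is_derive_eq (is_deriveB d1 d3) _; rewrite /dy /GRing.scale/= !mulr0 !addr0 !expr2.
 by rewrite (_ : (D * D) r = D r * D r)//; ring.
have := @derive_nonneg_le _ y dy 0 t t0 (fun r _ => dyP r); move=> /(_ _)/wrap[|].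
 move=> r /andP[r0 _].
 have e1 : expR (- s^-1 * r) <= 1.
 by rewrite -[leRHS]expR0 ler_expR mulNr oppr_le0 mge0// invr_ge0 ltW.
 have e0 := expR_gt0 (- s^-1 * r); have e2 := expR_gt0 (1 : R).
 have h1 : 2 * D r * g r - s^-1 * D r ^+ 2 <= s * g r ^+ 2.
 rewrite -subr_ge0 (_ : _ - _ = s^-1 * (D r - s * g r) ^+ 2); last by field; rewrite gt_eqF.
 by rewrite mge0 ?sqr_ge0// invr_ge0 ltW.
 have h2 : expR (- s^-1 * r) * (2 * D r * g r - s^-1 * D r ^+ 2) <= s * g r ^+ 2.
 apply: (le_via (expR (- s^-1 * r) * (s * g r ^+ 2))); first by rewrite ler_pM2l.
 by rewrite ler_piMl// mge0 ?sqr_ge0// ltW.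
 rewrite /dy (_ : _ - _ = expR 1 * (s * g r ^+ 2 - expR (- s^-1 * r) * (2 * D r * g r - s^-1 * D r ^+ 2))); last by ring.
 by rewrite mge0 ?subr_ge0// ltW.
rewrite /y G0 /D subrr expr0n/= !mulr0 subr0 => h.
have e1 : 1 <= expR 1 * expR (- s^-1 * t).
 rewrite -expRD -[leLHS]expR0 ler_expR mulNr subr_ge0 mulrC ler_pdivrMr// mul1r//.
have h3 : (f t - f 0) ^+ 2 <= s * expR 1 * G t.
 have : 1 * (f t - f 0) ^+ 2 <= expR 1 * expR (- s^-1 * t) * (f t - f 0) ^+ 2 by rewrite ler_wpM2r ?sqr_ge0.
 by rewrite mul1r -mulrA; lra.
have := sqr_ge0 (f t - 2 * f 0); move: h3; rewrite !sqrrB; rewrite !expr2; nra.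
Qed.

Lemma poincare_slab (psi : VT -> R) (s : R) : Ck_on 1 setT psi -> 0 < s -> s < T ->
 (\int[lamB]_z (\1_Q z * ((tof z < s)%R%:R * psi z ^+ 2))%:E <=
 (2 * s)%:E * \int[lamB]_(x in Om) (psi (spacetime x 0) ^+ 2)%:E +
 (2 * expR 1 * s ^+ 2)%:E * \int[lamB]_z (\1_Q z * ((tof z < s)%R%:R * partial ord_max psi z ^+ 2))%:E)%E.
Proof.
move=> cpsi s0 sT; set g := partial ord_max psi.
have cps : continuous psi by move=> z; have [+ _] := cpsi; exact.
have cg : continuous g by move=> z; have [_ /(_ ord_max)[_ [+ _]]] := cpsi; exact.
have mQ : mfunT (\1_Q : BT -> R) by apply: measI; exact: measurable_cylinder.
have mF (f : VT -> R) : continuous f ->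
 mfunT (fun z : BT => (\1_Q z * ((tof z < s)%R%:R * f z ^+ 2))%:E).
 move=> cf; apply/mEF; apply: measM => //; apply: measM; first exact: measurable_below.
 by apply: measX; exact: cont_meas.
have F0 (f : VT -> R) (z : BT) : (0 <= (\1_Q z * ((tof z < s)%R%:R * f z ^+ 2))%:E)%E.
 by rewrite lee_fin mge0// mge0 ?sqr_ge0.
rewrite !lamB_tonelli1//; try exact: mF.
pose J (f : VT -> R) (x : BV) := (\int[mu]_t (\1_Q (pack (x, t)) * ((tof (pack (x, t)) < s)%R%:R * f (pack (x, t)) ^+ 2))%:E)%E.
rewrite -/(J psi) -/(J g).
have J0 f x : (0 <= J f x)%E by apply: integral_ge0 => t _; exact: F0.
have mJ f : continuous f -> mfunT (J f).
 move=> cf; have m := measC (mF f cf) (@meas_pack R d).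
 exact: (measurable_fun_fubini_tonelli_F (m2 := mu) _ m (fun p => F0 f (pack p))).
have mp0 : mfunT (fun x : BV => (psi (spacetime x 0) ^+ 2)%:E).
 apply/mEF; apply: measX.
 apply: (measC (f := (psi : BT -> R)) (g := fun x : BV => pack (x, 0))).
 exact: cont_meas.
 exact: (measurable_fun_pair1 (0 : R) (@meas_pack R d)).
have mOm : measurable (Om : set BV) by exact: rVB_open.
have c1 : (0 <= (2 * s)%:E)%E by rewrite lee_fin mge0// ltW.
have c2 : (0 <= (2 * expR 1 * s ^+ 2)%:E)%E by rewrite lee_fin; apply: mge0; [apply: mge0 => //; exact: expR_ge0|exact: sqr_ge0].
have mA : mfunT (fun x : BV => (2 * s)%:E * (\1_Om x * psi (spacetime x 0) ^+ 2)%:E)%E.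
 apply: measeM; apply/mEF; apply: measM; first exact: measI.
 by move/mEF: mp0.
rewrite (integral_mulI lamB Om) -intZl//; try (by move/mEF: mp0 => mp0;
 apply/mEF; apply: measM => //; exact: measI);
 try (by move=> x _; rewrite lee_fin mge0 ?sqr_ge0).
rewrite -intZl//; try exact: mJ; try (by move=> x _; exact: (J0 g x)).
rewrite -ge0_integralD//; try (by move=> x _; rewrite mule_ge0// lee_fin mge0 ?sqr_ge0);
 try (by move=> x _; apply: mule_ge0 => //; exact: (J0 g x)); try (by apply: measeM; exact: mJ).
apply: ge0_le_integral => //.
- by move=> x _; exact: (J0 psi x).
- exact: mJ.
- by apply: emeasurable_funD => //; apply: measeM; exact: mJ.
move=> x _; have [Ox|nOx] := pselect (Om x); last first.
 rewrite [leLHS](_ : _ = 0%E); first (apply: adde_ge0; apply: mule_ge0 => //;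
 [by rewrite lee_fin mge0 ?sqr_ge0|exact: (J0 g x)]).
 apply: integral0_eq => t _; rewrite indicE memNset ?mul0r// => -[].
 by rewrite /pack/= xofE.
have JE f : continuous f -> J f x = (\int[mu]_(t in `[0%R, s]) (f (spacetime x t) ^+ 2)%:E)%E.
 move=> cf; have mf : mfunT (fun t : R => f (spacetime x t) ^+ 2).
 apply: measX; apply: (measC (f := (f : BT -> R)) (g := fun t : R => pack (x, t))).
 exact: cont_meas.
 exact: (measurable_fun_pair2 (x : BV) (@meas_pack R d)).
 rewrite -integral_itv_bndo_bndc; last by apply: measTS; exact/mEF.
 rewrite -integral_itv_obnd_cbnd; last by apply: measTS; exact/mEF.
 rewrite [RHS]integral_mulI; apply: eq_integral => t _; congr EFin.
 rewrite !indicE mem_setE in_itv/= mulrA; congr (_ * _).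
 rewrite (_ : tof _ = t); last by rewrite /pack/= tofE.
 have [Qt|nQt] := pselect (Q (pack (x : BV, t))).
 move: (Qt) => [_]; rewrite /pack/= tofE => /andP[t0 _].
 by rewrite mem_set// mul1r t0.
 rewrite memNset// mul0r; case: (ltP 0 t) => //= t0; case: (ltP t s) => //= ts.
 case: nQt; rewrite /cylinder/pack/= xofE tofE t0; split=> //.
 exact: lt_trans ts sT.
have dpsi (t : R) := time_derive x t cpsi.
have cgt : continuous (fun t : R => g (spacetime x t) ^+ 2).
 have ct : continuous (fun t : R => spacetime x t).
 apply: (@lipschitz_curve_continuous _ _ _ 1) => a b; rewrite mul1r; apply: norm_le => // j.
 by rewrite !mxE; case: unliftP => [i _|_]//; rewrite subrr normr0.
 have cgc : continuous (fun t : R => g (spacetime x t)) by move=> t; apply: continuous_comp; [exact: ct|exact: cg].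
 by move=> t; apply: (cvgM (cgc t) (cgc t)).
have [G G0 dG] := continuous_antiderivative cgt.
rewrite [X in (X <= _)%E](JE psi cps) [X in (_ <= _ + _ * X)%E](JE g cg) (integral_antiderivative s0 cgt dG) G0 subr0 indicE mem_set// mul1r -!EFinM -EFinD.
apply: (le_via (\int[mu]_(t in `[0%R, s]) (2 * psi (spacetime x 0) ^+ 2 + 2 * (s * expR 1 * G s))%:E)%E).
 apply: ge0_le_integral => //.
 - by move=> t _; rewrite lee_fin sqr_ge0.
 - apply: measTS; apply/mEF; apply: measX.
 apply: (measC (f := (psi : BT -> R)) (g := fun t : R => pack (x : BV, t))).
 exact: cont_meas.
 exact: (measurable_fun_pair2 (x : BV) (@meas_pack R d)).
 move=> t; rewrite /= in_itv/= => /andP[t0 ts]; rewrite lee_fin.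
 apply: le_trans (poincare_1d s0 _ dpsi G0 dG) _; first by rewrite t0.
 rewrite lerD2l ler_pM2l// ler_wpM2l ?mge0 ?expR_ge0 ?(ltW s0)//.
 by apply: (derive_nonneg_le ts (fun u _ => dG u)) => u _; exact: sqr_ge0.
rewrite integral_cst//= lebesgue_measure_itv/= lte_fin s0 oppr0 adde0 -EFinM lee_fin.
by rewrite le_eqVlt; apply/orP; left; apply/eqP; ring.
Qed.

Lemma early_bound (u : VT -> R) (Du : VT -> VT) u0 w0 :
 measurable_fun (Q : set LM) u ->
 measurable_fun (Q : set LM) (fun z => Du z ord0 ord_max) ->
 L2rep Om T u u0 -> L2rep Om T (fun z => Du z ord0 ord_max) w0 ->
 trace_on Q (initial_slice Om) u Du (fun=> 0) ->
 forall s : R, 0 < s -> s < T ->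
 \int[lamB]_z (u0 z ^+ 2 * (tof z < s)%R%:R) <= 8 * expR 1 * s ^+ 2 * \int[lamB]_z (w0 z ^+ 2 * (tof z < s)%R%:R).
Proof.
move=> mu_ mw ru rw [_ [psi [smpsi cv1 cv2 cv3]]] s s0 sT.
have [C C0 hC] := initial_trace.
have [mu0 zu fu Nu] := ru; have [mw0 zw fw Nw] := rw.
pose low (z : BT) : R := (tof z < s)%R%:R.
have mlow : mfunT low by exact: measurable_below.
have low01 z : 0 <= low z <= 1 by rewrite /low ler0n lern1 leq_b1.
have isq (q : BT -> R) : mfunT q -> (\int[lamB]_z (q z ^+ 2)%:E < +oo)%E ->
 lamB.-integrable setT (EFin \o (fun z => q z ^+ 2 * low z)).
 move=> mq fq; apply: (@integrable_mulb _ _ _ _ 1) => //; last first.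
 by move=> z; have /andP[h1 h2] := low01 z; rewrite ger0_norm.
 apply/integrableP; split; first by apply/mEF; exact: measX.
 by under eq_integral do rewrite /= ger0_norm ?sqr_ge0//.
have iu := isq _ mu0 fu; have iw := isq _ mw0 fw.
set W := \int[lamB]_z (w0 z ^+ 2 * _).
have WE : (\int[lamB]_z (w0 z ^+ 2 * low z)%:E)%E = W%:E by rewrite fineK// (integrable_fin_num measurableT iw).
rewrite -lee_fin fineK; last exact: (integrable_fin_num measurableT iu).
apply/lee_addgt0Pr => e e0.
pose e1 := e / (4 * s * C + 8 * expR 1 * s ^+ 2 + 2).
have den : 0 < 4 * s * C + 8 * expR 1 * s ^+ 2 + 2.
 by rewrite addr_gt0// addr_gt0 ?mulr_gt0 ?exprn_gt0//.
have e10 : 0 < e1 by rewrite divr_gt0.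
have [k [k1 k2 k3]] : exists k, [/\ (\int[lebesgueN]_(z in Q) ((psi k z - u z) ^+ 2)%:E <= e1%:E)%E,
 (\int[lebesgueN]_(z in Q) ((partial ord_max (psi k) z - Du z ord0 ord_max) ^+ 2)%:E <= e1%:E)%E &
 (\int[surface]_(z in initial_slice Om) ((psi k z - 0) ^+ 2)%:E <= e1%:E)%E].
 have n1 := Lp_norm2_cvg0 cv1 e10; have n2 := Lp_norm2_cvg0 (cv2 ord_max) e10; have n3 := Lp_norm2_cvg0 cv3 e10.
 have [k _ hk] := filterI n1 (filterI n2 n3); exists k; have [h1 [h2 h3]] := hk k (leqnn k); split.
 - exact: h1.
 - exact: h2.
 - exact: h3.
have cpsi : Ck_on 1 setT (psi k) := smpsi k 1%N.
have cps : continuous (psi k) by move=> z; have [+ _] := cpsi; exact.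
have cg : continuous (partial ord_max (psi k)) by move=> z; have [_ /(_ ord_max)[_ [+ _]]] := cpsi; exact.
rewrite (L2rep_diff mu_ ru cps) in k1; rewrite (L2rep_diff mw rw cg) in k2.
have mQ : measurable (Q : set BT) by exact: measurable_cylinder.
have comb (v : VT -> R) (v0 : BT -> R) : continuous v -> mfunT v0 -> (forall z, ~ Q z -> v0 z = 0) ->
 (\int[lamB]_z (v0 z ^+ 2 * low z)%:E <= 2%:E * \int[lamB]_z (\1_Q z * (low z * v z ^+ 2))%:E +
 2%:E * \int[lamB]_(z in Q) ((v z - v0 z) ^+ 2)%:E)%E /\
 (\int[lamB]_z (\1_Q z * (low z * v z ^+ 2))%:E <= 2%:E * \int[lamB]_z (v0 z ^+ 2 * low z)%:E +
 2%:E * \int[lamB]_(z in Q) ((v z - v0 z) ^+ 2)%:E)%E.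
 move=> cv mv0 zv0; have mv : mfunT (v : BT -> R) by exact: cont_meas.
 have m1 : mfunT (fun z : BT => (v0 z ^+ 2 * low z)%:E).
 by apply/mEF; apply: measM => //; exact: measX.
 have m2 : mfunT (fun z : BT => (\1_Q z * (low z * v z ^+ 2))%:E).
 apply/mEF; apply: measM; first exact: measI.
 by apply: measM => //; exact: measX.
 have m3 : mfunT (fun z : BT => (\1_Q z * (v z - v0 z) ^+ 2)%:E).
 apply/mEF; apply: measM; first exact: measI.
 by apply: measX; exact: measB.
 have p1 z : (0 <= (v0 z ^+ 2 * low z)%:E)%E by rewrite lee_fin mge0 ?sqr_ge0//; have /andP[] := low01 z.
 have p2 z : (0 <= (\1_Q z * (low z * v z ^+ 2))%:E)%E.
 by rewrite lee_fin mge0// mge0 ?sqr_ge0//; have /andP[] := low01 z.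
 have p3 z : (0 <= (\1_Q z * (v z - v0 z) ^+ 2)%:E)%E by rewrite lee_fin mge0 ?sqr_ge0.
 have two (x y l : R) : 0 <= l <= 1 -> x ^+ 2 * l <= 2 * (l * y ^+ 2) + 2 * (y - x) ^+ 2.
 move=> /andP[l0 l1]; have := sqr_ge0 (2 * y - x); have := sqr_ge0 (y - x) => a b.
 have : x ^+ 2 <= 2 * y ^+ 2 + 2 * (y - x) ^+ 2 by move: a b; rewrite !expr2; nra.
 move/(ler_wpM2r l0); have : (y - x) ^+ 2 * l <= (y - x) ^+ 2 by rewrite ler_piMr.
 by rewrite mulrDl; lra.
 rewrite !(integral_mulI lamB Q); split.
 rewrite -!intZl// -ge0_integralD//; try (by move=> z _; rewrite mule_ge0); try exact: measeM.
 apply: ge0_le_integral => //; first by apply: emeasurable_funD; exact: measeM.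
 move=> z _; rewrite -!EFinM -EFinD lee_fin indicE; have [Qz|nQz] := pselect (Q z).
 by rewrite mem_set// !mul1r; exact: two.
 by rewrite memNset// !mul0r zv0// expr0n mul0r !mulr0 addr0.
 rewrite -!intZl// -ge0_integralD//; try (by move=> z _; rewrite mule_ge0); try exact: measeM.
 apply: ge0_le_integral => //; first by apply: emeasurable_funD; exact: measeM.
 move=> z _; rewrite -!EFinM -EFinD lee_fin indicE; have [Qz|nQz] := pselect (Q z).
 rewrite mem_set// !mul1r mulrC -(opprB (v0 z)) sqrrN [v0 z ^+ 2 * _]mulrC; exact: two.
 by rewrite memNset// !mul0r zv0// expr0n mul0r !mulr0 addr0.
have [a1 _] := comb _ _ cps mu0 zu; have [_ a2] := comb _ _ cg mw0 zw.
have a3 := poincare_slab cpsi s0 sT.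
have a4 : (\int[lamB]_(x in Om) (psi k (spacetime x 0) ^+ 2)%:E <= (C * e1)%:E)%E.
 have mps2 : mfunT (fun z : BT => (psi k z ^+ 2)%:E).
 by apply/mEF; apply: measX; exact: cont_meas.
 have p0 (z : BT) : (0 <= (psi k z ^+ 2)%:E)%E by rewrite lee_fin sqr_ge0.
 apply: le_trans (hC _ mps2 p0) _; rewrite EFinM; apply: lee_wpmul2l; first by rewrite lee_fin ltW.
 rewrite -(ge0_integral_surface measurable_initial)//; last by apply: measTS.
 by move: k3; under eq_integral do rewrite subr0.
have two0 : (0 <= 2%:E :> \bar R)%E by rewrite lee_fin.
have b2 : (\int[lamB]_z (\1_Q z * (low z * partial ord_max (psi k) z ^+ 2))%:E <= (2 * W + 2 * e1)%:E)%E.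
 by apply: le_trans a2 _; rewrite WE (EFinD (2 * W)) !EFinM; apply: leeD => //; exact: lee_wpmul2l.
have b1 : (\int[lamB]_z (\1_Q z * (low z * psi k z ^+ 2))%:E <= (2 * s * (C * e1) + 2 * expR 1 * s ^+ 2 * (2 * W + 2 * e1))%:E)%E.
 apply: le_trans a3 _; rewrite EFinD (EFinM (2 * s)) (EFinM (2 * expR 1 * s ^+ 2)); apply: leeD.
 by apply: lee_wpmul2l; rewrite // lee_fin mge0// ltW.
 apply: lee_wpmul2l; last exact: b2.
 by rewrite lee_fin; apply: mge0; [apply: mge0 => //; exact: expR_ge0|exact: sqr_ge0].
apply: le_trans a1 _; apply: le_trans (leeD (lee_wpmul2l two0 b1) (lee_wpmul2l two0 k1)) _.
rewrite -!EFinM -!EFinD lee_fin (_ : e = e1 * (4 * s * C + 8 * expR 1 * s ^+ 2 + 2)); last by rewrite /e1 divfK ?gt_eqF.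
by rewrite le_eqVlt; apply/orP; left; apply/eqP; ring.
Qed.

End slices.

Section lower_integral.
Local Open Scope ereal_scope.

Lemma le_lower_integral {dT} {S : measurableType dT} {R : realType} (m : {measure set S -> \bar R}) (D : set S)
 (f g : S -> \bar R) : (forall x, D x -> 0 <= f x) -> (forall x, D x -> f x <= g x) ->
 \int[m]_(x in D) f x <= \int[m]_(x in D) g x.
Proof.
move=> f0 fg; rewrite !ge0_integralE//; last by move=> x Dx; apply: le_trans (fg x Dx); exact: f0.
apply: le_ereal_sup => _ [h hf <-]; exists h => // x; apply: le_trans (hf x) _.
by rewrite !patchE; case: ifPn => // /set_mem; exact: fg.
Qed.

End lower_integral.

Section essential_bound.
Context {R : realType} {d : nat}.
Local Notation V := 'rV[R]_d.+1.
Local Notation BV := (rVB R d).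
Local Notation VT := 'rV[R]_d.+2.
Local Notation BT := (rVB R d.+1).
Local Notation mu := (@lebesgue_measure R).
Variables (Om : set V) (T : R).
Hypotheses (oOm : open Om) (bOm : bounded_set Om) (T0 : 0 < T).
Local Notation Q := (cylinder Om T).

(* The smallest integer dominating the essential supremum of a slice counts the
 thresholds that are exceeded on a set of positive measure. *)
Lemma slice_bound (r1 : BT -> R) : mfunT r1 ->
 exists k : R -> R, [/\ mfunT k, forall t, 0 <= k t & forall (t c : R), 0 <= c ->
 (exists2 N : set V, lam N = 0%E & forall x, ~ N x -> `|r1 (spacetime x t)| <= c) ->
 k t <= c + 1 /\ lamB (slice [set z | k t < `|r1 z|] t) = 0%E].
Proof.
move=> m1; pose A (n : nat) : set BT := [set z | n%:R < `|r1 z|].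
have mA c : measurable ([set z | c < `|r1 z|] : set BT).
 rewrite (_ : [set z | _] = (fun z => `|r1 z|) @^-1` `]c, +oo[); last by apply/seteqP; split=> z; rewrite /= in_itv/= andbT.
 rewrite -[mset]setTI; apply: (_ : mfunT _) => //.
 by apply: measC.
pose mass n t := lamB (slice (A n) t).
have mmass n : mfunT (mass n : R -> \bar R) by exact: measurable_slice_mass (mA _).
have massle n n' t : (n <= n')%N -> mass n t = 0%E -> mass n' t = 0%E.
 move=> nn h; apply/eqP; rewrite eq_le lam_ge0 andbT -h; apply: le_lam => x; rewrite /slice/A/=.
 by apply: le_lt_trans; rewrite ler_nat.
pose I n (t : R) : \bar R := if mass n t == 0%E then 0%E else 1%E.
have mI n : mfunT (I n).
 rewrite (_ : I n = (fun t => (\1_(~` (mass n @^-1` [set 0%E])) t)%:E)); last first.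
 apply/funext => t; rewrite /I indicE; case: ifPn => [/eqP h|/eqP h].
 by rewrite memNset// => /=; apply.
 by rewrite mem_set.
 apply/mEF; apply: measI; apply: measurableC.
 by rewrite -[mset]setTI; apply: mmass.
have I0 n t : (0 <= I n t)%E by rewrite /I; case: ifP.
pose kE t := (\sum_(n <oo) I n t)%E.
have mkE : mfunT kE.
 have := @ge0_emeasurable_sum _ _ R setT (fun n t => I n t) xpredT (fun n t _ _ => I0 n t) (fun n _ => mI n).
 by congr measurable_fun; apply/funext => t.
have kval t n : mass n t = 0%E -> (forall j, (j < n)%N -> mass j t != 0%E) -> kE t = n%:R%:E.
 move=> h0 h1; apply: lim_near_cst => //; near=> m.
 have nm : (n <= m)%N by near: m; exact: nbhs_infty_ge.
 rewrite (big_cat_nat (leq0n n) nm)//= [X in (_ + X)%E]big_nat_cond [X in (_ + X)%E]big1 ?adde0.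
 rewrite (eq_big_nat _ _ (F2 := fun=> 1%E)); last by move=> j /andP[_ jn]; rewrite /I (negbTE (h1 j jn)).
 by rewrite sumEFin; congr EFin; rewrite sumr_const_nat subn0.
 by move=> j /andP[/andP[nj _] _]; rewrite /I (massle _ _ _ nj h0) eqxx.
exists (fun t => fine (kE t)); split.
- by apply: measC => //; exact: fine_measurable.
- by move=> t; apply: fine_ge0; apply: nneseries_ge0 => n _ _; exact: I0.
move=> t c c0 [N N0 hN].
have mc n : c <= n%:R -> mass n t = 0%E.
 move=> cn; apply/eqP; rewrite eq_le lam_ge0 andbT -N0; apply: le_lam => x; rewrite /slice/A/= => h.
 by apply: contrapT => Nx; have := hN x Nx; rewrite leNgt (le_lt_trans cn h).
have ex : exists n, mass n t == 0%E.
 by exists (Num.bound c); apply/eqP/mc/ltW/archi_boundP.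
case: (ex_minnP ex) => n /eqP mn minn.
have kn : kE t = n%:R%:E by apply: kval => // j jn; apply/negP => /minn; rewrite leqNgt jn.
rewrite kn /=; split; last exact: mn.
case: n mn minn {kn} => [|n] mn minn; first by rewrite addr_ge0.
rewrite -natr1 lerD2r leNgt; apply/negP => cn.
by have := minn n (introT eqP (mc n (ltW cn))); rewrite ltnn.
Unshelve. all: by end_near. Qed.

Lemma lam_setU_null {n : nat} (A B : set 'rV[R]_n.+1) : lam A = 0%E -> lam B = 0%E ->
 lam (A `|` B) = 0%E.
Proof.
move=> A0 B0; rewrite (_ : A `|` B = \bigcup_(b : bool) if b then A else B); last first.
 apply/seteqP; split=> [x [Ax|Bx]|x [[] _ h]]; [by exists true|by exists false|by left|by right].
by apply: lam_bigcup_null => -[].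
Qed.

Lemma L2_Linfty_rep (r : VT -> R) : L2_Linfty Om T r -> exists r1 (k : R -> R),
 [/\ L2rep Om T r r1, mfunT k, forall t : R, 0 <= k t,
 (\int[mu]_t (k t ^+ 2)%:E < +oo)%E & forall z, `|r1 z| <= k (tof z)].
Proof.
move=> [mr _ fr]; have oQ : open Q by exact: cylinder_open.
have [r1 [m1 z1 _ [N [mN N0] rN]]] := borel_zero_extension oQ mr.
have [k [mk k0 hk]] := slice_bound m1.
have good : {ae mu, forall t, lam (slice N t) = 0%E} by exact: null_slices.
have [N' [mN' N'0 sN']] := good.
have bound (t c : R) : 0 < t < T -> ~ N' t -> 0 <= c ->
 (Lp_norm lebesgueN Om +oo (fun x => r (spacetime x t)) <= c%:E)%E ->
 k t <= c + 1 /\ lamB (slice [set z | k t < `|r1 z|] t) = 0%E.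
 move=> tT nt c0 hc; apply: hk => //.
 have [M [mM M0] hM] := Lp_oo_bound hc.
 exists (M `|` slice N t); first by apply: lam_setU_null => //; apply: contrapT => h; apply: nt; exact: sN'.
 move=> x /not_orP[nM nN]; have [Ox|nOx] := pselect (Om x); last first.
 by rewrite z1 ?normr0// => -[]; rewrite xofE.
 have Qx : Q (spacetime x t) by rewrite /cylinder/= xofE tofE.
 by rewrite -rN//; exact: hM.
pose N2 : set BT := [set z | k (tof z) < `|r1 z|].
have mkt : mfunT (fun z : BT => k (tof z)).
 by apply: (measC mk); exact: meas_tof.
have mN2 : measurable N2.
 rewrite (_ : N2 = (fun z => `|r1 z| - k (tof z)) @^-1` `]0, +oo[); last first.
 by apply/seteqP; split=> z; rewrite /N2/= in_itv/= andbT subr_gt0.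
 rewrite -[mset]setTI; apply: (_ : mfunT _) => //.
 by apply: measB => //; exact: measC.
have sl t : slice N2 t = slice [set z | k t < `|r1 z|] t.
 by apply/seteqP; split=> x; rewrite /slice/N2/= tofE.
pose B : set R := (fun t => lamB (slice N2 t)) @^-1` (~` [set 0%E]) `\` N'.
have mB : measurable B.
 apply: measurableD => //; rewrite -[mset]setTI.
 by apply: measurable_slice_mass => //; exact: measurableC.
pose ft (t : R) : R := \1_(~` N') t * Num.max 0 (k t ^+ 2 / 2 - 1).
pose F (t : R) : \bar R := (+oo * (\1_B t)%:E + (ft t)%:E)%E.
have ft0 t : 0 <= ft t by rewrite mge0// le_max lexx.
have mft : mfunT ft.
 apply: measM; first by apply: measI; exact: measurableC.
 apply: measurable_maxr => //; apply: measB => //.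
 by apply: measM => //; exact: measX.
have mI : mfunT (fun t => +oo * (\1_B t)%:E : \bar R)%E.
 by apply: emeasurable_funM => //; apply/mEF; exact: measI.
have mF : mfunT F by apply: emeasurable_funD => //; exact/mEF.
have I0 t : (0 <= +oo * (\1_B t)%:E :> \bar R)%E by rewrite mule_ge0// lee_fin.
have F0 t : (0 <= F t)%E by rewrite adde_ge0// lee_fin.
have Fle t : `]0, T[%classic t -> (F t <= Lp_norm lebesgueN Om +oo (fun x => r (spacetime x t)) `^ 2)%E.
 rewrite /= in_itv/= => tT; have n0 : (0 <= Lp_norm lebesgueN Om +oo (fun x => r (spacetime x t)))%E by exact: Lnorm_ge0.
 have [nt|nt] := pselect (N' t).
 rewrite /F /ft !indicE memNset ?mule0; last by move=> [_].
 by rewrite memNset ?mul0r ?adde0 ?poweR_ge0//; apply.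
 case e : (Lp_norm lebesgueN Om +oo%E (fun x => r (spacetime x t))) => [c| |]; last by move: n0; rewrite e.
 have c0 : 0 <= c by move: n0; rewrite e lee_fin.
 have := bound t c tT nt c0; rewrite e => /(_ (lexx _))[kc s0].
 rewrite /F indicE memNset ?mule0 ?add0e; last by rewrite /B/= sl s0 => -[] /(_ erefl).
 rewrite poweR_EFin lee_fin powR_mulrn// /ft indicE mem_set// mul1r ge_max sqr_ge0/=.
 have := k0 t => kt; rewrite !expr2; have := sqr_ge0 (c - 1); rewrite expr2; nra.
 by rewrite poweRyr ?leey.
have FI : (\int[mu]_(t in `]0%R, T[) F t < +oo)%E by apply: le_lt_trans fr; exact: le_lower_integral.
have iF : mu.-integrable `]0, T[ F.
 apply/integrableP; split; first exact: measTS.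
 by under eq_integral do rewrite gee0_abs//.
have aeF : {ae mu, forall t, `]0, T[%classic t -> F t \is a fin_num}.
 by apply: (integrable_ae _ iF); exact: measurable_itv.
have N20 : lamB N2 = 0%E.
 apply: (slices_null mN2); case: aeF => M1 [mM1 M10 s1]; exists (M1 `|` N'); split; first exact: measurableU.
 by rewrite measureU0.
 move=> t nt; apply: contrapT => /not_orP[nM nN]; apply: nt; change (lamB (slice N2 t) = 0%E).
 have [tT|tT] := pselect (0 < t < T); last first.
 rewrite (_ : slice N2 t = set0) ?measure0//; apply/seteqP; split=> x //.
 rewrite /slice/N2/= tofE z1 ?normr0 ?ltNge ?k0// => -[_].
 by rewrite tofE.
 have tin : `]0, T[%classic t by rewrite /= in_itv.
 have fin : F t \is a fin_num by apply: contrapT => h; apply: nM; apply: s1 => /(_ tin).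
 apply: contrapT => nz; have Bt : B t by split.
 by move: fin; rewrite /F indicE mem_set// mule1.
have IF : (\int[mu]_(t in `]0%R, T[) (k t ^+ 2)%:E < +oo)%E.
 apply: (@le_lt_trans _ _ (\int[mu]_(t in `]0%R, T[) (2%:E * F t + 2%:E))%E).
 apply: ae_ge0_le_integral => //.
 - by move=> t _; rewrite lee_fin sqr_ge0.
 - by apply: measTS; apply/mEF; exact: measX.
 - by move=> t _; rewrite adde_ge0// mule_ge0.
 - by apply: measTS; apply: emeasurable_funD => //; exact: measeM.
 exists N'; split=> // t nt; apply: contrapT => Nt; apply: nt => _.
 apply: (le_via (2%:E * (ft t)%:E + 2%:E)%E); last first.
 by rewrite leeD2r// lee_wpmul2l// leeDr.
 rewrite -EFinM -EFinD lee_fin /ft indicE mem_set// mul1r.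
 have : k t ^+ 2 / 2 - 1 <= Num.max 0 (k t ^+ 2 / 2 - 1) by rewrite le_max lexx orbT.
 lra.
 rewrite ge0_integralD//; try (by move=> t _; rewrite mule_ge0);
 try (by apply: measTS; exact: measeM); try (by move=> t _; rewrite lee_fin).
 rewrite intZl//; try exact: measTS.
 rewrite integral_cst//= lebesgue_measure_itv/= lte_fin T0 oppr0 adde0.
 by rewrite lte_add_pinfty// ?lte_mul_pinfty ?ltry// -EFinM ltry.
pose r2 (z : BT) : R := \1_(~` N2) z * r1 z; pose k2 (t : R) : R := \1_`]0, T[ t * k t.
have mr2 : mfunT r2.
 by apply: measM => //; apply: measI; exact: measurableC.
have mk2 : mfunT k2 by apply: measM => //; exact: measI.
have k20 t : 0 <= k2 t by rewrite mge0.
have zr2 z : ~ Q z -> r2 z = 0 by move=> nz; rewrite /r2 z1// mulr0.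
have r2k z : `|r2 z| <= k2 (tof z).
 have [Qz|nQz] := pselect (Q z); last by rewrite zr2// normr0.
 rewrite /r2 /k2 !indicE; have [Nz|Nz] := pselect (N2 z).
 by rewrite memNset ?mul0r ?normr0 ?mge0//; apply.
 rewrite mem_set// mul1r mem_setE in_itv/=; have [_ ->] := Qz; rewrite mul1r leNgt; exact/negP.
have Ik2 : (\int[mu]_t (k2 t ^+ 2)%:E < +oo)%E.
 rewrite (_ : (\int[mu]_t _)%E = \int[mu]_(t in `]0%R, T[) (k t ^+ 2)%:E)%E//.
 rewrite [RHS]integral_mulI; apply: eq_integral => t _; rewrite /k2 exprMn indicE.
 by case: (t \in _); rewrite ?expr1n ?expr0n.
exists r2, k2; split=> //; split=> //; last first.
 exists (N `|` N2); first by split; [exact: measurableU|exact: lam_setU_null].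
 by move=> z Qz /not_orP[nN nN2]; rewrite /r2 indicE mem_set// mul1r rN.
have mOm : measurable (Om : set BV) by exact: rVB_open.
have lOm : (lamB (Om : set BV) < +oo)%E.
 move: bOm => [M [Mr hM]]; apply: (@lamB_bounded _ _ _ (`|M| + 1)) => x Ox.
 by apply: hM => //; rewrite ltr_pwDr// ler_norm.
have mG : mfunT (fun z : BT => (\1_Om (xof z) * k2 (tof z) ^+ 2)%:E).
 apply/mEF; apply: measM.
 rewrite (_ : (fun _ => _) = (\1_Om : BV -> R) \o xof)//.
 by apply: measC; [exact: measI|exact: meas_xof].
 by apply: measX; apply: (measC mk2); exact: meas_tof.
have G0 z : (0 <= (\1_Om (xof z) * k2 (tof z) ^+ 2)%:E)%E by rewrite lee_fin mge0 ?sqr_ge0.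
apply: (@le_lt_trans _ _ (\int[lamB]_z (\1_Om (xof z) * k2 (tof z) ^+ 2)%:E)%E).
 apply: ge0_le_integral => //.
 - by move=> z _; rewrite lee_fin sqr_ge0.
 - by apply/mEF; exact: measX.
 move=> z _; rewrite lee_fin; have [[Oz _]|nQz] := pselect (Q z); last first.
 by rewrite zr2// expr0n/= mge0 ?sqr_ge0.
 by rewrite indicE mem_set// mul1r -real_normK ?num_real// ler_sqr ?nnegrE.
rewrite lamB_tonelli2//.
rewrite (_ : (\int[mu]_t _)%E = \int[mu]_t ((k2 t ^+ 2)%:E * lamB Om))%E; last first.
 apply: eq_integral => t _; rewrite -(setIT Om) -integral_indic// -intZl//; last 2 first.
 - by apply/mEF; exact: measI.
 - by rewrite lee_fin sqr_ge0.
 apply: eq_integral => x _; rewrite /pack/= xofE tofE -EFinM mulrC.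
 by rewrite setIT.
rewrite ge0_integralZr//; last 2 first.
- by apply/mEF; exact: measX.
- by move=> t _; rewrite lee_fin sqr_ge0.
by apply: lte_mul_pinfty => //; [apply: integral_ge0 => t _; rewrite lee_fin sqr_ge0|rewrite ge0_fin_numE//; apply: integral_ge0 => t _; rewrite lee_fin sqr_ge0].
Qed.

Lemma locally_null (A : set V) : (forall x, A x -> exists2 U, open_nbhs x U & lam (A `&` U) = 0%E) ->
 lam A = 0%E.
Proof.
move=> h; pose B (q : 'rV[rat]_d.+1 * 'rV[rat]_d.+1) : set V := obox (map_mx ratr q.1) (map_mx ratr q.2).
pose G q : set V := if `[< lam (A `&` B q) = 0%E >] then A `&` B q else set0.
have G0 : lam (\bigcup_q G q) = 0%E.
 by apply: lam_bigcup_null => q; rewrite /G; case: ifPn => [/asboolP//|_]; exact: outer_measure0.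
apply/eqP; rewrite eq_le lam_ge0 andbT -G0; apply: le_lam => x Ax.
have [U xU U0] := h x Ax; have [q [xq qU]] := rational_obox xU; exists q => //.
rewrite /G asboolT//; apply/eqP; rewrite eq_le lam_ge0 andbT -U0; apply: le_lam; exact: setIS.
Qed.

Lemma nonvanishing_lower_bound (r0 : V -> R) : nonvanishing_on_closure Om r0 -> exists2 m : R, 0 < m &
 exists2 N : set BV, nullB N & forall x, Om x -> ~ N x -> m <= `|r0 x|.
Proof.
move=> nv; have cpt : compact (closure Om).
 move: bOm => [M [Mr hM]]; apply: (@subclosed_compact V (closure Om) [set y | `|0 - y| <= `|M| + 1]).
 - exact: closed_closure.
 - exact: compact_rVball.
 have cB : closed [set y : V | `|0 - y| <= `|M| + 1] by exact: closed_rVball.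
 rewrite [X in _ `<=` X]((closure_id _).1 cB).
 apply: closure_subset => x Ox.
 by rewrite /= sub0r normrN; apply: hM => //; rewrite ltr_pwDr// ler_norm.
pose P (e : R) (y : V) := exists2 U : set V, open_nbhs y U &
 exists2 N : set BV, lam N = 0%E & forall x, Om x -> U x -> ~ N x -> e <= `|r0 x|.
have [e e0 he] : exists2 e : R, 0 < e & forall y, closure Om y -> P e y.
 have /compact_near_coveringP cov := cpt.
 have cov' : \forall e \near (0 : R)^'+, closure Om `<=` P e.
 apply: cov => y cy.
 have [m m0 [U [oU Uy] /ae_lebesgueN[N [mN N0] hN]]] := nv y cy.
 exists (U, [set e : R | e < m]) => /=.
 by split; [exact: open_nbhs_nbhs|exact: nbhs_right_lt].
 move=> [z e] /= [Uz em]; exists U => //; exists N => // x Ox Ux Nx.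
 by apply: le_trans (hN x Nx _) => //; exact/ltW.
 have [e [e0 he]] : exists e : R, 0 < e /\ forall y, closure Om y -> P e y.
 near (0 : R)^'+ => e; exists e; split; first by near: e; exact: nbhs_right_gt.
 by near: e; exact: cov'.
 by exists e.
pose A : set V := [set x | Om x /\ `|r0 x| < e].
have A0 : lam A = 0%E.
 apply: locally_null => x [Ox _]; have [U xU [N N0 hN]] := he x (subset_closure Ox).
 exists U => //; apply/eqP; rewrite eq_le lam_ge0 andbT -N0; apply: le_lam => y [[Oy ry] Uy].
 by apply: contrapT => Ny; have := hN y Oy Uy Ny; rewrite leNgt ry.
have [N [mN AN] N0] := null_borel A0.
exists e => //; exists N; first by split.
by move=> x Ox Nx; rewrite leNgt; apply/negP => h; apply: Nx; apply: AN; split.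
Unshelve. all: by end_near. Qed.

Lemma initial_sign (r : VT -> R) (r0 : V -> R) (r1 : BT -> R) : L2rep Om T r r1 -> initial_value Om r r0 ->
 nonvanishing_on_closure Om r0 -> exists (m dl : R) (sg : BV -> R),
 [/\ 0 < m, 0 < dl, mfunT sg, forall x, `|sg x| <= 1 &
 exists2 N : set BT, nullB N & forall z, Q z -> ~ N z ->
 tof z < dl -> m <= r1 z * sg (xof z)].
Proof.
move=> [m1 z1 f1 [N1 [mN1 N10] rN1]] [[mr0 _] iv] nv.
have [m m0 [N2 [mN2 N20] hm]] := nonvanishing_lower_bound nv.
have [s0 [N3 [ms0 mN3 N30 rs0]]] := borel_representative oOm mr0.
have m20 : 0 < m / 2 by rewrite divr_gt0.
have [dl dl0 hdl] := iv (m / 2) m20.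
pose sg (x : BV) : R := if 0 <= s0 x then 1 else -1.
have msg : mfunT sg.
 rewrite /sg; apply: measurable_fun_ifT => //.
 rewrite (_ : (fun _ => _) = (fun x => s0 x \in `[0, +oo[)); last by apply/funext => x; rewrite in_itv/= andbT.
 apply: (measurable_fun_bool true); rewrite setTI.
 rewrite (_ : _ @^-1` _ = s0 @^-1` `[0, +oo[); last by apply/seteqP; split=> x.
 by rewrite -[mset]setTI; apply: ms0 => //; exact: measurable_itv.
exists (m / 2), dl, sg; split=> //.
- by move=> x; rewrite /sg; case: ifP; rewrite ?normrN normr1.
pose A : set BT := [set z | [/\ Q z, tof z < dl & r1 z * sg (xof z) < m / 2]].
have [N' N'0 hN'] : exists2 N' : set R, mu.-negligible N' & forall t, 0 < t < dl -> ~ N' t ->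
 (Lp_norm lebesgueN Om +oo (fun x => r (spacetime x t) - r0 x)%R <= (m / 2)%:E)%E /\ lam (slice N1 t) = 0%E.
 have sN := null_slices mN1 N10.
 exists ([set t | ~ (`]0, dl[%classic t ->
 (Lp_norm lebesgueN Om +oo (fun x => r (spacetime x t) - r0 x)%R <= (m / 2)%:E)%E)] `|`
 [set t | lam (slice N1 t) <> 0%E]); first exact: negligibleU.
 by move=> t tdl /not_orP[/contrapT h1 /contrapT h2]; split=> //; apply: h1; rewrite /= in_itv.
have sA t : ~ N' t -> lam (slice A t) = 0%E.
 move=> nt; have [tdl|tdl] := pselect (0 < t < dl); last first.
 rewrite (_ : slice A t = set0); first exact: outer_measure0.
 apply/seteqP; split=> x // [[_]].
 by rewrite !tofE => /andP[t0 _] tl _; apply: tdl; rewrite t0.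
 have [h1 h2] := hN' t tdl nt; have [M [mM M0] hM] := Lp_oo_bound h1.
 have B0 : lam (M `|` slice N1 t `|` (N2 `|` N3)) = 0%E by do !apply: lam_setU_null.
 apply/eqP; rewrite eq_le lam_ge0 andbT -B0; apply: le_lam => x [Qx _].
 rewrite xofE => small; apply: contrapT => /not_orP[/not_orP[nM nN1] /not_orP[nN2 nN3]].
 have Ox : Om x by have [+ _] := Qx; rewrite xofE.
 have b1 := hM x Ox nM; have b2 := hm x Ox nN2.
 rewrite rN1// rs0// in b1; rewrite rs0// in b2.
 move: small b1 b2; rewrite /sg; case: ifPn => s; rewrite ?mulr1 ?mulrN1 => small.
 by rewrite (ger0_norm s) ler_norml => /andP[]; lra.
 by rewrite -ltNge in s; rewrite (ltr0_norm s) ler_norml => /andP[]; lra.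
have mA : measurable A.
 rewrite (_ : A = Q `&` tof @^-1` `]-oo, dl[ `&` (fun z => m / 2 - r1 z * sg (xof z)) @^-1` `]0, +oo[); last first.
 apply/seteqP; split=> z; rewrite /A/= !in_itv/= andbT subr_gt0; first by move=> [a b c].
 by move=> [[a b] c].
 apply: measurableI; first apply: measurableI.
 - exact: measurable_cylinder.
 - by rewrite -[mset]setTI; apply: meas_tof => //; exact: measurable_itv.
 rewrite -[mset]setTI; apply: (_ : mfunT _) => //.
 apply: measB => //; apply: measM => //.
 by apply: (measC msg); exact: meas_xof.
have A0 : lamB A = 0%E.
 apply: (slices_null mA); case: N'0 => N'' [mN'' N''0 sub]; exists N''; split=> // t nt; apply: sub.
 by apply: contrapT => h; apply: nt; exact: sA.
exists A => // z Qz nA zdl; rewrite leNgt; apply/negP => h; exact: nA.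
Qed.

End essential_bound.

Section energy.
Context {R : realType} {d : nat}.
Local Notation V := 'rV[R]_d.+1.
Local Notation BV := (rVB R d).
Local Notation VT := 'rV[R]_d.+2.
Local Notation BT := (rVB R d.+1).
Local Notation mu := (@lebesgue_measure R).

Lemma lipschitz_measurable (F : V -> V) (L : R) : 0 <= L -> (forall x y, `|F x - F y| <= L * `|x - y|) ->
 mfunT (F : BV -> BV).
Proof.
move=> L0 FL; apply: measurable_rV => i; apply: cont_meas => x; apply/continuous_ballP => r r0.
have L1 : 0 < L + 1 by rewrite ltr_wpDl.
exists (r / (L + 1)) => [|y /ball_normP]; first by rewrite divr_gt0.
rewrite ltr_pdivlMr// => xy; have := coord_le (F x - F y) i; rewrite !mxE => /le_trans; apply.
apply: le_trans (FL x y) _; apply: le_trans (ltW xy); rewrite mulrC; apply: ler_wpM2l => //.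
by rewrite lerDl.
Qed.

Lemma integral_unit_mass (a h : R) (be G : R -> R) : a < h -> smooth1 be -> (forall t : R, is_derive t 1 G (be t)) ->
 (forall t, ~ (a < t < h) -> be t = 0) -> (forall t, t <= a -> G t = 0) -> (forall t, h <= t -> G t = 1) ->
 (\int[mu]_t (be t)%:E = 1)%E.
Proof.
move=> ah sbe dG be0 Gl Gr.
have := integral_antiderivative ah (smooth1_cont sbe) dG; rewrite (Gl a)// (Gr h)// subr0 => <-.
rewrite [RHS]integral_mkcond; apply: eq_integral => t _; rewrite patchE; case: ifPn => //.
rewrite notin_setE/= in_itv/= => nt; rewrite be0// => /andP[t1 t2]; apply: nt; by rewrite !ltW.
Qed.

Lemma kernel_small (k : R -> R) (K S : R) : mfunT k -> (\int[mu]_t (k t ^+ 2)%:E < +oo)%E -> 0 < K ->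
 exists2 l : R, 0 <= l & exists2 h : R, 0 < h & forall eta, 0 < eta -> eta < h ->
 (\int[mu]_t ((eta <= t <= eta + S)%R%:R * (k t * expR (- l * (t - eta))) ^+ 2)%:E <= K%:E)%E.
Proof.
move=> mk fk K0.
pose q (n : nat) (t : R) := (0 < t)%R%:R * (k t * expR (- (n%:R * t))) ^+ 2.
have mpos : mfunT (fun t : R => (0 < t)%R%:R : R).
 rewrite (_ : (fun _ => _) = \1_(`]0, +oo[%classic : set R)).
 by apply: measI; exact: measurable_itv.
 by apply/funext => t; rewrite indicE mem_setE in_itv/= andbT.
have mq n : mfunT (q n).
 apply: measM => //; apply: measX; apply: measM => //.
 by apply: measC => //; apply: measC => //; exact: measM.
have q0 n t : 0 <= q n t by rewrite mge0 ?ler0n//; exact: sqr_ge0.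
have cv : (\int[mu]_t (q n t)%:E)%E @[n --> \oo] --> (\int[mu]_t (cst 0 t : \bar R))%E.
 apply: (@dominated_cvg _ _ _ mu setT measurableT (fun n t => (q n t)%:E) (cst 0%E) (fun t => (k t ^+ 2)%:E)) => //.
 - by move=> n; apply/mEF; exact: mq.
 - move=> t _; have [t0|t0] := ltP 0 t; last first.
 apply: (@cvg_trans _ (nbhs (0%E : \bar R))) => //; apply: cvg_near_cst; apply: nearW => n.
 by rewrite /q ltNge t0 mul0r.
 apply: cvg_EFin; first exact: nearW.
 have e1 : expR (- t) ^+ n @[n --> \oo] --> (0 : R).
 apply: cvg_expr; rewrite ger0_norm ?expR_ge0//.
 by rewrite -expR0 ltr_expR oppr_lt0.
 have : k t * expR (- t) ^+ n * (k t * expR (- t) ^+ n) @[n --> \oo] --> k t * 0 * (k t * 0).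
 by apply: cvgM; apply: cvgMr.
 rewrite !mulr0; apply: cvg_trans; apply: near_eq_cvg; apply: nearW => n.
 by rewrite /= /q t0 mul1r -expRM_natl mulrN expr2.
 - apply/integrableP; split; first by apply/mEF; exact: measX.
 by under eq_integral do rewrite /= ger0_norm ?sqr_ge0//.
 - move=> n t _; rewrite lee_fin ger0_norm//; rewrite /q; have [t0|t0] := ltP 0 t; last by rewrite mul0r sqr_ge0.
 rewrite mul1r exprMn ler_piMr ?sqr_ge0// expr_le1 ?expR_ge0//.
 by rewrite -expR0 ler_expR oppr_le0 mge0// ltW.
rewrite integral0 in cv.
have K2 : 0 < K / expR 2 by rewrite divr_gt0 ?expR_gt0.
have [n hn] : exists n, (\int[mu]_t (q n t)%:E <= (K / expR 2)%:E)%E.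
 have : \forall n \near \oo, ((\int[mu]_t (q n t)%:E) < (K / expR 2)%:E)%E.
 have h0 : (0 < (K / expR 2)%:E)%E by rewrite lte_fin.
 exact: (cv _ (open_nbhs_nbhs (conj (@open_ereal_lt_ereal R (K / expR 2)%:E) h0))).
 by move=> [n _ /(_ n (leqnn n))/ltW h]; exists n.
exists n%:R => //; exists (n.+1%:R)^-1; first by rewrite invr_gt0.
move=> eta e0 eh; apply: (le_via ((expR 2)%:E * \int[mu]_t (q n t)%:E)%E).
 have <- : (\int[mu]_t ((expR 2)%:E * (q n t)%:E) = (expR 2)%:E * \int[mu]_t (q n t)%:E)%E.
 rewrite intZl//; first by apply/mEF; exact: mq.
 by move=> t _; rewrite lee_fin.
 apply: le_lower_integral => t _; first by rewrite lee_fin mge0 ?ler0n//; exact: sqr_ge0.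
 rewrite -EFinM lee_fin /q; case: (boolP (eta <= t <= _)) => [/andP[et _]|_]; last first.
 by rewrite mul0r; apply: mge0; [exact: expR_ge0|exact: q0].
 rewrite (lt_le_trans e0 et) !mul1r !exprMn [leRHS]mulrCA ler_wpM2l ?sqr_ge0//.
 rewrite mulNr -!expRM_natl -expRD ler_expR.
 have : n%:R * eta <= 1.
 apply: (le_via (n.+1%:R * eta)); first by rewrite ler_wpM2r ?ler_nat// ltW.
 by rewrite mulrC -ler_pdivlMr// div1r ltW.
 by move: e0 et; nra.
apply: (le_via ((expR 2)%:E * (K / expR 2)%:E)%E); first by apply: lee_wpmul2l => //; rewrite lee_fin expR_ge0.
by rewrite -EFinM mulrC divfK ?gt_eqF ?expR_gt0.
Qed.


Variables (Om : set V) (F : V -> V) (Phi : R -> V -> V) (S L : R).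
Hypotheses (oOm : open Om) (bOm : bounded_set Om) (fl : is_flow F Phi) (S0 : 0 < S).
Hypothesis exits : forall x, exists2 t, 0 <= t <= S & ~ Om (Phi t x).
Hypotheses (L0 : 0 <= L) (FL : forall x y, `|F x - F y| <= L * `|x - y|).
Local Notation tau := (exit_time Om Phi).
Local Notation Q T := (cylinder Om T).

Definition weight (l : R) (x : BV) : R := expR (- l * tau x).

Lemma measurable_weight l : mfunT (weight l).
Proof. by apply: measC => //; apply: measM => //; exact: measurable_exit_time oOm fl exits. Qed.

Lemma weight_le1 l x : 0 <= l -> 0 <= weight l x <= 1.
Proof.
move=> l0; rewrite expR_ge0/= -expR0 ler_expR mulNr oppr_le0 mge0//.
exact: exit_time_ge0.
Qed.

Lemma weight_ge l x : 0 <= l -> expR (- l * S) <= weight l x.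
Proof. by move=> l0; rewrite ler_expR !mulNr lerN2 ler_wpM2l//; exact: exit_time_le oOm fl S0 exits _. Qed.

Lemma integral_space_time (g : BV -> R) (be : R -> R) : mfunT g -> mfunT be ->
 (forall x, 0 <= g x) -> (forall t, 0 <= be t) -> (\int[mu]_t (be t)%:E = 1)%E ->
 (\int[lamB]_z (g (xof (z : VT)) * be (tof z))%:E = \int[lamB]_x (g x)%:E)%E.
Proof.
move=> mg mb g0 b0 b1; rewrite lamB_tonelli1.
- apply: eq_integral => x _; transitivity (\int[mu]_t ((g x)%:E * (be t)%:E))%E.
 by apply: eq_integral => t _; rewrite xofE tofE EFinM.
 by rewrite intZl ?b1 ?mule1 ?lee_fin//; [apply/mEF|move=> t _; rewrite lee_fin].
- apply/mEF; apply: measM.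
 by apply: (measC mg); exact: meas_xof.
 by apply: (measC mb); exact: meas_tof.
- by move=> z; rewrite lee_fin mge0.
Qed.

Lemma slab_average (M T : R) : 0 <= M -> exists2 C : R, 0 < C &
 forall (phi : VT -> R) (k : R -> R) (f : BV -> R) (eps : BT -> R) (l a h K : R) (be : R -> R),
 Ck_on 1 setT phi -> mfunT k -> mfunT f -> mfunT eps ->
 (forall z, 0 <= eps z) -> (forall z, excess F M phi z <= k (tof z) * `|f (xof z)| + eps z) ->
 0 < a -> h + S < T -> 0 <= l ->
 (forall eta, 0 < eta -> eta < h ->
 (\int[mu]_t ((eta <= t <= eta + S)%R%:R * (k t * expR (- l * (t - eta))) ^+ 2)%:E <= K%:E)%E) ->
 mfunT be -> (forall t, 0 <= be t) -> (forall t, ~ (a < t < h) -> be t = 0) ->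
 (\int[mu]_t (be t)%:E = 1)%E ->
 (\int[lamB]_z (\1_(Q T) z * (weight l (xof z) * phi z) ^+ 2 * be (tof z))%:E <=
 C%:E * (\int[surfB]_(z in lateral Om T) (phi z ^+ 2)%:E +
 K%:E * \int[lamB]_(x in Om) ((weight l x * f x) ^+ 2)%:E +
 \int[lamB]_(z in Q T) (eps z ^+ 2)%:E))%E.
Proof.
move=> M0; have [C C0 hC] := slab_estimate oOm fl S0 exits L0 FL T M0; exists C => //.
move=> phi k f eps l a h K be cphi mk mf me e0 hex a0 hT l0 hK mbe be0 beout be1.
have mphi : mfunT (phi : BT -> R).
 by apply: cont_meas => z; have [+ _] := cphi; exact.
have mw := measurable_weight l.
rewrite lamB_tonelli2; last 2 first.
- apply/mEF; apply: measM; last first.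
 by apply: (measC mbe); exact: meas_tof.
 apply: measM; first by apply: measI; exact: measurable_cylinder.
 apply: measX; apply: measM => //.
 by apply: (measC mw); exact: meas_xof.
- by move=> z; rewrite lee_fin; apply: mge0 => //; apply: mge0 => //; exact: sqr_ge0.
set X := (C%:E * _)%E.
rewrite (_ : X = \int[mu]_t (X * (be t)%:E))%E; last first.
 have X0 : (0 <= X)%E.
 apply: mule_ge0; first by rewrite lee_fin ltW.
 apply: adde_ge0; last by apply: integral_ge0 => z _; rewrite lee_fin sqr_ge0.
 apply: adde_ge0; first by apply: integral_ge0 => z _; rewrite lee_fin sqr_ge0.
 apply: mule_ge0; last by apply: integral_ge0 => z _; rewrite lee_fin sqr_ge0.
 have [ah|ha] := ltP a h.
 apply: le_trans (hK ((a + h) / 2) _ _); [|lra|lra].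
 by apply: integral_ge0 => t _; rewrite lee_fin; apply: mge0; [exact: ler0n|exact: sqr_ge0].
 exfalso; move: be1; rewrite (eq_integral (cst 0%E)).
 by rewrite integral0 => /eqP; rewrite eq_sym onee_eq0.
 by move=> t _; rewrite beout// => /andP[]; lra.
 by rewrite intZl ?be1 ?mule1//; [apply/mEF|move=> t _; rewrite lee_fin].
apply: le_lower_integral => t _.
 by apply: integral_ge0 => x _; rewrite lee_fin; apply: mge0 => //; apply: mge0 => //; exact: sqr_ge0.
have [ta|nta] := pselect (a < t < h); last first.
 by rewrite beout// mule0; under eq_integral do rewrite /= tofE (beout t nta) mulr0; rewrite integral0.
have t0 : 0 < t by move: ta => /andP[]; lra.
have tT : t + S < T by move: ta => /andP[]; lra.
have mom : mfunT (fun x : BV => (weight l x * phi (spacetime x t)) ^+ 2).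
 apply: measX; apply: measM => //; apply: (measC mphi).
 exact: (measurable_fun_pair1 t (@meas_pack R d)).
have mI : mfunT (fun x : BV => \1_Om x : R) by apply: measI; exact: rVB_open.
have -> : (\int[lamB]_x (\1_(Q T) (pack (x, t)) * (weight l (xof (pack (x, t))) * phi (pack (x, t))) ^+ 2 *
 be (tof (pack (x, t))))%:E = \int[lamB]_(x in Om) ((weight l x * phi (spacetime x t)) ^+ 2)%:E * (be t)%:E)%E.
 rewrite (integral_mulI lamB Om) -ge0_integralZr//; first last.
 - by rewrite lee_fin.
 - by move=> x _; rewrite lee_fin; apply: mge0 => //; exact: sqr_ge0.
 - by apply/mEF; exact: measM.
 apply: eq_integral => x _; rewrite -EFinM /pack/= xofE tofE.
 congr (_ * _ * _)%:E; rewrite !indicE; congr (_%:R); congr (nat_of_bool _).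
 apply/idP/idP; rewrite !inE /cylinder/= xofE tofE; first by case.
 by move=> Ox; split=> //; rewrite t0/=; apply: lt_trans tT; rewrite ltrDl.
apply: lee_wpmul2r; first by rewrite lee_fin.
apply: le_trans (hC phi k f eps l t cphi mk mf me e0 hex t0 tT l0) _.
apply: lee_wpmul2l; first by rewrite lee_fin ltW.
apply: leeD => //; apply: leeD => //; apply: lee_wpmul2r; last first.
 by apply: hK => //; move: ta => /andP[].
by apply: integral_ge0 => x _; rewrite lee_fin sqr_ge0.
Qed.

Lemma defect_square (e x y b m X Y : R) : e <= (x + y) ^+ 2 -> y ^+ 2 = m ^+ 2 * Y -> x ^+ 2 <= b ^+ 2 * X ->
 0 <= b ^+ 2 * Y -> 0 <= m ^+ 2 * X -> e <= (2 * b ^+ 2 + 2 * m ^+ 2) * (X + Y).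
Proof. have := sqr_ge0 (x - y); rewrite !expr2; lra. Qed.

Lemma weighted_energy (M T B : R) : 0 <= M -> (forall x, `|F x| <= B) -> exists2 C : R, 0 < C &
 forall (k : R -> R) (f : BV -> R) (l a h K Kb Fo : R) (be : R -> R)
 (w g : VT -> R) (Dw : VT -> VT) (w0 : BT -> R) (D0 : 'I_d.+2 -> BT -> R),
 measurable_fun (Q T : set LM) w ->
 (forall j, measurable_fun (Q T : set LM) (fun z => Dw z ord0 j)) ->
 L2rep Om T w w0 -> (forall j, L2rep Om T (fun z => Dw z ord0 j) (D0 j)) ->
 trace_on (Q T) (lateral Om T) w Dw g ->
 (exists2 N : set BT, nullB N & forall z, Q T z -> ~ N z ->
 `|dot (\row_j D0 j z) (spacetime (F (xof z)) 1)| <= M * `|w0 z| + k (tof z) * `|f (xof z)|) ->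
 mfunT k -> (forall t, 0 <= k t) -> mfunT f -> 0 < a -> h + S < T -> 0 <= l -> 0 <= K ->
 (forall eta, 0 < eta -> eta < h ->
 (\int[mu]_t ((eta <= t <= eta + S)%R%:R * (k t * expR (- l * (t - eta))) ^+ 2)%:E <= K%:E)%E) ->
 mfunT be -> (forall t, 0 <= be t <= Kb) -> (forall t, ~ (a < t < h) -> be t = 0) ->
 (\int[mu]_t (be t)%:E = 1)%E -> 0 <= Fo ->
 (\int[lamB]_(x in Om) ((weight l x * f x) ^+ 2)%:E <= Fo%:E)%E ->
 (\int[lamB]_z ((weight l (xof z) * w0 z) ^+ 2 * be (tof z))%:E <=
 (4 * C * (fine (\int[surface]_(z in lateral Om T) (g z ^+ 2)%:E) + K * Fo))%:E)%E.
Proof.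
move=> M0 FB; have [C C0 hC] := slab_average T M0; exists C => //.
move=> k f l a h K Kb Fo be w g Dw w0 D0 cw cDw rw rD [[mg fg] [phi [sphi cv1 cv2 cv3]]] [N [mN N0] hN].
move=> mk k0 mf a0 hT l0 K0 hK mbe beK beout be1 Fo0 hFo.
set G := fine _; have GE : (\int[surface]_(z in lateral Om T) (g z ^+ 2)%:E = G%:E)%E.
 rewrite fineK// ge0_fin_numE; first exact: in_Lp2_lty fg.
 by apply: integral_ge0 => z _; rewrite lee_fin sqr_ge0.
have Kb0 : 0 <= Kb by have /andP[h1 h2] := beK 0; exact: le_trans h2.
have B0 : 0 <= B by apply: le_trans (FB 0).
pose n : R := d.+2%:R; pose B1 := B + 1; pose C1 := 2 * (n * B1) ^+ 2 + 2 * M ^+ 2.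
have n0 : 0 <= n by exact: ler0n.
have C10 : 0 <= C1 by rewrite addr_ge0// mge0//; exact: sqr_ge0.
apply/lee_addgt0Pr => e e0; pose c := 4 * C + 2 * C * C1 * (n + 1) + 2 * Kb + 1.
have c0 : 0 < c.
 have c1 : 0 <= 2 * C * C1 * (n + 1) by exact: (mge0 (mge0 (mge0 (ler0n R 2) (ltW C0)) C10) (addr_ge0 n0 ler01)).
 by have := mge0 (ler0n R 2) Kb0; rewrite /c; move: (2 * C * C1 * _) c1 (2 * Kb) => x x0 y y0; lra.
pose e1 := e / c; have e10 : 0 < e1 by rewrite divr_gt0.
have [i [k1 k2 k3]] : exists i, [/\ (\int[lebesgueN]_(z in Q T) ((phi i z - w z) ^+ 2)%:E <= e1%:E)%E,
 forall j, (\int[lebesgueN]_(z in Q T) ((partial j (phi i) z - Dw z ord0 j) ^+ 2)%:E <= e1%:E)%E &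
 (\int[surface]_(z in lateral Om T) ((phi i z - g z) ^+ 2)%:E <= e1%:E)%E].
 have n1 := Lp_norm2_cvg0 cv1 e10; have n3 := Lp_norm2_cvg0 cv3 e10.
 have n2 := filter_forall _ (fun j => Lp_norm2_cvg0 (cv2 j) e10).
 have [i _ hi] := filterI n1 (filterI (n2 _) n3); exists i; have [h1 [h2 h3]] := hi i (leqnn i); split.
 - exact: h1.
 - exact: h2.
 - exact: h3.
have cphi : Ck_on 1 setT (phi i) := sphi i 1%N.
have cps : continuous (phi i) by move=> z; have [+ _] := cphi; exact.
have cg j : continuous (partial j (phi i)) by move=> z; have [_ /(_ j)[_ [+ _]]] := cphi; exact.
have {}k2 j : (\int[lamB]_(z in Q T) ((partial j (phi i) z - D0 j z) ^+ 2)%:E <= e1%:E)%E.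
 by rewrite -(L2rep_diff oOm (cDw j) (rD j) (cg j)); exact: k2.
rewrite (L2rep_diff oOm cw rw cps) in k1.
have mQ : measurable (Q T : set BT) by exact: measurable_cylinder.
have mph : mfunT (phi i : BT -> R) by exact: cont_meas.
have mpa j : mfunT (partial j (phi i) : BT -> R) by exact: cont_meas.
have [mw0 zw0 _ _] := rw; have mD0 j : mfunT (D0 j) by have [] := rD j.
pose v (z : VT) := spacetime (F (xof z)) 1.
have vB z : `|v z| <= B1.
 apply: norm_le => [|j]; first by rewrite addr_ge0.
 rewrite mxE; case: unliftP => [j' _|_]; last by rewrite normr1 lerDr.
 by apply: le_trans (coord_le _ _) _; apply: le_trans (FB _) _; rewrite lerDl.
have mv j : mfunT (fun z : BT => v z ord0 j).
 have mF := lipschitz_measurable L0 FL.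
 rewrite /v; under eq_fun do rewrite mxE.
 case: (unlift ord_max j) => [j'|]; last exact: measK.
 apply: (measC (measurable_coord j')); apply: (measC mF); exact: meas_xof.
have mex : mfunT (fun z : BT => excess F M (phi i) z).
 apply: measTS; apply: measurable_maxr; first exact: measK.
 apply: measB; last by apply: measM => //; exact: measC.
 apply: measC => //; apply: measurable_sum => j.
 by apply: measM; [under eq_fun do rewrite mxE; exact: mpa|exact: mv].
pose eps (z : BT) := Num.max 0 (excess F M (phi i) z - k (tof z) * `|f (xof z)|).
have meps : mfunT eps.
 apply: measurable_maxr; first exact: measK.
 apply: measB => //; apply: measM.
 by apply: (measC mk); exact: meas_tof.
 by apply: measC => //; apply: (measC mf); exact: meas_xof.
pose D z := \sum_j (partial j (phi i) z - D0 j z) ^+ 2 + (phi i z - w0 z) ^+ 2.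
have hD z : Q T z -> ~ N z -> eps z ^+ 2 <= C1 * D z.
 move=> Qz nz; pose X : VT := grad (phi i) z - \row_j D0 j z.
 have XE : \sum_j (partial j (phi i) z - D0 j z) ^+ 2 = dot X X.
 by apply: eq_bigr => j _; rewrite !mxE expr2.
 have X2 : `|X| ^+ 2 <= dot X X.
 by rewrite -enorm_sqr ler_sqr ?nnegrE// ?sqrtr_ge0//; exact: norm_le_enorm.
 have h1 := hN z Qz nz.
 have h2 : `|dot X (v z)| <= n * `|X| * B1.
 by apply: le_trans (dot_le_norm _ _) _; rewrite ler_wpM2l// mge0.
 have h3 : `|along F (phi i) z| <= `|dot X (v z)| + `|dot (\row_j D0 j z) (v z)|.
 by rewrite /along -[grad _ _](subrK (\row_j D0 j z)) dotDl; exact: ler_normD.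
 have h4 : M * `|w0 z| <= M * `|phi i z| + M * `|phi i z - w0 z|.
 rewrite -mulrDr ler_wpM2l//.
 by rewrite -{1}[w0 z](subrK (phi i z)) addrC; apply: le_trans (ler_normD _ _) _; rewrite (distrC (w0 z)).
 have h5 : 0 <= n * `|X| * B1 by rewrite !mge0// addr_ge0.
 have h6 : 0 <= M * `|phi i z - w0 z| by rewrite mge0.
 have ep : 0 <= eps z <= n * `|X| * B1 + M * `|phi i z - w0 z|.
 rewrite /eps le_max lexx/= ge_max addr_ge0//= lerBlDr /excess ge_max.
 have kf : 0 <= k (tof z) * `|f (xof z)| by rewrite mge0.
 rewrite (addr_ge0 (addr_ge0 h5 h6) kf)/= lerBlDr; apply: le_trans h3 _; apply: le_trans (lerD h2 h1) _.
 by rewrite -!addrA lerD2l [leRHS]addrCA [leLHS]addrC lerD2l [leRHS]addrC.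
 rewrite /D XE; move: ep => /andP[e2 e3].
 have : eps z ^+ 2 <= (n * `|X| * B1 + M * `|phi i z - w0 z|) ^+ 2 by rewrite ler_sqr ?nnegrE// addr_ge0.
 have : (M * `|phi i z - w0 z|) ^+ 2 = M ^+ 2 * (phi i z - w0 z) ^+ 2 by rewrite exprMn real_normK// num_real.
 have : (n * `|X| * B1) ^+ 2 <= (n * B1) ^+ 2 * dot X X.
 by rewrite mulrAC exprMn ler_wpM2l// sqr_ge0.
 have : 0 <= (n * B1) ^+ 2 * (phi i z - w0 z) ^+ 2 by rewrite mge0// sqr_ge0.
 have : 0 <= M ^+ 2 * dot X X by rewrite mge0 ?dot_ge0// sqr_ge0.
 by move=> *; apply: (@defect_square _ (n * `|X| * B1) (M * `|phi i z - w0 z|)).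
have mX j : measurable_fun (Q T : set BT) (fun z : BT => ((partial j (phi i) z - D0 j z) ^+ 2)%:E).
 by apply: measTS; apply/mEF; apply: measX; exact: measB.
have mY : measurable_fun (Q T : set BT) (fun z : BT => ((phi i z - w0 z) ^+ 2)%:E).
 by apply: measTS; apply/mEF; apply: measX; exact: measB.
have hE : (\int[lamB]_(z in Q T) (eps z ^+ 2)%:E <= (C1 * ((n + 1) * e1))%:E)%E.
 apply: (le_via (\int[lamB]_(z in Q T) (C1%:E * (\sum_j ((partial j (phi i) z - D0 j z) ^+ 2)%:E + ((phi i z - w0 z) ^+ 2)%:E)))%E).
 apply: ae_ge0_le_integral => //.
 - by move=> z _; rewrite lee_fin sqr_ge0.
 - by apply: measTS; apply/mEF; exact: measX.
 - by move=> z _; rewrite mule_ge0 ?lee_fin// adde_ge0 ?lee_fin ?sqr_ge0// sume_ge0// => j _; rewrite lee_fin sqr_ge0.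
 - by apply: measeM; apply: emeasurable_funD => //; exact: emeasurable_sum.
 exists N; split=> // z /= hz; apply: contrapT => nz; apply: hz => Qz.
 by rewrite sumEFin -EFinD -EFinM lee_fin; exact: hD.
 have p1 z : (0 <= \sum_j ((partial j (phi i) z - D0 j z) ^+ 2)%:E)%E by apply: sume_ge0 => j _; rewrite lee_fin sqr_ge0.
 rewrite intZl//; try (by apply: emeasurable_funD => //; exact: emeasurable_sum);
 try (by move=> z _; rewrite adde_ge0 ?lee_fin ?sqr_ge0).
 rewrite EFinM; apply: lee_wpmul2l; first by rewrite lee_fin.
 rewrite ge0_integralD//; try (by move=> z _; rewrite lee_fin sqr_ge0); try exact: emeasurable_sum.
 rewrite ge0_integral_sum//; last by move=> j z _; rewrite lee_fin sqr_ge0.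
 rewrite mulrDl mul1r EFinD; apply: leeD => //.
 apply: (le_via (\sum_(j < d.+2) e1%:E)%E); first by apply: lee_sum => j _; exact: k2.
 by rewrite sumEFin sumr_const card_ord -mulr_natl.
have hG : (\int[surfB]_(z in lateral Om T) (phi i z ^+ 2)%:E <= (2 * G + 2 * e1)%:E)%E.
 have mL : measurable (lateral Om T : set BT) by exact: measurable_lateral.
 have mL' : measurable (lateral Om T : set (caratheodory_type (@surface_om R d.+1))).
 by apply: borel_hausdorff; exact: mL.
 have mp2 : measurable_fun (lateral Om T : set BT) (fun z : BT => (phi i z ^+ 2)%:E).
 by apply: measTS; apply/mEF; exact: measX.
 rewrite -ge0_integral_surface//; last by move=> z _; rewrite lee_fin sqr_ge0.
 have mph' : measurable_fun (lateral Om T : set (caratheodory_type (@surface_om R d.+1))) (phi i).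
 move=> _ Y mY'; apply: borel_hausdorff; exact: (measTS mph mL mY').
 have mg2 : measurable_fun (lateral Om T : set (caratheodory_type (@surface_om R d.+1))) (fun z => (g z ^+ 2)%:E).
 by apply/mEF; exact: measX.
 have md2 : measurable_fun (lateral Om T : set (caratheodory_type (@surface_om R d.+1))) (fun z => ((phi i z - g z) ^+ 2)%:E).
 by apply/mEF; apply: measX; exact: measB.
 apply: (le_via (\int[surface]_(z in lateral Om T) (2%:E * (g z ^+ 2)%:E + 2%:E * ((phi i z - g z) ^+ 2)%:E))%E).
 apply: le_lower_integral => z _; first by rewrite lee_fin sqr_ge0.
 rewrite -!EFinM -EFinD lee_fin.
 by rewrite -subr_ge0 (_ : _ - _ = (phi i z - 2 * g z) ^+ 2) ?sqr_ge0//; ring.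
 have z2 (q : VT -> R) z : lateral Om T z -> (0 <= (q z ^+ 2)%:E)%E by rewrite lee_fin sqr_ge0.
 have two : (0 <= 2%:E :> \bar R)%E by rewrite lee_fin.
 have z3 (q : VT -> R) z : lateral Om T z -> (0 <= 2%:E * (q z ^+ 2)%:E)%E by move=> zL; apply: mule_ge0 => //; exact: z2.
 rewrite (ge0_integralD surface mL' (z3 g) (measeM _ mg2) (z3 (fun z => phi i z - g z)) (measeM _ md2)).
 rewrite (intZl surface mL' mg2 (z2 g) two) (intZl surface mL' md2 (z2 (fun z => phi i z - g z)) two).
 by rewrite GE (EFinD (2 * G)) !EFinM; apply: leeD => //; exact: lee_wpmul2l.
have be0 t : 0 <= be t by have /andP[] := beK t.
have hS := hC (phi i) k f eps l a h K be cphi mk mf meps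
 (fun z => ltac:(by rewrite /eps le_max lexx))
 (fun z => ltac:(by rewrite -lerBlDl /eps le_max lexx orbT)) a0 hT l0 hK mbe be0 beout be1.
have mbt : mfunT (fun z : BT => be (tof z)) by apply: (measC mbe); exact: meas_tof.
have mws : mfunT (fun z : BT => weight l (xof z)).
 by apply: (measC (measurable_weight l)); exact: meas_xof.
have mI : mfunT (fun z : BT => \1_(Q T) z : R) by exact: measI.
apply: (le_via (\int[lamB]_z (2%:E * (\1_(Q T) z * (weight l (xof z) * phi i z) ^+ 2 * be (tof z))%:E +
 (2 * Kb)%:E * (\1_(Q T) z * (phi i z - w0 z) ^+ 2)%:E))%E).
 apply: le_lower_integral => z _.
 by rewrite lee_fin; apply: mge0 => //; exact: sqr_ge0.
 rewrite -!EFinM -EFinD lee_fin indicE; have [Qz|nQz] := pselect (Q T z); last first.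
 by rewrite zw0// mulr0 expr0n mul0r memNset// !mul0r !mulr0 addr0.
 have b01 := beK (tof z); move/andP: b01 => [b0 b1]; rewrite mem_set// !mul1r.
 have /andP[s0 s1] : 0 <= weight l (xof z) <= 1 by exact: weight_le1.
 move: (weight _ _) s0 s1 (be _) b0 b1 => s s0 s1 b b0 b1.
 have s2 : 0 <= s ^+ 2 <= 1 by rewrite sqr_ge0 expr_le1.
 have : (s * w0 z) ^+ 2 * b <= (2 * (s * phi i z) ^+ 2 + 2 * (s * (phi i z - w0 z)) ^+ 2) * b.
 by rewrite ler_wpM2r// -subr_ge0 (_ : _ - _ = (2 * (s * phi i z) - s * w0 z) ^+ 2) ?sqr_ge0//; ring.
 have : (s * (phi i z - w0 z)) ^+ 2 * b <= Kb * (phi i z - w0 z) ^+ 2.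
 have y0 := sqr_ge0 (phi i z - w0 z); move/andP: s2 => [s2 s3].
 by rewrite exprMn mulrC; apply: ler_pM => //; [exact: mge0|exact: ler_piMl].
 by lra.
rewrite ge0_integralD//; first last.
- by apply: measeM; apply/mEF; apply: measM => //; apply: measX; exact: measB.
- by move=> z _; rewrite -EFinM lee_fin; apply: mge0; [exact: mge0|apply: mge0 => //; exact: sqr_ge0].
- apply: measeM; apply/mEF; apply: measM => //; apply: measM => //.
 by apply: measX; exact: measM.
- by move=> z _; rewrite -EFinM lee_fin; apply: mge0 => //; apply: mge0 => //; apply: mge0 => //; exact: sqr_ge0.
rewrite !intZl//; first last.
- by move=> z _; rewrite lee_fin; apply: mge0 => //; apply: mge0 => //; exact: sqr_ge0.
- apply/mEF; apply: measM => //; apply: measM => //.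
 by apply: measX; exact: measM.
- by rewrite lee_fin mge0.
- by move=> z _; rewrite lee_fin; apply: mge0 => //; exact: sqr_ge0.
- by apply/mEF; apply: measM => //; apply: measX; exact: measB.
rewrite -(integral_mulI lamB (Q T)).
have hS' : (\int[lamB]_z (\1_(Q T) z * (weight l (xof z) * phi i z) ^+ 2 * be (tof z))%:E <=
 (C * (2 * G + 2 * e1 + K * Fo + C1 * ((n + 1) * e1)))%:E)%E.
 apply: le_trans hS _; rewrite EFinM; apply: lee_wpmul2l; first by rewrite lee_fin ltW.
 rewrite EFinD; apply: leeD => //; rewrite EFinD; apply: leeD => //.
 by rewrite EFinM; apply: lee_wpmul2l; rewrite ?lee_fin.
have p2 : (0 <= 2%:E :> \bar R)%E by rewrite lee_fin.
have p3 : (0 <= (2 * Kb)%:E)%E by rewrite lee_fin mge0.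
apply: le_trans (leeD (lee_wpmul2l p2 hS') (lee_wpmul2l p3 k1)) _.
rewrite -!EFinM -!EFinD lee_fin.
have -> : e = e1 * c by rewrite /e1 divfK ?gt_eqF.
have X0 : 0 <= C * (K * Fo) := mge0 (ltW C0) (mge0 K0 Fo0).
rewrite -subr_ge0 (_ : _ - _ = 2 * (C * (K * Fo)) + e1); last by rewrite /c; ring.
by rewrite addr_ge0 ?(ltW e10)// mge0.
Qed.

End energy.

Section source.
Context {R : realType} {d : nat}.
Local Notation V := 'rV[R]_d.+1.
Local Notation VT := 'rV[R]_d.+2.
Local Notation BT := (rVB R d.+1).
Local Notation mu := (@lebesgue_measure R).
Local Notation intg F := (lamB.-integrable setT (EFin \o (F : BT -> R))).
Variables (Om : set V) (T : R).
Hypotheses (oOm : open Om) (bOm : bounded_set Om).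
Local Notation Q := (cylinder Om T).
Variables (u w r : BT -> R) (a b : 'I_d.+1 -> BT -> R).
Variables (H : 'I_d.+1 -> rVB R d -> R) (p f sg om : rVB R d -> R) (B E m dl h0 A : R).
Hypotheses (uw : weakly Om T ord_max u w) (ua : forall i, weakly Om T (lift ord_max i) u (a i)).
Hypotheses (wb : forall i, weakly Om T (lift ord_max i) w (b i)) (Lr : L2Q Om T r).
Hypotheses (mH : forall i, mfunT (H i)) (mp : mfunT p) (mf : mfunT f).
Hypotheses (HB : forall i x, `|H i x| <= B) (pB : forall x, `|p x| <= B).
Hypothesis eqn : exists2 N : set BT, nullB N & forall z, Q z -> ~ N z ->
 w z + \sum_i H i (xof z) * a i z + p (xof z) * u z = r z * f (xof z).
Hypothesis early : forall s : R, 0 < s -> s < T ->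
 \int[lamB]_z (u z ^+ 2 * (tof z < s)%R%:R) <= E * s ^+ 2 * \int[lamB]_z (w z ^+ 2 * (tof z < s)%R%:R).
Hypotheses (f0 : forall x, ~ Om x -> f x = 0) (ff : (\int[lamB]_x (f x ^+ 2)%:E < +oo)%E).
Hypotheses (msg : mfunT sg) (sg1 : forall x, `|sg x| <= 1).
Hypotheses (mom : mfunT om) (om01 : forall x, 0 <= om x <= 1).
Hypotheses (m0 : 0 < m) (dl0 : 0 < dl) (h00 : 0 < h0) (T0 : 0 < T).
Hypothesis sgn : exists2 N : set BT, nullB N & forall z, Q z -> ~ N z ->
 tof z < dl -> m <= r z * sg (xof z).
Hypothesis energy : forall (a' h Kb : R) (be : R -> R), 0 < a' -> a' < h -> h < h0 -> mfunT be ->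
 (forall t, 0 <= be t <= Kb) -> (forall t, ~ (a' < t < h) -> be t = 0) -> (\int[mu]_t (be t)%:E = 1)%E ->
 (\int[lamB]_z ((om (xof z) * w z) ^+ 2 * be (tof z))%:E <= A%:E)%E.

Let cut (n : nat) (x : rVB R d) : R := (`|f x| <= n%:R)%R%:R.

Let mcut n : mfunT (cut n).
Proof.
rewrite (_ : cut n = \1_(`]-oo, n%:R]%classic : set R) \o (fun x => `|f x|)); last first.
 by apply/funext => x; rewrite /= /cut indicE mem_setE in_itv.
by apply: measC; [apply: measI; exact: measurable_itv|exact: measC].
Qed.

Let q (n : nat) (x : rVB R d) : R := (om x * f x) ^+ 2 * cut n x.

Let mq n : mfunT (q n).
Proof. by apply: measM => //; apply: measX; exact: measM. Qed.

Let q0 n x : 0 <= q n x.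
Proof. by rewrite mge0 ?ler0n//; exact: sqr_ge0. Qed.

Let q_le n x : q n x <= (om x * f x) ^+ 2.
Proof. by rewrite ler_piMr ?sqr_ge0// lern1 leq_b1. Qed.

Let of2 x : (om x * f x) ^+ 2 <= f x ^+ 2.
Proof. by have /andP[h1 h2] := om01 x; rewrite exprMn ler_piMl ?sqr_ge0// expr_le1. Qed.

Let layer (z : BT) : R := \sum_i `|b i z| + `|w z|.

Let layer_integrable : intg layer.
Proof.
have abs (v : BT -> R) : L2Q Om T v -> intg (fun z => `|v z|).
 move=> [mv zv fv]; have iv : intg v := L2_integrable oOm bOm mv zv fv.
 by have := integrable_abse iv; congr integrable.
have [iS _] := @Rintegral_sum _ _ _ (index_enum 'I_d.+1) (fun i z => `|b i z|) (fun i => abs _ (weakly_L2 (wb i)).2).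
have := integrableD measurableT iS (abs _ (weakly_L2 uw).2).
by congr integrable.
Qed.

Let layer_zero z : ~ Q z -> layer z = 0.
Proof.
move=> nz; have z0 (v : BT -> R) : L2Q Om T v -> v z = 0 by move=> [_ + _]; exact.
rewrite /layer (z0 _ (weakly_L2 uw).2) normr0 addr0 big1// => i _.
by rewrite (z0 _ (weakly_L2 (wb i)).2) normr0.
Qed.

Let layer_ge0 z : 0 <= layer z.
Proof. by rewrite addr_ge0// sumr_ge0. Qed.

Lemma truncated_bound (n : nat) (F h : R) : (\int[lamB]_x (q n x)%:E = F%:E)%E ->
 0 < h -> h < h0 -> h < T -> h < dl ->
 3 / 4 * (m * F) <= A / m + n%:R * B * \int[lamB]_z (layer z * (tof z < h)%R%:R).
Proof.
move=> FE hpos hh0 hT hdl.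
have B0 : 0 <= B by apply: le_trans (pB 0).
have a0 : 0 < h / 2 by rewrite divr_gt0.
have ah : h / 2 < h by rewrite ltr_pdivrMr// ltr_pMr// ltr1n.
have [be [G [sbe dG be0 beout [Gl Gr G01]]]] := unit_bump ah.
have [Kb Kb0 hKb] := time_test_bounded (time_test_be a0 hT sbe beout).
have mbe : mfunT be by apply: measF; exact: smooth1_cont.
have mG : mfunT (fun t => 1 - G t).
 by apply: measB => //; apply: measF; exact: is_derive_continuous dG.
have be1 := integral_unit_mass ah sbe dG beout Gl Gr.
have hA := energy a0 ah hh0 mbe (fun t => ltac:(by rewrite be0/=; apply: le_trans (hKb t); exact: ler_norm)) beout be1.
pose g x := om x ^+ 2 * f x * cut n x * sg x.
have mg : mfunT g.
 by apply: measM => //; apply: measM => //; apply: measM => //; exact: measX.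
have fcut x : `|f x * cut n x| <= n%:R.
 by rewrite /cut; case: (leP `|f x| n%:R) => [h'|_]; rewrite ?mulr1// mulr0 normr0.
have om2 x : 0 <= om x ^+ 2 <= 1 by have /andP[h1 h2] := om01 x; rewrite sqr_ge0 expr_le1.
have gn x : `|g x| <= n%:R.
 rewrite /g normrM -(mulrA _ (f x)) normrM -[leRHS]mulr1 ler_pM//.
 by rewrite -[leRHS]mul1r ler_pM// ger0_norm; have /andP[] := om2 x.
have gOm x : ~ Om x -> g x = 0 by move=> nx; rewrite /g f0// mulr0 !mul0r.
have mS (s : rVB R d -> R) : mfunT s -> mfunT (fun z : BT => s (xof z)).
 by move=> ms; apply: (measC ms); exact: meas_xof.
have mT (s : R -> R) : mfunT s -> mfunT (fun z : BT => s (tof z)).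
 by move=> ms; apply: (measC ms); exact: meas_tof.
have G1 t : `|1 - G t| <= 1 by have /andP[h1 h2] := G01 t; rewrite ger0_norm; lra.
pose K := Num.max Kb 1.
have k1 t : `|be t| <= K by apply: le_trans (hKb t) _; rewrite le_max lexx.
have k2 t : `|1 - G t| <= K by apply: le_trans (G1 t) _; rewrite le_max lexx orbT.
have term (v : BT -> R) (s : rVB R d -> R) (c : R -> R) (C : R) : L2Q Om T v -> mfunT s ->
 (forall x, `|s x| <= C) -> mfunT c -> (forall t, `|c t| <= K) ->
 intg (fun z => v z * (s (xof z) * c (tof z))).
 move=> Lv ms sC mc cK; apply: (@L2Q_mul _ _ _ _ oOm bOm _ _ (C * K) Lv).
 by apply: measM; [exact: mS|exact: mT].
 by move=> z; rewrite normrM ler_pM.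
have [Lu Lw] := weakly_L2 uw.
have La i := (weakly_L2 (ua i)).2; have Lb i := (weakly_L2 (wb i)).2.
pose Hg i x := H i x * g x; pose pg x := p x * g x.
have mHg i : mfunT (Hg i) by exact: measM.
have mpg : mfunT pg by exact: measM.
have HgB i x : `|Hg i x| <= B * n%:R by rewrite normrM ler_pM.
have pgB x : `|pg x| <= B * n%:R by rewrite normrM ler_pM.
pose fg x := f x * g x.
have fgE x : fg x = q n x * sg x by rewrite /fg /g /q; ring.
have fgB x : `|fg x| <= n%:R * n%:R.
 rewrite (_ : fg x = f x * cut n x * g x); first by rewrite normrM ler_pM.
 have cc : cut n x * cut n x = cut n x by rewrite /cut; case: (_ <= _); rewrite ?mulr1 ?mulr0.
 by rewrite /fg /g -{1}cc; ring.
have mfg : mfunT fg by exact: measM.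
have i0 := term r fg be _ Lr mfg fgB mbe k1.
have i1 := term w g be _ Lw mg gn mbe k1.
have ia i := term (a i) (Hg i) be _ (La i) (mHg i) (HgB i) mbe k1.
have ib i := term (b i) (Hg i) (fun t => 1 - G t) _ (Lb i) (mHg i) (HgB i) mG k2.
have iu := term u pg be _ Lu mpg pgB mbe k1.
have iw := term w pg (fun t => 1 - G t) _ Lw mpg pgB mG k2.
have e1 i : \int[lamB]_z (a i z * (Hg i (xof z) * be (tof z))) =
 \int[lamB]_z (b i z * (Hg i (xof z) * (1 - G (tof z)))).
 have := @multiplier _ _ _ _ oOm bOm (a i) (b i) be (fun t => 1 - G t) K 1 (La i) (Lb i) mbe mG k1 k2 _ (Hg i) _ (mHg i) (HgB i).
 rewrite !mul1r; apply; last by move=> x nx; rewrite /Hg gOm// mulr0.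
 by move=> g' tg'; rewrite mul1r; exact: (initial_gradient oOm bOm uw early a0 ah hT sbe dG beout Gl Gr G01 (ua i) (wb i) tg').
have e2 : \int[lamB]_z (u z * (pg (xof z) * be (tof z))) = \int[lamB]_z (w z * (pg (xof z) * (1 - G (tof z)))).
 have := @multiplier _ _ _ _ oOm bOm u w be (fun t => 1 - G t) K 1 Lu Lw mbe mG k1 k2 _ pg _ mpg pgB.
 rewrite !mul1r; apply; last by move=> x nx; rewrite /pg gOm// mulr0.
 by move=> g' tg'; rewrite mul1r; exact: (initial_time oOm bOm uw early a0 ah hT sbe dG beout Gl Gr G01 tg').
have [sa sa'] := @Rintegral_sum _ _ _ (index_enum 'I_d.+1) _ ia.
have [N1 [mN1 N10] hN1] := eqn; have [N2 [mN2 N20] hN2] := sgn.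
have id : \int[lamB]_z (r z * (fg (xof z) * be (tof z))) =
 \int[lamB]_z (w z * (g (xof z) * be (tof z))) +
 \sum_i \int[lamB]_z (b i z * (Hg i (xof z) * (1 - G (tof z)))) +
 \int[lamB]_z (w z * (pg (xof z) * (1 - G (tof z)))).
 rewrite -e2 -(eq_bigr _ (fun i _ => e1 i)) -sa' -RintegralD// -RintegralD//; last first.
 by have := integrableD measurableT i1 sa.
 have i12 := integrableD measurableT i1 sa; have i123 := integrableD measurableT i12 iu.
 rewrite /Rintegral; congr fine; apply: ae_eq_integral => //.
 - by have /integrableP[] := i0.
 - by have /integrableP[] := i123.
 exists N1; split=> // z /= nz; apply: contrapT => Nz; apply: nz => _; congr EFin.
 have [Qz|nQz] := pselect (Q z); last first.
 have z0 v : L2Q Om T v -> v z = 0 by move=> [_ + _]; exact.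
 rewrite big1 => [|i _]; last by rewrite (z0 _ (La i)) mul0r.
 by rewrite (z0 _ Lw) (z0 _ Lu) (z0 _ Lr) !mul0r !addr0.
 rewrite (_ : \sum_i a i z * _ = (\sum_i H i (xof z) * a i z) * (g (xof z) * be (tof z))); last first.
 by rewrite mulr_suml; apply: eq_bigr => i _; rewrite /Hg; ring.
 transitivity (r z * f (xof z) * (g (xof z) * be (tof z))); first by rewrite /fg; ring.
 by rewrite -(hN1 z Qz Nz) /pg; ring.
have qbE : (\int[lamB]_z (q n (xof z) * be (tof z))%:E = F%:E)%E by rewrite integral_space_time// FE.
have mqb : mfunT (fun z : BT => q n (xof z) * be (tof z)).
 by apply: measM; [exact: mS|exact: mT].
have qb0 z : 0 <= q n (xof z) * be (tof z) by apply: mge0.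
have iqb : intg (fun z => q n (xof z) * be (tof z)).
 apply/integrableP; split; first exact/mEF.
 by under eq_integral do rewrite /= ger0_norm ?qb0//; rewrite qbE ltry.
have qbR : \int[lamB]_z (q n (xof z) * be (tof z)) = F by rewrite /Rintegral qbE.
have low : m * F <= \int[lamB]_z (r z * (fg (xof z) * be (tof z))).
 have imq : intg (fun z => m * (q n (xof z) * be (tof z))).
 by have := integrableZl measurableT m iqb; congr integrable.
 rewrite -qbR -RintegralZl// -lee_fin !fineK; last 2 first.
 - exact: (integrable_fin_num measurableT i0).
 - exact: (integrable_fin_num measurableT imq).
 have m1 := measM (measK m) mqb.
 have m2 : mfunT (fun z : BT => r z * (fg (xof z) * be (tof z))).
 by have /integrableP[/mEF] := i0.
 rewrite [leRHS](@ae_eq_integral _ _ _ lamB setT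
 (fun z => (Num.max (m * (q n (xof z) * be (tof z))) (r z * (fg (xof z) * be (tof z))))%:E))//.
 - apply: ge0_le_integral => //.
 + by move=> z _; rewrite lee_fin; apply: mge0; [exact: ltW|exact: qb0].
 + exact/mEF.
 + by apply/mEF; exact: measurable_maxr.
 + by move=> z _; rewrite lee_fin le_max lexx.
 - exact/mEF.
 - by apply/mEF; exact: measurable_maxr.
 exists N2; split=> // z /= nz; apply: contrapT => Nz; apply: nz => _; congr EFin; apply/esym/max_idPr.
 have [thz|/beout ->] := pselect (h / 2 < tof z < h); last by rewrite !mulr0.
 have [Oz|nOz] := pselect (Om (xof z)); last by rewrite fgE /q f0// mulr0 expr0n !mul0r !mulr0.
 move/andP: thz => [t1 t2]; rewrite fgE (_ : r z * _ = r z * sg (xof z) * (q n (xof z) * be (tof z))); last by ring.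
 rewrite ler_wpM2r ?qb0//; apply: (hN2 z _ Nz (lt_trans t2 hdl)); split=> //.
 by rewrite (lt_trans a0 t1) (lt_trans t2 hT).
have up1 : \int[lamB]_z (w z * (g (xof z) * be (tof z))) <= A / m + m / 4 * F.
 pose e (z : BT) := (om (xof z) * w z) ^+ 2 * be (tof z).
 have me : mfunT e.
 have [mw _ _] := Lw; apply: measM; last exact: mT.
 by apply: measX; apply: measM => //; exact: mS.
 have e0 z : 0 <= e z by rewrite /e; apply: mge0 => //; exact: sqr_ge0.
 have ie : intg e.
 apply/integrableP; split; first exact/mEF.
 by under eq_integral do rewrite /= ger0_norm ?e0//; apply: le_lt_trans hA _; exact: ltry.
 have eA : \int[lamB]_z e z <= A by rewrite -lee_fin fineK//; exact: (integrable_fin_num measurableT ie).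
 have ie' : intg (fun z => m^-1 * e z) by have := integrableZl measurableT m^-1 ie; congr integrable.
 have iq' : intg (fun z => m / 4 * (q n (xof z) * be (tof z))).
 by have := integrableZl measurableT (m / 4) iqb; congr integrable.
 apply: (le_via (\int[lamB]_z (m^-1 * e z + m / 4 * (q n (xof z) * be (tof z))))); last first.
 rewrite RintegralD// !RintegralZl// qbR lerD2r mulrC; apply: ler_wpM2r => //.
 by rewrite invr_ge0 ltW.
 apply: le_Rintegral => //; first by have := integrableD measurableT ie' iq'; congr integrable.
 move=> z _; rewrite /e /g /q; have b0 := be0 (tof z); have s1 := sg1 (xof z).
 move: (be _) b0 (sg _) s1 (om _) => c c0 s s1 o.
 set k := cut n _; have k01 : k = 0 \/ k = 1 by rewrite /k /cut; case: (_ <= _); [right|left].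
 move: (w z) (f _) k k01 => x y k k01; set X := o * x; set Y := o * y.
 rewrite (_ : x * _ = X * Y * (k * s) * c); last by rewrite /X /Y; ring.
 rewrite (_ : m^-1 * _ + _ = (m^-1 * X ^+ 2 + m / 4 * (Y ^+ 2 * k)) * c) ?ler_wpM2r//; last by ring.
 have [->|->] := k01; first by rewrite !(mul0r, mulr0) addr0; apply: mge0; [by rewrite invr_ge0 ltW|exact: sqr_ge0].
 rewrite !mulr1 mul1r; apply: (le_via (`|X| * `|Y|)).
 by apply: le_trans (ler_norm _) _; rewrite !normrM -[leRHS]mulr1 ler_pM// mge0.
 rewrite -subr_ge0 -[X ^+ 2]real_normK ?num_real// -[Y ^+ 2]real_normK ?num_real//.
 rewrite (_ : _ - _ = m^-1 * (`|X| - m / 2 * `|Y|) ^+ 2); last by field; exact: lt0r_neq0.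
 by rewrite mge0 ?sqr_ge0// invr_ge0 ltW.
have up2 : \sum_i \int[lamB]_z (b i z * (Hg i (xof z) * (1 - G (tof z)))) +
 \int[lamB]_z (w z * (pg (xof z) * (1 - G (tof z)))) <=
 n%:R * B * \int[lamB]_z (layer z * (tof z < h)%R%:R).
 have [sb sb'] := @Rintegral_sum _ _ _ (index_enum 'I_d.+1) _ ib.
 have il : intg (fun z => layer z * (tof z < h)%R%:R).
 apply: (@integrable_mulb _ _ _ _ 1 layer_integrable); first exact: measurable_below.
 by move=> z; rewrite ger0_norm ?ler0n// lern1 leq_b1.
 rewrite -sb' -RintegralD// -RintegralZl//; apply: le_Rintegral => //.
 - by have := integrableD measurableT sb iw; congr integrable.
 - by have := integrableZl measurableT (n%:R * B) il; congr integrable.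
 have nB : 0 <= n%:R * B by rewrite mge0.
 move=> z _; have one (v s : R) : `|s| <= B * n%:R ->
 v * (s * (1 - G (tof z))) <= n%:R * B * (`|v| * (tof z < h)%R%:R).
 move=> sB; have [th|th] := ltP (tof z) h; last by rewrite Gr// subrr !mulr0.
 rewrite mulr1; apply: le_trans (ler_norm _) _; rewrite !normrM mulrC.
 rewrite ler_wpM2r// -[leRHS]mulr1 (mulrC n%:R) ler_pM//.
 rewrite /layer [_ * (tof z < h)%R%:R]mulrDl mulrDr lerD//; last exact: one.
 by rewrite mulr_suml mulr_sumr; apply: ler_sum => i _; exact: one.
by move: low up1 up2; rewrite id; lra.
Qed.

Lemma source_bound : (\int[lamB]_x ((om x * f x) ^+ 2)%:E <= (2 * A / m ^+ 2)%:E)%E.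
Proof.
have mof : mfunT (fun x => (om x * f x) ^+ 2) by apply: measX; exact: measM.
have bound n : (\int[lamB]_x (q n x)%:E <= (2 * A / m ^+ 2)%:E)%E.
 have fin : (\int[lamB]_x (q n x)%:E)%E \is a fin_num.
 rewrite ge0_fin_numE; last by apply: integral_ge0 => x _; rewrite lee_fin.
 apply: le_lt_trans ff; apply: le_lower_integral => x _; rewrite lee_fin//.
 exact: le_trans (of2 x).
 have FE := esym (fineK fin); set F := fine _ in FE.
 have F0 : 0 <= F by apply: fine_ge0; apply: integral_ge0 => x _; rewrite lee_fin.
 rewrite FE lee_fin.
 have B0 : 0 <= B by apply: le_trans (pB 0).
 have key : 3 / 4 * (m * F) <= A / m.
 apply/ler_addgt0Pr => e e0; pose e1 := e / (n%:R * B + 1).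
 have nB : 0 < n%:R * B + 1 by rewrite ltr_wpDl ?mge0.
 have e10 : 0 < e1 by rewrite divr_gt0.
 have cv := layer_vanish layer_ge0 layer_zero layer_integrable.
 have small (x : R) : 0 < x -> \forall j \near \oo, 2 / j.+1%:R < x.
 move=> x0; have /cvgrPdist_lt /(_ _ (divr_gt0 x0 (ltr0n R 2))) := @cvg_harmonic R.
 apply: filterS => j; rewrite sub0r normrN ger0_norm ?invr_ge0// ltr_pdivlMr// => h.
 by rewrite mulrC.
 have c1 : \forall j \near \oo, \int[lamB]_z (layer z * (tof z < 2 / j.+1%:R)%R%:R) < e1.
 by apply: (cvgr_lt (0 : R)).
 have [j _ hj] := filterI c1 (filterI (small _ h00) (filterI (small _ T0) (small _ dl0))).
 have [j1 [j2 [j3 j4]]] := hj j (leqnn j).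
 apply: le_trans (truncated_bound FE _ j2 j3 j4) _; first by rewrite divr_gt0.
 rewrite lerD2l; apply: (le_via ((n%:R * B) * e1)); first by rewrite ler_wpM2l ?mge0// ltW.
 apply: (le_via ((n%:R * B + 1) * e1)); first by rewrite ler_wpM2r ?ltW// ltrDl.
 by rewrite /e1 mulrC divfK// gt_eqF.
 have m2 : 0 < m ^+ 2 by rewrite exprn_gt0.
 have mF : 0 <= m ^+ 2 * F by rewrite mge0// ltW.
 rewrite ler_pdivlMr//; move: key; rewrite ler_pdivlMr// (_ : 3 / 4 * (m * F) * m = 3 / 4 * (m ^+ 2 * F)); last by ring.
 by rewrite [F * _]mulrC => k; lra.
have cv : (\int[lamB]_x (q n x)%:E)%E @[n --> \oo] --> (\int[lamB]_x ((om x * f x) ^+ 2)%:E)%E.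
 apply: (@dominated_cvg _ _ _ lamB setT measurableT (fun n x => (q n x)%:E) _ (fun x => (f x ^+ 2)%:E)) => //.
 - by move=> n; apply/mEF; exact: mq.
 - move=> x _; apply: cvg_near_cst; exists (Num.bound `|f x|) => // n /= nb; rewrite /q /cut.
 rewrite (_ : (_ <= _) = true) ?mulr1//; apply: le_trans (ltW (archi_boundP (normr_ge0 _))) _.
 by rewrite ler_nat.
 - apply/integrableP; split; first by apply/mEF; exact: measX.
 by under eq_integral do rewrite /= ger0_norm ?sqr_ge0//.
 - by move=> n x _; rewrite lee_fin ger0_norm//; exact: le_trans (of2 x).
rewrite -(cvg_lim _ cv)//; apply: lime_le; first by apply/cvg_ex; eexists; exact: cv.
exact: nearW.
Qed.

End source.

Theorem theorem4p2 (R : realType) (d : nat) (Om : set 'rV[R]_d.+1)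
    (H : 'rV[R]_d.+1 -> 'rV[R]_d.+1) :
  is_domain Om -> bounded_set Om -> smooth_boundary Om ->
  C1_closure Om H ->
  (exists2 delta0 : R, 0 < delta0 &
    forall x, closure Om x -> delta0 <= enorm (H x)) ->
  exists2 T0 : R, 0 < T0 &
  forall M : R, 0 < M ->
  forall (N : nat) (Oi : 'I_N -> set 'rV[R]_d.+1)
         (nu : 'I_N -> 'I_N -> 'rV[R]_d.+1 -> 'rV[R]_d.+1),
  domain_partition Om Oi nu -> condition_B H Oi nu -> condition_C H Oi nu ->
  forall T : R, T0 < T ->
  let Q := cylinder Om T in
  forall (r dtr : 'rV[R]_d.+2 -> R) (r0 : 'rV[R]_d.+1 -> R),
  L2_Linfty Om T r -> L2_Linfty Om T dtr -> weak_partial Q ord_max r dtr ->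
  initial_value Om r r0 -> nonvanishing_on_closure Om r0 ->
  exists2 C : R, 0 < C &
  forall (p f : 'rV[R]_d.+1 -> R) (u : 'rV[R]_d.+2 -> R)
         (Du Ddtu : 'rV[R]_d.+2 -> 'rV[R]_d.+2),
  let dtu z := Du z ord0 ord_max in
  in_Lp lebesgueN Om +oo%E p -> (Lp_norm lebesgueN Om +oo p <= M%:E)%E ->
  in_Lp lebesgueN Om 2%:E f ->
  H1 Q u Du -> H1 Q dtu Ddtu ->
  ae_on lebesgueN Q (fun z =>
    dtu z + dot (H (space_of z)) (space_of (Du z)) + p (space_of z) * u z
      = r z * f (space_of z)) ->
  trace_on Q (initial_slice Om) u Du (fun=> 0) ->
  forall g : 'rV[R]_d.+2 -> R,
  trace_on Q (lateral Om T) dtu Ddtu g ->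
  (Lp_norm lebesgueN Om 2%:E f <=
     C%:E * Lp_norm surface (lateral Om T) 2%:E g)%E.
Proof.
move=> dom bnd sm C1H _; have [oOm _ neOm] := dom.
have [Ht [L [B [L0 B0 HtL HtB HtH]]]] := domain_field_extension oOm neOm bnd sm C1H.
have [Phi fl] := flow_exists L0 B0 HtL HtB.
have [[S S0 exits]|noS] := pselect (exists2 S : R, 0 < S & forall x, exists2 t, 0 <= t <= S & ~ Om (Phi t x));
 last first.
 exists 1 => // M M0 N Oi nu part cB cC; exfalso; apply: noS.
 have [S S0 [Z Z0 hZ]] := exit_time_ae dom bnd part cB cC HtL L0 HtH fl.
 by exists S => //; exact: (exit_from_ae oOm fl (ltW S0) Z0 hZ).
exists S => // M M0 N Oi nu part cB cC T ST Q r dtr r0 hr hdtr rw iv nv.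
have T0 : 0 < T by exact: lt_trans ST.
have [r1 [kr [Lr1 _ _ _ _]]] := L2_Linfty_rep oOm bnd T0 hr.
have [rt [k [Lrt mk k0 fk rtk]]] := L2_Linfty_rep oOm bnd T0 hdtr.
have [m [dl [sg [m0 dl0 msg sg1 hsg]]]] := initial_sign oOm bnd Lr1 iv nv.
have [C0 C00 hC] := weighted_energy oOm fl S0 exits L0 HtL T (ltW M0) HtB.
pose K := m ^+ 2 / (16 * C0); have m20 : 0 < m ^+ 2 by rewrite exprn_gt0.
have K0 : 0 < K by rewrite divr_gt0// mulr_gt0.
have [l l0 [h1 h10 hK]] := kernel_small S mk fk K0.
pose h0 := Num.min h1 (T - S); have h00 : 0 < h0 by rewrite lt_min h10 subr_gt0.
pose C2 := expR (2 * l * S) * (16 * C0 / m ^+ 2).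
have C20 : 0 < C2 by rewrite mulr_gt0 ?expR_gt0// divr_gt0// mulr_gt0.
exists (Num.sqrt C2) => [|p f u Du Ddtu dtu pL pM fL [uL Du1] [wL Dw1] eq0 tr0 g trg]; first by rewrite sqrtr_gt0.
have [u0 Lu0] := L2rep_exists oOm uL.
have /choice[a0 La0] : forall j, exists v, L2rep Om T (fun z => Du z ord0 j) v.
 by move=> j; have [h _] := Du1 j; exact: (L2rep_exists oOm h).
have /choice[D0 LD0] : forall j, exists v, L2rep Om T (fun z => Ddtu z ord0 j) v.
 by move=> j; have [h _] := Dw1 j; exact: (L2rep_exists oOm h).
pose w0 := a0 ord_max.
have weak j : weakly Om T j u0 (a0 j).
 by exists u, (fun z => Du z ord0 j); split; [exact: uL.1|exact: (Du1 j).1.1|exact: Lu0|exact: La0|exact: (Du1 j).2].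
have weakw j : weakly Om T j w0 (D0 j).
 exists dtu, (fun z => Ddtu z ord0 j).
 by split; [exact: wL.1|exact: (Dw1 j).1.1|exact: La0|exact: LD0|exact: (Dw1 j).2].
have weakr : weakly Om T ord_max r1 rt.
 by exists r, dtr; have [mr _ _] := hr; have [mdr _ _] := hdtr; split.
have [p1 [Np [mp1 mNp Np0 hp]]] := borel_representative oOm pL.1.
have [Np' [mNp' Np'0] hp'] := Lp_oo_bound pM.
pose p0 (x : rVB R d) := Num.max (- M) (Num.min M (p1 x)).
have mp0 : mfunT p0.
 by apply: measurable_maxr; [exact: measK|apply: measurable_minr => //; exact: measK].
have p0M x : `|p0 x| <= M.
 by rewrite ler_norml /p0 le_max lexx/= ge_max ge_min lexx/= andbT; have := M0; lra.
have p0E x : Om x -> ~ Np x -> ~ Np' x -> p0 x = p x.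
 move=> Ox n1 n2; rewrite /p0 -hp//; have := hp' x Ox n2; rewrite ler_norml => /andP[h2 h3].
 by rewrite (min_idPr h3) (max_idPr h2).
have [f1 [mf1 zf1 f2 [Nf [mNf Nf0] hf]]] := borel_zero_extension oOm fL.1.
have ff : (\int[lamB]_x (f1 x ^+ 2)%:E < +oo)%E by rewrite -f2; exact: in_Lp2_lty fL.2.
pose Hi i (x : rVB R d) := Ht x ord0 i; pose B1 := Num.max B M.
have mH i : mfunT (Hi i).
 by apply: (measC (measurable_coord i)); exact: lipschitz_measurable L0 HtL.
have HB i x : `|Hi i x| <= B1 by rewrite /B1 le_max (le_trans (coord_le _ _) (HtB x)).
have pB x : `|p0 x| <= B1 by rewrite /B1 le_max p0M orbT.
have eqn : exists2 N : set (rVB R d.+1), nullB N & forall z, Q z -> ~ N z ->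
 w0 z + \sum_i Hi i (xof z) * a0 (lift ord_max i) z + p0 (xof z) * u0 z = r1 z * f1 (xof z).
 have /ae_lebesgueN[Ne [_ Ne0] hNe] := eq0.
 have [_ _ _ [Nu [_ Nu0] hNu]] := Lu0; have [_ _ _ [Nr [_ Nr0] hNr]] := Lr1.
 pose Na := \bigcup_j [set z | Q z /\ Du z ord0 j <> a0 j z].
 have Na0 : lam Na = 0%E.
 apply: lam_bigcup_null => j; have [_ _ _ [Nj [_ Nj0] hNj]] := La0 j.
 apply/eqP; rewrite eq_le lam_ge0 andbT -Nj0; apply: le_lam => z [Qz hz].
 by apply: contrapT => nz; apply: hz; exact: hNj.
 have s1 := (space_null mNp Np0).2; have s2 := (space_null mNp' Np'0).2; have s3 := (space_null mNf Nf0).2.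
 have [NN [mNN sub] NN0] := null_borel (lam_setU_null (lam_setU_null (lam_setU_null Ne0 Nu0) (lam_setU_null Nr0 Na0))
 (lam_setU_null (lam_setU_null s1 s2) s3)).
 exists NN; first by split.
 move=> z Qz nz; move: (fun h => nz (sub z h)) => /not_orP[/not_orP[/not_orP[n1 n2] /not_orP[n3 n4]] /not_orP[/not_orP[n5 n6] n7]].
 have Oz : Om (xof z) by have [] := Qz.
 have aE j : a0 j z = Du z ord0 j.
 by apply/esym; apply: contrapT => h; apply: n4; exists j.
 have := hNe z n1 Qz; rewrite hNr// hf// -(p0E _ Oz n5 n6) hNu// => <-.
 rewrite /w0 aE /dot; congr (_ + _ + _); apply: eq_bigr => i _.
 by rewrite aE mxE /Hi HtH.
have early (s : R) : 0 < s -> s < T ->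
 \int[lamB]_z (u0 z ^+ 2 * (tof z < s)%R%:R) <= 8 * expR 1 * s ^+ 2 * \int[lamB]_z (w0 z ^+ 2 * (tof z < s)%R%:R).
 by move=> s0 sT; have := early_bound oOm uL.1 wL.1 Lu0 (La0 ord_max) tr0 s0 sT.
have [Nd [mNd Nd0] hNd] := differentiated_equation oOm bnd (weak ord_max) (weakw ord_max) weakr
 (fun i => weak (lift ord_max i)) (fun i => weakw (lift ord_max i)) mH mp0 mf1 HB pB eqn.
have transport : exists2 N : set (rVB R d.+1), nullB N & forall z, Q z -> ~ N z ->
 `|dot (\row_j D0 j z) (spacetime (Ht (xof z)) 1)| <= M * `|w0 z| + k (tof z) * `|f1 (xof z)|.
 exists Nd => // z Qz nz; have e := hNd z Qz nz.
 have -> : dot (\row_j D0 j z) (spacetime (Ht (xof z)) 1) =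
 D0 ord_max z + \sum_i Hi i (xof z) * D0 (lift ord_max i) z.
 rewrite /dot big_ord_recr/= addrC !mxE unlift_none mulr1; congr (_ + _); apply: eq_bigr => i _.
 have -> : widen_ord (leqnSn d.+1) i = lift ord_max i by apply: val_inj; rewrite /= /bump leqNgt ltn_ord.
 by rewrite !mxE liftK mulrC.
 have -> : D0 ord_max z + \sum_i Hi i (xof z) * D0 (lift ord_max i) z =
 rt z * f1 (xof z) - p0 (xof z) * w0 z by rewrite -e addrK.
 apply: le_trans (ler_normB _ _) _; rewrite [leLHS]addrC !normrM.
 by apply: lerD; apply: ler_wpM2r.
have mwt : mfunT (weight Om Phi l) by exact: (measurable_weight oOm fl exits).
have mwf : mfunT (fun x => (weight Om Phi l x * f1 x) ^+ 2).
 by apply: measX; exact: measM.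
have Ffin : (\int[lamB]_x ((weight Om Phi l x * f1 x) ^+ 2)%:E)%E \is a fin_num.
 rewrite ge0_fin_numE; last by apply: integral_ge0 => x _; rewrite lee_fin sqr_ge0.
 apply: le_lt_trans ff; apply: le_lower_integral => x _; rewrite lee_fin ?sqr_ge0//.
 have /andP[h2 h3] := weight_le1 exits x l0.
 by rewrite exprMn ler_piMl ?sqr_ge0// expr_le1.
have FE := esym (fineK Ffin); set Fo := fine _ in FE.
have Fo0 : 0 <= Fo by apply: fine_ge0; apply: integral_ge0 => x _; rewrite lee_fin sqr_ge0.
have hFo : (\int[lamB]_(x in Om) ((weight Om Phi l x * f1 x) ^+ 2)%:E <= Fo%:E)%E.
 rewrite -FE (integral_mulI lamB Om); apply: le_lower_integral => x _; rewrite lee_fin.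
 by rewrite mge0 ?sqr_ge0.
 by rewrite indicE; case: (x \in Om); rewrite ?mul1r ?mul0r// sqr_ge0.
set G := fine (\int[surface]_(z in lateral Om T) (g z ^+ 2)%:E)%E in hC *.
have energy (a' h Kb : R) (be : R -> R) : 0 < a' -> a' < h -> h < h0 -> mfunT be ->
 (forall t, 0 <= be t <= Kb) -> (forall t, ~ (a' < t < h) -> be t = 0) ->
 (\int[lebesgue_measure]_t (be t)%:E = 1)%E ->
 (\int[lamB]_z ((weight Om Phi l (xof z) * w0 z) ^+ 2 * be (tof z))%:E <= (4 * C0 * (G + K * Fo))%:E)%E.
 move=> a'0 a'h; rewrite lt_min => /andP[hh1 hTS] mbe beK beout be1.
 have hST : h + S < T by rewrite -ltrBrDr.
 have hK' eta (e0 : 0 < eta) (eh : eta < h) := hK eta e0 (lt_trans eh hh1).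
 exact: (hC k f1 l a' h K Kb Fo be dtu g Ddtu w0 D0 wL.1 (fun j => (Dw1 j).1.1) (La0 ord_max) LD0 trg transport
 mk k0 mf1 a'0 hST l0 (ltW K0) hK' mbe beK beout be1 Fo0 hFo).
have Lr : L2Q Om T r1 by have [? ? ? _] := Lr1.
have key := source_bound oOm bnd (weak ord_max) (fun i => weak (lift ord_max i)) (fun i => weakw (lift ord_max i))
 Lr mH mp0 mf1 HB pB eqn early zf1 ff msg sg1 mwt
 (fun x => weight_le1 exits x l0) m0 dl0 h00 T0 hsg energy.
have GE : (\int[surface]_(z in lateral Om T) (g z ^+ 2)%:E = G%:E)%E.
 rewrite fineK// ge0_fin_numE; first exact: in_Lp2_lty trg.1.2.
 by apply: integral_ge0 => z _; rewrite lee_fin sqr_ge0.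
have FG : Fo <= 16 * C0 / m ^+ 2 * G.
 move: key; rewrite FE lee_fin.
 have -> : 2 * (4 * C0 * (G + K * Fo)) / m ^+ 2 = 8 * C0 / m ^+ 2 * G + Fo / 2.
 by rewrite /K; field; rewrite !lt0r_neq0.
 rewrite (_ : 16 * C0 / m ^+ 2 * G = 2 * (8 * C0 / m ^+ 2 * G)); last by field; rewrite lt0r_neq0.
 by move: (_ * G) => x hx; lra.
apply: Lp_norm2_le; first exact: sqrtr_ge0.
rewrite sqr_sqrtr ?(ltW C20)// GE f2 -EFinM.
apply: (le_via ((expR (2 * l * S))%:E * \int[lamB]_x ((weight Om Phi l x * f1 x) ^+ 2)%:E)%E).
 have <- : (\int[lamB]_x ((expR (2 * l * S))%:E * ((weight Om Phi l x * f1 x) ^+ 2)%:E) =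
 (expR (2 * l * S))%:E * \int[lamB]_x ((weight Om Phi l x * f1 x) ^+ 2)%:E)%E.
 rewrite intZl//; first by apply/mEF; exact: mwf.
 by move=> x _; rewrite lee_fin sqr_ge0.
 apply: le_lower_integral => x _; first by rewrite lee_fin sqr_ge0.
 rewrite -EFinM lee_fin exprMn mulrA ler_peMl ?sqr_ge0//.
 have h2 := weight_ge oOm fl S0 exits x l0.
 rewrite -[leLHS]expR0 (_ : 0 = 2 * l * S + 2%:R * (- l * S)); last by ring.
 by rewrite expRD expRM_natl ler_wpM2l ?expR_ge0// ler_sqr ?nnegrE ?expR_ge0.
rewrite FE -EFinM lee_fin (_ : C2 * G = expR (2 * l * S) * (16 * C0 / m ^+ 2 * G)); last by rewrite mulrA.
by rewrite ler_wpM2l ?expR_ge0.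
Qed.
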